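(* Let $(Z,\Omega,\mathcal L)$ be a generalized Kähler structure of symplectic type, viewed as a holomorphic symplectic Morita equivalence with brane bisection between holomorphic Poisson manifolds $(X_\pm,\sigma_\pm)$ with common imaginary part $-\tfrac14Q$ (after identifying $X_-\cong\mathcal L\cong X_+$ as smooth manifolds via $\pi_\pm|_{\mathcal L}$). Let $z\in\mathcal L$. Then: 1. It is possible to choose a family of local brane bisections $\mathcal L_t$, $t\in[0,1]$, such that $\mathcal L_1=\mathcal L$, $\mathcal L_0=\Lambda$ is a holomorphic Lagrangian bisection, and $z\in\mathcal L_t$ for all $t\in[0,1]$. 2. There is a (locally defined) time-dependent real-valued function $f_t\in C^\infty(X_-,\mathbb R)$ such that in a neighbourhood of $z$ the family $\mathcal L_t$ is given by $\tilde\tau_t(\Lambda)$, where $\tilde\tau_t$ is the flow of the (time-dependent) Hamiltonian vector field of $(\phi^{-1}\circ\pi_+)^*f_t$ with respect to the symplectic form $\mathrm{Im}(\Omega)$. Here $\phi:(U,\sigma_-)\to(V,\sigma_+)$, $U=\pi_-(\Lambda)$, $V=\pi_+(\Lambda)$, is the holomorphic Poisson isomorphism $\phi=\pi_+\circ(\pi_-|_\Lambda)^{-1}$ induced by $\Lambda$. 3. In a neighbourhood of $\pi_-(z)$ in $X_-$ the generalized Kähler structure is given by the data $(I_+,I_-,Q,F)$, where $I_-$ is the given complex structure on $X_-$, $I_+=\psi_1^*(I_-)$, and $$F=\int_0^1\psi_t^*\big(d^c_-d f_t\big)\,dt,$$ where $\psi_t$ is the flow of the time-dependent Hamiltonian vector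 field $X_{f_t}=Q(df_t)$ and $d^c_-=i(\bar\partial_{I_-}-\partial_{I_-})$.
   Context: Conventions. 2-forms $F$ are maps $TM\to T^*M$, $X\mapsto\iota_XF$; bivectors are maps $T^*M\to TM$. A holomorphic Poisson structure on $X=(M,I)$ is written $\sigma=-\tfrac14(IQ+iQ)$, with $Q=-4\,\mathrm{Im}\,\sigma$ a real Poisson structure. The Hamiltonian vector field of $f$ for a symplectic form $\omega$ is $\omega^{-1}(df)$. For a holomorphic symplectic form $\Omega=B+i\omega$ one has $B=\omega I$ and $Q=\omega^{-1}$ for the inverse Poisson structure. $\psi^*(I)=(d\psi)^{-1}\circ I\circ d\psi$. Flows of time-dependent vector fields start at the identity at time $0$. Holomorphic symplectic Morita equivalence between (integrable) holomorphic Poisson manifolds $(X_-,\sigma_-)$ and $(X_+,\sigma_+)$: a holomorphic symplectic manifold $(Z,\Omega)$ with holomorphic surjective submersions $\pi_\pm:Z\to X_\pm$ with connected, simply connected fibres such that $\pi_+$ is Poisson, $\pi_-$ is anti-Poisson, $\ker d\pi_+$ and $\ker d\pi_-$ are symplectic orthogonals of each other, and $\pi_\pm$ are complete (pullbacks of complete Hamiltonian vector fields are complete). Brane bisection: a smooth submanifold $\mathcal L\subset Z$, Lagrangian for $\mathrm{Im}(\Omega)$, which is a section of both $\pi_+$ and $\pi_-$ (i.e. $\pi_\pm|_{\mathcal L}$ are diffeomorphisms onto $X_\pm$). A local brane bisection is an (embedded) submanifold, Lagrangian for $\mathrm{Im}(\Omega)$ and transverse to $\ker d\pi_\pm$, which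 $\pi_\pm$ map diffeomorphically onto open subsets of $X_\pm$; a (local) holomorphic Lagrangian bisection is defined similarly with ''holomorphic Lagrangian for $\Omega$''. Equalities such as $\mathcal L_1=\mathcal L$ are understood in a neighbourhood of $z$. Associated generalized Kähler data: identifying $X_+\cong\mathcal L\cong X_-$ as smooth manifolds through $\pi_\pm|_{\mathcal L}$, $I_\pm$ are the complex structures of $X_\pm$, the real Poisson structures $-4\,\mathrm{Im}\,\sigma_\pm$ coincide and are denoted $Q$, and $F=\Omega|_{\mathcal L}$; these satisfy $I_+-I_-=QF$ and $FI_++I_-^*F=0$. Being a generalized Kähler structure of symplectic type means in addition that $g=-\tfrac12F(I_++I_-)$ is positive definite. In item 3, the data are regarded on $X_-$ using $\pi_-|_{\mathcal L}$. *)

(* Defs.v *)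
From mathcomp Require Import all_boot all_order all_algebra.
From mathcomp Require Import complex.
From mathcomp Require Import all_classical all_reals all_analysis.
Set Implicit Arguments.
Unset Strict Implicit.
Unset Printing Implicit Defensive.
Import Order.TTheory GRing.Theory Num.Theory numFieldNormedType.Exports.
Local Open Scope classical_set_scope.
Local Open Scope complex_scope.
Local Open Scope ring_scope.

(* Vectors and covectors are columns and tensors are matrices acting on columns,
   so that the composites of the text are matrix products in the same order:
   - a 2-form F is the map X |-> i_X F, hence F(X, Y) = Y^T *m F *m X, i.e. the
     entry F a b is F(e_b, e_a);
   - a bivector Q is a map from covectors to vectors;
   - the transpose I^* of an endomorphism I is I^T. *)

Section Euclidean.
Context {R : realType}.

Definition cvec {n} (i : 'I_n) : 'cV[R]_n := delta_mx i ord0.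

Fixpoint Ck {n} (k : nat) (U : set 'cV[R]_n) (f : 'cV[R]_n -> R) : Prop :=
  (forall u, U u -> {for u, continuous f}) /\
  match k with
  | 0%N => True
  | k'.+1 => forall i : 'I_n, (forall u, U u -> derivable f u (cvec i)) /\
               Ck k' U (fun u => 'D_(cvec i) f u)
  end.

(* Only used for open U. *)
Definition Cinfty {n} (U : set 'cV[R]_n) (f : 'cV[R]_n -> R) : Prop :=
  forall k, Ck k U f.

Definition Cinftyv {n m} (U : set 'cV[R]_n) (f : 'cV[R]_n -> 'cV[R]_m) : Prop :=
  forall i, Cinfty U (fun u => f u i ord0).

Definition Cinftyc {n} (U : set 'cV[R]_n) (h : 'cV[R]_n -> R[i]) : Prop :=
  Cinfty U (fun u => complex.Re (h u)) /\ Cinfty U (fun u => complex.Im (h u)).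

Definition jac {n m} (f : 'cV[R]_n -> 'cV[R]_m) (u : 'cV[R]_n) : 'M[R]_(m, n) :=
  \matrix_(i, j) 'D_(cvec j) (fun w => f w i ord0) u.

Definition cD {n} (v : 'cV[R]_n) (h : 'cV[R]_n -> R[i]) (u : 'cV[R]_n) : R[i] :=
  ('D_v (fun w => complex.Re (h w)) u) +i* ('D_v (fun w => complex.Im (h w)) u).

Definition cmx {m n} (A : 'M[R]_(m, n)) : 'M[R[i]]_(m, n) :=
  map_mx (fun a : R => a%:C) A.
Definition re_mx {m n} (A : 'M[R[i]]_(m, n)) : 'M[R]_(m, n) :=
  map_mx (fun a : R[i] => complex.Re a) A.
Definition im_mx {m n} (A : 'M[R[i]]_(m, n)) : 'M[R]_(m, n) :=
  map_mx (fun a : R[i] => complex.Im a) A.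

Definition ext0 {n} (h : 'cV[R]_n -> R[i]) (u : 'cV[R]_n) : 'cV[R[i]]_n :=
  \col_i cD (cvec i) h u.

Definition ext1 {n} (al : 'cV[R]_n -> 'cV[R[i]]_n) (u : 'cV[R]_n) : 'M[R[i]]_n :=
  \matrix_(a, b) (cD (cvec b) (fun w => al w a ord0) u
                  - cD (cvec a) (fun w => al w b ord0) u).

Definition closed2 {n} (U : set 'cV[R]_n) (F : 'cV[R]_n -> 'M[R[i]]_n) : Prop :=
  forall u, U u -> forall a b c,
    cD (cvec a) (fun w => F w b c) u + cD (cvec b) (fun w => F w c a) u
    + cD (cvec c) (fun w => F w a b) u = 0.

(* [s, s] = 0 for the Schouten bracket. *)
Definition jacobi {n} (U : set 'cV[R]_n) (s : 'cV[R]_n -> 'M[R[i]]_n) : Prop :=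
  forall u, U u -> forall a b c,
    \sum_l (s u a l * cD (cvec l) (fun w => s w b c) u
            + s u b l * cD (cvec l) (fun w => s w c a) u
            + s u c l * cD (cvec l) (fun w => s w a b) u) = 0.

(* Cauchy-Riemann equations with respect to the constant complex structure J. *)
Definition holo_fun {n} (J : 'M[R]_n) (U : set 'cV[R]_n) (h : 'cV[R]_n -> R[i]) :
  Prop := forall u, U u -> forall v, cD (J *m v) h u = 'i%C * cD v h u.

Section Dolbeault.
Variables (n : nat) (J : 'cV[R]_n -> 'M[R]_n).

(* Projections of complexified tangent vectors onto types (1,0) and (0,1). *)
Definition P10 u : 'M[R[i]]_n := 2^-1 *: (1%:M - 'i%C *: cmx (J u)).
Definition P01 u : 'M[R[i]]_n := 2^-1 *: (1%:M + 'i%C *: cmx (J u)).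

Definition typ10 (al : 'cV[R]_n -> 'cV[R[i]]_n) u := (P10 u)^T *m al u.
Definition typ01 (al : 'cV[R]_n -> 'cV[R[i]]_n) u := (P01 u)^T *m al u.

Definition typ20 (F : 'cV[R]_n -> 'M[R[i]]_n) u := (P10 u)^T *m F u *m P10 u.
Definition typ11 (F : 'cV[R]_n -> 'M[R[i]]_n) u :=
  (P01 u)^T *m F u *m P10 u + (P10 u)^T *m F u *m P01 u.
Definition typ02 (F : 'cV[R]_n -> 'M[R[i]]_n) u := (P01 u)^T *m F u *m P01 u.

(* The operators del (of bidegree (1,0)) and delbar (of bidegree (0,1)) on
   complex 1-forms. *)
Definition del1 al u := typ20 (ext1 (typ10 al)) u + typ11 (ext1 (typ01 al)) u.
Definition delbar1 al u := typ11 (ext1 (typ10 al)) u + typ02 (ext1 (typ01 al)) u.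

Definition dc1 al u : 'M[R[i]]_n := 'i%C *: (delbar1 al u - del1 al u).

End Dolbeault.
End Euclidean.

Section Manifolds.
Context {R : realType}.

Record chart (M : topologicalType) (n : nat) := Chart {
  cdom : set M ;
  coord : M -> 'cV[R]_n ;
  icoord : 'cV[R]_n -> M }.

Definition cimg M n (c : chart M n) : set 'cV[R]_n := coord c @` cdom c.

Definition is_chart M n (c : chart M n) : Prop :=
  [/\ open (cdom c), open (cimg c),
      forall x, cdom c x -> icoord c (coord c x) = x,
      forall x, cdom c x -> {for x, continuous (coord c)}
    & forall u, cimg c u -> {for u, continuous (icoord c)}].

Definition compat M n (c c' : chart M n) : Prop :=
  Cinftyv (coord c @` (cdom c `&` cdom c')) (coord c' \o icoord c).

(* chart_at fixes a preferred chart around each point; the tangent space at x is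
   'cV[R]_n through chart_at x, and the matrix of a tensor at x is its matrix in
   the coordinates of chart_at x. *)
Record manifold (n : nat) := Manifold {
  msort :> topologicalType ;
  atlas : set (chart msort n) ;
  chart_at : msort -> chart msort n ;
  atlas_chart : forall c, atlas c -> is_chart c ;
  atlas_compat : forall c c', atlas c -> atlas c' -> compat c c' ;
  chart_at_atlas : forall x, atlas (chart_at x) ;
  chart_at_dom : forall x, cdom (chart_at x) x ;
  mfd_hausdorff : hausdorff_space msort ;
  mfd_countable : @second_countable msort }.

Definition smooth_chart n (M : manifold n) (c : chart M n) : Prop :=
  is_chart c /\ forall c', atlas c' -> compat c c' /\ compat c' c.

(* Change of basis at y from chart_at y to c. *)
Definition tr n (M : manifold n) (c : chart M n) (y : M) : 'M[R]_n :=
  jac (coord c \o icoord (chart_at y)) (coord (chart_at y) y).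

Definition smooth_map n m (M : manifold n) (N : manifold m) (U : set M)
    (f : M -> N) : Prop :=
  (forall x, U x -> {for x, continuous f}) /\
  forall c d, atlas c -> atlas d ->
    Cinftyv (coord c @` (U `&` cdom c `&` f @^-1` cdom d))
            (coord d \o f \o icoord c).

Definition smooth_fun n (M : manifold n) (U : set M) (f : M -> R) : Prop :=
  forall c, atlas c -> Cinfty (coord c @` (U `&` cdom c)) (f \o icoord c).

(* f is smooth on a neighbourhood of [0, 1] x U; the first coordinate of w is
   the time. *)
Definition smooth_tfun n (M : manifold n) (U : set M) (f : R -> M -> R) : Prop :=
  exists2 e : R, 0 < e & forall c, atlas c ->
    Cinfty [set w : 'cV[R]_(1 + n) |
              - e < usubmx w ord0 ord0 < 1 + e /\
              (coord c @` (U `&` cdom c)) (dsubmx w)]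
           (fun w => f (usubmx w ord0 ord0) (icoord c (dsubmx w))).

(* The tangent map. *)
Definition tmap n m (M : manifold n) (N : manifold m) (f : M -> N) (x : M) :
    'M[R]_(m, n) :=
  jac (coord (chart_at (f x)) \o f \o icoord (chart_at x)) (coord (chart_at x) x).

Definition dfun n (M : manifold n) (f : M -> R) (x : M) : 'cV[R]_n :=
  \col_i 'D_(cvec i) (f \o icoord (chart_at x)) (coord (chart_at x) x).

(* Tensor fields in the coordinates of c. *)
Definition rep_endo n (M : manifold n) (c : chart M n) (A : M -> 'M[R]_n)
    (u : 'cV[R]_n) : 'M[R]_n :=
  let y := icoord c u in tr c y *m A y *m invmx (tr c y).
Definition rep_form n (M : manifold n) (c : chart M n) (F : M -> 'M[R[i]]_n)
    (u : 'cV[R]_n) : 'M[R[i]]_n :=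
  let y := icoord c u in
  (cmx (invmx (tr c y)))^T *m F y *m cmx (invmx (tr c y)).
Definition rep_biv n (M : manifold n) (c : chart M n) (s : M -> 'M[R[i]]_n)
    (u : 'cV[R]_n) : 'M[R[i]]_n :=
  let y := icoord c u in cmx (tr c y) *m s y *m (cmx (tr c y))^T.

Definition pull_form n m (M : manifold n) (N : manifold m) (f : M -> N)
    (F : N -> 'M[R[i]]_m) (x : M) : 'M[R[i]]_n :=
  (cmx (tmap f x))^T *m F (f x) *m cmx (tmap f x).

Definition pull_endo n (M N : manifold n) (f : M -> N) (A : N -> 'M[R]_n)
    (x : M) : 'M[R]_n :=
  invmx (tmap f x) *m A (f x) *m tmap f x.

(* Velocity of the curve g at time t, for g continuous at t. *)
Definition velocity n (M : manifold n) (g : R -> M) (t : R) (v : 'cV[R]_n) : Prop :=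
  {for t, continuous g} /\
  forall i, is_derive t 1 (fun s => coord (chart_at (g t)) (g s) i ord0) (v i ord0).

Definition complete_vf n (M : manifold n) (V : M -> 'cV[R]_n) : Prop :=
  forall p, exists2 g : R -> M, g 0 = p & forall t, velocity g t (V (g t)).

(* tau t, t in [0,1], is the flow on W of the time-dependent vector field V
   defined on D; all trajectories from W stay in D. *)
Definition is_flow n (M : manifold n) (D : set M) (V : R -> M -> 'cV[R]_n)
    (W : set M) (tau : R -> M -> M) : Prop :=
  forall p, W p ->
    [/\ tau 0 p = p,
        forall t, 0 <= t <= 1 -> D (tau t p),
        {within `[0, 1], continuous (fun t => tau t p)}
      & forall t, 0 < t < 1 -> velocity (fun s => tau s p) t (V t (tau t p))].

Definition simply_connected (T : topologicalType) (A : set T) : Prop :=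
  forall g : R -> T, {within `[0, 1], continuous g} ->
    (forall s, 0 <= s <= 1 -> A (g s)) -> g 0 = g 1 ->
  exists H : R * R -> T,
    [/\ {within `[0, 1] `*` `[0, 1], continuous H},
        forall t s, 0 <= t <= 1 -> 0 <= s <= 1 -> A (H (t, s)),
        forall s, 0 <= s <= 1 -> H (0, s) = g s /\ H (1, s) = g 0
      & forall t, 0 <= t <= 1 -> H (t, 0) = g 0 /\ H (t, 1) = g 0].

(* Slice charts of a d-dimensional embedded submanifold. *)
Definition slice_chart n (M : manifold n) (d : nat) (L : set M) (c : chart M n) :
    Prop :=
  smooth_chart c /\
  forall y, cdom c y -> (L y <-> forall j : 'I_n, (d <= j)%N -> coord c y j ord0 = 0).

Definition submanifold n (M : manifold n) (d : nat) (L : set M) : Prop :=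
  (d <= n)%N /\ forall p, L p -> exists2 c, slice_chart d L c & cdom c p.

Definition tangent n (M : manifold n) (d : nat) (L : set M) (p : M) :
    set 'cV[R]_n :=
  [set v | exists c, [/\ slice_chart d L c, cdom c p &
             forall j : 'I_n, (d <= j)%N -> (tr c p *m v) j ord0 = 0]].

Definition germ_eq (T : topologicalType) (p : T) (A B : set T) : Prop :=
  exists W : set T, [/\ open W, W p & A `&` W = B `&` W].

(* (pi|_L)^{-1}; the value off pi @` L is the junk value z. *)
Definition sinv (S T : topologicalType) (z : S) (pi : S -> T) (L : set S) (x : T) : S :=
  xget z [set p | L p /\ pi p = x].

(* pi maps the submanifold L diffeomorphically onto an open set.  L being
   embedded, smoothness of the inverse may be tested in the ambient manifold. *)
Definition diffeo_on n m (M : manifold n) (N : manifold m) (pi : M -> N)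
    (L : set M) : Prop :=
  [/\ open (pi @` L), {in L &, injective pi}
    & exists2 s : N -> M, smooth_map (pi @` L) s &
        forall x, (pi @` L) x -> L (s x) /\ pi (s x) = x].

End Manifolds.

Section Holomorphic.
Context {R : realType}.

(* A chart in which the almost complex structure A is the constant J, i.e., up
   to a linear change of coordinates, a holomorphic chart. *)
Definition holo_chart n (M : manifold (R := R) n) (A : M -> 'M[R]_n)
    (J : 'M[R]_n) (c : chart M n) : Prop :=
  smooth_chart c /\ forall y, cdom c y -> tr c y *m A y = J *m tr c y.

Definition complex_structure n (M : manifold (R := R) n) (A : M -> 'M[R]_n) : Prop :=
  (forall x, A x *m A x = - 1%:M) /\
  (forall x, exists J c, holo_chart A J c /\ cdom c x).

Definition holo_map n m (M : manifold (R := R) n) (N : manifold (R := R) m)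
    (A : M -> 'M[R]_n) (B : N -> 'M[R]_m) (U : set M) (f : M -> N) : Prop :=
  smooth_map U f /\
  forall x, U x -> tmap f x *m A x = B (f x) *m tmap f x.

Definition holo_poisson n (M : manifold (R := R) n) (A : M -> 'M[R]_n)
    (s : M -> 'M[R[i]]_n) : Prop :=
  [/\ forall x, (s x)^T = - s x,
      forall x, cmx (A x) *m s x = 'i%C *: s x,
      forall c, atlas c -> forall a b, Cinftyc (cimg c) (fun u => rep_biv c s u a b),
      forall J c, holo_chart A J c ->
        forall a b, holo_fun J (cimg c) (fun u => rep_biv c s u a b)
    & forall c, atlas c -> jacobi (cimg c) (rep_biv c s)].

Definition holo_symplectic n (M : manifold (R := R) n) (A : M -> 'M[R]_n)
    (Om : M -> 'M[R[i]]_n) : Prop :=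
  [/\ (forall x, (Om x)^T = - Om x) /\
      (forall x, Om x *m cmx (A x) = 'i%C *: Om x),
      forall c, atlas c -> forall a b, Cinftyc (cimg c) (fun u => rep_form c Om u a b),
      forall J c, holo_chart A J c ->
        forall a b, holo_fun J (cimg c) (fun u => rep_form c Om u a b),
      forall c, atlas c -> closed2 (cimg c) (rep_form c Om)
    & forall x (v : 'cV[R]_n), Om x *m cmx v = 0 -> v = 0].

Record holPoisson (n : nat) := HolPoisson {
  hpM :> manifold (R := R) n ;
  cpx : hpM -> 'M[R]_n ;
  sigma : hpM -> 'M[R[i]]_n ;
  cpxP : complex_structure cpx ;
  sigmaP : holo_poisson cpx sigma }.

Record holSymp (m : nat) := HolSymp {
  hsM :> manifold (R := R) m ;
  cpxZ : hsM -> 'M[R]_m ;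
  Omega : hsM -> 'M[R[i]]_m ;
  cpxZP : complex_structure cpxZ ;
  OmegaP : holo_symplectic cpxZ Omega }.

(* Q = -4 Im sigma *)
Definition Qpois n (X : holPoisson n) (x : X) : 'M[R]_n :=
  (- 4) *: im_mx (sigma x).

Definition omegaZ m (Z : holSymp m) (p : Z) : 'M[R]_m := im_mx (Omega p).

(* The Poisson structure -1/4 (I Q + i Q), Q = (Im Omega)^{-1}, inverse to Omega. *)
Definition sigmaZ m (Z : holSymp m) (p : Z) : 'M[R[i]]_m :=
  let Q := invmx (omegaZ p) in
  (- 4^-1) *: (cmx (cpxZ p *m Q) + 'i%C *: cmx Q).

Definition complete_map n m (X : holPoisson n) (Z : holSymp m) (pi : Z -> X) : Prop :=
  forall f : X -> R, smooth_fun setT f ->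
    complete_vf (fun x : X => Qpois x *m dfun f x) ->
    complete_vf (fun p : Z => invmx (omegaZ p) *m dfun (f \o pi) p).

Definition good_submersion n m (X : holPoisson n) (Z : holSymp m) (pi : Z -> X) :
    Prop :=
  [/\ holo_map (@cpxZ m Z) (@cpx n X) setT pi,
      forall x, exists p, pi p = x,
      forall p, \rank (tmap pi p) = n
    & forall x, connected (pi @^-1` [set x]) /\
                simply_connected (R := R) (pi @^-1` [set x])].

Definition ker_t n m (X : holPoisson n) (Z : holSymp m) (pi : Z -> X) (p : Z) :
    set 'cV[R]_m := [set v | tmap pi p *m v = 0].

Definition Om_orth m (Z : holSymp m) (p : Z) (E : set 'cV[R]_m) : set 'cV[R]_m :=
  [set v | forall w, E w -> (cmx w)^T *m Omega p *m cmx v = 0].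

Definition morita n m (Xm Xp : holPoisson n) (Z : holSymp m)
    (pim : Z -> Xm) (pip : Z -> Xp) : Prop :=
  [/\ good_submersion pim /\ good_submersion pip,
      forall p, cmx (tmap pip p) *m sigmaZ p *m (cmx (tmap pip p))^T
                = sigma (pip p),
      forall p, cmx (tmap pim p) *m sigmaZ p *m (cmx (tmap pim p))^T
                = - sigma (pim p),
      forall p, ker_t pip p = Om_orth p (ker_t pim p) /\
                ker_t pim p = Om_orth p (ker_t pip p)
    & complete_map pim /\ complete_map pip].

Definition lagrangian m (Z : holSymp m) (d : nat) (L : set Z) : Prop :=
  [/\ (d + d = m)%N, submanifold d L
    & forall p, L p -> forall v w, tangent d L p v -> tangent d L p w ->
        w^T *m omegaZ p *m v = 0].

Definition holo_lagrangian m (Z : holSymp m) (d : nat) (L : set Z) : Prop :=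
  [/\ (d + d = m)%N, submanifold d L,
      forall p, L p -> forall v, tangent d L p v -> tangent d L p (cpxZ p *m v)
    & forall p, L p -> forall v w, tangent d L p v -> tangent d L p w ->
        (cmx w)^T *m Omega p *m cmx v = 0].

Section Bisections.
Variables (n m : nat) (Xm Xp : holPoisson n) (Z : holSymp m).
Variables (pim : Z -> Xm) (pip : Z -> Xp).

Definition transverse_ker (X : holPoisson n) (pi : Z -> X) (d : nat) (L : set Z) :
    Prop :=
  forall p, L p -> forall v, exists2 w, tangent d L p w & ker_t pi p (v - w).

Definition brane_bisection (L : set Z) : Prop :=
  [/\ exists d, lagrangian d L, diffeo_on pim L, diffeo_on pip L,
      pim @` L = setT & pip @` L = setT].

Definition local_brane_bisection (L : set Z) : Prop :=
  exists d, [/\ lagrangian d L, transverse_ker pim d L, transverse_ker pip d L,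
                diffeo_on pim L & diffeo_on pip L].

Definition local_holo_bisection (L : set Z) : Prop :=
  exists d, [/\ holo_lagrangian d L, transverse_ker pim d L, transverse_ker pip d L,
                diffeo_on pim L & diffeo_on pip L].

(* The data on X_- associated with a brane bisection L through z.  Since
   Im Omega vanishes on L, F = Omega|_L is Re Omega|_L. *)
Definition gkI (z : Z) (L : set Z) : Xm -> 'M[R]_n :=
  pull_endo (pip \o sinv z pim L) (@cpx n Xp).

Definition gkF (z : Z) (L : set Z) (x : Xm) : 'M[R]_n :=
  re_mx (pull_form (sinv z pim L) (@Omega m Z) x).

Definition gkg (z : Z) (L : set Z) (x : Xm) : 'M[R]_n :=
  (- 2^-1) *: (gkF z L x *m (gkI z L x + cpx x)).

Definition symplectic_type (z : Z) (L : set Z) : Prop :=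
  forall (x : Xm) (v : 'cV[R]_n), v != 0 -> 0 < (v^T *m gkg z L x *m v) ord0 ord0.

End Bisections.

Definition holo_poisson_iso n (X Y : holPoisson n) (U : set X) (V : set Y)
    (phi : X -> Y) (phi' : Y -> X) : Prop :=
  [/\ open U /\ open V,
      holo_map (@cpx n X) (@cpx n Y) U phi /\ holo_map (@cpx n Y) (@cpx n X) V phi',
      forall x, U x -> V (phi x) /\ phi' (phi x) = x,
      forall y, V y -> U (phi' y) /\ phi (phi' y) = y
    & forall x, U x -> cmx (tmap phi x) *m sigma x *m (cmx (tmap phi x))^T
                       = sigma (phi x)].

(* d^c d f at x, for d^c = i (delbar - del), computed in the chart chart_at x. *)
Definition ddc n (X : holPoisson n) (f : X -> R) (x : X) : 'M[R[i]]_n :=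
  dc1 (rep_endo (chart_at x) (@cpx n X))
      (ext0 (fun u => (f (icoord (chart_at x) u))%:C))
      (coord (chart_at x) x).

Definition int01 n (G : R -> 'M[R[i]]_n) : 'M[R[i]]_n :=
  \matrix_(a, b)
    ((\int[lebesgue_measure]_(t in `[0, 1]) complex.Re (G t a b)) +i*
     (\int[lebesgue_measure]_(t in `[0, 1]) complex.Im (G t a b))).

End Holomorphic.

(* Main.v *)
Require Import Defs.
From mathcomp Require Import all_boot all_order all_algebra.
From mathcomp Require Import complex perm.
From mathcomp Require Import all_classical all_reals all_analysis.
From mathcomp Require Import ring lra zify.
Set Implicit Arguments.
Unset Strict Implicit.
Unset Printing Implicit Defensive.
(* Again, since [vector.coord] shadows the projection [coord] of charts. *)
Require Import Defs.
Import Order.TTheory GRing.Theory Num.Theory numFieldNormedType.Exports.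
Local Open Scope classical_set_scope.
Local Open Scope ring_scope.

(* Let J be the complex structure of Z, omega = Im Omega, so that
   Re Omega = omega J.  In a holomorphic chart J is constant, and Moser's vector
   field for omega also straightens omega J; hence near z there are coordinates
   in which Omega is constant.  Positivity of g at z provides a symplectic basis
   in which these coordinates are (q, xi), with {xi = 0} complex Lagrangian,
   T_z L = {xi = - S q} with S symmetric, and every {xi = - t S q}, 0 <= t <= 1,
   transverse to the kernels of d pi_- and d pi_+.  So L = {xi = theta(q)} with
   theta = dh, and L_t = {xi = t theta(q)} is the required family, on a
   neighbourhood uniform in t.

   If s_t is the inverse of pi_- on L_t and f_t o phi^-1 is the function that h
   induces on X_+ through L_t, then d/dt s_t is the Hamiltonian vector field of
   (phi^-1 o pi_+)^* f_t because the kernels of d pi_- and d pi_+ are omega-orthogonal;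
   this gives tau_t on Lambda, and psi_t = phi^-1 o pi_+ o s_t.  As Re Omega is
   closed, d/dt (s_t^* Re Omega) = d (psi_t^* (I_-^* df_t)) = psi_t^* (d^c d f_t),
   and s_0^* Re Omega = 0 as Lambda is complex Lagrangian; integrate over [0, 1]. *)

(** * Calculus of several variables *)

Section Differential_calculus.
Context {R : realType}.

(** Everything must hold on one neighbourhood of [z] for all [t] in [0, 1], and [f_t] must be smooth
    for times slightly beyond that interval; so the inverse function theorem and the shrinking of
    domains are carried out along the whole segment [0, 1] x {0}. Since [z] is the origin and lies
    on every [L_t], the Hamiltonian fields vanish there, and flows starting nearby last until time
    1. Positivity of g enters twice: F is nondegenerate on [T_z L], so it has a compatible complex
    structure G with F G positive, and F I_- and F I_+ have one and the same negative quadratic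
    form. If E spans [T_z L], the complex Lagrangian plane is the image of E + J E G, and the planes
    in between are the images of E + (1 - t) J E G. Projected to X_- such a plane becomes 1 + (1 -
    t) I_- G, which is invertible because F G is positive and F I_- negative; X_+ is similar. A flow
    is a condition on each trajectory separately, so [tau_t] is read off from the sections [s_t] on
    Lambda and completed off Lambda by solving the differential equation. *)

Lemma cV_norm_le n (v : 'cV[R]_n) e : 0 <= e ->
  (forall i, `|v i ord0| <= e) -> `|v| <= e.
Proof.
move=> e0 h; rewrite /Num.Def.normr/= mx_normrE bigmax_le// => -[i j] _ /=.
by rewrite (ord1 j).
Qed.

Lemma coord_le_norm n (v : 'cV[R]_n) i : `|v i ord0| <= `|v|.
Proof.
rewrite [leRHS]/Num.Def.normr/= mx_normrE.
by apply: le_trans; last exact: (le_bigmax _ _ (i, ord0)).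
Qed.

Lemma cV_norm_lt n (v : 'cV[R]_n) e : 0 < e ->
  (forall i, `|v i ord0| < e) -> `|v| < e.
Proof.
move=> e0 h; rewrite /Num.Def.normr/= mx_normrE bigmax_lt// => -[i j] _ /=.
by rewrite (ord1 j).
Qed.

Lemma cont_atP (T : topologicalType) (f : T -> R) (u : T) :
  {for u, continuous f} <-> (forall e, 0 < e -> \forall w \near u, `|f w - f u| < e).
Proof.
split=> [h e e0|h].
  have /cvgrPdist_lt/(_ _ e0) : f w @[w --> u] --> f u by [].
  by apply: filterS => w; rewrite distrC.
suff : f w @[w --> u] --> f u by [].
by apply/cvgrPdist_lt => e e0; near do rewrite distrC; exact: h.
Unshelve. all: by end_near. Qed.

Lemma is_derive_lineP (V : normedModType R) (f : V -> R) a v (t df : R) :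
  is_derive (a + t *: v) v f df <-> is_derive t 1 (fun s : R => f (a + s *: v)) df.
Proof.
have E : (fun h : R => h^-1 *: (f (h *: v + (a + t *: v)) - f (a + t *: v))) =
  (fun h : R => h^-1 *: (f (a + (h *: 1 + t) *: v) - f (a + t *: v))).
  apply/funext => h; congr (_ *: (f _ - _)).
  by rewrite scalerDl addrCA /GRing.scale/= mulr1.
split=> -[h1 h2]; split.
- by move: h1; rewrite /derivable E.
- by move: h2; rewrite /derive E.
- by move: h1; rewrite /derivable -E.
- by move: h2; rewrite /derive -E.
Qed.

Lemma is_derive_scale (V : normedModType R) (f : V -> R) a v k df :
  is_derive a v f df -> is_derive a (k *: v) f (k * df).
Proof.
rewrite -{1}(addr0 a) -(scale0r v) => /is_derive_lineP h.
have -> : a = a + (0 : R) *: (k *: v) by rewrite scale0r addr0.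
apply/is_derive_lineP.
have hk : is_derive (0:R) 1 (fun s : R => s * k) k.
  have -> : (fun s : R => s * k) = k *: (@id R).
    by apply/funext => s; rewrite /= mulrC.
  by apply: is_derive_eq; rewrite /GRing.scale/= mulr1.
have {}h : is_derive (0 * k) 1 (fun s : R => f (a + s *: v)) df by rewrite mul0r.
have := @is_derive1_comp R (fun s : R => f (a + s *: v)) (fun s => s * k) 0 df k h hk.
have -> : (fun s : R => f (a + s *: v)) \o (fun s => s * k) =
  (fun s : R => f (a + s *: (k *: v))).
  by apply/funext => s; rewrite /= scalerA.
by rewrite mulrC.
Qed.

Lemma MVT_line (V : normedModType R) (f df : V -> R) a v :
  (forall t : R, 0 <= t <= 1 -> is_derive (a + t *: v) v f (df (a + t *: v))) ->
  exists2 t : R, 0 < t < 1 & f (a + v) - f a = df (a + t *: v).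
Proof.
move=> h.
have h' (t : R) : 0 <= t <= 1 ->
    is_derive t 1 (fun s : R => f (a + s *: v)) (df (a + t *: v)).
  by move=> t01; exact: (proj1 (is_derive_lineP f a v t _) (h t t01)).
have [||t] := @MVT R (fun s : R => f (a + s *: v)) (fun t => df (a + t *: v)) 0 1 ltr01.
- by move=> x; rewrite in_itv/= => /andP[x0 x1]; apply: h'; rewrite !ltW.
- apply: derivable_within_continuous => x; rewrite in_itv/= => x01.
  by have [] := h' x x01.
rewrite in_itv/= => t01; rewrite scale1r scale0r addr0 subr0 mulr1 => e.
by exists t.
Qed.

(** The partial derivatives exist near [u] and are continuous at [u]: a pointwise condition, which
    is the form that the chain rule consumes. *)
Definition C1at n (f : 'cV[R]_n -> R) (u : 'cV[R]_n) :=
  forall i, (\forall w \near u, derivable f w (cvec i)) /\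
            {for u, continuous (fun w => 'D_(cvec i) f w)}.

Lemma near_norm n (u : 'cV[R]_n) (P : set 'cV[R]_n) :
  (\forall w \near u, P w) -> exists2 e : R, 0 < e & forall w, `|w - u| < e -> P w.
Proof.
move/nbhs_ballP => [e /= e0 he]; exists e => // w hw; apply: he.
by rewrite mx_norm_ball /ball_/= distrC.
Qed.

Lemma norm_near n (u : 'cV[R]_n) (P : set 'cV[R]_n) e :
  0 < e -> (forall w, `|w - u| < e -> P w) -> \forall w \near u, P w.
Proof.
move=> e0 h; apply/nbhs_ballP; exists e => //= w; rewrite mx_norm_ball /ball_/= => hw.
by apply: h; rewrite distrC.
Qed.

(** Passing from [u] to [v] one coordinate at a time, each increment is a slope times a coordinate
    difference, and the mean value theorem makes the slopes continuous at [u]. This form replaces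
    Frechet differentiability in the chain rule and in the differentiation of an inverse map. *)
Lemma caratheodory n (f : 'cV[R]_n -> R) u : C1at f u ->
  exists c : 'I_n -> 'cV[R]_n -> R,
    (forall i, {for u, continuous (c i)} /\ c i u = 'D_(cvec i) f u) /\
    (forall v, f v - f u = \sum_i c i v * (v i ord0 - u i ord0)).
Proof.
move=> hf.
(* [mix k v] has the coordinates of [v] below index [k] and those of [u] from [k] on. *)
pose mix k (v : 'cV[R]_n) : 'cV[R]_n := \col_i (if (i < k)%N then v i ord0 else u i ord0).
have mixS (k : 'I_n) v : mix k.+1 v = mix k v + (v k ord0 - u k ord0) *: cvec k.
  apply/colP => i; rewrite !mxE ltnS leq_eqVlt.
  case: (eqVneq (i : nat) k) => [/val_inj ->|ik] /=.
    by rewrite ltnn !eqxx/= mulr1 subrKC.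
  have -> : (i == k) = false by apply/negbTE.
  by rewrite mulr0 addr0.
pose c (k : 'I_n) (v : 'cV[R]_n) := if v k ord0 == u k ord0 then 'D_(cvec k) f u else
  (f (mix k.+1 v) - f (mix k v)) / (v k ord0 - u k ord0).
exists c; split; last first.
  move=> v.
  have -> : f v - f u = f (mix n v) - f (mix 0%N v).
    by congr (f _ - f _); apply/colP => i; rewrite !mxE ?ltn_ord.
  rewrite -(telescope_sumr (fun k => f (mix k v)))// big_mkord; apply: eq_bigr => k _.
  rewrite /c; case: eqVneq => [e|ne]; last by rewrite divfK// subr_eq0.
  by rewrite mixS e subrr mulr0 scale0r addr0 subrr.
move=> k; split; last by rewrite /c eqxx.
have [hd hc] := hf k.
apply/cont_atP => e e0; have {}hc := (proj1 (cont_atP _ _) hc) e e0.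
have [d d0 hd'] := near_norm (filterI hd hc).
apply: (norm_near d0) => v hv; rewrite /c eqxx.
case: eqVneq => [_|ne]; first by rewrite subrr normr0.
have hw t : 0 <= t <= 1 ->
    `|mix k v + t *: ((v k ord0 - u k ord0) *: cvec k) - u| < d.
  move=> /andP[t0 t1]; apply: (le_lt_trans _ hv); apply: cV_norm_le => // i.
  have hi := coord_le_norm (v - u) i.
  rewrite !mxE in hi *; case: ltnP => ik.
    have -> : (i == k) = false by apply/negbTE; move: ik; rewrite ltn_neqAle => /andP[].
    by rewrite !mulr0 addr0.
  case: eqVneq => [ek|_] /=; last by rewrite !mulr0 addr0 subrr normr0.
  rewrite mulr1 addrAC subrr add0r -ek normrM ger0_norm//.
  by apply: (le_trans _ hi); rewrite ler_piMl.
have [t t01] := @MVT_line _ f (fun w => (v k ord0 - u k ord0) * 'D_(cvec k) f w)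
  (mix k v) ((v k ord0 - u k ord0) *: cvec k)
  (fun t ht => is_derive_scale _ (derivableP (proj1 (hd' _ (hw t ht))))).
rewrite mixS => ->; rewrite mulrC mulKf; last by rewrite subr_eq0.
by have [] := hd' _ (hw t _); first by case/andP: t01 => *; rewrite !ltW.
Qed.

Lemma cV_cvg n (T : Type) (F : set_system T) {FF : Filter F} (g : T -> 'cV[R]_n) (u : 'cV[R]_n) :
  (forall i, g x i ord0 @[x --> F] --> u i ord0) -> g x @[x --> F] --> u.
Proof.
move=> h; apply/cvgrPdist_le => e e0; near=> x.
apply: cV_norm_le; first exact: ltW.
move=> i; rewrite !mxE; move: i; near: x; apply: filter_forall => i.
by move/cvgrPdist_le : (h i) => /(_ _ e0).
Unshelve. all: by end_near. Qed.

Lemma derivable_line_cvg (V : normedModType R) (f : V -> R) x v :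
  derivable f x v -> f (h *: v + x) @[h --> (0 : R)^'] --> f x.
Proof.
move=> /derivable1P /derivable1_diffP /differentiable_continuous.
move=> /continuous_withinNx; rewrite scale0r add0r; exact.
Qed.

(** By the Caratheodory form of [f], the difference quotient of the composite is a sum of slopes
    times difference quotients of the coordinates of [g]. Only the direction [v] is involved, so [g]
    may be a curve as well as a map of several variables. *)
Lemma is_derive_chain n (V : normedModType R) (g : V -> 'cV[R]_n) (f : 'cV[R]_n -> R)
    x v (d : 'I_n -> R) :
  C1at f (g x) -> (forall i, is_derive x v (fun y => g y i ord0) (d i)) ->
  is_derive x v (f \o g) (\sum_i 'D_(cvec i) f (g x) * d i).
Proof.
move=> hf hg.
have [c [hc hfc]] := caratheodory hf.
have gc : g (h *: v + x) @[h --> (0 : R)^'] --> g x.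
  by apply: cV_cvg => i; apply: (@derivable_line_cvg V (fun y => g y i ord0)); have [] := hg i.
have Q : h^-1 *: ((f \o g) (h *: v + x) - (f \o g) x) @[h --> (0 : R)^'] -->
    \sum_i 'D_(cvec i) f (g x) * d i.
  have -> : (fun h : R => h^-1 *: ((f \o g) (h *: v + x) - (f \o g) x)) =
    (fun h => \sum_i c i (g (h *: v + x)) *
        (h^-1 *: (g (h *: v + x) i ord0 - g x i ord0))).
    apply/funext => h; rewrite /= hfc scaler_sumr; apply: eq_bigr => i _.
    by rewrite scalerAr.
  apply: cvg_big => [|i _]; first exact: add_continuous.
  have [cc <-] := hc i; apply: cvgM.
    exact: (cvg_comp _ _ gc cc).
  have [h1 <-] := hg i; exact: h1.
by split; [apply/cvg_ex; exists (\sum_i 'D_(cvec i) f (g x) * d i)|apply/cvg_lim].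
Qed.

Lemma cont_cV_atP (T : topologicalType) n (f : T -> 'cV[R]_n) (u : T) :
  {for u, continuous f} <-> (forall i, {for u, continuous (fun x => f x i ord0)}).
Proof.
split=> h.
  by move=> i; apply: (@continuous_comp _ _ _ f (fun M => M i ord0)) => //; exact: coord_continuous.
suff : f w @[w --> u] --> f u by [].
by apply: cV_cvg => i; exact: h.
Qed.

Lemma cont_pair_at (A B C : topologicalType) (a : A -> B) (b : A -> C) u :
  {for u, continuous a} -> {for u, continuous b} ->
  {for u, continuous (fun x => (a x, b x))}.
Proof. by move=> ha hb; exact: (cvg_pair ha hb). Qed.

Lemma cst_cont_at (A B : topologicalType) (b : B) (u : A) : {for u, continuous (fun=> b)}.
Proof. exact: cst_continuous. Qed.

Section CkP.
Context {T : topologicalType} {n : nat}.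
Implicit Types (O : set (T * 'cV[R]_n)) (f g : T -> 'cV[R]_n -> R).

(** Derivatives are taken in the space variable only, but all of them are jointly continuous in
    parameter and space. A bare topological space [T] of parameters suits time-dependent fields,
    which are merely continuous in time after clamping; with a dummy [T] it covers ordinary
    functions. *)
Fixpoint CkP (k : nat) O f : Prop :=
  (forall p, O p -> {for p, continuous (fun q => f q.1 q.2)}) /\
  match k with
  | 0%N => True
  | k'.+1 => forall i, (forall p, O p -> derivable (f p.1) p.2 (cvec i)) /\
               CkP k' O (fun t x => 'D_(cvec i) (f t) x)
  end.

Lemma CkP_sub k O O' f : O' `<=` O -> CkP k O f -> CkP k O' f.
Proof.
move=> s; elim: k f => [|k IH] f [c h]; (split; first by move=> p /s; exact: c) => //.
move=> i; by have [h1 h2] := h i; split=> [p /s|]; [exact: h1|exact: IH].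
Qed.

Lemma CkP_cont k O f p : CkP k O f -> O p -> {for p, continuous (fun q => f q.1 q.2)}.
Proof. by case: k => [|k] [h _]; exact: h. Qed.

Lemma CkP_derivable k O f p i : CkP k.+1 O f -> O p -> derivable (f p.1) p.2 (cvec i).
Proof. by move=> [_ /(_ i)[h _]]; exact: h. Qed.

Lemma CkP_D k O f i : CkP k.+1 O f -> CkP k O (fun t x => 'D_(cvec i) (f t) x).
Proof. by move=> [_ /(_ i)[_ h]]. Qed.

Lemma CkPW k O f : CkP k.+1 O f -> CkP k O f.
Proof.
elim: k f => [|k IH] f [c h]; split=> // i; have [h1 h2] := h i.
by split=> //; apply: IH.
Qed.

Lemma CkP_le k k' O f : (k' <= k)%N -> CkP k O f -> CkP k' O f.
Proof.
move=> /subnKC <-; elim: (k - k')%N => [|d IH]; first by rewrite addn0.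
by rewrite addnS => /CkPW.
Qed.

Lemma slice_near O (t : T) (x : 'cV[R]_n) : open O -> O (t, x) -> \forall y \near x, O (t, y).
Proof.
move=> oO Op; have hc : {for x, continuous (fun y : 'cV[R]_n => (t, y))}.
  by apply: (@cont_pair_at _ _ _ (fun=> t) id); [exact: cst_cont_at|exact: cvg_id].
by apply: hc; apply: open_nbhs_nbhs; split.
Qed.

Lemma open_near O p : open O -> O p -> \forall q \near p, O q.
Proof. by move=> oO Op; apply: open_nbhs_nbhs. Qed.

Lemma CkP_ext k O f g : open O -> (forall p, O p -> f p.1 p.2 = g p.1 p.2) ->
  CkP k O f -> CkP k O g.
Proof.
move=> oO; have near_cont a b : (forall p, O p -> a p.1 p.2 = b p.1 p.2) ->
    (forall p, O p -> {for p, continuous (fun q : T * 'cV[R]_n => a q.1 q.2)}) ->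
    (forall p, O p -> {for p, continuous (fun q : T * 'cV[R]_n => b q.1 q.2 : R)}).
  move=> e c p Op; apply/cont_atP => d d0.
  have := (proj1 (cont_atP _ _) (c p Op)) d d0.
  by apply: filterS2 (open_near oO Op) => q Oq; rewrite !e.
elim: k f g => [|k IH] f g e [c h]; split=> //; try exact: near_cont c.
move=> i; have [h1 h2] := h i.
have ne p : O p -> \forall y \near p.2, f p.1 y = g p.1 y.
  by case: p => t x Op; apply: filterS (slice_near oO Op) => y Oy; exact: (e (t, y)).
split=> [p Op|]; first exact: near_eq_derivable (ne p Op) (h1 p Op).
by apply: IH h2 => p Op; apply: near_eq_derive; exact: ne.
Qed.

Lemma CkP_local k O f : (forall p, O p -> exists O', [/\ open O', O' p & CkP k O' f]) -> CkP k O f.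
Proof.
elim: k f => [|k IH] f h; split=> //.
- by move=> p /h[U [oU Op hf]]; exact: CkP_cont hf Op.
- by move=> p /h[U [oU Op hf]]; exact: CkP_cont hf Op.
move=> i; split; first by move=> p /h[U [oU Op hf]]; exact: CkP_derivable hf Op.
by apply: IH => p /h[U [q1 q2 q3]]; exists U; split=> //; exact: CkP_D.
Qed.

Lemma CkP_C1at O f t x : open O -> CkP 1 O f -> O (t, x) -> C1at (f t) x.
Proof.
move=> oO hf Op i; split.
  by apply: filterS (slice_near oO Op) => y Oy; exact: (CkP_derivable hf Oy).
have c := CkP_cont (CkP_D i hf) Op.
apply: (@continuous_comp _ _ _ (fun y => (t, y)) (fun q => 'D_(cvec i) (f q.1) q.2)) => //.
by apply: (@cont_pair_at _ _ _ (fun=> t) id); [exact: cst_cont_at|exact: cvg_id].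
Qed.

Lemma CkP_time k O (h : T -> R) : (forall p, O p -> {for p.1, continuous h}) ->
  CkP k O (fun t _ => h t).
Proof.
have cst_ok k' c : CkP k' O (fun _ _ => c).
  elim: k' c => [|k' IH] c; (split; first by move=> p _; exact: cvg_cst) => // i.
  split=> [p _|]; first exact: derivable_cst.
  have -> : (fun (_ : T) => 'D_(cvec i) (fun _ : 'cV[R]_n => c)) = (fun _ _ => 0).
    by apply/funext => t; apply/funext => x; rewrite derive_cst.
  exact: IH.
move=> hc; have cc p : O p -> {for p, continuous (fun q : T * 'cV[R]_n => h q.1)}.
  by move=> Op; apply: (@continuous_comp _ _ _ fst h); [exact: cvg_fst|exact: hc].
case: k => [|k]; split=> // i.
split=> [p _|]; first exact: derivable_cst.
have -> : (fun t => 'D_(cvec i) (fun _ : 'cV[R]_n => h t)) = (fun _ _ => 0).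
  by apply/funext => t; apply/funext => x; rewrite derive_cst.
exact: cst_ok.
Qed.

Lemma CkP_cst k O c : CkP k O (fun _ _ => c).
Proof. by apply: (@CkP_time k O (fun=> c)) => p _; exact: cvg_cst. Qed.

Lemma is_derive_coordv (i : 'I_n) (x v : 'cV[R]_n) :
  is_derive x v (fun y : 'cV[R]_n => y i ord0) (v i ord0).
Proof.
have E : (fun h : R => h^-1 *: ((h *: v + x) i ord0 - x i ord0)) =
    (fun h : R => h^-1 *: (h * v i ord0)).
  by apply/funext => h; rewrite !mxE addrK.
have Q : h^-1 *: ((h *: v + x) i ord0 - x i ord0) @[h --> (0 : R)^'] --> (v i ord0 : R).
  rewrite E; apply: cvg_near_cst; near=> h.
  by rewrite /GRing.scale/= mulKf//; near: h; exact: nbhs_dnbhs_neq.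
split; first by apply/cvg_ex; exists (v i ord0).
exact/cvg_lim.
Unshelve. all: by end_near. Qed.

Lemma is_derive_coord (i j : 'I_n) (x : 'cV[R]_n) :
  is_derive x (cvec j) (fun y : 'cV[R]_n => y i ord0) (i == j)%:R.
Proof.
have := is_derive_coordv i x (cvec j).
by rewrite /cvec mxE eqxx andbT.
Qed.

Lemma CkP_coord k O i : CkP k O (fun _ x => x i ord0).
Proof.
have cc p : O p -> {for p, continuous (fun q : T * 'cV[R]_n => q.2 i ord0)}.
  move=> _; apply: (@continuous_comp _ _ _ snd (fun M : 'cV[R]_n => M i ord0)).
    exact: cvg_snd.
  exact: coord_continuous.
case: k => [|k]; split=> // j.
split=> [p _|]; first by have [] := is_derive_coord i j p.2.
rewrite (_ : (fun _ _ => _) = (fun _ _ => (i == j)%:R)); first exact: CkP_cst.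
apply/funext => t; apply/funext => x.
by have [_ ->] := is_derive_coord i j x.
Qed.

Lemma CkP_add k O f g : open O -> CkP k O f -> CkP k O g ->
  CkP k O (fun t x => f t x + g t x).
Proof.
move=> oO; elim: k f g => [|k IH] f g [cf hf] [cg hg]; split=> //.
- by move=> p Op; apply: cvgD; [exact: cf|exact: cg].
- by move=> p Op; apply: cvgD; [exact: cf|exact: cg].
move=> i; have [f1 f2] := hf i; have [g1 g2] := hg i.
split=> [p Op|]; first by apply: derivableD; [exact: f1|exact: g1].
apply: CkP_ext (IH _ _ f2 g2) => // p Op.
by rewrite -(deriveD (f1 p Op) (g1 p Op)).
Qed.

Lemma CkP_mul k O f g : open O -> CkP k O f -> CkP k O g ->
  CkP k O (fun t x => f t x * g t x).
Proof.
move=> oO; elim: k f g => [|k IH] f g hf hg; split=> //.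
- by move=> p Op; apply: cvgM; [exact: (CkP_cont hf)|exact: (CkP_cont hg)].
- by move=> p Op; apply: cvgM; [exact: (CkP_cont hf)|exact: (CkP_cont hg)].
move=> i; split=> [p Op|].
  by apply: derivableM; [exact: CkP_derivable hf _|exact: CkP_derivable hg _].
have h := CkP_add oO (IH _ _ (CkPW hf) (CkP_D i hg)) (IH _ _ (CkPW hg) (CkP_D i hf)).
apply: CkP_ext h => // p Op.
by rewrite -(deriveM (CkP_derivable hf Op) (CkP_derivable hg Op)).
Qed.

Lemma CkP_opp k O f : open O -> CkP k O f -> CkP k O (fun t x => - f t x).
Proof.
move=> oO hf; have := CkP_mul oO (CkP_cst k O (-1)) hf.
by apply: CkP_ext => // p _; rewrite mulN1r.
Qed.

Lemma CkP_sum k O (I : Type) (r : seq I) (P : pred I) (F : I -> T -> 'cV[R]_n -> R) :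
  open O -> (forall i, CkP k O (F i)) -> CkP k O (fun t x => \sum_(i <- r | P i) F i t x).
Proof.
move=> oO h; elim: r => [|a r IH].
  apply: CkP_ext (CkP_cst k O 0) => // p _; by rewrite big_nil.
case: (boolP (P a)) => Pa.
  apply: CkP_ext (CkP_add oO (h a) IH) => // p _; by rewrite big_cons Pa.
by apply: CkP_ext IH => // p _; rewrite big_cons (negbTE Pa).
Qed.

Lemma CkP_prod k O (I : Type) (r : seq I) (P : pred I) (F : I -> T -> 'cV[R]_n -> R) :
  open O -> (forall i, CkP k O (F i)) -> CkP k O (fun t x => \prod_(i <- r | P i) F i t x).
Proof.
move=> oO h; elim: r => [|a r IH].
  apply: CkP_ext (CkP_cst k O 1) => // p _; by rewrite big_nil.
case: (boolP (P a)) => Pa.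
  apply: CkP_ext (CkP_mul oO (h a) IH) => // p _; by rewrite big_cons Pa.
by apply: CkP_ext IH => // p _; rewrite big_cons (negbTE Pa).
Qed.

Lemma CkP_inv k O f : open O -> (forall p, O p -> f p.1 p.2 != 0) -> CkP k O f ->
  CkP k O (fun t x => (f t x)^-1).
Proof.
move=> oO f0; elim: k => [|k IH] hf; split=> //.
- by move=> p Op; apply: cvgV; [exact: f0|exact: (CkP_cont hf)].
- by move=> p Op; apply: cvgV; [exact: f0|exact: (CkP_cont hf)].
move=> i; split=> [p Op|].
  by apply: derivableV; [exact: f0|exact: CkP_derivable hf _].
have hi := IH (CkPW hf).
have h := CkP_opp oO (CkP_mul oO (CkP_mul oO hi hi) (CkP_D i hf)).
apply: CkP_ext h => // p Op.
rewrite (deriveV (f0 p Op) (CkP_derivable hf Op)).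
by rewrite -exprVn -mulNr.
Qed.

End CkP.

(** The chain rule writes the first derivatives as sums of products of maps of order [k], so
    induction on the order works; the reparametrization [tau] is never differentiated, whence mere
    continuity. *)
Lemma CkP_comp (T T' : topologicalType) n p (tau : T -> T') (g : T -> 'cV[R]_n -> 'cV[R]_p)
    (O : set (T * 'cV[R]_n)) (O' : set (T' * 'cV[R]_p)) k f :
  open O -> open O' -> (forall q, O q -> {for q.1, continuous tau}) ->
  (forall j, CkP k O (fun t x => g t x j ord0)) ->
  (forall q, O q -> O' (tau q.1, g q.1 q.2)) -> CkP k O' f ->
  CkP k O (fun t x => f (tau t) (g t x)).
Proof.
move=> oO oO' ht hg hO.
have cc f' : (forall q, O' q -> {for q, continuous (fun q => f' q.1 q.2)}) ->
    forall q, O q -> {for q, continuous (fun q => f' (tau q.1) (g q.1 q.2) : R)}.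
  move=> c q Oq.
  apply: (@continuous_comp _ _ _ (fun q => (tau q.1, g q.1 q.2)) (fun q => f' q.1 q.2)).
    apply: cont_pair_at.
      by apply: (@continuous_comp _ _ _ fst tau); [exact: cvg_fst|exact: ht].
    apply: (proj2 (cont_cV_atP _ _)) => j; exact: (CkP_cont (hg j)).
  exact: c (hO _ Oq).
elim: k f hg => [|k IH] f hg hf; split=> //.
- by apply: cc => q; exact: CkP_cont hf.
- by apply: cc => q; exact: CkP_cont hf.
have D q i : O q -> is_derive q.2 (cvec i) (fun x => f (tau q.1) (g q.1 x))
    (\sum_j 'D_(cvec j) (f (tau q.1)) (g q.1 q.2) * 'D_(cvec i) (fun x => g q.1 x j ord0) q.2).
  move=> Oq; apply: is_derive_chain.
    by apply: (CkP_C1at oO') (hO _ Oq); apply: CkP_le hf.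
  by move=> j; apply: derivableP; exact: CkP_derivable (hg j) Oq.
move=> i; split=> [q Oq|]; first by have [] := D q i Oq.
have h : CkP k O (fun t x => \sum_j 'D_(cvec j) (f (tau t)) (g t x) *
    'D_(cvec i) (fun x => g t x j ord0) x).
  apply: CkP_sum => // j; apply: CkP_mul => //; last exact: CkP_D.
  apply: (IH (fun t x => 'D_(cvec j) (f t) x)) => [j'|]; first exact: CkPW.
  exact: CkP_D.
by apply: CkP_ext h => // q Oq; have [_ ->] := D q i Oq.
Qed.

Lemma C1_is_derive n (f : 'cV[R]_n -> R) w v : C1at f w ->
  is_derive w v f (\sum_i 'D_(cvec i) f w * v i ord0).
Proof.
move=> hf; apply: (@is_derive_chain n _ id f w v (fun i => v i ord0)) => // i.
exact: is_derive_coordv.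
Qed.

Lemma contD (T : topologicalType) (f g : T -> R) u :
  {for u, continuous f} -> {for u, continuous g} -> {for u, continuous (fun x => f x + g x)}.
Proof. by move=> hf hg; exact: cvgD. Qed.

Lemma contB (T : topologicalType) (f g : T -> R) u :
  {for u, continuous f} -> {for u, continuous g} -> {for u, continuous (fun x => f x - g x)}.
Proof. by move=> hf hg; exact: cvgB. Qed.

Lemma contM (T : topologicalType) (f g : T -> R) u :
  {for u, continuous f} -> {for u, continuous g} -> {for u, continuous (fun x => f x * g x)}.
Proof. by move=> hf hg; exact: cvgM. Qed.

Lemma cont_sum (T : topologicalType) (I : Type) (r : seq I) (P : pred I) (F : I -> T -> R) u :
  (forall i, {for u, continuous (F i)}) ->
  {for u, continuous (fun x => \sum_(i <- r | P i) F i x)}.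
Proof.
move=> h; suff : \sum_(i <- r | P i) F i x @[x --> u] --> \sum_(i <- r | P i) F i u by [].
apply: cvg_big => [|i _]; first exact: add_continuous.
exact: h.
Qed.

Lemma C1_continuous n (f : 'cV[R]_n -> R) w : C1at f w -> {for w, continuous f}.
Proof.
move=> hf; have [c [hc e]] := caratheodory hf.
have -> : f = (fun v => f w + \sum_i c i v * (v i ord0 - w i ord0)).
  by apply/funext => v; rewrite -e subrKC.
apply: contD; first exact: cst_cont_at.
apply: cont_sum => i; apply: contM; first by have [] := hc i.
by apply: contB; [exact: coord_continuous|exact: cst_cont_at].
Qed.

Lemma dist_half (a b c e : R) : `|b - a| < e / 2 -> `|c - b| < e / 2 -> `|a - c| <= e.
Proof.
move=> h1 h2; rewrite (splitr e) -(subrK b a) -addrA (le_trans (ler_normD _ _))//.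
by rewrite lerD// ltW// distrC.
Qed.

Lemma MVT_grad n (f : 'cV[R]_n -> R) a v :
  (forall t : R, 0 <= t <= 1 -> C1at f (a + t *: v)) ->
  exists2 t : R, 0 < t < 1 &
    f (a + v) - f a = \sum_i 'D_(cvec i) f (a + t *: v) * v i ord0.
Proof.
move=> h; apply: (@MVT_line _ f (fun w => \sum_i 'D_(cvec i) f w * v i ord0)) => t t01.
exact: C1_is_derive (h t t01).
Qed.

Lemma derive_shiftv n (g : 'cV[R]_n -> R) (w y v : 'cV[R]_n) :
  derivable g (y + w) v -> is_derive y v (fun y' => g (y' + w)) ('D_v g (y + w)).
Proof.
move=> hd; have E : (fun h : R => h^-1 *: (g (h *: v + y + w) - g (y + w))) =
    (fun h : R => h^-1 *: (g (h *: v + (y + w)) - g (y + w))).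
  by apply/funext => h; rewrite addrA.
by split; [rewrite /derivable E | rewrite /derive E].
Qed.

Lemma addKv (V : zmodType) (x a b : V) : x + a + b - x = a + b.
Proof. by rewrite addrC !addrA addNr add0r. Qed.

Lemma subr4C (V : zmodType) (a b c d : V) : a - b - (c - d) = a - c - (b - d).
Proof. by rewrite !opprB addrACA [RHS]addrACA [- b - c]addrC. Qed.

(** The mean value theorem is applied to the increment of [g] by [h *: v], along [u], and then to
    ['D_u g] along [v]. The left side is symmetric in [u] and [v], which is how the mixed
    derivatives get compared. *)
Lemma second_difference n (g : 'cV[R]_n -> R) (x u v : 'cV[R]_n) (d h : R) :
  `|u| <= 1 -> `|v| <= 1 ->
  (forall y, `|y - x| < d -> derivable g y u) ->
  (forall y, `|y - x| < d -> derivable (fun z => 'D_u g z) y v) ->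
  0 < h -> h + h < d ->
  exists2 y, `|y - x| <= h + h &
    (g (x + h *: u + h *: v) - g (x + h *: v)) - (g (x + h *: u) - g x) =
    h * (h * 'D_v (fun z => 'D_u g z) y).
Proof.
move=> u1 v1 du dv h0 hd.
have near (s t : R) : 0 <= s <= 1 -> 0 <= t <= 1 ->
    `|x + s *: (h *: u) + t *: (h *: v) - x| <= h + h.
  move=> /andP[s0 s1] /andP[t0 t1].
  rewrite addKv (le_trans (ler_normD _ _))// lerD//.
    rewrite !normrZ ger0_norm// (ger0_norm (ltW h0)).
    by rewrite mulrA -[leRHS]mulr1 ler_pM// ?mulr_ge0// ?(ltW h0)// ler_piMl// ltW.
  rewrite !normrZ ger0_norm// (ger0_norm (ltW h0)).
  by rewrite mulrA -[leRHS]mulr1 ler_pM// ?mulr_ge0// ?(ltW h0)// ler_piMl// ltW.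
have d1 (s : R) : 0 <= s <= 1 -> `|x + s *: (h *: u) + h *: v - x| < d.
  move=> hs; apply: le_lt_trans hd; rewrite -[h *: v]scale1r; apply: near => //.
  by rewrite ler01 lexx.
have d2 (s : R) : 0 <= s <= 1 -> `|x + s *: (h *: u) - x| < d.
  move=> hs; have := near s 0 hs; rewrite scale0r addr0 lexx ler01 => /(_ isT) H.
  exact: le_lt_trans H hd.
have [|s s01] := @MVT_line _ (fun y => g (y + h *: v) - g y)
    (fun y => h * ('D_u g (y + h *: v) - 'D_u g y)) x (h *: u).
  move=> t t01; apply: is_derive_scale; apply: is_deriveB.
    by apply: derive_shiftv; apply: du; exact: d1.
  by apply: derivableP; apply: du; exact: d2.
move=> E; have s01' : 0 <= s <= 1 by case/andP: s01 => *; rewrite !ltW.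
have [|t t01 E2] := @MVT_line _ (fun z => 'D_u g z) (fun z => h * 'D_v (fun z => 'D_u g z) z)
    (x + s *: (h *: u)) (h *: v).
  move=> t t01; apply: is_derive_scale; apply: derivableP; apply: dv.
  exact: le_lt_trans (near _ _ s01' t01) hd.
have t01' : 0 <= t <= 1 by case/andP: t01 => *; rewrite !ltW.
exists (x + s *: (h *: u) + t *: (h *: v)); first exact: near.
by rewrite -E2 -E; exact: subr4C.
Qed.

Lemma norm_cvec n (i : 'I_n) : `|cvec i : 'cV[R]_n| <= 1.
Proof.
apply: cV_norm_le => // j; rewrite mxE eqxx andbT.
by case: (j == i); rewrite ?normr0 ?normr1.
Qed.

Lemma schwarz (T : topologicalType) n (O : set (T * 'cV[R]_n)) (f : T -> 'cV[R]_n -> R)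
    (t : T) (x : 'cV[R]_n) (i j : 'I_n) :
  open O -> CkP 2 O f -> O (t, x) ->
  'D_(cvec i) (fun y => 'D_(cvec j) (f t) y) x = 'D_(cvec j) (fun y => 'D_(cvec i) (f t) y) x.
Proof.
move=> oO hf Op; apply/eqP; rewrite -subr_eq0 -normr_eq0; apply/eqP/le_anti/andP.
split=> //; apply/ler_addgt0Pl => e e0; rewrite addr0.
have e2 : 0 < e / 2 by rewrite divr_gt0.
have cont a b : \forall y \near x,
    `|'D_(cvec a) (fun y => 'D_(cvec b) (f t) y) y -
      'D_(cvec a) (fun y => 'D_(cvec b) (f t) y) x| < e / 2.
  apply: (proj1 (cont_atP _ _)) e2.
  by have [_] := (CkP_C1at oO (CkP_D b hf) Op) a.
have [d d0 hd] := near_norm (filterI (slice_near oO Op) (filterI (cont i j) (cont j i))).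
(* Both intermediate points then lie within [2 h < d] of [x], where the mixed derivatives differ
   from their values at [x] by less than [e / 2]. *)
pose h := d / 4; have h0 : 0 < h by rewrite divr_gt0.
have hhd : h + h < d by rewrite /h; lra.
have der a y : `|y - x| < d -> derivable (f t) y (cvec a).
  by move=> /hd[Oy _]; exact: CkP_derivable hf Oy.
have der2 a b y : `|y - x| < d -> derivable (fun z => 'D_(cvec a) (f t) z) y (cvec b).
  by move=> /hd[Oy _]; exact: CkP_derivable (CkP_D a hf) Oy.
have [y1 hy1 E1] := second_difference (norm_cvec i) (norm_cvec j)
  (der i) (der2 i j) h0 hhd.
have [y2 hy2 E2] := second_difference (norm_cvec j) (norm_cvec i)
  (der j) (der2 j i) h0 hhd.
have [_ [_ c1]] := hd y1 (le_lt_trans hy1 hhd).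
have [_ [c2 _]] := hd y2 (le_lt_trans hy2 hhd).
have E : 'D_(cvec j) (fun z => 'D_(cvec i) (f t) z) y1 =
         'D_(cvec i) (fun z => 'D_(cvec j) (f t) z) y2.
  apply: (mulfI (lt0r_neq0 h0)); apply: (mulfI (lt0r_neq0 h0)).
  by apply: etrans (esym E1) _; apply: etrans _ E2; rewrite (addrAC x); exact: subr4C.
rewrite E distrC in c1.
exact: dist_half c2 c1.
Qed.

(** [bool] is a dummy parameter space: a function constant in the parameter is [Ck] exactly when it
    is [CkP], so one calculus serves both notions. *)
Definition lift1 n (U : set 'cV[R]_n) : set (bool * 'cV[R]_n) := [set p | U p.2].

Lemma open_lift1 n (U : set 'cV[R]_n) : open U -> open (lift1 U).
Proof.
move=> oU; have -> : lift1 U = (fun p : bool * 'cV[R]_n => p.2) @^-1` U by [].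
by apply: open_comp => // p _; exact: cvg_snd.
Qed.

Lemma CkE n k (U : set 'cV[R]_n) f : Ck k U f <-> CkP k (lift1 U) (fun _ : bool => f).
Proof.
have cE f' : (forall u, U u -> {for u, continuous f'}) <->
    (forall p, lift1 U p -> {for p, continuous (fun q : bool * 'cV[R]_n => f' q.2 : R)}).
  split=> h.
    move=> p Up; apply: (@continuous_comp _ _ _ snd f'); first exact: cvg_snd.
    exact: h.
  move=> u Uu; have /= c := h (true, u) Uu.
  apply: (@continuous_comp _ _ _ (fun y => (true, y)) (fun q : bool * 'cV[R]_n => f' q.2)) => //.
  by apply: (@cont_pair_at _ _ _ (fun=> true) id); [exact: cst_cont_at|exact: cvg_id].
elim: k f => [|k IH] f /=.
  by split=> -[h _]; split=> //; exact/(cE f).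
split=> -[h1 h2]; split; try exact/(cE f).
  move=> i; have [h3 /IH h4] := h2 i; split=> // p; exact: h3.
move=> i; have [h3 /IH h4] := h2 i; split=> // u Uu; exact: (h3 (true, u)).
Qed.
End Differential_calculus.

(** * Matrix-valued maps and the inverse function theorem *)

Section Inverse_functions.
Context {R : realType}.

Definition CkPm (T : topologicalType) n p q (k : nat) (O : set (T * 'cV[R]_n))
    (A : T -> 'cV[R]_n -> 'M[R]_(p, q)) :=
  forall i j, CkP k O (fun t x => A t x i j).

Section CkPm.
Context {T : topologicalType} {n : nat}.
Implicit Types (O : set (T * 'cV[R]_n)).

Lemma CkPm_sub p q k O O' (A : T -> 'cV[R]_n -> 'M[R]_(p, q)) :
  O' `<=` O -> CkPm k O A -> CkPm k O' A.
Proof. by move=> s h i j; apply: CkP_sub (h i j). Qed.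

Lemma CkPm_ext p q k O (A B : T -> 'cV[R]_n -> 'M[R]_(p, q)) : open O ->
  (forall t x, O (t, x) -> A t x = B t x) -> CkPm k O A -> CkPm k O B.
Proof. by move=> oO e h i j; apply: CkP_ext (h i j) => // -[t x] /= /e ->. Qed.

Lemma CkPm_cst p q k O (M : 'M[R]_(p, q)) : CkPm k O (fun _ _ => M).
Proof. by move=> i j; exact: CkP_cst. Qed.

Lemma CkPm_id k O : CkPm k O (fun _ x => x).
Proof. by move=> i j; rewrite (ord1 j); exact: CkP_coord. Qed.

Lemma CkPm_add p q k O (A B : T -> 'cV[R]_n -> 'M[R]_(p, q)) : open O ->
  CkPm k O A -> CkPm k O B -> CkPm k O (fun t x => A t x + B t x).
Proof.
move=> oO hA hB i j; apply: CkP_ext (CkP_add oO (hA i j) (hB i j)) => // w _.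
by rewrite mxE.
Qed.

Lemma CkPm_opp p q k O (A : T -> 'cV[R]_n -> 'M[R]_(p, q)) : open O ->
  CkPm k O A -> CkPm k O (fun t x => - A t x).
Proof.
move=> oO hA i j; apply: CkP_ext (CkP_opp oO (hA i j)) => // w _.
by rewrite mxE.
Qed.

Lemma CkPm_scale p q k O (a : T -> 'cV[R]_n -> R) (A : T -> 'cV[R]_n -> 'M[R]_(p, q)) :
  open O -> CkP k O a -> CkPm k O A -> CkPm k O (fun t x => a t x *: A t x).
Proof.
move=> oO ha hA i j; apply: CkP_ext (CkP_mul oO ha (hA i j)) => // w _.
by rewrite mxE.
Qed.

Lemma CkPm_mul p q r k O (A : T -> 'cV[R]_n -> 'M[R]_(p, q))
    (B : T -> 'cV[R]_n -> 'M[R]_(q, r)) : open O ->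
  CkPm k O A -> CkPm k O B -> CkPm k O (fun t x => A t x *m B t x).
Proof.
move=> oO hA hB i j.
have h : CkP k O (fun t x => \sum_l A t x i l * B t x l j).
  by apply: CkP_sum => // l; apply: CkP_mul => //.
by apply: CkP_ext h => // w _; rewrite mxE.
Qed.

Lemma CkPm_tr p q k O (A : T -> 'cV[R]_n -> 'M[R]_(p, q)) : open O ->
  CkPm k O A -> CkPm k O (fun t x => (A t x)^T).
Proof. by move=> oO hA i j; apply: CkP_ext (hA j i) => // w _; rewrite mxE. Qed.

Lemma CkPm_mx p q k O (F : T -> 'cV[R]_n -> 'I_p -> 'I_q -> R) : open O ->
  (forall i j, CkP k O (fun t x => F t x i j)) ->
  CkPm k O (fun t x => \matrix_(i, j) F t x i j).
Proof. by move=> oO hA i j; apply: CkP_ext (hA i j) => // w _; rewrite mxE. Qed.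

Lemma CkPm_col p1 p2 q k O (A : T -> 'cV[R]_n -> 'M[R]_(p1, q))
    (B : T -> 'cV[R]_n -> 'M[R]_(p2, q)) : open O ->
  CkPm k O A -> CkPm k O B -> CkPm k O (fun t x => col_mx (A t x) (B t x)).
Proof.
move=> oO hA hB i j; case: (split_ordP i) => l ->.
  by apply: CkP_ext (hA l j) => // w _; rewrite col_mxEu.
by apply: CkP_ext (hB l j) => // w _; rewrite col_mxEd.
Qed.

Lemma CkPm_usub p1 p2 q k O (A : T -> 'cV[R]_n -> 'M[R]_(p1 + p2, q)) : open O ->
  CkPm k O A -> CkPm k O (fun t x => usubmx (A t x)).
Proof. by move=> oO hA i j; apply: CkP_ext (hA (lshift _ i) j) => // w _; rewrite mxE. Qed.

Lemma CkPm_dsub p1 p2 q k O (A : T -> 'cV[R]_n -> 'M[R]_(p1 + p2, q)) : open O ->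
  CkPm k O A -> CkPm k O (fun t x => dsubmx (A t x)).
Proof. by move=> oO hA i j; apply: CkP_ext (hA (rshift _ i) j) => // w _; rewrite mxE. Qed.

Lemma CkP_det p k O (A : T -> 'cV[R]_n -> 'M[R]_p) : open O ->
  CkPm k O A -> CkP k O (fun t x => \det (A t x)).
Proof.
move=> oO hA; apply: CkP_sum => // s; apply: CkP_mul => //; first exact: CkP_cst.
by apply: CkP_prod => // i; exact: hA.
Qed.

(** Cramer's formula: the inverse is the adjugate divided by the determinant. *)
Lemma CkPm_inv p k O (A : T -> 'cV[R]_n -> 'M[R]_p) : open O ->
  (forall t x, O (t, x) -> A t x \in unitmx) ->
  CkPm k O A -> CkPm k O (fun t x => invmx (A t x)).
Proof.
move=> oO uA hA.
have h : CkPm k O (fun t x => (\det (A t x))^-1 *: \adj (A t x)).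
  apply: CkPm_scale => //.
    apply: CkP_inv => //; last exact: CkP_det.
    by move=> [t x] /uA; rewrite unitmxE unitfE.
  move=> i j; have h : CkP k O (fun t x => cofactor (A t x) j i).
    apply: CkP_mul => //; first exact: CkP_cst.
    apply: CkP_det => // i' j'.
    by apply: CkP_ext (hA (lift j i') (lift i j')) => // w _; rewrite !mxE.
  by apply: CkP_ext h => // w _; rewrite mxE.
by apply: CkPm_ext h => // t x /uA u; rewrite /invmx u.
Qed.

Lemma CkPm_jac p k O (g : T -> 'cV[R]_n -> 'cV[R]_p) : open O ->
  CkPm k.+1 O g -> CkPm k O (fun t x => jac (g t) x).
Proof. by move=> oO hg; apply: CkPm_mx => // i j; exact: CkP_D. Qed.

Lemma CkPmW p q k O (A : T -> 'cV[R]_n -> 'M[R]_(p, q)) :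
  CkPm k.+1 O A -> CkPm k O A.
Proof. by move=> h i j; exact: CkPW. Qed.

Lemma CkPm_S p k O (g : T -> 'cV[R]_n -> 'cV[R]_p) :
  CkPm k O g -> (forall p i j, O p -> derivable (fun w => g p.1 w i ord0) p.2 (cvec j)) ->
  CkPm k O (fun t x => jac (g t) x) -> open O -> CkPm k.+1 O g.
Proof.
move=> hg hd hj oO i j; rewrite (ord1 j); split.
  by move=> q Oq; exact: CkP_cont (hg i ord0) Oq.
move=> l; split=> [q Oq|]; first exact: hd.
by apply: CkP_ext (hj i l) => // w _; rewrite mxE.
Qed.

Definition C1v (p : nat) (f : 'cV[R]_n -> 'cV[R]_p) u :=
  forall i, C1at (fun w => f w i ord0) u.

Lemma CkPm_C1v p O (g : T -> 'cV[R]_n -> 'cV[R]_p) (t : T) (x : 'cV[R]_n) :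
  open O -> CkPm 1 O g -> O (t, x) -> C1v (g t) x.
Proof. by move=> oO hg Op i; exact: (CkP_C1at oO (hg i ord0) Op). Qed.

End CkPm.

Lemma CkPm_comp (T T' : topologicalType) n p a b (tau : T -> T') (g : T -> 'cV[R]_n -> 'cV[R]_p)
    (O : set (T * 'cV[R]_n)) (O' : set (T' * 'cV[R]_p)) k (A : T' -> 'cV[R]_p -> 'M[R]_(a, b)) :
  open O -> open O' -> (forall q, O q -> {for q.1, continuous tau}) ->
  CkPm k O g -> (forall q, O q -> O' (tau q.1, g q.1 q.2)) -> CkPm k O' A ->
  CkPm k O (fun t x => A (tau t) (g t x)).
Proof.
move=> oO oO' ht hg hO hA i j.
by apply: (CkP_comp oO oO' ht _ hO (hA i j)) => l; exact: hg.
Qed.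

Lemma C1v_derive n p (f : 'cV[R]_n -> 'cV[R]_p) u v i : C1v f u ->
  is_derive u v (fun w => f w i ord0) ((jac f u *m v) i ord0).
Proof.
move=> h; apply: is_derive_eq; first exact: C1_is_derive (h i).
by rewrite mxE; apply: eq_bigr => j _; rewrite mxE.
Qed.

Lemma C1v_continuous n p (f : 'cV[R]_n -> 'cV[R]_p) u : C1v f u -> {for u, continuous f}.
Proof. by move=> h; apply/cont_cV_atP => i; exact: C1_continuous. Qed.

Lemma is_derive_chainv (V : normedModType R) n p (g : V -> 'cV[R]_n) (f : 'cV[R]_n -> 'cV[R]_p)
    x v (d : 'cV[R]_n) i :
  C1v f (g x) -> (forall i, is_derive x v (fun y => g y i ord0) (d i ord0)) ->
  is_derive x v (fun y => f (g y) i ord0) ((jac f (g x) *m d) i ord0).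
Proof.
move=> hf hg; apply: is_derive_eq; first exact: (is_derive_chain (hf i) hg).
by rewrite mxE; apply: eq_bigr => j _; rewrite mxE.
Qed.

Lemma jacE n p (f : 'cV[R]_n -> 'cV[R]_p) u (M : 'M[R]_(p, n)) :
  (forall i j, is_derive u (cvec j) (fun w => f w i ord0) (M i j)) -> jac f u = M.
Proof. by move=> h; apply/matrixP => i j; rewrite mxE; have [_ ->] := h i j. Qed.

Lemma jac_comp m n p (g : 'cV[R]_m -> 'cV[R]_n) (f : 'cV[R]_n -> 'cV[R]_p) u :
  C1v f (g u) -> C1v g u -> jac (f \o g) u = jac f (g u) *m jac g u.
Proof.
move=> hf hg; apply: jacE => i j.
apply: is_derive_eq.
  apply: (is_derive_chainv (d := jac g u *m cvec j)) => // l; exact: C1v_derive.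
by rewrite mulmxA -colE mxE.
Qed.

Lemma jac_near n p (f g : 'cV[R]_n -> 'cV[R]_p) (u : 'cV[R]_n) :
  (\forall w \near u, f w = g w) -> jac f u = jac g u.
Proof.
move=> h; apply/matrixP => i j; rewrite !mxE.
by apply: near_eq_derive; apply: filterS h => w ->.
Qed.

Lemma jac_affine n p (A : 'M[R]_(p, n)) b u : jac (fun w => A *m w + b) u = A.
Proof.
apply: jacE => i j.
have h : is_derive u (cvec j) (fun w : 'cV[R]_n => \sum_l A i l * w l ord0 + b i ord0)
   (\sum_l A i l * (l == j)%:R + 0).
  apply: is_deriveD.
  have -> : (fun w : 'cV[R]_n => \sum_l A i l * w l ord0) =
      \sum_l (A i l *: (fun w : 'cV[R]_n => w l ord0)).
    by apply/funext => w; rewrite fct_sumE.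
  apply: is_derive_sum => l; apply: is_deriveZ; exact: is_derive_coord.
have -> : (fun w : 'cV[R]_n => (A *m w + b) i ord0) =
  (fun w : 'cV[R]_n => \sum_l A i l * w l ord0 + b i ord0).
  by apply/funext => w; rewrite !mxE.
apply: is_derive_eq h _.
rewrite addr0 (bigD1 j)//= eqxx mulr1 big1 ?addr0// => l /negbTE ->.
by rewrite mulr0.
Qed.

Lemma jac_id n (u : 'cV[R]_n) : jac id u = 1%:M.
Proof.
apply: jacE => i j; rewrite mxE; exact: is_derive_coord.
Qed.

Lemma C1v_affine n p (A : 'M[R]_(p, n)) b u : C1v (fun w => A *m w + b) u.
Proof.
apply: (@CkPm_C1v bool n p setT (fun _ w => A *m w + b) true u) => //.
  exact: openT.
apply: CkPm_add; [exact: openT| |exact: CkPm_cst].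
by apply: CkPm_mul; [exact: openT|exact: CkPm_cst|exact: CkPm_id].
Qed.

Lemma jac_mull m n p (A : 'M[R]_(p, n)) (f : 'cV[R]_m -> 'cV[R]_n) u :
  C1v f u -> jac (fun x => A *m f x) u = A *m jac f u.
Proof.
move=> hf; have e : (fun x => A *m f x) = (fun y => A *m y + 0) \o f.
  by apply/funext => x; rewrite /= addr0.
by rewrite e jac_comp ?jac_affine//; exact: C1v_affine.
Qed.

Lemma mulmx_norm p q (M : 'M[R]_(p, q)) (v : 'cV[R]_q) (c : R) : 0 <= c ->
  (forall i j, `|M i j| <= c) -> `|M *m v| <= c * q%:R * `|v|.
Proof.
move=> c0 h; apply: cV_norm_le; first by rewrite !mulr_ge0.
move=> i; rewrite mxE (le_trans (ler_norm_sum _ _ _))//.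
have -> : c * q%:R * `|v| = \sum_(j < q) (c * `|v|).
  by rewrite sumr_const card_ord -[RHS]mulr_natr mulrAC.
apply: ler_sum => j _; rewrite normrM ler_pM//; exact: coord_le_norm.
Qed.

(** The mean value theorem is used row by row, so each row has its own intermediate point; this is
    harmless because the bound on [jac f - A] holds along the whole segment. *)
Lemma lip_jac n p (f : 'cV[R]_n -> 'cV[R]_p) (A : 'M[R]_(p, n))
    (a b : 'cV[R]_n) (c : R) : 0 <= c ->
  (forall t : R, 0 <= t <= 1 -> C1v f (a + t *: (b - a)) /\
      forall i j, `|jac f (a + t *: (b - a)) i j - A i j| <= c) ->
  `|f b - f a - A *m (b - a)| <= c * n%:R * `|b - a|.
Proof.
move=> c0 h; apply: cV_norm_le; first by rewrite !mulr_ge0.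
move=> i.
have [|t t01 E] := @MVT_grad R n (fun w => f w i ord0) a (b - a).
  by move=> t t01; have [h1 _] := h t t01; exact: h1.
have {}t01 : 0 <= t <= 1 by case/andP: t01 => *; rewrite !ltW.
have [_ hc] := h t t01.
rewrite subrKC in E.
have -> : (f b - f a - A *m (b - a)) i ord0 =
    ((jac f (a + t *: (b - a)) - A) *m (b - a)) i ord0.
  rewrite mulmxBl [LHS]mxE [RHS]mxE; congr (_ + _).
  rewrite !mxE; apply: etrans E _; apply: eq_bigr => j _.
  by rewrite !mxE.
apply: le_trans (coord_le_norm _ i) _; apply: mulmx_norm => // i' j'.
by rewrite mxE [(- A) _ _]mxE; exact: hc.
Qed.

(** Compactness of [0, 1]. The larger open time interval in the conclusion comes from adding a small
    time shift to the parameters of the covering: a time in []- e, 1 + e[] is its nearest point of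
    [0, 1] plus a shift. *)
Lemma tube (X : topologicalType) (x0 : X) (P : set (R * X)) :
  (forall t : R, 0 <= t <= 1 -> \forall p \near (t, x0), P p) ->
  exists2 e : R, 0 < e & \forall x \near x0, forall t : R, - e < t < 1 + e -> P (t, x).
Proof.
move=> h.
have nc := (proj1 (compact_near_coveringP _) (@segment_compact R 0 1)).
have := nc (X * R)%type (nbhs (x0, 0 : R)) (fun i t => P (t + i.2, i.1)) _.
have cond : forall t : R, `[0, 1]%classic t ->
    \forall t' \near t & i \near (x0, 0 : R), P (t' + i.2, i.1).
  move=> t; rewrite /= in_itv/= => /h ht.
  have c : {for (t, (x0, 0 : R)), continuous (fun q : R * (X * R) => (q.1 + q.2.2, q.2.1))}.
    apply: cont_pair_at.
      apply: contD; first exact: cvg_fst.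
      by apply: (@continuous_comp _ _ _ snd snd); exact: cvg_snd.
    by apply: (@continuous_comp _ _ _ snd fst); [exact: cvg_snd|exact: cvg_fst].
  by apply: c; rewrite /= addr0.
move=> /(_ _ cond) [[U V] /= [hU hV] hUV].
have [e /= e0 he] := proj1 (nbhs_ballP _ _) hV.
exists (e / 2); first by rewrite divr_gt0.
apply: filterS hU => x Ux t /andP[t1 t2].
pose c := if t < 0 then 0 else if 1 < t then 1 else t.
have c01 : `[0, 1]%classic c.
  rewrite /= in_itv/= /c; case: ltP => [//|t0]; first by rewrite lexx ler01.
  by case: ltP => [|->]; rewrite ?lexx ?ler01 ?t0.
have Vs : V (t - c).
  apply: he; rewrite /ball/= sub0r normrN /c ltr_norml.
  by case: (ltP t 0) => [t0|t0]; [|case: (ltP 1 t) => ?]; apply/andP; split; lra.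
by have := hUV (x, t - c) (conj Ux Vs) c c01; rewrite /= addrC subrK.
Qed.

(** The intervals centred at [a k] with radius [2 * C / 2 ^+ k] are nested, so the supremum of their
    left ends lies in all of them, which gives the limit together with the rate. *)
Lemma geom_cvg (a : nat -> R) C :
  (forall k, `|a k.+1 - a k| <= C / 2 ^+ k) ->
  exists l, forall k, `|a k - l| <= 2 * C / 2 ^+ k.
Proof.
move=> h.
have C0 k : 0 <= C / 2 ^+ k by exact: le_trans (normr_ge0 _) (h k).
pose p k := a k - 2 * C / 2 ^+ k; pose r k := a k + 2 * C / 2 ^+ k.
have E k : 2 * C / 2 ^+ k.+1 = C / 2 ^+ k.
  by rewrite exprS invfM mulrACA divff// mul1r.
have E2 k : 2 * C / 2 ^+ k = C / 2 ^+ k + C / 2 ^+ k.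
  by rewrite -mulrA mulrDl mul1r.
have pS k : p k <= p k.+1.
  by have := h k; rewrite ler_norml /p E E2 => /andP[h1 h2]; lra.
have rS k : r k.+1 <= r k.
  by have := h k; rewrite ler_norml /r E E2 => /andP[h1 h2]; lra.
have pm j k : (j <= k)%N -> p j <= p k.
  by move=> /subnKC <-; elim: (k - j)%N => [|d IH]; rewrite ?addn0// addnS (le_trans IH).
have rm j k : (j <= k)%N -> r k <= r j.
  by move=> /subnKC <-; elim: (k - j)%N => [|d IH]; rewrite ?addn0// addnS (le_trans _ IH).
have pr k : p k <= r k by have := C0 k; rewrite /p /r E2 => ?; lra.
have prjk j k : p j <= r k.
  apply: le_trans (pm j (maxn j k) (leq_maxl _ _)) _.
  exact: le_trans (pr _) (rm _ _ (leq_maxr _ _)).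
pose l := sup (range p).
have l1 k : p k <= l.
  apply: ub_le_sup; last by exists k.
  by exists (r 0%N) => _ [j _ <-].
have l2 k : l <= r k.
  by apply: ge_sup; [exists (p 0%N); exists 0%N|move=> _ [j _ <-]].
exists l => k; rewrite ler_norml; have := l1 k; have := l2 k; rewrite /p /r => *.
by apply/andP; split; lra.
Qed.

Lemma half_pow_small (C e : R) : 0 < e -> exists k, C / 2 ^+ k < e.
Proof.
move=> e0; have [C0|C0] := leP C 0.
  exists 0%N; rewrite expr0 divr1; exact: le_lt_trans e0.
have h : (1 / 2 : R) ^+ k @[k --> \oo] --> 0.
  by apply: cvg_expr; rewrite ger0_norm; lra.
have /cvgrPdist_lt/(_ (e / C)) : (1 / 2 : R) ^+ k @[k --> \oo] --> 0 by [].
rewrite divr_gt0// => /(_ isT) [k _ /(_ k (leqnn k))] /=.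
rewrite sub0r normrN ger0_norm ?exprn_ge0// => hk; exists k.
by rewrite mulrC -ltr_pdivlMr// -exprVn -div1r.
Qed.

(** Banach iteration of [u - K u + y], a contraction of ratio 1/2 that maps the ball of radius [rho]
    about [u0] to itself; the limit is built coordinatewise. *)
Lemma near_id_surj n (K : 'cV[R]_n -> 'cV[R]_n) (u0 y : 'cV[R]_n) rho : 0 < rho ->
  (forall u v, `|u - u0| <= rho -> `|v - u0| <= rho ->
     `|K u - K v - (u - v)| <= 2^-1 * `|u - v|) ->
  `|y - K u0| <= rho / 2 -> exists2 u, `|u - u0| <= rho & K u = y.
Proof.
move=> rho0 hK hy.
pose T u := u - K u + y.
pose s k := iter k T u0.
have TT u v : `|u - u0| <= rho -> `|v - u0| <= rho -> `|T u - T v| <= 2^-1 * `|u - v|.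
  move=> hu hv; have -> : T u - T v = - (K u - K v - (u - v)).
    by rewrite /T; apply/colP => i; rewrite !mxE; ring.
  by rewrite normrN; exact: hK.
have u00 : `|u0 - u0| <= rho by rewrite subrr normr0 ltW.
have Tb u : `|u - u0| <= rho -> `|T u - u0| <= rho.
  move=> hu; have -> : T u - u0 = (T u - T u0) + (y - K u0).
    by rewrite /T; apply/colP => i; rewrite !mxE; ring.
  rewrite (le_trans (ler_normD _ _))//.
  have h1 := TT _ _ hu u00; have h2 : 2^-1 * `|u - u0| <= 2^-1 * rho by rewrite ler_pM2l// invr_gt0.
  lra.
have sb k : `|s k - u0| <= rho by elim: k => [|k IH]; [|exact: Tb].
have sd k : `|s k.+1 - s k| <= (rho / 2) / 2 ^+ k.
  elim: k => [|k IH].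
    rewrite expr0 divr1 (_ : s 1%N - s 0%N = y - K u0)//.
    by rewrite /s /= /T; apply/colP => i; rewrite !mxE; ring.
  apply: le_trans (TT _ _ (sb k.+1) (sb k)) _.
  have -> : rho / 2 / 2 ^+ k.+1 = 2^-1 * (rho / 2 / 2 ^+ k).
    by rewrite exprS invfM mulrCA.
  by rewrite ler_pM2l// invr_gt0.
have cc i : exists l, forall k, `|s k i ord0 - l| <= 2 * (rho / 2) / 2 ^+ k.
  apply: geom_cvg => k; apply: le_trans (sd k).
  by have := coord_le_norm (s k.+1 - s k) i; rewrite !mxE.
pose u : 'cV[R]_n := \col_i sval (cid (cc i)).
have hu k : `|s k - u| <= 2 * (rho / 2) / 2 ^+ k.
  apply: cV_norm_le => [|i]; last by rewrite !mxE; case: cid => l /= hl.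
  by rewrite divr_ge0 ?mulr_ge0 ?exprn_ge0 ?ltW// divr_ge0// ltW.
have ub : `|u - u0| <= rho.
  apply/ler_addgt0Pl => e /(half_pow_small (2 * (rho / 2)))[k hk].
  have -> : u - u0 = - (s k - u) + (s k - u0) by rewrite opprB addrA subrK.
  by rewrite (le_trans (ler_normD _ _))// normrN lerD// ltW// (le_lt_trans (hu k)).
exists u => //.
suff : `|T u - u| <= 0.
  rewrite normr_le0 subr_eq0 /T => /eqP h.
  have : u - K u + y - u = 0 by rewrite h subrr.
  rewrite addrAC [u - _ - u]addrAC subrr add0r addrC => /eqP.
  by rewrite subr_eq0 => /eqP ->.
apply/ler_addgt0Pl => e e0; rewrite addr0.
have [k hk] := half_pow_small (2 * (rho / 2)) (divr_gt0 e0 (ltr0n R 2)).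
have -> : T u - u = (T u - T (s k)) + (s k.+1 - u) by rewrite addrA subrK.
rewrite (le_trans (ler_normD _ _))//.
have h2 := hu k; have h3 := hu k.+1.
have h4 : 2 * (rho / 2) / 2 ^+ k.+1 <= 2 * (rho / 2) / 2 ^+ k.
  rewrite ler_pM2l ?mulr_gt0 ?divr_gt0// lef_pV2 ?posrE ?exprn_gt0//.
  by rewrite exprS ler_peMl ?exprn_ge0// ler1n.
have h5 : `|T u - T (s k)| <= 2^-1 * `|s k - u|.
  by rewrite (distrC (s k)); exact: TT.
have h0 : 0 <= `|s k - u| by [].
rewrite /= in h3 *; lra.
Qed.

Lemma cont_near (T : topologicalType) (f : T -> R) t (d : R) :
  {for t, continuous f} -> f t < d -> \forall s \near t, f s < d.
Proof.
move=> hf hd; have := proj1 (cont_atP _ _) hf (d - f t); rewrite subr_gt0 => /(_ hd).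
by apply: filterS => s; rewrite ltr_norml => /andP[_]; rewrite ltrBlDr subrK.
Qed.

Lemma cont_norm (T : topologicalType) (f : T -> R) t :
  {for t, continuous f} -> {for t, continuous (fun s => `|f s|)}.
Proof. by move=> h; apply: (continuous_comp h); exact: norm_continuous. Qed.

Lemma cont_prod (T : topologicalType) (I : Type) (r : seq I) (P : pred I) (F : I -> T -> R) u :
  (forall i, {for u, continuous (F i)}) ->
  {for u, continuous (fun x => \prod_(i <- r | P i) F i x)}.
Proof.
move=> h; elim: r => [|a r IH].
  rewrite (_ : (fun x => _) = fun=> 1); first exact: cst_cont_at.
  by apply/funext => x; rewrite big_nil.
case: (boolP (P a)) => Pa.
  rewrite (_ : (fun x => _) = fun x => F a x * \prod_(i <- r | P i) F i x).
    exact: contM.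
  by apply/funext => x; rewrite big_cons Pa.
rewrite (_ : (fun x => _) = fun x => \prod_(i <- r | P i) F i x) //.
by apply/funext => x; rewrite big_cons (negbTE Pa).
Qed.

Lemma cont_det (T : topologicalType) n (A : T -> 'M[R]_n) t :
  (forall i j, {for t, continuous (fun s => A s i j)}) ->
  {for t, continuous (fun s => \det (A s))}.
Proof.
move=> h; apply: cont_sum => s; apply: contM; first exact: cst_cont_at.
by apply: cont_prod => i; exact: h.
Qed.

Lemma cont_unitmx (T : topologicalType) n (A : T -> 'M[R]_n) t :
  (forall i j, {for t, continuous (fun s => A s i j)}) -> A t \in unitmx ->
  \forall s \near t, A s \in unitmx.
Proof.
move=> h; rewrite unitmxE unitfE -normr_gt0 => u.
have := cont_near (d := 0) (f := fun s => - `|\det (A s)|) (t := t).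
rewrite oppr_lt0 => /(_ _ u) H.
have : \forall s \near t, - `|\det (A s)| < 0.
  apply: H; apply: (@continuous_comp _ _ _ (fun s => `|\det (A s)|) -%R).
    by apply: cont_norm; exact: cont_det.
  exact: opp_continuous.
by apply: filterS => s; rewrite oppr_lt0 normr_gt0 unitmxE unitfE.
Qed.

Lemma cont_ext_near (T : topologicalType) (f g : T -> R) t :
  (\forall s \near t, f s = g s) -> {for t, continuous f} -> {for t, continuous g}.
Proof.
move=> e /cont_atP h; apply/cont_atP => d d0; have e' := nbhs_singleton e.
by apply: filterS2 e (h d d0) => s; rewrite e' => ->.
Qed.

Lemma cont_invmx (T : topologicalType) n (A : T -> 'M[R]_n) t :
  (forall i j, {for t, continuous (fun s => A s i j)}) -> A t \in unitmx ->
  forall i j, {for t, continuous (fun s => invmx (A s) i j)}.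
Proof.
move=> h u i j.
apply: (@cont_ext_near _ (fun s => (\det (A s))^-1 * cofactor (A s) j i)).
  by apply: filterS (cont_unitmx h u) => s us; rewrite /invmx us !mxE.
apply: contM.
  apply: (@cvgV _ _ _ _ (fun s => \det (A s))); last exact: cont_det.
  by move: u; rewrite unitmxE unitfE.
apply: contM; first exact: cst_cont_at.
apply: cont_det => a b.
rewrite (_ : (fun s => _) = fun s => A s (lift j a) (lift i b)); first exact: h.
by apply/funext => s; rewrite !mxE.
Qed.

Lemma cont_mulmx (T : topologicalType) p q r (A : T -> 'M[R]_(p, q)) (B : T -> 'M[R]_(q, r)) t :
  (forall i j, {for t, continuous (fun s => A s i j)}) ->
  (forall i j, {for t, continuous (fun s => B s i j)}) ->
  forall i j, {for t, continuous (fun s => (A s *m B s) i j)}.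
Proof.
move=> hA hB i j; rewrite (_ : (fun s => _) = fun s => \sum_l A s i l * B s l j).
  by apply: cont_sum => l; exact: contM.
by apply/funext => s; rewrite mxE.
Qed.

(** The Caratheodory slopes of [f] form a matrix [C] with [x - y = C (g x) *m (g x - g y)]. It is
    continuous along [g] and equals the Jacobian at [y], so it can be inverted near [y], and the
    difference quotients of [g] are entries of [invmx C]. *)
Lemma inverse_derive n (f g : 'cV[R]_n -> 'cV[R]_n) (y : 'cV[R]_n) :
  C1v f (g y) -> jac f (g y) \in unitmx -> {for y, continuous g} ->
  (\forall x \near y, f (g x) = x) ->
  forall i j, is_derive y (cvec j) (fun x => g x i ord0) (invmx (jac f (g y)) i j).
Proof.
move=> hf u gc fg i j.
have [c hc] := choice (fun k => caratheodory (hf k)).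
pose C v : 'M[R]_n := \matrix_(k, l) c k l v.
have CE : C (g y) = jac f (g y).
  by apply/matrixP => k l; rewrite !mxE; have [h _] := hc k; have [_ ->] := h l.
have Cc k l : {for y, continuous (fun x => C (g x) k l)}.
  rewrite (_ : (fun x => _) = fun x => c k l (g x)); last by apply/funext => x; rewrite mxE.
  apply: (continuous_comp gc); have [h _] := hc k; by have [h' _] := h l.
have uC : C (g y) \in unitmx by rewrite CE.
have ic := cont_invmx Cc uC.
have key : \forall x \near y, g x - g y = invmx (C (g x)) *m (x - y).
  have fgy := nbhs_singleton fg.
  apply: filterS2 (cont_unitmx Cc uC) fg => x ux fgx.
  apply: (canRL (mulKmx ux)); apply/colP => k.
  have E : (x - y) k ord0 = f (g x) k ord0 - f (g y) k ord0 by rewrite fgx fgy !mxE.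
  apply/esym; apply: etrans E _; have [_ ->] := hc k.
  by rewrite mxE; apply: eq_bigr => l _; rewrite !mxE.
have near0 : (fun h : R => h *: cvec j + y) @ (0 : R)^' --> y.
  apply: cV_cvg => l; apply: (@derivable_line_cvg _ _ (fun x : 'cV[R]_n => x l ord0)).
  by have [] := is_derive_coord l j y.
have key0 : \forall h \near (0 : R)^', g (h *: cvec j + y) - g y =
    invmx (C (g (h *: cvec j + y))) *m (h *: cvec j + y - y) := near0 _ key.
have Q : h^-1 *: (g (h *: cvec j + y) i ord0 - g y i ord0) @[h --> (0 : R)^'] -->
    invmx (jac f (g y)) i j.
  have : invmx (C (g (h *: cvec j + y))) i j @[h --> (0 : R)^'] --> invmx (C (g y)) i j.
    exact: (cvg_comp _ _ near0 (ic i j)).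
  rewrite CE; apply: cvg_trans; apply: near_eq_cvg; near=> h.
  have hx : g (h *: cvec j + y) - g y = invmx (C (g (h *: cvec j + y))) *m (h *: cvec j).
    by rewrite -[X in _ *m X](addrK y); near: h.
  have -> : g (h *: cvec j + y) i ord0 - g y i ord0 = (g (h *: cvec j + y) - g y) i ord0.
    by rewrite !mxE.
  rewrite hx -scalemxAr -colE !mxE /GRing.scale/= mulKf//.
  by near: h; exact: nbhs_dnbhs_neq.
split; first by apply/cvg_ex; exists (invmx (jac f (g y)) i j).
exact/cvg_lim.
Unshelve. all: by end_near. Qed.
(** One notion of smoothness for vectors and matrices; it agrees with [Cinftyv] on vectors and is
    stable under matrix algebra. *)
Definition sm n p q (U : set 'cV[R]_n) (f : 'cV[R]_n -> 'M[R]_(p, q)) :=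
  forall k, CkPm k (lift1 U) (fun _ : bool => f).

Lemma smE n p (U : set 'cV[R]_n) (f : 'cV[R]_n -> 'cV[R]_p) : Cinftyv U f <-> sm U f.
Proof.
split=> h; first by move=> k i j; rewrite (ord1 j); apply/CkE; exact: h.
by move=> i k; apply/CkE; exact: h.
Qed.

Lemma sm1E n (U : set 'cV[R]_n) (f : 'cV[R]_n -> R) :
  Cinfty U f <-> sm U (fun u => (f u)%:M : 'M[R]_1).
Proof.
have e : (fun u => ((f u)%:M : 'M[R]_1) ord0 ord0) = f by apply/funext => u; rewrite mxE eqxx mulr1n.
rewrite -smE; split=> [h i|/(_ ord0)]; last by rewrite e.
by rewrite (ord1 i) e.
Qed.

Section smooth.
Variables (n : nat) (U : set 'cV[R]_n).
Hypothesis oU : open U.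

Lemma sm_restrict p q V (f : 'cV[R]_n -> 'M[R]_(p, q)) : V `<=` U -> sm U f -> sm V f.
Proof. by move=> s h k; apply: CkPm_sub (h k) => w; exact: s. Qed.

Lemma sm_ext p q (f g : 'cV[R]_n -> 'M[R]_(p, q)) :
  (forall u, U u -> f u = g u) -> sm U f -> sm U g.
Proof. by move=> e h k; apply: CkPm_ext (h k) => [|t x]; [exact: open_lift1|exact: e]. Qed.

Lemma sm_cst p q (M : 'M[R]_(p, q)) : sm U (fun _ => M).
Proof. by move=> k; exact: CkPm_cst. Qed.

Lemma sm_id : sm U id.
Proof. by move=> k; exact: CkPm_id. Qed.

Lemma sm_add p q (f g : 'cV[R]_n -> 'M[R]_(p, q)) : sm U f -> sm U g -> sm U (fun u => f u + g u).
Proof. by move=> hf hg k; apply: CkPm_add => //; exact: open_lift1. Qed.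

Lemma sm_opp p q (f : 'cV[R]_n -> 'M[R]_(p, q)) : sm U f -> sm U (fun u => - f u).
Proof. by move=> hf k; apply: CkPm_opp => //; exact: open_lift1. Qed.

Lemma sm_subr p q (f g : 'cV[R]_n -> 'M[R]_(p, q)) : sm U f -> sm U g -> sm U (fun u => f u - g u).
Proof. by move=> hf hg; apply: sm_add => //; exact: sm_opp. Qed.

Lemma sm_mul p q r (f : 'cV[R]_n -> 'M[R]_(p, q)) (g : 'cV[R]_n -> 'M[R]_(q, r)) :
  sm U f -> sm U g -> sm U (fun u => f u *m g u).
Proof. by move=> hf hg k; apply: CkPm_mul => //; exact: open_lift1. Qed.

Lemma sm_tr p q (f : 'cV[R]_n -> 'M[R]_(p, q)) : sm U f -> sm U (fun u => (f u)^T).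
Proof. by move=> hf k; apply: CkPm_tr => //; exact: open_lift1. Qed.

Lemma sm_col p1 p2 q (f : 'cV[R]_n -> 'M[R]_(p1, q)) (g : 'cV[R]_n -> 'M[R]_(p2, q)) :
  sm U f -> sm U g -> sm U (fun u => col_mx (f u) (g u)).
Proof. by move=> hf hg k; apply: CkPm_col => //; exact: open_lift1. Qed.

Lemma sm_usub p1 p2 q (f : 'cV[R]_n -> 'M[R]_(p1 + p2, q)) : sm U f -> sm U (fun u => usubmx (f u)).
Proof. by move=> hf k; apply: CkPm_usub => //; exact: open_lift1. Qed.

Lemma sm_dsub p1 p2 q (f : 'cV[R]_n -> 'M[R]_(p1 + p2, q)) : sm U f -> sm U (fun u => dsubmx (f u)).
Proof. by move=> hf k; apply: CkPm_dsub => //; exact: open_lift1. Qed.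

Lemma sm_inv p (f : 'cV[R]_n -> 'M[R]_p) : (forall u, U u -> f u \in unitmx) ->
  sm U f -> sm U (fun u => invmx (f u)).
Proof. by move=> u hf k; apply: CkPm_inv => //; exact: open_lift1. Qed.

Lemma sm_jac p (f : 'cV[R]_n -> 'cV[R]_p) : sm U f -> sm U (jac f).
Proof. by move=> hf k; apply: CkPm_jac; [exact: open_lift1|exact: hf]. Qed.

Lemma sm_C1v p (f : 'cV[R]_n -> 'cV[R]_p) u : sm U f -> U u -> C1v f u.
Proof. by move=> hf Uu; apply: (CkPm_C1v (t := true) (open_lift1 oU) (hf 1%N)). Qed.

Lemma sm_cont p q (f : 'cV[R]_n -> 'M[R]_(p, q)) u i j : sm U f -> U u ->
  {for u, continuous (fun w => f w i j)}.
Proof.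
move=> hf Uu; apply: C1_continuous.
exact: (CkP_C1at (t := true) (open_lift1 oU) (hf 1%N i j)).
Qed.

Lemma sm_local p q (f : 'cV[R]_n -> 'M[R]_(p, q)) :
  (forall u, U u -> exists V, [/\ open V, V u & sm V f]) -> sm U f.
Proof.
move=> h k i j; apply: CkP_local => -[b u] /h[V [oV Vu hV]].
by exists (lift1 V); split=> //; [exact: open_lift1|exact: hV].
Qed.

Lemma sm_comp m p q (g : 'cV[R]_n -> 'cV[R]_m) (V : set 'cV[R]_m) (f : 'cV[R]_m -> 'M[R]_(p, q)) :
  open V -> sm U g -> (forall u, U u -> V (g u)) -> sm V f -> sm U (f \o g).
Proof.
move=> oV hg h hf k.
apply: (CkPm_comp (tau := id) (open_lift1 oU) (open_lift1 oV) _ (hg k) _ (hf k)).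
  by move=> w _; exact: cvg_id.
by move=> w; exact: h.
Qed.

End smooth.

(** Bootstrap: the Jacobian of [g] is the inverse of [jac f] evaluated along [g], hence as regular
    as [g], which therefore gains one order at each step. *)
Lemma inverse_smooth n (U V : set 'cV[R]_n) (f g : 'cV[R]_n -> 'cV[R]_n) :
  open U -> open V -> sm U f -> (forall u, U u -> jac f u \in unitmx) ->
  (forall y, V y -> U (g y) /\ f (g y) = y) ->
  (forall y, V y -> {for y, continuous g}) -> sm V g.
Proof.
move=> oU oV hf uf fg gc; have oV1 := open_lift1 oV.
have D y : V y -> forall i j, is_derive y (cvec j) (fun x => g x i ord0) (invmx (jac f (g y)) i j).
  move=> Vy; have [Ugy _] := fg y Vy.
  apply: inverse_derive; [exact: (sm_C1v oU)|exact: uf|exact: gc|].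
  have : \forall x \near y, V x by apply: open_nbhs_nbhs.
  by apply: filterS => x /fg[].
elim=> [|k IH].
  move=> i j; rewrite (ord1 j); split=> // p Vp.
  apply: (@continuous_comp _ _ _ snd (fun y => g y i ord0)); first exact: cvg_snd.
  by apply: (proj1 (cont_cV_atP _ _)); exact: gc.
apply: CkPm_S => //.
  by move=> p i j Vp; have [] := D p.2 Vp i j.
have h : CkPm k (lift1 V) (fun _ : bool => fun x => invmx (jac f (g x))).
  apply: CkPm_inv => // [t x|]; first by move=> /fg[/uf].
  apply: (CkPm_comp (tau := id) oV1 (open_lift1 oU) _ IH _ (sm_jac oU hf k)).
    by move=> w _; exact: cvg_id.
  by move=> w /fg[].
apply: CkPm_ext h => // t x Vx; apply/esym/jacE => i j; exact: D.
Qed.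

Lemma unitmx_inj n (M : 'M[R]_n) : (forall v : 'cV[R]_n, M *m v = 0 -> v = 0) -> M \in unitmx.
Proof.
move=> h; rewrite -unitmx_tr -row_free_unit -kermx_eq0; apply/eqP/row_matrixP => i.
rewrite row0; apply: trmx_inj; rewrite trmx0; apply: h.
by apply: trmx_inj; rewrite trmx_mul trmxK -row_mul mulmx_ker row0 trmx0.
Qed.

Lemma inj_unitmx n (M : 'M[R]_n) (v : 'cV[R]_n) : M \in unitmx -> M *m v = 0 -> v = 0.
Proof. by move=> u e; rewrite -(mulKmx u v) e mulmx0. Qed.

Lemma sm_slice n p (O : set 'cV[R]_(1 + n)) (G : 'cV[R]_(1 + n) -> 'cV[R]_p) (s : 'cV[R]_1) :
  open O -> sm O G ->
  [/\ open [set q | O (col_mx s q)], sm [set q | O (col_mx s q)] (fun q => G (col_mx s q))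
    & forall q, O (col_mx s q) ->
        jac (fun q => G (col_mx s q)) q = rsubmx (jac G (col_mx s q))].
Proof.
move=> oO hG.
have E : (fun q : 'cV[R]_n => col_mx s q) = (fun q => col_mx 0 1%:M *m q + col_mx s 0).
  by apply/funext => u; rewrite mul_col_mx mul0mx mul1mx add_col_mx add0r addr0.
have hE q : C1v (fun q : 'cV[R]_n => col_mx s q) q by rewrite E; exact: C1v_affine.
have oS : open [set q | O (col_mx s q)].
  apply: (@open_comp _ _ (fun q => col_mx s q)) => // q _; exact: C1v_continuous.
split=> //.
  apply: (sm_comp oS oO _ _ hG) => //.
  apply: sm_col => //; [exact: sm_cst|exact: sm_id].
move=> q Oq; rewrite (jac_comp (g := fun q => col_mx s q)) //; last exact: (sm_C1v oO hG).
have -> : jac (fun q : 'cV[R]_n => col_mx s q) q = col_mx 0 1%:M by rewrite E jac_affine.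
by rewrite -{1}[jac G _]hsubmxK mul_row_col mulmx0 mulmx1 add0r.
Qed.

(** A kernel vector [v] would satisfy [|v| <= |v| / 2]. *)
Lemma near_unit n (M : 'M[R]_n) (c : R) : 0 <= c -> c * n%:R <= 2^-1 ->
  (forall i j, `|(M - 1%:M) i j| <= c) -> M \in unitmx.
Proof.
move=> c0 cn h; apply: unitmx_inj => v Mv.
have := mulmx_norm v c0 h; rewrite mulmxBl Mv mul1mx sub0r normrN => h1.
have v0 : 0 <= `|v| by [].
have h2 : c * n%:R * `|v| <= 2^-1 * `|v| by exact: ler_wpM2r.
by apply/eqP; rewrite -normr_le0; lra.
Qed.

Lemma cont_colmx n (t : R) (q : 'cV[R]_n) :
  {for (t, q), continuous (fun p : R * 'cV[R]_n => col_mx p.1%:M p.2 : 'cV[R]_(1 + n))}.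
Proof.
apply/cont_cV_atP => i; case: (split_ordP i) => j ->.
  rewrite (_ : (fun p : R * 'cV[R]_n => _) = fst); first exact: cvg_fst.
  by apply/funext => p; rewrite col_mxEu (ord1 j) mxE eqxx mulr1n.
rewrite (_ : (fun p : R * 'cV[R]_n => _) = fun p : R * 'cV[R]_n => p.2 j ord0).
  apply: (@continuous_comp _ _ _ snd (fun M : 'cV[R]_n => M j ord0)); first exact: cvg_snd.
  exact: coord_continuous.
by apply/funext => p; rewrite col_mxEd.
Qed.

Lemma usub1 n (w : 'cV[R]_(1 + n)) : usubmx w = (usubmx w ord0 ord0)%:M.
Proof. exact: mx11_scalar. Qed.

Lemma ball_convex n (u v : 'cV[R]_n) (e t : R) : 0 <= t <= 1 -> `|u| < e -> `|v| < e ->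
  `|u + t *: (v - u)| < e.
Proof.
move=> /andP[t0 t1] hu hv.
have -> : u + t *: (v - u) = (1 - t) *: u + t *: v.
  by apply/colP => i; rewrite !mxE; ring.
rewrite (le_lt_trans (ler_normD _ _))// !normrZ (ger0_norm t0) ger0_norm ?subr_ge0//.
have := ltW hu; have := ltW hv => h1 h2.
have h3 : (1 - t) * `|u| <= (1 - t) * e by rewrite ler_wpM2l// subr_ge0.
have h4 : t * `|v| <= t * e by rewrite ler_wpM2l.
have [t2|t2] := ltP t (2^-1).
  have : (1 - t) * `|u| < (1 - t) * e by rewrite ltr_pM2l// subr_gt0; lra.
  lra.
have : t * `|v| < t * e by rewrite ltr_pM2l//; lra.
lra.
Qed.

Lemma near_forall (T : topologicalType) (t : T) (I : finType) (P : I -> T -> Prop) :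
  (forall i, \forall s \near t, P i s) -> \forall s \near t, forall i, P i s.
Proof. by move=> h; apply: filter_forall. Qed.

Lemma open_box n (a b e : R) :
  open [set w : 'cV[R]_(1 + n) | a < usubmx w ord0 ord0 < b /\ `|dsubmx w| < e].
Proof.
have uc (w : 'cV[R]_(1 + n)) : {for w, continuous (fun w : 'cV[R]_(1 + n) => usubmx w ord0 ord0 : R)}.
  rewrite (_ : (fun w => _) = fun w : 'cV[R]_(1 + n) => w (lshift n ord0) ord0); first exact: coord_continuous.
  by apply/funext => v; rewrite mxE.
have dc (w : 'cV[R]_(1 + n)) : {for w, continuous (fun w : 'cV[R]_(1 + n) => `|dsubmx w| : R)}.
  apply: (@continuous_comp _ _ _ dsubmx (fun q : 'cV[R]_n => `|q|)); last exact: norm_continuous.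
  apply/cont_cV_atP => i.
  rewrite (_ : (fun w => _) = fun w : 'cV[R]_(1 + n) => w (rshift 1 i) ord0); first exact: coord_continuous.
  by apply/funext => v'; rewrite mxE.
rewrite openE => w [/andP[w1 w2] w3]; rewrite /interior.
have n1 : \forall s \near w, - (usubmx s ord0 ord0) < - a.
  apply: cont_near; last by rewrite ltrN2.
  by apply: (continuous_comp (uc w)); exact: opp_continuous.
have n2 := cont_near (uc w) w2.
have n3 := cont_near (dc w) w3.
apply: filterS2 n1 (filterI n2 n3) => s; rewrite ltrN2 => h1 [h2 h3].
by split=> //; apply/andP.
Qed.

(** An inverse function theorem for the maps [G (t, .)] all at once: [Gh] keeps the time, and its
    inverse lives over a box around [0, 1] x {0} because invertibility is assumed along that whole
    segment. The box contains times outside [0, 1], as the smoothness of [f_t] in time requires. *)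
Lemma uniform_ift n (O : set 'cV[R]_(1 + n)) (G : 'cV[R]_(1 + n) -> 'cV[R]_n) :
  open O -> sm O G -> (forall t : R, 0 <= t <= 1 -> O (col_mx t%:M 0)) ->
  (forall t : R, 0 <= t <= 1 -> rsubmx (jac G (col_mx t%:M 0)) \in unitmx) ->
  exists2 e : R, 0 < e &
  let D := [set w : 'cV[R]_(1 + n) | - e < usubmx w ord0 ord0 < 1 + e /\ `|dsubmx w| < e] in
  let Gh := fun w : 'cV[R]_(1 + n) => col_mx (usubmx w) (G w) in
  [/\ D `<=` O, open (Gh @` D), forall w, D w -> rsubmx (jac G w) \in unitmx
    & exists2 H : 'cV[R]_(1 + n) -> 'cV[R]_n, sm (Gh @` D) H
        & forall w, D w -> H (Gh w) = dsubmx w].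
Proof.
move=> oO hG hO hu.
pose Dq w := rsubmx (jac G w).
have Dqc w : O w -> forall i j, {for w, continuous (fun w => Dq w i j)}.
  move=> Ow i j; rewrite (_ : (fun w => _) = fun w => jac G w i (rshift 1 j)).
    exact: (sm_cont oO) (sm_jac oO hG) Ow.
  by apply/funext => v; rewrite mxE.
pose z (t : R) : 'cV[R]_(1 + n) := col_mx t%:M 0.
(* Entries within [c] of the identity give an operator within [c * n <= 1/2] of it, the ratio wanted
   by [near_id_surj] and [near_unit]. *)
pose c : R := 2^-1 / n.+1%:R.
have c0 : 0 < c by rewrite divr_gt0 ?invr_gt0.
have cn : c * n%:R <= 2^-1.
  rewrite /c mulrAC ler_pdivrMr// ler_wpM2l ?invr_ge0//.
  by rewrite ler_nat.
pose P (p : R * 'cV[R]_n) := [/\ O (col_mx p.1%:M p.2), Dq (z p.1) \in unitmx, O (z p.1) &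
  forall i j, `|(invmx (Dq (z p.1)) *m Dq (col_mx p.1%:M p.2) - 1%:M) i j| < c].
have zc (p : R * 'cV[R]_n) : {for p, continuous (fun p : R * 'cV[R]_n => z p.1)}.
  apply: (@continuous_comp _ _ _ (fun p : R * 'cV[R]_n => (p.1, 0 : 'cV[R]_n))
    (fun p : R * 'cV[R]_n => col_mx p.1%:M p.2 : 'cV[R]_(1 + n))).
    by apply: cont_pair_at; [exact: cvg_fst|exact: cst_cont_at].
  exact: cont_colmx.
have wc (p : R * 'cV[R]_n) : {for p, continuous (fun p : R * 'cV[R]_n => col_mx p.1%:M p.2 : 'cV[R]_(1 + n))}.
  by case: p => t q; exact: cont_colmx.
have hP (t : R) : 0 <= t <= 1 -> \forall p \near (t, 0 : 'cV[R]_n), P p.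
  move=> t01; pose p0 := (t, 0 : 'cV[R]_n).
  have nO (f : R * 'cV[R]_n -> 'cV[R]_(1 + n)) : {for p0, continuous f} -> f p0 = z t ->
      \forall p \near p0, O (f p).
    move=> fc fe; apply: fc; rewrite fe; apply: open_nbhs_nbhs; split=> //; exact: hO.
  have Dc (f : R * 'cV[R]_n -> 'cV[R]_(1 + n)) : {for p0, continuous f} -> f p0 = z t ->
      forall i j, {for p0, continuous (fun p => Dq (f p) i j)}.
    move=> fc fe i j; apply: (@continuous_comp _ _ _ f (fun w => Dq w i j)) => //.
    by rewrite fe; apply: Dqc; exact: hO.
  have uz := hu t t01.
  have ic := cont_invmx (Dc _ (zc p0) erefl) uz.
  have mc := cont_mulmx ic (Dc _ (wc p0) erefl).
  have n4 : \forall p \near p0, forall i j,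
      `|(invmx (Dq (z p.1)) *m Dq (col_mx p.1%:M p.2) - 1%:M) i j| < c.
    apply: near_forall => i; apply: near_forall => j.
    apply: cont_near; last by rewrite /= mulVmx// subrr mxE normr0.
    apply: cont_norm; rewrite (_ : (fun p : R * 'cV[R]_n => _) = fun p : R * 'cV[R]_n =>
      (invmx (Dq (z p.1)) *m Dq (col_mx p.1%:M p.2)) i j - (1%:M : 'M[R]_n) i j).
      by apply: contB; [exact: mc|exact: cst_cont_at].
    by apply/funext => p; rewrite !mxE.
  have n1 := nO _ (wc p0) erefl.
  have n2 := cont_unitmx (Dc _ (zc p0) erefl) uz.
  have n3 := nO _ (zc p0) erefl.
  by apply: filterS2 (filterI n1 n2) (filterI n3 n4) => p [? ?] [? ?].
have [e1 e10 /near_norm[d d0 hd]] := tube hP.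
pose e := Num.min e1 d.
have e0 : 0 < e by rewrite lt_min e10.
exists e => //=.
set D := [set w | _]; set Gh := fun w => _.
have PD w : D w -> P (usubmx w ord0 ord0, dsubmx w).
  move=> [/andP[w1 w2] w3]; apply: hd.
    by rewrite subr0 (lt_le_trans w3)// ge_min lexx orbT.
  have ee : e <= e1 by rewrite ge_min lexx.
  by apply/andP; split; [apply: le_lt_trans w1; rewrite lerN2|apply: lt_le_trans w2 _; rewrite lerD2l].
have wE (w : 'cV[R]_(1 + n)) : col_mx (usubmx w ord0 ord0)%:M (dsubmx w) = w.
  by rewrite -usub1 vsubmxK.
have DO : D `<=` O by move=> w /PD[]; rewrite wE.
have uD w : D w -> Dq w \in unitmx.
  move=> /PD[/=]; rewrite wE => _ u _ h.
  have u2 : invmx (Dq (z (usubmx w ord0 ord0))) *m Dq w \in unitmx.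
    by apply: (near_unit (ltW c0) cn) => i j; exact: ltW.
  by move: u2; rewrite unitmx_mul => /andP[].
have DE (t : R) q : - e < t < 1 + e -> `|q| < e -> D (col_mx t%:M q).
  by move=> ht hq; split; rewrite ?col_mxKu ?col_mxKd// mxE eqxx mulr1n.
(* Normalizing by the derivative at [q = 0] makes every slice of [G] close to the identity, so that
   one estimate covers all [t]. *)
pose A (t : R) := invmx (Dq (z t)).
have Au (t : R) : - e < t < 1 + e -> A t \in unitmx.
  move=> ht; have := PD _ (DE t 0 ht _); rewrite normr0 => /(_ e0) [_ /=].
  by rewrite col_mxKu mxE eqxx mulr1n => u _ _; rewrite unitmx_inv.
have lip (t : R) u v : - e < t < 1 + e -> `|u| < e -> `|v| < e ->
    `|A t *m G (col_mx t%:M u) - A t *m G (col_mx t%:M v) - (u - v)| <= 2^-1 * `|u - v|.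
  move=> ht hu' hv.
  have [oS sS jS] := sm_slice (t%:M) oO hG.
  have := @lip_jac n n (fun q => A t *m G (col_mx t%:M q)) 1%:M v u c (ltW c0).
  rewrite mul1mx => H; apply: le_trans (H _) _; last exact: ler_wpM2r.
  move=> s hs; have := ball_convex hs hv hu'; set q := v + _ => hq.
  have Oq : O (col_mx t%:M q) by apply: DO; exact: DE.
  split.
    apply: (@sm_C1v n _ oS) => //; apply: sm_mul => //; exact: sm_cst.
  have -> : jac (fun q => A t *m G (col_mx t%:M q)) q = A t *m Dq (col_mx t%:M q).
    rewrite /Dq -(jS _ Oq).
    by rewrite jac_mull//; exact: (sm_C1v oS sS).
  move=> i j; have [_ _ _ /(_ i j) h] := PD _ (DE t q ht hq).
  have := ltW h; rewrite /= wE col_mxKu [t%:M _ _]mxE eqxx mulr1n => {}h.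
  by move: h; rewrite mxE [X in _ + X]mxE.
have inj w w' : D w -> D w' -> Gh w = Gh w' -> w = w'.
  move=> Dw Dw' /eq_col_mx[e1' e2'].
  rewrite -(vsubmxK w) -(vsubmxK w') -e1'; congr col_mx.
  have [ht hq] := Dw; have [_ hq'] := Dw'.
  have E : col_mx (usubmx w ord0 ord0)%:M (dsubmx w') = w' by rewrite e1' wE.
  have := lip _ _ _ ht hq hq'; rewrite wE E e2' subrr sub0r normrN.
  move=> h; have h0 : 0 <= `|dsubmx w - dsubmx w'| by [].
  by apply/eqP; rewrite -subr_eq0 -normr_le0; lra.
(* Targets close to [Gh w0] are attained close to [w0], at the time prescribed by the target. This
   gives both the openness of the image and the continuity of the inverse. *)
have local w0 rho : D w0 -> 0 < rho -> `|dsubmx w0| + rho < e ->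
    \forall y \near Gh w0, exists w, [/\ D w, Gh w = y & `|dsubmx w - dsubmx w0| <= rho].
  move=> Dw0 rho0 hrho.
  pose t0 := usubmx w0 ord0 ord0; pose q0 := dsubmx w0.
  have [ht0 hq0] := Dw0.
  pose ty (y : 'cV[R]_(1 + n)) : R := usubmx y ord0 ord0.
  pose Psi (y : 'cV[R]_(1 + n)) := A (ty y) *m (dsubmx y - G (col_mx (ty y)%:M q0)).
  have tyE : ty (Gh w0) = t0 by rewrite /ty col_mxKu.
  have tyc y : {for y, continuous ty}.
    rewrite (_ : ty = fun w : 'cV[R]_(1 + n) => w (lshift n ord0) ord0); first exact: coord_continuous.
    by apply/funext => w; rewrite /ty mxE.
  have fc (q : 'cV[R]_n) y : {for y, continuous (fun y => col_mx (ty y)%:M q : 'cV[R]_(1 + n))}.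
    apply: (@continuous_comp _ _ _ (fun y => (ty y, q))
      (fun p : R * 'cV[R]_n => col_mx p.1%:M p.2 : 'cV[R]_(1 + n))).
      by apply: cont_pair_at; [exact: tyc|exact: cst_cont_at].
    exact: cont_colmx.
  have Dz : D (z t0) by apply: DE => //; rewrite normr0.
  have Ac i j : {for Gh w0, continuous (fun y => A (ty y) i j)}.
    apply: cont_invmx; last by rewrite tyE; exact: uD.
    move=> i' j'; apply: (@continuous_comp _ _ _ (fun y => z (ty y)) (fun w => Dq w i' j')).
      exact: fc.
    by rewrite tyE; apply: Dqc; exact: DO.
  have Pc i : {for Gh w0, continuous (fun y => Psi y i ord0)}.
    apply: cont_mulmx => // i' j'; rewrite (ord1 j').
    rewrite (_ : (fun y : 'cV[R]_(1 + n) => _) = fun y : 'cV[R]_(1 + n) =>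
      y (rshift 1 i') ord0 - G (col_mx (ty y)%:M q0) i' ord0); last first.
      by apply/funext => y; rewrite !mxE.
    apply: contB; first exact: coord_continuous.
    apply: (@continuous_comp _ _ _ (fun y => col_mx (ty y)%:M q0) (fun w => G w i' ord0)).
      exact: fc.
    apply: (sm_cont oO) hG _; rewrite tyE; apply: DO; exact: DE.
  have P0 : Psi (Gh w0) = 0.
    by rewrite /Psi tyE col_mxKd wE subrr mulmx0.
  have n1 : \forall y \near Gh w0, forall i, `|Psi y i ord0| < rho / 2.
    apply: near_forall => i; apply: cont_near; first exact: cont_norm.
    by rewrite P0 mxE normr0 divr_gt0.
  have n2 : \forall y \near Gh w0, - e < ty y < 1 + e.
    have : \forall t \near ty (Gh w0), - e < t < 1 + e.
      rewrite tyE; have : \forall t \near t0, t \in `](- e), (1 + e)[.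
        by apply: near_in_itvoo; rewrite in_itv.
      by apply: filterS => t; rewrite in_itv.
    exact: (tyc (Gh w0)).
  apply: filterS2 n1 n2 => y hy hty.
  have [||u hu' Ku] := @near_id_surj n (fun q => A (ty y) *m G (col_mx (ty y)%:M q)) q0
      (A (ty y) *m dsubmx y) rho rho0.
  - move=> u v h1 h2; apply: lip => //.
      by rewrite -(subrK q0 u) (le_lt_trans (ler_normD _ _))// (le_lt_trans _ hrho)// addrC lerD2l.
    by rewrite -(subrK q0 v) (le_lt_trans (ler_normD _ _))// (le_lt_trans _ hrho)// addrC lerD2l.
  - rewrite -mulmxBr; apply: cV_norm_le; first by rewrite ltW// divr_gt0.
    by move=> i; exact: ltW.
  have ue : `|u| < e.
    by rewrite -(subrK q0 u) (le_lt_trans (ler_normD _ _))// (le_lt_trans _ hrho)// addrC lerD2l.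
  exists (col_mx (ty y)%:M u); split; first exact: DE.
    rewrite /Gh col_mxKu -[RHS]wE; congr (col_mx _ _).
    by rewrite -(mulKmx (Au _ hty) (G _)) Ku mulKmx// Au.
  by rewrite col_mxKd.
have ngap w0 (eps : R) : D w0 -> 0 < eps -> exists rho : R, [/\ 0 < rho, `|dsubmx w0| + rho < e & rho < eps].
  move=> [_ hq] eps0; exists (Num.min ((e - `|dsubmx w0|) / 2) (eps / 2)).
  have h1 : 0 < e - `|dsubmx w0| by rewrite subr_gt0.
  split; first by rewrite lt_min !divr_gt0.
    apply: (@le_lt_trans _ _ (`|dsubmx w0| + (e - `|dsubmx w0|) / 2)).
      by rewrite lerD2l ge_min lexx.
    by lra.
  by rewrite gt_min; apply/orP; right; lra.
have oGD : open (Gh @` D).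
  rewrite openE => _ [w0 Dw0 <-]; rewrite /interior.
  have [rho [r0 r1 _]] := ngap w0 1 Dw0 ltr01.
  by apply: filterS (local w0 rho Dw0 r0 r1) => y [w [Dw <- _]]; exists w.
split=> //.
have oD : open D by exact: open_box.
pose g y := xget 0 [set w | D w /\ Gh w = y].
have gP y : (Gh @` D) y -> D (g y) /\ Gh (g y) = y.
  by move=> [w Dw hw]; apply: (@xgetPex _ 0 [set w | D w /\ Gh w = y]); exists w.
have gG w : D w -> g (Gh w) = w.
  move=> Dw; have [h1 h2] := gP (Gh w) (ex_intro2 _ _ w Dw erefl); exact: inj.
exists (fun y => dsubmx (g y)); last by move=> w Dw; rewrite gG.
apply: sm_dsub => //.
have hGh : sm D Gh.
  apply: sm_col => //; first by apply: sm_usub => //; exact: sm_id.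
  exact: sm_restrict DO hG.
apply: (inverse_smooth oD oGD hGh) => //.
  move=> w Dw; apply: unitmx_inj => v hv.
  have Ow := DO _ Dw.
  have jE : jac Gh w = col_mx (row_mx 1%:M 0) (jac G w).
    apply: jacE => i j; case: (split_ordP i) => l ->.
      rewrite col_mxEu (ord1 l).
      rewrite (_ : (fun w => _) = fun w : 'cV[R]_(1 + n) => w (lshift n ord0) ord0); last first.
        by apply/funext => v'; rewrite col_mxEu mxE.
      apply: is_derive_eq; first exact: is_derive_coord.
      by case: (split_ordP j) => l' ->; rewrite ?row_mxEl ?row_mxEr !mxE ?eq_lshift ?eq_lrshift// (ord1 l') eqxx.
    rewrite col_mxEd (_ : (fun w => _) = fun w => G w l ord0); last first.
      by apply/funext => v'; rewrite col_mxEd.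
    apply: is_derive_eq; first exact: (C1v_derive _ _ (sm_C1v oO hG Ow)).
    by rewrite -colE mxE.
  move: hv; rewrite jE mul_col_mx => /eqP; rewrite col_mx_eq0 => /andP[/eqP h1 /eqP h2].
  rewrite -{1}(vsubmxK v) mul_row_col mul0mx addr0 mul1mx in h1.
  have uw := uD _ Dw.
  rewrite -(hsubmxK (jac G w)) -{1}(vsubmxK v) mul_row_col h1 mulmx0 add0r in h2.
  by rewrite -(vsubmxK v) h1 (inj_unitmx uw h2) col_mx0.
move=> _ [w0 Dw0 <-].
apply/cont_cV_atP => i; apply/cont_atP => eps eps0; rewrite gG//.
case: (split_ordP i) => l ->.
  have cc := @coord_continuous R (1 + n) 1 (lshift n l) ord0 (Gh w0).
  have n1 := proj1 (cont_atP _ _) cc eps eps0.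
  have nD : \forall y \near Gh w0, (Gh @` D) y by apply: open_nbhs_nbhs; split=> //; exists w0.
  apply: filterS2 nD n1 => y /gP[_ hy]; rewrite -{1}hy /Gh !col_mxEu.
  by rewrite !mxE.
have [rho [r0 r1 r2]] := ngap w0 eps Dw0 eps0.
apply: filterS (local w0 rho Dw0 r0 r1) => y [w [Dw <- hw]]; rewrite gG//.
apply: le_lt_trans r2; apply: le_trans hw.
by have := coord_le_norm (dsubmx w - dsubmx w0) l; rewrite !mxE.
Unshelve. all: by end_near. Qed.
Lemma open_ballcV n (u0 : 'cV[R]_n) e : open [set u : 'cV[R]_n | `|u - u0| < e].
Proof.
rewrite openE => u Vu; rewrite /interior.
suff c : {for u, continuous (fun v : 'cV[R]_n => `|v - u0| : R)} by exact: (cont_near c Vu).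
apply: (@continuous_comp _ _ _ (fun v : 'cV[R]_n => v - u0) (fun v : 'cV[R]_n => `|v|)); last exact: norm_continuous.
apply: (C1v_continuous (f := fun v : 'cV[R]_n => v - u0)).
apply: (sm_C1v openT) => //; apply: sm_subr => //; [exact: openT|exact: sm_id|exact: sm_cst].
Qed.

(** The uniform theorem applied to a [G] that is constant in time and centred at [u0], read at time
    0. *)
Lemma ift n (U : set 'cV[R]_n) (f : 'cV[R]_n -> 'cV[R]_n) u0 :
  open U -> sm U f -> U u0 -> jac f u0 \in unitmx ->
  exists V, [/\ open V, V u0, V `<=` U, open (f @` V) &
    (forall u, V u -> jac f u \in unitmx) /\
    exists2 g, sm (f @` V) g & forall u, V u -> g (f u) = u].
Proof.
move=> oU hf Uu0 uf.
pose tr (w : 'cV[R]_(1 + n)) := u0 + dsubmx w.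
have smtr (O : set 'cV[R]_(1 + n)) : open O -> sm O tr.
  by move=> oO; apply: sm_add => //; [exact: sm_cst|apply: sm_dsub => //; exact: sm_id].
have trc w : {for w, continuous tr}.
  by apply: C1v_continuous; apply: (sm_C1v openT (smtr _ openT)).
pose O := [set w | U (tr w)].
have oO : open O by apply: (@open_comp _ _ tr) => // w _; exact: trc.
pose G w := f (tr w).
have hG : sm O G by apply: (sm_comp oO oU (smtr _ oO)).
have jE s q : O (col_mx s q) -> rsubmx (jac G (col_mx s q)) = jac f (u0 + q).
  move=> Oq; have [_ _ <-//] := sm_slice s oO hG.
  have E : (fun q => G (col_mx s q)) = f \o (fun q => 1%:M *m q + u0).
    by apply/funext => v; rewrite /G /tr col_mxKd /= mul1mx addrC.
  have ev : 1%:M *m q + u0 = u0 + q by rewrite mul1mx addrC.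
  move: Oq; rewrite /O /= /tr col_mxKd => Oq.
  rewrite E jac_comp; [|by rewrite ev; exact: (sm_C1v oU)|exact: C1v_affine].
  by rewrite jac_affine mulmx1 ev.
have [||e e0 [DO oG uG [H hH HG]]] := uniform_ift oO hG.
- by move=> t _; rewrite /O /= /tr col_mxKd addr0.
- by move=> t _; rewrite jE ?addr0// /O /= /tr col_mxKd addr0.
set D := [set w | _] in DO oG uG hH HG; set Gh := fun w => _ in oG hH HG.
have De q : `|q| < e -> D (col_mx 0 q).
  by move=> hq; split; rewrite ?col_mxKu ?col_mxKd// mxE oppr_lt0 e0 ltr_wpDr// ltW.
pose V := [set u : 'cV[R]_n | `|u - u0| < e].
have VU : V `<=` U.
  by move=> u Vu; have := DO _ (De _ Vu); rewrite /O /= /tr col_mxKd subrKC.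
have oV : open V by exact: open_ballcV.
have fV y : (f @` V) y <-> (Gh @` D) (col_mx 0 y).
  split.
    move=> [u Vu <-]; exists (col_mx 0 (u - u0)); first exact: De.
    by rewrite /Gh col_mxKu /G /tr col_mxKd subrKC.
  move=> [w [Dw1 Dw2] /eq_col_mx[_ <-]]; exists (u0 + dsubmx w) => //.
  by rewrite /V /= addrAC subrr add0r.
have [oS sS _] := sm_slice (G := H) 0 oG hH.
have fVE : f @` V = [set y | (Gh @` D) (col_mx 0 y)] by apply/seteqP; split=> y /fV.
exists V; split=> //; first by rewrite /V /= subrr normr0.
  by rewrite fVE.
split=> [u Vu|].
  by rewrite -[u](subrKC u0) -(jE 0); [exact/uG/De|exact/DO/De].
exists (fun y => u0 + H (col_mx 0 y)).
  by rewrite fVE; apply: sm_add => //; exact: sm_cst.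
move=> u Vu; have := HG _ (De _ Vu).
by rewrite /Gh col_mxKu /G /tr !col_mxKd subrKC => ->; rewrite subrKC.
Qed.

End Inverse_functions.

(** * Ordinary differential equations *)

Section Differential_equations.
Context {R : realType}.

Lemma is_derive_addf (V : normedModType R) (f g : V -> R) x v a b :
  is_derive x v f a -> is_derive x v g b -> is_derive x v (fun s => f s + g s) (a + b).
Proof. by move=> hf hg; exact: (is_deriveD hf hg). Qed.

Lemma is_derive_subf (V : normedModType R) (f g : V -> R) x v a b :
  is_derive x v f a -> is_derive x v g b -> is_derive x v (fun s => f s - g s) (a - b).
Proof. by move=> hf hg; exact: (is_deriveB hf hg). Qed.

Lemma is_derive_mulf (V : normedModType R) (f g : V -> R) x v a b :
  is_derive x v f a -> is_derive x v g b ->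
  is_derive x v (fun s => f s * g s) (a * g x + f x * b).
Proof.
move=> hf hg; have h := is_deriveM hf hg.
by apply: is_derive_eq h _; rewrite addrC mulrC.
Qed.

Lemma is_derive_sumf (V : normedModType R) (I : Type) (r : seq I) (P : pred I)
    (F : I -> V -> R) (a : I -> R) x v :
  (forall i, is_derive x v (F i) (a i)) ->
  is_derive x v (fun s => \sum_(i <- r | P i) F i s) (\sum_(i <- r | P i) a i).
Proof.
move=> h; elim: r => [|i r IH].
  rewrite big_nil (_ : (fun s => _) = cst 0); first exact: is_derive_cst.
  by apply/funext => s; rewrite big_nil.
rewrite big_cons (_ : (fun s => _) =
  if P i then (fun s => F i s + \sum_(j <- r | P j) F j s)
  else (fun s => \sum_(j <- r | P j) F j s)); last first.
  by apply/funext => s; rewrite big_cons; case: ifP.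
by case: ifP => // _; exact: is_derive_addf.
Qed.

(** Precomposing with this retraction of the line onto [0, 1] makes objects given for times in
    [0, 1] continuous on the whole line, which keeps the subspace topology out of most arguments. *)
Definition clamp (t : R) : R := Num.max 0 (Num.min 1 t).

Lemma clamp01 t : 0 <= clamp t <= 1.
Proof. by rewrite /clamp le_max lexx/= ge_max ler01/= ge_min lexx. Qed.

Lemma clamp_id t : 0 <= t <= 1 -> clamp t = t.
Proof. by move=> /andP[t0 t1]; rewrite /clamp (min_idPr t1) (max_idPr t0). Qed.

Lemma clamp_cont t : {for t, continuous clamp}.
Proof.
have min_cont : {for t, continuous (Num.min (1 : R))}.
  apply: (@continuous_min _ _ (fun=> 1) id t); [exact: cst_cont_at|exact: cvg_id].
by apply: (@continuous_max _ _ (fun=> 0) (Num.min (1 : R)) t) => //; exact: cst_cont_at.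
Qed.

Lemma continuous_within (T : topologicalType) (f : R -> T) (A : set R) :
  (forall t : R, {for t, continuous f}) -> {within A, continuous f}.
Proof. by move=> h; apply: continuous_subspaceT => t; exact: h. Qed.

Lemma deriv_le (h h' b b' : R -> R) :
  (forall t : R, {for t, continuous h}) -> (forall t : R, {for t, continuous b}) ->
  (forall t : R, 0 < t < 1 -> is_derive t 1 h (h' t)) ->
  (forall t : R, 0 < t < 1 -> is_derive t 1 b (b' t)) ->
  (forall t : R, 0 < t < 1 -> h' t <= b' t) ->
  forall t : R, 0 <= t <= 1 -> h t - h 0 <= b t - b 0.
Proof.
move=> hc bc hd bd hb t /andP[t0 t1].
have dd (s : R) : 0 < s < 1 -> is_derive s 1 (fun s => b s - h s) (b' s - h' s).
  by move=> s01; apply: is_deriveB; [exact: bd|exact: hd].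
have key : b 0 - h 0 <= b t - h t.
  apply: (@ger0_derive1_le_cc R (fun s => b s - h s) 0 1) => //.
  - by move=> s; rewrite in_itv/= => s01; have [] := dd s s01.
  - move=> s; rewrite in_itv/= => s01; rewrite derive1E.
    by have [_ ->] := dd s s01; rewrite subr_ge0; exact: hb.
  - by apply: continuous_within => s; exact: contB.
  - by rewrite in_itv/= lexx ler01.
  - by rewrite in_itv/= t0.
lra.
Qed.

Lemma deriv_norm_le (h h' b b' : R -> R) :
  (forall t : R, {for t, continuous h}) -> (forall t : R, {for t, continuous b}) ->
  (forall t : R, 0 < t < 1 -> is_derive t 1 h (h' t)) ->
  (forall t : R, 0 < t < 1 -> is_derive t 1 b (b' t)) ->
  (forall t : R, 0 < t < 1 -> `|h' t| <= b' t) ->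
  forall t : R, 0 <= t <= 1 -> `|h t - h 0| <= b t - b 0.
Proof.
move=> hc bc hd bd hb t t01; rewrite ler_norml; apply/andP; split; last first.
  apply: (deriv_le hc bc hd bd) => // s s01.
  by apply: le_trans (hb s s01); exact: ler_norm.
have := @deriv_le (fun s => - h s) (fun s => - h' s) b b' _ bc _ bd _ t t01.
rewrite opprK => H; suff : - h t + h 0 <= b t - b 0 by lra.
apply: H.
- by move=> s; apply: (continuous_comp (hc s)); exact: opp_continuous.
- by move=> s /hd hs; exact: is_deriveN.
- move=> s s01; apply: le_trans (hb s s01); by rewrite -normrN ler_norm.
Qed.

(** Its derivative is [2 * M] times itself, so the integral of [M * expb K M] is at most
    [expb (K / 2) M]: in norms weighted by this exponential an [M]-Lipschitz right-hand side
    contracts by 1/2. *)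
Definition expb (c M t : R) : R := c * expR (2 * M * t).

Lemma expb_derive (c M t : R) : is_derive t 1 (expb c M) (2 * M * (c * expR (2 * M * t))).
Proof.
have h : is_derive t 1 (fun s : R => 2 * M * s) (2 * M).
  have -> : (fun s : R => 2 * M * s) = (2 * M) *: (@id R) by apply/funext.
  by apply: is_derive_eq; rewrite /GRing.scale/= mulr1.
have h2 : is_derive t 1 (expR \o (fun s : R => 2 * M * s)) (expR (2 * M * t) * (2 * M)).
  exact: is_derive1_comp.
have -> : expb c M = c *: (expR \o (fun s : R => 2 * M * s)) by apply/funext.
by apply: is_derive_eq; rewrite /GRing.scale/=; ring.
Qed.

Lemma is_derive_cont (f : R -> R) (t d : R) : is_derive t 1 f d -> {for t, continuous f}.
Proof. by move=> [h _]; exact/differentiable_continuous/derivable1_diffP. Qed.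

Lemma expb_cont (c M t : R) : {for t, continuous (expb c M)}.
Proof. exact: is_derive_cont (expb_derive c M t). Qed.

Lemma expb_ge c M t : 0 <= c -> 0 <= M -> 0 <= t -> c <= expb c M t.
Proof. by move=> c0 M0 t0; rewrite ler_peMr// -expR0 ler_expR !mulr_ge0. Qed.

Lemma expb_le c M t : 0 <= c -> 0 <= M -> t <= 1 -> expb c M t <= expb c M 1.
Proof. by move=> c0 M0 t1; rewrite ler_wpM2l// ler_expR ler_wpM2l// mulr_ge0. Qed.

Lemma expb0 c M : expb c M 0 = c.
Proof. by rewrite /expb mulr0 expR0 mulr1. Qed.

(* The weight exp (2 M t) turns the integral inequality into a contraction. *)
Lemma gronwall N (d d' : R -> 'cV[R]_N) (M eps : R) : 0 <= M -> 0 <= eps ->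
  (forall t : R, {for t, continuous d}) ->
  (forall t : R, 0 < t < 1 -> forall i, is_derive t 1 (fun s => d s i ord0) (d' t i ord0)) ->
  (forall t : R, 0 < t < 1 -> `|d' t| <= M * `|d t| + eps) ->
  forall t : R, 0 <= t <= 1 -> `|d t| <= 2 * (`|d 0| + eps) * expR (2 * M).
Proof.
move=> M0 e0 dc dd hd.
have dc' i (t : R) : {for t, continuous (fun s => d s i ord0)} by exact: (proj1 (cont_cV_atP _ _)).
have wc (t : R) : {for t, continuous (fun t => expb 1 M (- t) * `|d t|)}.
  apply: contM; last by apply: (continuous_comp (dc t)); exact: norm_continuous.
  apply: (@continuous_comp _ _ _ -%R (expb 1 M)); [exact: opp_continuous|exact: expb_cont].
(* [s] maximizes the weighted norm; the estimate at [s] bounds the maximum [S] by half of itself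
   plus the data. *)
have [s + hs] := EVT_max (@ler01 R) (@continuous_within _ _ `[0, 1]%classic wc).
rewrite in_itv/= => s01; set S := expb 1 M (- s) * `|d s| in hs.
have S0 : 0 <= S by rewrite mulr_ge0// mulr_ge0// expR_ge0.
have ex (t : R) : expb 1 M (- t) * expb 1 M t = 1.
  by rewrite /expb !mul1r mulrN -expRD addNr expR0.
have dS (t : R) : 0 <= t <= 1 -> `|d t| <= expb S M t.
  move=> t01; have : expb 1 M (- t) * `|d t| <= S by apply: hs; rewrite in_itv.
  move=> h; have e1 : 0 <= expb 1 M t by rewrite mulr_ge0// expR_ge0.
  have := ler_wpM2l e1 h; rewrite mulrA [X in X * _]mulrC ex mul1r => h2.
  by apply: le_trans h2 _; rewrite /expb mul1r mulrC.
pose b t := expb (S / 2) M t + eps * t.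
have be (t : R) : is_derive t 1 (fun t : R => eps * t) eps.
  have -> : (fun s : R => eps * s) = eps *: (@id R) by apply/funext.
  by apply: is_derive_eq; rewrite /GRing.scale/= mulr1.
have bd (t : R) : is_derive t 1 b (M * expb S M t + eps).
  apply: (is_derive_eq (is_derive_addf (expb_derive (S / 2) M t) (be t))).
  by rewrite /expb; congr (_ + _); field.
have est i : `|d s i ord0 - d 0 i ord0| <= b s - b 0.
  apply: (deriv_norm_le (dc' i) _ (fun t ht => dd t ht i) (fun t _ => bd t)) => //.
    by move=> t; exact: is_derive_cont (bd t).
  move=> t t01; apply: le_trans (coord_le_norm _ _) _; apply: le_trans (hd t t01) _.
  by rewrite lerD2r ler_wpM2l// dS//; case/andP: t01 => *; rewrite !ltW.
have e0S (t : R) : 0 <= expb S M t by rewrite mulr_ge0// expR_ge0.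
have dsS : `|d s| = expb S M s.
  have -> : expb S M s = `|d s| * (expb 1 M (- s) * expb 1 M s).
    by rewrite /S /expb; ring.
  by rewrite ex mulr1.
have [s0 s1] := andP s01.
have bs : b s - b 0 <= expb S M s / 2 + eps.
  rewrite /b expb0 mulr0 addr0.
  have -> : expb (S / 2) M s = expb S M s / 2 by rewrite /expb mulrAC.
  have : eps * s <= eps by rewrite ler_piMr.
  lra.
have h1 : `|d s| <= `|d 0| + (expb S M s / 2 + eps).
  have -> : d s = d 0 + (d s - d 0) by rewrite subrKC.
  rewrite (le_trans (ler_normD _ _))// lerD2l; apply: cV_norm_le.
    by rewrite addr_ge0// divr_ge0.
  by move=> i; rewrite !mxE; apply: le_trans (est i) bs.
have S2 : S <= 2 * (`|d 0| + eps).
  by have := expb_ge S0 M0 s0; rewrite dsS in h1; lra.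
move=> t t01; apply: le_trans (dS t t01) _.
apply: le_trans (expb_le S0 M0 _) _; first by case/andP: t01.
by rewrite /expb mulr1 ler_wpM2r// expR_ge0.
Qed.

Lemma primitive (g : R -> R) : (forall t : R, {for t, continuous g}) ->
  exists G : R -> R, (forall t : R, {for t, continuous G}) /\ G 0 = 0 /\
    forall t : R, 0 < t < 1 -> is_derive t 1 G (g t).
Proof.
move=> gc.
(* Integrating from -1 keeps [0, 1] in the interior of the interval where the fundamental theorem
   yields a two-sided derivative. *)
pose F (x : R) := \int[lebesgue_measure]_(t in [set` `[-1, x]]) g t.
have Fd (t : R) : -1 < t < 2 -> is_derive t 1 F (g t).
  move=> /andP[t1 t2].
  have [|] := @continuous_FTC1_closed R g (-1) t 2 t2 _ t1 (gc t).
    apply: continuous_compact_integrable; first exact: segment_compact.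
    exact: continuous_within.
  by move=> h1 h2; exact: (DeriveDef h1 (etrans (esym (derive1E F t)) h2)).
exists (fun t => F (clamp t) - F 0).
have c01 (t : R) : -1 < clamp t < 2 by have /andP[h1 h2] := clamp01 t; apply/andP; split; lra.
split=> [t|].
  apply: contB; last exact: cst_cont_at.
  apply: (@continuous_comp _ _ _ clamp F); first exact: clamp_cont.
  exact: is_derive_cont (Fd _ (c01 t)).
split; first by rewrite clamp_id ?subrr// lexx ler01.
move=> t /andP[t0 t1].
have h : is_derive t 1 (fun t => F t - F 0) (g t - 0).
  by apply: is_deriveB; apply: Fd; apply/andP; split; lra.
rewrite subr0 in h; apply: near_eq_is_derive h.
have : \forall s \near t, s \in `]0, 1[ by apply: near_in_itvoo; rewrite in_itv/= t0.
by apply: filterS => s; rewrite in_itv/= => /andP[h1 h2]; rewrite clamp_id// !ltW.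
Qed.

(* Trajectories are parametrized by R and constant outside [0, 1]. *)
Definition solves N (F : R -> 'cV[R]_N -> 'cV[R]_N) (y0 : 'cV[R]_N) (phi : R -> 'cV[R]_N) :=
  [/\ phi 0 = y0, forall t : R, phi t = phi (clamp t), forall t : R, {for t, continuous phi}
    & forall t : R, 0 < t < 1 ->
        forall i, is_derive t 1 (fun s => phi s i ord0) (F t (phi t) i ord0)].

Lemma integral_curve N (g : R -> 'cV[R]_N) y0 : (forall t : R, {for t, continuous g}) ->
  exists phi, solves (fun t _ => g t) y0 phi.
Proof.
move=> gc.
have gi i : exists G : R -> R, (forall t : R, {for t, continuous G}) /\ G 0 = 0 /\
    forall t : R, 0 < t < 1 -> is_derive t 1 G (g t i ord0).
  by apply: primitive => t; exact: (proj1 (cont_cV_atP _ _)).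
have [G hG] := choice gi.
exists (fun t => \col_i (y0 i ord0 + G i (clamp t))); split.
- apply/colP => i; rewrite mxE clamp_id ?lexx ?ler01//.
  by have [_ [-> _]] := hG i; rewrite addr0.
- by move=> t; apply/colP => i; rewrite !mxE (clamp_id (clamp01 t)).
- move=> t; apply/cont_cV_atP => i.
  rewrite (_ : (fun x : R => _) = fun x : R => y0 i ord0 + G i (clamp x)); last first.
    by apply/funext => x; rewrite mxE.
  apply: contD; first exact: cst_cont_at.
  apply: (@continuous_comp _ _ _ clamp (G i)); first exact: clamp_cont.
  by have [h _] := hG i; exact: h.
- move=> t t01 i; have [_ [_ hd]] := hG i.
  have h : is_derive t 1 (fun s => y0 i ord0 + G i s) (0 + g t i ord0).
    by apply: is_deriveD; exact: hd.
  rewrite add0r in h; apply: near_eq_is_derive h.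
  have [t0 t1] := andP t01.
  have : \forall s \near t, s \in `]0, 1[ by apply: near_in_itvoo; rewrite in_itv/= t0.
  by apply: filterS => s; rewrite in_itv/= mxE => /andP[h1 h2]; rewrite clamp_id// !ltW.
Qed.

Lemma cont_atvP (T : topologicalType) n (f : T -> 'cV[R]_n) (u : T) :
  {for u, continuous f} <-> (forall e, 0 < e -> \forall w \near u, `|f w - f u| < e).
Proof.
split=> [h e e0|h].
  have H : \forall w \near u, forall i, `|f w i ord0 - f u i ord0| < e.
    apply: near_forall => i.
    by apply: (proj1 (cont_atP _ _)) e0; exact: (proj1 (cont_cV_atP _ _)).
  by apply: filterS H => w hw; apply: cV_norm_lt => // i; rewrite !mxE.
apply/cont_cV_atP => i; apply/cont_atP => e /h; apply: filterS => w.
by apply: le_lt_trans; have := coord_le_norm (f w - f u) i; rewrite !mxE.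
Qed.

Lemma unif_lim_cont N (x : nat -> R -> 'cV[R]_N) (phi : R -> 'cV[R]_N) (C : R) :
  (forall k (t : R), {for t, continuous (x k)}) ->
  (forall k (t : R), `|x k t - phi t| <= C / 2 ^+ k) ->
  forall t : R, {for t, continuous phi}.
Proof.
move=> xc h t; apply/cont_atvP => e e0.
have [k hk] := half_pow_small C (divr_gt0 e0 (ltr0n R 3)).
have := proj1 (cont_atvP _ _) (xc k t) (e / 3) (divr_gt0 e0 (ltr0n R 3)).
apply: filterS => s hs.
have -> : phi s - phi t = - (x k s - phi s) + (x k s - x k t) + (x k t - phi t).
  by apply/colP => i; rewrite !mxE; ring.
have h1 := h k s; have h2 := h k t.
apply: le_lt_trans (ler_normD _ _) _.
have h3 := ler_normD (- (x k s - phi s)) (x k s - x k t); rewrite normrN in h3.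
lra.
Qed.

Lemma cont_comp (A B C : topologicalType) (f : A -> B) (g : B -> C) u :
  {for u, continuous f} -> {for f u, continuous g} -> {for u, continuous (fun x => g (f x))}.
Proof. by move=> hf hg; exact: (continuous_comp hf hg). Qed.

(** Picard iteration in the exponentially weighted norm, where it has ratio 1/2 up to time 1. The
    field is controlled only on the ball of radius [r]; the last hypothesis puts the a priori bound
    [2 * (|y0| + beta) * expR (2 * M)] below [r], so that no iterate leaves the ball. *)
Lemma picard N (F : R -> 'cV[R]_N -> 'cV[R]_N) (y0 : 'cV[R]_N) (M beta r : R) :
  0 <= M -> 0 <= beta ->
  (forall (t : R) y, `|y| < r ->
     {for (t, y), continuous (fun p : R * 'cV[R]_N => F (clamp p.1) p.2)}) ->
  (forall (t : R) (y y' : 'cV[R]_N), 0 <= t <= 1 -> `|y| < r -> `|y'| < r ->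
     `|F t y - F t y'| <= M * `|y - y'|) ->
  (forall t : R, 0 <= t <= 1 -> `|F t 0| <= beta) ->
  2 * (`|y0| + beta) * expR (2 * M) < r ->
  exists2 phi, solves F y0 phi & forall t : R, `|phi t| <= 2 * (`|y0| + beta) * expR (2 * M).
Proof.
move=> M0 beta0 Fc Fl F0 hr.
pose C := 2 * (`|y0| + beta).
have C0 : 0 <= C by rewrite mulr_ge0// addr_ge0.
have Cr (t : R) : t <= 1 -> expb C M t < r.
  move=> t1; apply: le_lt_trans (expb_le C0 M0 t1) _.
  by rewrite /expb mulr1.
have r0 : 0 < r by apply: le_lt_trans hr; rewrite mulr_ge0// expR_ge0.
(* Curves obeying the a priori bound. The integral of the field along such a curve is at most
   [expb (C / 2) M t - C / 2 + beta]; adding [|y0|] and using [|y0| + beta = C / 2] gives the bound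
   back. *)
pose ok (x : R -> 'cV[R]_N) := (forall t : R, {for t, continuous x}) /\
   forall t : R, `|x t| <= expb C M (clamp t).
have okr x (t : R) : ok x -> `|x t| < r.
  by move=> [_ h]; apply: le_lt_trans (h t) _; apply: Cr; case/andP: (clamp01 t).
have Fxc x : ok x -> forall t : R, {for t, continuous (fun t => F (clamp t) (x t))}.
  move=> hx t; have [xc _] := hx.
  apply: (@cont_comp _ _ _ (fun t => (t, x t)) (fun p : R * 'cV[R]_N => F (clamp p.1) p.2)).
    by apply: cont_pair_at; [exact: cvg_id|exact: xc].
  by apply: Fc; exact: okr.
pose stp (x : R -> 'cV[R]_N) : R -> 'cV[R]_N :=
  xget x [set phi | solves (fun t _ => F (clamp t) (x t)) y0 phi].
have stpP x : ok x -> solves (fun t _ => F (clamp t) (x t)) y0 (stp x).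
  move=> hx; have [phi hphi] := integral_curve y0 (Fxc x hx).
  by apply: (@xgetPex _ x [set phi | solves (fun t _ => F (clamp t) (x t)) y0 phi]); exists phi.
have stp_est x1 x2 phi1 phi2 (K : R) : ok x1 -> ok x2 -> 0 <= K ->
    solves (fun t _ => F (clamp t) (x1 t)) y0 phi1 ->
    solves (fun t _ => F (clamp t) (x2 t)) y0 phi2 ->
    (forall t : R, 0 <= t <= 1 -> `|x1 t - x2 t| <= expb K M t) ->
    forall t : R, 0 <= t <= 1 -> `|phi1 t - phi2 t| <= expb (K / 2) M t.
  move=> o1 o2 K0 [p10 _ p1c p1d] [p20 _ p2c p2d] hx t t01.
  have K20 : 0 <= K / 2 by rewrite divr_ge0.
  apply: cV_norm_le; first by rewrite mulr_ge0// expR_ge0.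
  move=> i; have := @deriv_norm_le (fun t => phi1 t i ord0 - phi2 t i ord0)
    (fun t => (F (clamp t) (x1 t) - F (clamp t) (x2 t)) i ord0)
    (expb (K / 2) M) (fun t => 2 * M * (K / 2 * expR (2 * M * t))) _ _ _ _ _ t t01.
  rewrite p10 p20 subrr subr0 expb0 !mxE => H; apply: le_trans (H _ _ _ _ _) _.
  - by move=> s; apply: contB; exact: (proj1 (cont_cV_atP _ _)).
  - by move=> s; exact: expb_cont.
  - by move=> s s01; rewrite !mxE; apply: is_deriveB; [exact: p1d|exact: p2d].
  - by move=> s _; exact: expb_derive.
  - move=> s s01; apply: le_trans (coord_le_norm _ _) _.
    have s01' : 0 <= s <= 1 by case/andP: s01 => *; rewrite !ltW.
    rewrite clamp_id//; apply: le_trans (Fl _ _ _ s01' (okr _ _ o1) (okr _ _ o2)) _.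
    apply: le_trans (ler_wpM2l M0 (hx s s01')) _.
    rewrite /expb le_eqVlt; apply/orP; left; apply/eqP; by field.
  - by rewrite lerBlDr lerDl.
have stp_ok x : ok x -> ok (stp x).
  move=> hx; have [p0 pcl pc pd] := stpP x hx; split=> // t; rewrite pcl.
  have := clamp01 t; move: (clamp t) => {}t t01.
  have t0 : 0 <= t by case/andP: t01.
  have -> : stp x t = y0 + (stp x t - stp x 0) by rewrite p0 subrKC.
  apply: le_trans (ler_normD _ _) _.
  have bb : `|stp x t - stp x 0| <= (expb (C / 2) M t + beta * t) - C / 2.
    apply: cV_norm_le.
      rewrite addrAC; apply: addr_ge0; last by rewrite mulr_ge0.
      by rewrite subr_ge0; apply: expb_ge => //; rewrite divr_ge0.
    move=> i; rewrite !mxE.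
    have be (s : R) : is_derive s 1 (fun t : R => beta * t) beta.
      have -> : (fun s : R => beta * s) = beta *: (@id R) by apply/funext.
      by apply: is_derive_eq; rewrite /GRing.scale/= mulr1.
    have bd (s : R) : is_derive s 1 (fun t => expb (C / 2) M t + beta * t)
        (2 * M * (C / 2 * expR (2 * M * s)) + beta).
      by apply: is_derive_addf => //; exact: expb_derive.
    have := @deriv_norm_le (fun t => stp x t i ord0) (fun t => F (clamp t) (x t) i ord0)
      (fun t => expb (C / 2) M t + beta * t) (fun t => 2 * M * (C / 2 * expR (2 * M * t)) + beta)
      _ _ _ _ _ t t01.
    rewrite expb0 mulr0 addr0; apply.
    - by move=> s; exact: (proj1 (cont_cV_atP _ _)).
    - by move=> s; exact: is_derive_cont (bd s).
    - by move=> s s01; exact: pd.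
    - move=> s s01; apply: le_trans (coord_le_norm _ _) _.
      have s01' : 0 <= s <= 1 by case/andP: s01 => *; rewrite !ltW.
      rewrite clamp_id//.
      have -> : F s (x s) = (F s (x s) - F s 0) + F s 0 by rewrite subrK.
      apply: le_trans (ler_normD _ _) _; apply: lerD; last exact: F0.
      have z0 : `|0 : 'cV[R]_N| < r by rewrite normr0.
      apply: le_trans (Fl _ _ _ s01' (okr _ _ hx) z0) _; rewrite subr0.
      have [_ hx2] := hx; have := ler_wpM2l M0 (hx2 s); rewrite clamp_id// => h.
      apply: le_trans h _; rewrite /expb le_eqVlt; apply/orP; left; apply/eqP; by field.
  have e2 : expb (C / 2) M t = expb C M t / 2 by rewrite /expb mulrAC.
  have hC := expb_ge C0 M0 t0.
  have hb : beta * t <= beta by rewrite ler_piMr//; case/andP: t01.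
  have hy : `|y0| + beta = C / 2 by rewrite /C mulrC mulKf.
  rewrite e2 in bb; apply: le_trans (lerD (lexx _) bb) _; lra.
pose x (k : nat) := iter k stp (fun=> y0).
have ok0 : ok (fun=> y0).
  split; first by move=> t; exact: cst_cont_at.
  move=> t; apply: (@le_trans _ _ C).
    by rewrite /C; have := normr_ge0 y0; lra.
  by apply: expb_ge => //; case/andP: (clamp01 t).
have okx k : ok (x k) by elim: k => [//|k IH]; exact: stp_ok.
have x_cl k (t : R) : x k t = x k (clamp t).
  by case: k => [//|k]; have [_ h _ _] := stpP _ (okx k); exact: h.
have r20 : 0 <= 2 * r by rewrite mulr_ge0// ltW.
have dx k (t : R) : 0 <= t <= 1 -> `|x k.+1 t - x k t| <= expb (2 * r / 2 ^+ k) M t.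
  elim: k t => [|k IH] t t01.
    rewrite expr0 divr1; apply: (@le_trans _ _ (2 * r)).
      apply: le_trans (ler_normB _ _) _.
      by have := okr _ t (okx 1%N); have := okr _ t (okx 0%N); lra.
    by apply: expb_ge => //; case/andP: t01.
  have -> : 2 * r / 2 ^+ k.+1 = (2 * r / 2 ^+ k) / 2 by rewrite exprSr invfM mulrA.
  apply: (stp_est (x k.+1) (x k)) => //.
  - by rewrite divr_ge0// exprn_ge0.
  - exact: stpP.
  - exact: stpP.
pose Cx := 2 * r * expR (2 * M).
have Cx0 : 0 <= Cx by rewrite mulr_ge0// expR_ge0.
have dx' k (t : R) : `|x k.+1 t - x k t| <= Cx / 2 ^+ k.
  rewrite (x_cl k.+1) (x_cl k); apply: le_trans (dx k _ (clamp01 t)) _.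
  apply: le_trans (expb_le _ M0 _) _; first by rewrite divr_ge0// exprn_ge0.
    by case/andP: (clamp01 t).
  by rewrite /expb mulr1 mulrAC.
have cc (q : R * 'I_N) : exists l, forall k, `|x k q.1 q.2 ord0 - l| <= 2 * Cx / 2 ^+ k.
  apply: geom_cvg => k; apply: le_trans (dx' k q.1).
  by have := coord_le_norm (x k.+1 q.1 - x k q.1) q.2; rewrite !mxE.
have [l hl] := choice cc.
pose phi (t : R) : 'cV[R]_N := \col_i l (clamp t, i).
have K0 k : 0 <= 2 * Cx / 2 ^+ k.
  by apply: divr_ge0; [exact: mulr_ge0|exact: exprn_ge0].
have lim k (t : R) : `|x k t - phi t| <= 2 * Cx / 2 ^+ k.
  apply: cV_norm_le => //.
  by move=> i; rewrite !mxE x_cl; exact: (hl (clamp t, i)).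
have phic := unif_lim_cont (fun k => proj1 (okx k)) lim.
have okphi : ok phi.
  split=> // t; apply/ler_addgt0Pl => e e0.
  have [k hk] := half_pow_small (2 * Cx) e0.
  have -> : phi t = - (x k t - phi t) + x k t by rewrite opprB subrK.
  rewrite (le_trans (ler_normD _ _))// normrN lerD//; first by apply: ltW; exact: le_lt_trans (lim k t) hk.
  by have [_ h] := okx k; exact: h.
(* Both sides are within a multiple of [1 / 2 ^+ k] of the iterate [x k.+1], for every [k]. *)
have E : stp phi = phi.
  have [_ scl _ _] := stpP _ okphi.
  apply/funext => t; rewrite scl [RHS](_ : _ = phi (clamp t)); last first.
    by apply/colP => i; rewrite !mxE (clamp_id (clamp01 t)).
  have := clamp01 t; move: (clamp t) => {}t t01.
  apply/eqP; rewrite -subr_eq0 -normr_le0; apply/ler_addgt0Pl => e e0; rewrite addr0.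
  have [k hk] := half_pow_small (2 * (2 * Cx * expR (2 * M))) e0.
  have h1 := stp_est phi (x k) _ _ _ okphi (okx k) (K0 k) (stpP _ okphi) (stpP _ (okx k)) _ t t01.
  have {}h1 : `|stp phi t - x k.+1 t| <= expb (2 * Cx / 2 ^+ k / 2) M t.
    apply: h1 => s s01; rewrite distrC; apply: le_trans (lim k s) _.
    by apply: expb_ge => //; case/andP: s01.
  have h2 := lim k.+1 t.
  have -> : stp phi t - phi t = (stp phi t - x k.+1 t) + (x k.+1 t - phi t) by rewrite addrA subrK.
  rewrite (le_trans (ler_normD _ _))//.
  have EK : 2 * Cx * expR (2 * M) / 2 ^+ k = 2 * Cx / 2 ^+ k * expR (2 * M) by rewrite mulrAC.
  have h3 : expb (2 * Cx / 2 ^+ k / 2) M t <= 2 * Cx * expR (2 * M) / 2 ^+ k.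
    apply: le_trans (expb_le _ M0 _) _; [by rewrite divr_ge0|by case/andP: t01|].
    rewrite EK /expb mulr1 ler_wpM2r ?expR_ge0//.
    by rewrite ler_pdivrMr// ler_peMr// ler1n.
  have e1 : 1 <= expR (2 * M) by rewrite -expR0 ler_expR mulr_ge0.
  have h4 : 2 * Cx / 2 ^+ k.+1 <= 2 * Cx * expR (2 * M) / 2 ^+ k.
    rewrite EK exprSr invfM mulrA ler_wpM2l//.
    by apply: le_trans e1; rewrite invf_le1// ler1n.
  have h5 : 2 * (2 * Cx * expR (2 * M)) / 2 ^+ k =
     2 * Cx * expR (2 * M) / 2 ^+ k + 2 * Cx * expR (2 * M) / 2 ^+ k.
    by rewrite -mulrA mulrDl mul1r.
  rewrite h5 in hk; lra.
have [p0 pcl pc pd] := stpP _ okphi; rewrite E in p0 pcl pc pd.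
exists phi.
  split=> // t t01 i; have := pd t t01 i; rewrite clamp_id//.
  by case/andP: t01 => *; rewrite !ltW.
move=> t; have [_ h] := okphi; apply: le_trans (h t) _.
have -> : 2 * (`|y0| + beta) * expR (2 * M) = expb C M 1 by rewrite /expb mulr1.
by apply: expb_le => //; case/andP: (clamp01 t).
Qed.
End Differential_equations.

(** * Smooth dependence of solutions on parameters *)

Section Smooth_dependence.
Context {R : realType}.
Lemma evt01 (f : R -> R) : (forall t : R, {for t, continuous f}) ->
  exists s, forall t : R, 0 <= t <= 1 -> f t <= f s.
Proof.
move=> fc; have [s _ h] := EVT_max (@ler01 R) (@continuous_within R _ _ `[0, 1]%classic fc).
by exists s => t t01; apply: h; rewrite in_itv.
Qed.

Lemma derive_bound (V : normedModType R) (f : V -> R) x v d C :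
  is_derive x v f d ->
  (\forall h \near (0 : R)^', `|f (h *: v + x) - f x| <= C * `|h|) -> `|d| <= C.
Proof.
move=> [hd <-] hb; apply/ler_addgt0Pl => e e0.
have q : h^-1 *: (f (h *: v + x) - f x) @[h --> (0 : R)^'] --> 'D_v f x by exact: hd.
have n1 : \forall h \near (0 : R)^', `|'D_v f x - h^-1 *: (f (h *: v + x) - f x)| < e.
  by move/cvgrPdist_lt : q => /(_ e e0).
have n2 : \forall h \near (0 : R)^', h != 0 by exact: nbhs_dnbhs_neq.
have [h [[h1 h2] h0]] := filter_ex (filterI (filterI n1 hb) n2).
rewrite -(subrK (h^-1 *: (f (h *: v + x) - f x)) ('D_v f x)).
apply: le_trans (ler_normD _ _) _; apply: lerD; first exact: ltW.
rewrite normrM normfV ler_pdivrMl ?normr_gt0// mulrC.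
exact: h2.
Qed.

Lemma norm_col_mx a b (u : 'cV[R]_a) (v : 'cV[R]_b) e : 0 <= e ->
  `|u| <= e -> `|v| <= e -> `|col_mx u v| <= e.
Proof.
move=> e0 hu hv; apply: cV_norm_le => // i; case: (split_ordP i) => j ->.
  by rewrite col_mxEu (le_trans (coord_le_norm _ _)).
by rewrite col_mxEd (le_trans (coord_le_norm _ _)).
Qed.

Section ParamODE.
Variables (p N : nat) (O : set 'cV[R]_p) (Y : set 'cV[R]_N).
Variables (W : R -> 'cV[R]_(p + N) -> 'cV[R]_N) (phi0 : 'cV[R]_p -> 'cV[R]_N).
Variable (Phi : R -> 'cV[R]_p -> 'cV[R]_N) (M : R).
Hypotheses (M0 : 0 <= M) (oO : open O) (oY : open Y).

Let WC (t : R) u := W (clamp t) u.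
Let dom : set (R * 'cV[R]_(p + N)) := [set q | O (usubmx q.2) /\ Y (dsubmx q.2)].
Let OT : set (R * 'cV[R]_p) := [set q | O q.2].

Hypothesis hL : forall (t : R) x y y', 0 <= t <= 1 -> O x -> Y y -> Y y' ->
  `|W t (col_mx x y) - W t (col_mx x y')| <= M * `|y - y'|.
Hypothesis hPhi : forall x, O x ->
  solves (fun t y => W t (col_mx x y)) (phi0 x) (fun t => Phi t x) /\ forall t, Y (Phi t x).

Lemma usub_cont a b (u : 'cV[R]_(a + b)) : {for u, continuous (usubmx : 'cV[R]_(a + b) -> 'cV[R]_a)}.
Proof. by apply: C1v_continuous; apply: (sm_C1v openT) => //; apply: sm_usub => //; [exact: openT|exact: sm_id]. Qed.

Lemma dsub_cont a b (u : 'cV[R]_(a + b)) : {for u, continuous (dsubmx : 'cV[R]_(a + b) -> 'cV[R]_b)}.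
Proof. by apply: C1v_continuous; apply: (sm_C1v openT) => //; apply: sm_dsub => //; [exact: openT|exact: sm_id]. Qed.

Lemma cont_col_mx (T : topologicalType) a b (f : T -> 'cV[R]_a) (g : T -> 'cV[R]_b) t :
  {for t, continuous f} -> {for t, continuous g} -> {for t, continuous (fun s => col_mx (f s) (g s))}.
Proof.
move=> hf hg; apply/cont_cV_atP => i; case: (split_ordP i) => j ->.
  rewrite (_ : (fun s => _) = fun s => f s j ord0); first exact: (proj1 (cont_cV_atP _ _)).
  by apply/funext => s; rewrite col_mxEu.
rewrite (_ : (fun s => _) = fun s => g s j ord0); first exact: (proj1 (cont_cV_atP _ _)).
by apply/funext => s; rewrite col_mxEd.
Qed.

Lemma open_dom : open dom.
Proof.
have -> : dom = (fun q : R * 'cV[R]_(p + N) => usubmx q.2) @^-1` O `&`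
    (fun q : R * 'cV[R]_(p + N) => dsubmx q.2) @^-1` Y by [].
apply: openI; apply: open_comp => // q _.
  by apply: (@cont_comp _ _ _ snd usubmx); [exact: cvg_snd|exact: usub_cont].
by apply: (@cont_comp _ _ _ snd dsubmx); [exact: cvg_snd|exact: dsub_cont].
Qed.

Lemma open_OT : open OT.
Proof.
have -> : OT = snd @^-1` O by [].
by apply: open_comp => // q _; exact: cvg_snd.
Qed.

Lemma Phi_cont_t x : O x -> forall t : R, {for t, continuous (fun t => Phi t x)}.
Proof. by move=> /hPhi[[]]. Qed.

Section Cont.
Hypothesis Wc : forall q i, dom q -> {for q, continuous (fun q => WC q.1 q.2 i ord0)}.
Variable x0 : 'cV[R]_p.
Hypothesis Ox0 : O x0.
Hypothesis phi0c : {for x0, continuous phi0}.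

(** Gronwall for [Phi t x - Phi t x0]: the defect is the change of [W] along the fixed trajectory of
    [x0] when only the parameter moves, and it is small uniformly in [t] by compactness of
    [0, 1]. *)
Lemma ode_unif_cont (e : R) : 0 < e ->
  \forall x \near x0, O x /\ forall t : R, 0 <= t <= 1 -> `|Phi t x - Phi t x0| <= e.
Proof.
move=> e0; pose C : R := 2 * expR (2 * M).
have C0 : 0 < C by rewrite mulr_gt0// expR_gt0.
pose d := e / 2 / C; have d0 : 0 < d by rewrite !divr_gt0.
have [[p00 _ p0c p0d] Yp0] := hPhi Ox0.
pose P (q : R * 'cV[R]_p) := O q.2 /\
  `|WC q.1 (col_mx q.2 (Phi q.1 x0)) - WC q.1 (col_mx x0 (Phi q.1 x0))| < d.
have hP (t : R) : 0 <= t <= 1 -> \forall q \near (t, x0), P q.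
  move=> _; have n1 : \forall q \near (t, x0), O q.2 by exact: (open_near open_OT).
  have domt : dom (t, col_mx x0 (Phi t x0)) by split; rewrite /= ?col_mxKu ?col_mxKd.
  have Pc : {for (t, x0), continuous (fun q : R * 'cV[R]_p => Phi q.1 x0)}.
    by apply: (@cont_comp _ _ _ fst (fun t => Phi t x0)); [exact: cvg_fst|exact: p0c].
  have c1 i : {for (t, x0), continuous (fun q : R * 'cV[R]_p => WC q.1 (col_mx q.2 (Phi q.1 x0)) i ord0)}.
    apply: (@cont_comp _ _ _ (fun q : R * 'cV[R]_p => (q.1, col_mx q.2 (Phi q.1 x0)))
       (fun q => WC q.1 q.2 i ord0)); last exact: Wc.
    apply: (@cont_pair_at _ _ _ fst (fun q : R * 'cV[R]_p => col_mx q.2 (Phi q.1 x0))).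
      exact: cvg_fst.
    apply: (@cont_col_mx _ _ _ snd (fun q : R * 'cV[R]_p => Phi q.1 x0)); [exact: cvg_snd|exact: Pc].
  have c2 i : {for (t, x0), continuous (fun q : R * 'cV[R]_p => WC q.1 (col_mx x0 (Phi q.1 x0)) i ord0)}.
    apply: (@cont_comp _ _ _ (fun q : R * 'cV[R]_p => (q.1, col_mx x0 (Phi q.1 x0)))
       (fun q => WC q.1 q.2 i ord0)); last exact: Wc.
    apply: (@cont_pair_at _ _ _ fst (fun q : R * 'cV[R]_p => col_mx x0 (Phi q.1 x0))).
      exact: cvg_fst.
    apply: (@cont_col_mx _ _ _ (fun=> x0) (fun q : R * 'cV[R]_p => Phi q.1 x0)).
      exact: cst_cont_at.
    exact: Pc.
  have n2 : \forall q \near (t, x0), forall i,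
     `|WC q.1 (col_mx q.2 (Phi q.1 x0)) i ord0 - WC q.1 (col_mx x0 (Phi q.1 x0)) i ord0| < d.
    apply: near_forall => i.
    apply: (@cont_near _ _ (fun q : R * 'cV[R]_p =>
      `|WC q.1 (col_mx q.2 (Phi q.1 x0)) i ord0 - WC q.1 (col_mx x0 (Phi q.1 x0)) i ord0|)).
      by apply: cont_norm; apply: contB; [exact: c1|exact: c2].
    by rewrite /= subrr normr0.
  apply: filterS2 n1 n2 => q h1 h2; split=> //; apply: cV_norm_lt => // i.
  by rewrite !mxE; exact: h2.
have [e1 e10 n1] := tube hP.
have n2 := proj1 (cont_atvP _ _) phi0c d d0.
apply: filterS2 n1 n2 => x h1 h2.
have e1_ (t : R) : 0 <= t <= 1 -> - e1 < t < 1 + e1.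
  by move=> /andP[t0 t1]; apply/andP; split; lra.
have Ox : O x by have [] := h1 0 (e1_ 0 _); rewrite ?lexx ?ler01.
split=> // t t01; have [[q0 _ qc qd] Yq] := hPhi Ox.
have := @gronwall R N (fun t => Phi t x - Phi t x0)
  (fun t => W t (col_mx x (Phi t x)) - W t (col_mx x0 (Phi t x0))) M d M0 (ltW d0) _ _ _ t t01.
rewrite /= q0 p00 => H; apply: le_trans (H _ _ _) _.
- move=> s; apply/cont_cV_atP => i.
  rewrite (_ : (fun s => _) = fun s => Phi s x i ord0 - Phi s x0 i ord0).
    by apply: contB; [exact: (proj1 (cont_cV_atP _ _) (qc s))|exact: (proj1 (cont_cV_atP _ _) (p0c s))].
  by apply/funext => s'; rewrite !mxE.
- move=> s s01 i; rewrite (_ : (fun s => _) = fun s => Phi s x i ord0 - Phi s x0 i ord0).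
    by rewrite !mxE; apply: is_derive_subf; [exact: qd|exact: p0d].
  by apply/funext => s'; rewrite !mxE.
- move=> s s01; have s01' : 0 <= s <= 1 by case/andP: s01 => *; rewrite !ltW.
  have -> : W s (col_mx x (Phi s x)) - W s (col_mx x0 (Phi s x0)) =
    (W s (col_mx x (Phi s x)) - W s (col_mx x (Phi s x0))) +
    (W s (col_mx x (Phi s x0)) - W s (col_mx x0 (Phi s x0))) by rewrite addrA subrK.
  apply: le_trans (ler_normD _ _) _; apply: lerD; first exact: hL.
  have [_ h] := h1 s (e1_ s s01'); move: h; rewrite /WC /= clamp_id// => h; exact: ltW.
have -> : 2 * (`|phi0 x - phi0 x0| + d) * expR (2 * M) = C * (`|phi0 x - phi0 x0| + d).
  by rewrite /C mulrAC.
have Cd : C * d = e / 2 by rewrite /d mulrC divfK// gt_eqF.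
have : C * `|phi0 x - phi0 x0| <= C * d by rewrite ler_pM2l// ltW.
rewrite mulrDr Cd; lra.
Qed.

Lemma ode_cont (t : R) : {for (t, x0), continuous (fun q : R * 'cV[R]_p => Phi q.1 q.2)}.
Proof.
apply/cont_atvP => e e0.
have n1 := ode_unif_cont (divr_gt0 e0 (ltr0n R 3)).
have n1' : \forall q \near (t, x0), O q.2 /\ forall t : R, 0 <= t <= 1 -> `|Phi t q.2 - Phi t x0| <= e / 3.
  have c : {for (t, x0), continuous (@snd R 'cV[R]_p)} by exact: cvg_snd.
  exact: (c _ n1).
have c2 : {for (t, x0), continuous (fun q : R * 'cV[R]_p => Phi q.1 x0)}.
  by apply: (@cont_comp _ _ _ fst (fun t => Phi t x0)); [exact: cvg_fst|exact: Phi_cont_t].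
have n2 := proj1 (cont_atvP _ _) c2 (e / 3) (divr_gt0 e0 (ltr0n R 3)).
apply: filterS2 n1' n2 => -[s x] [Ox h1] /= h2.
have [[_ c _ _] _] := hPhi Ox; have [[_ c' _ _] _] := hPhi Ox0.
have -> : Phi s x - Phi t x0 = (Phi s x - Phi s x0) + (Phi s x0 - Phi t x0) by rewrite addrA subrK.
rewrite (le_lt_trans (ler_normD _ _))//.
have := h1 (clamp s) (clamp01 s); rewrite -c -c' => h3; lra.
Qed.

End Cont.

(** The Lipschitz constant bounds the difference quotients in the directions of the unknown, hence
    the derivatives. *)
Lemma Wjac_bound (t : R) x y (v : 'cV[R]_N) : 0 <= t <= 1 -> O x -> Y y -> C1v (W t) (col_mx x y) ->
  `|jac (W t) (col_mx x y) *m col_mx 0 v| <= M * `|v|.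
Proof.
move=> t01 Ox Yy h; apply: cV_norm_le; first exact: mulr_ge0.
move=> i; apply: (derive_bound (C1v_derive (col_mx 0 v) i h)).
have c : {for 0, continuous (fun h : R => h *: v + y)}.
  apply/cont_cV_atP => j.
  rewrite (_ : (fun s => _) = fun s : R => s * v j ord0 + y j ord0).
    by apply: contD; [apply: contM; [exact: cvg_id|exact: cst_cont_at]|exact: cst_cont_at].
  by apply/funext => s; rewrite !mxE.
have n1 : \forall s \near (0 : R), Y (s *: v + y).
  apply: c; rewrite /= scale0r add0r; exact: open_nbhs_nbhs.
have n2 : \forall s \near (0 : R)^', Y (s *: v + y) by exact: cvg_within n1.
apply: filterS n2 => s Ys.
rewrite scale_col_mx add_col_mx scaler0 add0r.
have := coord_le_norm (W t (col_mx x (s *: v + y)) - W t (col_mx x y)) i.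
rewrite !mxE => h1; apply: le_trans h1 _; apply: le_trans (hL t01 Ox Ys Yy) _.
by rewrite addrK normrZ mulrA mulrAC.
Qed.

Section Deriv.
Hypothesis W1 : CkPm 1 dom WC.
Hypothesis phi1 : CkPm 1 OT (fun _ => phi0).

Let DW (t : R) u := jac (WC t) u.

Lemma WC_cont q i : dom q -> {for q, continuous (fun q => WC q.1 q.2 i ord0)}.
Proof. exact: CkP_cont (W1 i ord0). Qed.

Lemma DW_cont q i j : dom q -> {for q, continuous (fun q => DW q.1 q.2 i j)}.
Proof. exact: CkP_cont (CkPm_jac open_dom W1 i j). Qed.

Lemma phi0_C1 x : O x -> C1v phi0 x.
Proof. by move=> Ox; exact: (CkPm_C1v (t := 0) open_OT phi1). Qed.

Lemma W_C1 (t : R) x y : 0 <= t <= 1 -> O x -> Y y -> C1v (W t) (col_mx x y).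
Proof.
move=> t01 Ox Yy; have : C1v (WC t) (col_mx x y).
  by apply: (CkPm_C1v (t := t) open_dom W1); split; rewrite /= ?col_mxKu ?col_mxKd.
by rewrite /WC clamp_id.
Qed.

(** [Z] solves the equation of variations; this is linear, so [picard] applies with a ball as large
    as needed. The difference quotient of [Phi] minus [Z] solves the same linear equation up to an
    error that tends to 0 with [h], and Gronwall makes it tend to 0 uniformly in [t]. *)
Lemma ode_deriv x0 i : O x0 ->
  exists Z : R -> 'cV[R]_N,
    solves (fun t z => DW t (col_mx x0 (Phi t x0)) *m col_mx (cvec i) z) (jac phi0 x0 *m cvec i) Z /\
    forall (t : R) a, is_derive x0 (cvec i) (fun x => Phi t x a ord0) (Z t a ord0).
Proof.
move=> Ox0.
have [[p00 p0cl p0c p0d] Yp0] := hPhi Ox0.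
have phi0c := C1v_continuous (phi0_C1 Ox0).
pose al (t : R) := col_mx x0 (Phi t x0).
have alc t : {for t, continuous al} by apply: cont_col_mx; [exact: cst_cont_at|exact: p0c].
have aldom t : dom (t, al t) by split; rewrite /= ?col_mxKu ?col_mxKd.
pose ZF (t : R) z := DW t (al t) *m col_mx (cvec i) z.
have DWal_cont (t : R) a b : {for t, continuous (fun t => DW t (al t) a b)}.
  apply: (@cont_comp _ _ _ (fun t => (t, al t)) (fun q => DW q.1 q.2 a b)).
    by apply: cont_pair_at; [exact: cvg_id|exact: alc].
  exact: DW_cont.
have DWB (t : R) (v : 'cV[R]_N) : 0 <= t <= 1 -> `|DW t (al t) *m col_mx 0 v| <= M * `|v|.
  move=> t01; rewrite /DW /WC clamp_id//; apply: Wjac_bound => //; exact: W_C1.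
have ZF_lip (t : R) z z' : 0 <= t <= 1 -> `|ZF t z - ZF t z'| <= M * `|z - z'|.
  move=> t01; rewrite /ZF -mulmxBr opp_col_mx add_col_mx subrr; exact: DWB.
have ZFc (t : R) z : {for (t, z), continuous (fun q : R * 'cV[R]_N => ZF (clamp q.1) q.2)}.
  apply/cont_cV_atP => a; apply: cont_mulmx => [a' b|a' b].
    apply: (@cont_comp _ _ _ (fun q : R * 'cV[R]_N => clamp q.1) (fun t => DW t (al t) a' b)) => //.
    by apply: (@cont_comp _ _ _ fst clamp); [exact: cvg_fst|exact: clamp_cont].
  rewrite (ord1 b); move: a'; apply: (proj1 (cont_cV_atP _ _)).
  by apply: cont_col_mx; [exact: cst_cont_at|exact: cvg_snd].
have ZF0c (t : R) : {for t, continuous (fun t => `|ZF t 0|)}.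
  apply: (@cont_comp _ _ _ (fun t => ZF t 0) (fun v : 'cV[R]_N => `|v|)); last exact: norm_continuous.
  by apply/cont_cV_atP => a; apply: cont_mulmx => // a' b; exact: cst_cont_at.
have [s1 hbeta] := evt01 ZF0c.
pose y0 := jac phi0 x0 *m cvec i.
have [||||Z Zs Zb] := @picard R N ZF y0 M (`|ZF s1 0|)
  (2 * (`|y0| + `|ZF s1 0|) * expR (2 * M) + 1) M0 (normr_ge0 _).
- by move=> t z _; exact: ZFc.
- by move=> t z z' t01 _ _; exact: ZF_lip.
- by move=> t t01; exact: hbeta.
- by rewrite ltrDl.
exists Z; split=> //; have [Z0 Zcl Zc Zd] := Zs.
pose Kz : R := 2 * (`|y0| + `|ZF s1 0|) * expR (2 * M).
have Kz0 : 0 <= Kz by apply: le_trans (normr_ge0 _) (Zb 0).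
have k1 : 0 < 1 + Kz by rewrite ltr_pwDl.
pose n1 : R := (p + N)%:R + 1; have n10 : 0 < n1 by rewrite ltr_wpDl.
(* The error of the linearization is at most [d * (1 + Kz + |dl|)] with [d <= 1]; its part
   proportional to [|dl|] raises the Gronwall constant from [M] to [M + 1]. *)
pose C := 2 * expR (2 * (M + 1)); have C0 : 0 < C by rewrite mulr_gt0// expR_gt0.
have key (e : R) : 0 < e -> \forall h \near (0 : R)^', forall t : R, 0 <= t <= 1 ->
    `|h^-1 *: (Phi t (h *: cvec i + x0) - Phi t x0) - Z t| <= e.
  move=> e0.
  (* Chosen so that the contributions [C * d] of the initial value and [C * (d * (1 + Kz))] of the
     error to the Gronwall bound are at most [e / 2] each. *)
  pose d := Num.min 1 (e / (2 * C * (1 + Kz))).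
  have d0 : 0 < d.
    by rewrite lt_min ltr01/=; apply: divr_gt0 => //; apply: mulr_gt0 => //; exact: mulr_gt0.
  pose eta := d / n1; have eta0 : 0 < eta by rewrite divr_gt0.
  have etan : eta * (p + N)%:R <= d.
    rewrite /eta mulrAC ler_pdivrMr//; apply: ler_wpM2l; first exact: ltW.
    by rewrite /n1 lerDl.
  pose P (q : R * 'cV[R]_(p + N)) := dom (q.1, al q.1 + q.2) /\
     forall a b, `|DW q.1 (al q.1 + q.2) a b - DW q.1 (al q.1) a b| < eta.
  have hP (t : R) : 0 <= t <= 1 -> \forall q \near (t, 0 : 'cV[R]_(p + N)), P q.
    move=> _.
    have c1 : {for (t, 0), continuous (fun q : R * 'cV[R]_(p + N) => (q.1, al q.1 + q.2))}.
      apply: cont_pair_at; first exact: cvg_fst.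
      apply/cont_cV_atP => a.
      rewrite (_ : (fun s => _) = fun q : R * 'cV[R]_(p + N) => al q.1 a ord0 + q.2 a ord0); last first.
        by apply/funext => q; rewrite !mxE.
      apply: contD; move: a; apply: (proj1 (cont_cV_atP _ _)); last exact: cvg_snd.
      by apply: (@cont_comp _ _ _ fst al); [exact: cvg_fst|exact: alc].
    have c2 : {for (t, 0), continuous (fun q : R * 'cV[R]_(p + N) => (q.1, al q.1))}.
      apply: cont_pair_at; first exact: cvg_fst.
      by apply: (@cont_comp _ _ _ fst al); [exact: cvg_fst|exact: alc].
    have m1 : \forall q \near (t, 0 : 'cV[R]_(p + N)), dom (q.1, al q.1 + q.2).
      by apply: c1; rewrite /= addr0; apply: (open_near open_dom); exact: aldom.
    have m2 : \forall q \near (t, 0 : 'cV[R]_(p + N)), forall a b,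
        `|DW q.1 (al q.1 + q.2) a b - DW q.1 (al q.1) a b| < eta.
      apply: near_forall => a; apply: near_forall => b.
      apply: (@cont_near _ _ (fun q : R * 'cV[R]_(p + N) => `|DW q.1 (al q.1 + q.2) a b - DW q.1 (al q.1) a b|)).
        apply: cont_norm; apply: contB.
          apply: (@cont_comp _ _ _ _ (fun q => DW q.1 q.2 a b) _ c1); apply: DW_cont.
          by rewrite /= addr0; exact: aldom.
        by apply: (@cont_comp _ _ _ _ (fun q => DW q.1 q.2 a b) _ c2); apply: DW_cont; exact: aldom.
      by rewrite /= addr0 subrr normr0.
    by apply: filterS2 m1 m2.
  have [e1 e10 /near_norm[rho rho0 hrho]] := tube hP.
  have hrho' (t : R) v : 0 <= t <= 1 -> `|v| < rho -> P (t, v).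
    move=> /andP[t0 t1] hv; apply: hrho; first by rewrite subr0.
    by apply/andP; split; lra.
  have line : (fun h : R => h *: cvec i + x0) @ (0 : R)^' --> x0.
    apply: cV_cvg => l; apply: (@derivable_line_cvg _ _ (fun x : 'cV[R]_p => x l ord0)).
    by have [] := is_derive_coord l i x0.
  have rho20 : 0 < rho / 2 by rewrite divr_gt0.
  have m1 : \forall h \near (0 : R)^', O (h *: cvec i + x0) /\
      forall t : R, 0 <= t <= 1 -> `|Phi t (h *: cvec i + x0) - Phi t x0| <= rho / 2.
    exact: (line _ (ode_unif_cont WC_cont Ox0 phi0c rho20)).
  have m2 : \forall h \near (0 : R)^', h != 0 by exact: nbhs_dnbhs_neq.
  have m3 : \forall h \near (0 : R)^', `|h| < rho by exact: dnbhs0_lt.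
  have m4 : \forall h \near (0 : R)^', forall a,
      `|y0 a ord0 - h^-1 *: (phi0 (h *: cvec i + x0) a ord0 - phi0 x0 a ord0)| < d.
    apply: filter_forall => a.
    have [hd he] := C1v_derive (cvec i) a (phi0_C1 Ox0).
    have q : h^-1 *: (phi0 (h *: cvec i + x0) a ord0 - phi0 x0 a ord0) @[h --> (0 : R)^'] --> y0 a ord0.
      by rewrite /y0 -he; exact: hd.
    by move/cvgrPdist_lt : q => /(_ d d0).
  apply: filterS2 (filterI m1 m2) (filterI m3 m4) => h [[Ox h1] h0] [h2 h3] t t01.
  set x := h *: cvec i + x0 in Ox h1 h3 *.
  have [[q0 _ qc qd] Yq] := hPhi Ox.
  pose dl (t : R) := h^-1 *: (Phi t x - Phi t x0) - Z t.
  pose dl' (t : R) := h^-1 *: (W t (col_mx x (Phi t x)) - W t (col_mx x0 (Phi t x0))) - ZF t (Z t).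
  have hn0 : 0 < `|h| by rewrite normr_gt0.
  have dlE a : (fun t => dl t a ord0) = (fun t => h^-1 * (Phi t x a ord0 - Phi t x0 a ord0) - Z t a ord0).
    by apply/funext => s; rewrite !mxE.
  have M1 : 0 <= M + 1 by rewrite addr_ge0.
  have eps0 : 0 <= d * (1 + Kz) by apply: mulr_ge0; exact: ltW.
  have G := @gronwall R N dl dl' (M + 1) (d * (1 + Kz)) M1 eps0 _ _ _ t t01.
  apply: le_trans (G _ _ _) _.
  - move=> s; apply/cont_cV_atP => a; rewrite dlE.
    apply: contB; last exact: (proj1 (cont_cV_atP _ _) (Zc s)).
    apply: contM; first exact: cst_cont_at.
    by apply: contB; [exact: (proj1 (cont_cV_atP _ _) (qc s))|exact: (proj1 (cont_cV_atP _ _) (p0c s))].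
  - move=> s s01 a; rewrite dlE.
    have hh : is_derive s 1 (fun t : R => h^-1 * (Phi t x a ord0 - Phi t x0 a ord0))
        (h^-1 * (W s (col_mx x (Phi s x)) a ord0 - W s (col_mx x0 (Phi s x0)) a ord0)).
      have hc : is_derive s 1 (fun=> h^-1 : R) 0 by exact: is_derive_cst.
      apply: is_derive_eq (is_derive_mulf hc (is_derive_subf (qd s s01 a) (p0d s s01 a))) _.
      by rewrite mul0r add0r.
    apply: is_derive_eq (is_derive_subf hh (Zd s s01 a)) _.
    by rewrite !mxE.
  - move=> s s01; have s01' : 0 <= s <= 1 by case/andP: s01 => *; rewrite !ltW.
    pose A := al s; pose B := col_mx x (Phi s x).
    have BA : B - A = col_mx (h *: cvec i) (Phi s x - Phi s x0).
      by rewrite /B /A /al opp_col_mx add_col_mx /x addrK.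
    have nBA : `|B - A| < rho.
      rewrite BA; apply: (@le_lt_trans _ _ (Num.max `|h| (rho / 2))).
        apply: norm_col_mx; first by rewrite le_max normr_ge0.
          by rewrite le_max normrZ ler_piMr// norm_cvec.
        by rewrite le_max h1// orbT.
      by rewrite gt_max h2/=; lra.
    have L := @lip_jac R (p + N) N (W s) (DW s A) A B eta (ltW eta0).
    have {}L : `|W s B - W s A - DW s A *m (B - A)| <= eta * (p + N)%:R * `|B - A|.
      apply: L => r r01.
      have nr : `|r *: (B - A)| < rho.
        rewrite normrZ ger0_norm; last by case/andP: r01.
        by apply: le_lt_trans nBA; rewrite ler_piMl//; case/andP: r01.
      have [dm hD] := hrho' s _ s01' nr.
      have WCE : WC s = W s by rewrite /WC clamp_id.
      split; last by move=> a b; apply: ltW; rewrite -WCE; exact: hD.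
      have := CkPm_C1v open_dom W1 dm; by rewrite WCE.
    (* The remainder of the first-order expansion of [W], plus the linear part acting on [dl]. *)
    have E : dl' s = h^-1 *: (W s B - W s A - DW s A *m (B - A)) + DW s A *m col_mx 0 (dl s).
      have -> : DW s A *m col_mx 0 (dl s) = h^-1 *: (DW s A *m (B - A)) - ZF s (Z s).
        rewrite /ZF -/A scalemxAr -mulmxBr; congr (_ *m _).
        rewrite BA scale_col_mx scalerA mulVf// scale1r opp_col_mx add_col_mx subrr.
        by [].
      by rewrite /dl' -/A -/B [X in _ = X + _]scalerBr addrA subrK.
    rewrite E; apply: le_trans (ler_normD _ _) _.
    have b1 := DWB s (dl s) s01'.
    have b2 : `|B - A| <= `|h| * (1 + Kz + `|dl s|).
      rewrite BA; apply: norm_col_mx; first by rewrite mulr_ge0// !addr_ge0.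
        rewrite normrZ ler_wpM2l//; apply: le_trans (norm_cvec i) _.
        by rewrite -addrA lerDl addr_ge0.
      have -> : Phi s x - Phi s x0 = h *: (dl s + Z s).
        by rewrite /dl subrK scalerA divff// scale1r.
      rewrite normrZ ler_wpM2l// (le_trans (ler_normD _ _))//.
      by have := Zb s; rewrite -/Kz; lra.
    have b3 : `|h^-1 *: (W s B - W s A - DW s A *m (B - A))| <= d * (1 + Kz + `|dl s|).
      rewrite normrZ normfV ler_pdivrMl//; apply: le_trans L _.
      rewrite mulrCA; apply: ler_pM => //; first by rewrite mulr_ge0// ltW.
    have d1 : d <= 1 by rewrite ge_min lexx.
    have b4 : d * `|dl s| <= `|dl s| by rewrite ler_piMl.
    rewrite mulrDr in b3; lra.
  - have dl0 : `|dl 0| <= d.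
      apply: cV_norm_le; first exact: ltW.
      move=> a; have := ltW (h3 a); rewrite distrC /dl q0 p00 Z0 !mxE.
      exact.
    have -> : 2 * (`|dl 0| + d * (1 + Kz)) * expR (2 * (M + 1)) = C * (`|dl 0| + d * (1 + Kz)).
      by rewrite /C mulrAC.
    have d2 : d <= e / (2 * C * (1 + Kz)) by rewrite ge_min lexx orbT.
    have d3 : C * (d * (1 + Kz)) <= e / 2.
      apply: (@le_trans _ _ (C * (e / (2 * C * (1 + Kz)) * (1 + Kz)))).
        by rewrite ler_pM2l// ler_pM2r.
      rewrite le_eqVlt; apply/orP; left; apply/eqP; field.
      by rewrite !gt_eqF.
    have d4 : C * d <= C * (d * (1 + Kz)).
      by rewrite ler_pM2l//; apply: ler_peMr; [exact: ltW|rewrite lerDl].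
    have d5 : C * `|dl 0| <= C * d by rewrite ler_pM2l.
    rewrite mulrDr; lra.
move=> t a.
have Q : h^-1 *: (Phi t (h *: cvec i + x0) a ord0 - Phi t x0 a ord0) @[h --> (0 : R)^'] --> Z t a ord0.
  apply/cvgrPdist_le => e e0.
  have line : (fun h : R => h *: cvec i + x0) @ (0 : R)^' --> x0.
    apply: cV_cvg => l; apply: (@derivable_line_cvg _ _ (fun x : 'cV[R]_p => x l ord0)).
    by have [] := is_derive_coord l i x0.
  have nO : \forall h \near (0 : R)^', O (h *: cvec i + x0).
    by apply: line; exact: open_nbhs_nbhs.
  apply: filterS2 nO (key e e0) => h Ox H.
  have [[_ qcl _ _] _] := hPhi Ox.
  have := H (clamp t) (clamp01 t); rewrite -Zcl -qcl -p0cl => {}H.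
  rewrite distrC; apply: le_trans H; apply: le_trans _ (coord_le_norm _ a).
  by rewrite !mxE.
split; first by apply/cvg_ex; exists (Z t a ord0).
exact/cvg_lim.
Qed.

End Deriv.
End ParamODE.
(* The derivative of the flow in a parameter solves an equation of the same
   kind, affine in the unknown; hence the smoothness by induction on the order. *)
Theorem ode_smooth k : forall (p N : nat) (O : set 'cV[R]_p) (Y : set 'cV[R]_N)
    (W : R -> 'cV[R]_(p + N) -> 'cV[R]_N) (phi0 : 'cV[R]_p -> 'cV[R]_N)
    (Phi : R -> 'cV[R]_p -> 'cV[R]_N) (M : R),
  0 <= M -> open O -> open Y ->
  (forall (t : R) x y y', 0 <= t <= 1 -> O x -> Y y -> Y y' ->
     `|W t (col_mx x y) - W t (col_mx x y')| <= M * `|y - y'|) ->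
  (forall x, O x -> solves (fun t y => W t (col_mx x y)) (phi0 x) (fun t => Phi t x) /\
     forall t, Y (Phi t x)) ->
  CkPm k [set q : R * 'cV[R]_(p + N) | O (usubmx q.2) /\ Y (dsubmx q.2)] (fun t => W (clamp t)) ->
  CkPm k [set q : R * 'cV[R]_p | O q.2] (fun _ => phi0) ->
  CkPm k [set q : R * 'cV[R]_p | O q.2] Phi.
Proof.
elim: k => [|k IH] p N O Y W phi0 Phi M M0 oO oY hL hPhi hW hp.
  move=> i j; rewrite (ord1 j); split=> // -[t x] Ox.
  apply: (proj1 (cont_cV_atP _ _)).
  apply: (ode_cont M0 oO hL hPhi) => //.
    by move=> q a dq; exact: (CkP_cont (hW a ord0) dq).
  apply/cont_cV_atP => a.
  have c := CkP_cont (hp a ord0) (Ox : [set q : R * 'cV[R]_p | O q.2] (t, x)).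
  apply: (@cont_comp _ _ _ (fun y => (t, y)) (fun q : R * 'cV[R]_p => phi0 q.2 a ord0)) => //.
  by apply: (@cont_pair_at _ _ _ (fun=> t) id); [exact: cst_cont_at|exact: cvg_id].
set dom := [set q | _] in hW; set OT := [set q | _] in hp *.
have oD : open dom by exact: open_dom.
have oOT : open OT by exact: open_OT.
have W1 : CkPm 1 dom (fun t => W (clamp t)) by move=> a b; apply: CkP_le (hW a b).
have p1 : CkPm 1 OT (fun=> phi0) by move=> a b; apply: CkP_le (hp a b).
have hP : CkPm k OT Phi by apply: IH (CkPmW hW) (CkPmW hp); eassumption.
pose DW (t : R) u := jac (W (clamp t)) u.
have der x i : O x -> (forall (t : R) a, derivable (fun x => Phi t x a ord0) x (cvec i)) /\
    solves (fun t z => DW t (col_mx x (Phi t x)) *m col_mx (cvec i) z) (jac phi0 x *m cvec i)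
      (fun t => jac (Phi t) x *m cvec i).
  move=> Ox; have [Z [Zs Zd]] := ode_deriv M0 oO oY hL hPhi W1 p1 i Ox.
  have -> : (fun t => jac (Phi t) x *m cvec i) = Z.
    apply/funext => t; apply/colP => a; rewrite -colE !mxE.
    by have [_ ->] := Zd t a.
  by split=> // t a; have [] := Zd t a.
have Phi_cl x (t : R) : O x -> Phi (clamp t) x = Phi t x.
  by move=> /hPhi[[_ cl _ _] _]; rewrite -cl.
apply: CkPm_S => //.
  by move=> q a b Oq; have [h _] := der q.2 b Oq; exact: h.
move=> a i.
(* Right-hand side of the equation of variations, with [Phi] itself inserted as a coefficient. It is
   one order less regular than [W] and defined for all values of the unknown, so the induction
   hypothesis applies with [Y = setT]. *)
pose W' (t : R) (u : 'cV[R]_(p + N)) :=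
  DW t (col_mx (usubmx u) (Phi t (usubmx u))) *m col_mx (cvec i) (dsubmx u).
pose dom' := [set q : R * 'cV[R]_(p + N) | O (usubmx q.2) /\ [set: 'cV[R]_N] (dsubmx q.2)].
have oD' : open dom' by apply: open_dom => //; exact: openT.
have hDW : CkPm k dom DW by exact: CkPm_jac.
have us : CkPm k dom' (fun _ u => usubmx u) by apply: CkPm_usub => //; exact: CkPm_id.
have hW' : CkPm k dom' (fun t => W' (clamp t)).
  have h : CkPm k dom' W'.
    apply: CkPm_mul => //.
      apply: (CkPm_comp (tau := id) oD' oD _ _ _ hDW).
      - by move=> q _; exact: cvg_id.
      - apply: CkPm_col => //.
        apply: (CkPm_comp (tau := id) oD' oOT _ us _ hP) => [q _|q []//]; exact: cvg_id.
      - move=> q [Oq _]; split; rewrite /= ?col_mxKu ?col_mxKd//.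
        by have [_ h] := hPhi _ Oq; exact: h.
    apply: CkPm_col => //; first exact: CkPm_cst.
    by apply: CkPm_dsub => //; exact: CkPm_id.
  apply: CkPm_ext h => // t u [Ou _].
  by rewrite /W' /DW (clamp_id (clamp01 t)) Phi_cl.
have hp' : CkPm k OT (fun _ x => jac phi0 x *m cvec i).
  by apply: CkPm_mul => //; [exact: CkPm_jac|exact: CkPm_cst].
have hL' (t : R) x y y' : 0 <= t <= 1 -> O x -> [set: 'cV[R]_N] y -> [set: 'cV[R]_N] y' ->
    `|W' t (col_mx x y) - W' t (col_mx x y')| <= M * `|y - y'|.
  move=> t01 Ox _ _; rewrite /W' !col_mxKu !col_mxKd -mulmxBr opp_col_mx add_col_mx subrr.
  have [_ YP] := hPhi _ Ox.
  rewrite /DW clamp_id//; apply: (Wjac_bound M0 oY hL _ t01 Ox (YP t)).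
  have : C1v (W (clamp t)) (col_mx x (Phi t x)).
    by apply: (CkPm_C1v (t := t) oD W1); split; rewrite /= ?col_mxKu ?col_mxKd.
  by rewrite clamp_id.
have hPhi' x : O x -> solves (fun t y => W' t (col_mx x y)) (jac phi0 x *m cvec i)
      (fun t => jac (Phi t) x *m cvec i) /\
    forall t : R, [set: 'cV[R]_N] (jac (Phi t) x *m cvec i).
  move=> Ox; have [_ [s1 s2 s3 s4]] := der x i Ox; split; last by move=> t; exact: I.
  split; [exact: s1|exact: s2|exact: s3|move=> t t01 b].
  by rewrite /W' col_mxKu col_mxKd; exact: s4.
have H := IH p N O setT W' _ _ M M0 oO openT hL' hPhi' hW' hp'.
by apply: CkP_ext (H a ord0) => // q _; rewrite -colE mxE.
Qed.

End Smooth_dependence.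

(** * Linear algebra at a point *)

Section Linear_algebra.
Context {R : realType}.

Lemma unitmx_injP n (A : 'M[R]_n) :
  (forall x : 'cV[R]_n, A *m x = 0 -> x = 0) -> A \in unitmx.
Proof.
move=> h; rewrite -unitmx_tr -row_free_unit -kermx_eq0; apply/eqP/row_matrixP => i.
rewrite row0; apply: trmx_inj; rewrite trmx0; apply: h.
by rewrite -[X in X *m _]trmxK -trmx_mul -row_mul mulmx_ker row0 trmx0.
Qed.

Definition posdef n (S : 'M[R]_n) := forall x : 'cV[R]_n, x != 0 -> 0 < (x^T *m S *m x) ord0 ord0.

Lemma scal_tr (a : 'M[R]_1) : a^T = a.
Proof. by rewrite [a]mx11_scalar tr_scalar_mx. Qed.

Lemma posdef_congr n (S : 'M[R]_n) (P : 'M[R]_n) : P \in unitmx ->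
  posdef S -> posdef (P^T *m S *m P).
Proof.
move=> uP h x x0; have := h (P *m x); rewrite trmx_mul !mulmxA; apply.
by apply: contraNneq x0 => e; rewrite -(mulKmx uP x) e mulmx0.
Qed.

Lemma posdef_block a b (S : 'M[R]_a) (S' : 'M[R]_b) : posdef S -> posdef S' ->
  posdef (block_mx S 0 0 S').
Proof.
move=> h h' x; rewrite -[x]vsubmxK => x0.
rewrite tr_col_mx mul_row_block !mulmx0 addr0 add0r mul_row_col mxE.
have [u0|u0] := eqVneq (usubmx x) 0; have [v0|v0] := eqVneq (dsubmx x) 0.
- by rewrite u0 v0 col_mx0 eqxx in x0.
- by rewrite u0 mulmx0 [X in X + _]mxE add0r; exact: h'.
- by rewrite v0 mulmx0 [X in _ + X]mxE addr0; exact: h.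
- by apply: addr_gt0; [exact: h|exact: h'].
Qed.

Lemma trmxD m n (A B : 'M[R]_(m, n)) : (A + B)^T = A^T + B^T.
Proof. by rewrite raddfD. Qed.

Lemma trmxB m n (A B : 'M[R]_(m, n)) : (A - B)^T = A^T - B^T.
Proof. by rewrite raddfB. Qed.

Lemma trmxN m n (A : 'M[R]_(m, n)) : (- A)^T = - A^T.
Proof. by rewrite raddfN. Qed.

Lemma skew_inv n (F : 'M[R]_n) : F^T = - F -> F \in unitmx -> (invmx F)^T = - invmx F.
Proof.
move=> Fs Fu; have FTu : F^T \in unitmx by rewrite unitmx_tr.
have e : - invmx F *m F^T = 1%:M by rewrite Fs mulmxN mulNmx opprK mulVmx.
by rewrite trmx_inv -[RHS](mulmxK FTu) e mul1mx.
Qed.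

Lemma skew_unit_size1 (F : 'M[R]_1) : F^T = - F -> F \notin unitmx.
Proof.
rewrite scal_tr => /eqP; rewrite -addr_eq0 -mulr2n -scaler_nat scaler_eq0 pnatr_eq0/=.
by move/eqP->; rewrite unitmxE det0 unitr0.
Qed.

Definition eps2 : 'M[R]_2 := \matrix_(i, j) (j%:R - i%:R).

Lemma ord2_case (P : 'I_2 -> Prop) : P ord0 -> P ord_max -> forall i, P i.
Proof.
move=> h0 h1 [[|[|//]] hi]; first by rewrite (_ : Ordinal hi = ord0)//; exact/val_inj.
by rewrite (_ : Ordinal hi = ord_max)//; exact/val_inj.
Qed.

Lemma skew2 (a : 'M[R]_2) : a^T = - a -> a = a ord0 ord_max *: eps2.
Proof.
move=> h; have e i j : a j i = - a i j by move/matrixP/(_ i j): h; rewrite !mxE.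
have d i : a i i = 0.
  by have /eqP := e i i; rewrite -addr_eq0 -mulr2n -mulr_natl mulf_eq0 pnatr_eq0/= => /eqP.
apply/matrixP; apply: ord2_case; apply: ord2_case; rewrite !mxE /= ?d ?subrr ?mulr0//.
  by rewrite subr0 mulr1.
by rewrite e sub0r mulrN1.
Qed.

Lemma eps2_sq : eps2 *m eps2 = - 1%:M.
Proof.
apply/matrixP; apply: ord2_case; apply: ord2_case; rewrite !mxE !big_ord_recl big_ord0 !mxE /= /bump /=; ring.
Qed.

(* Split off a hyperbolic plane by a Schur complement and induct. *)
Lemma compatible_structure n (F : 'M[R]_n) : F^T = - F -> F \in unitmx ->
  exists G : 'M[R]_n, [/\ G *m G = - 1%:M, (F *m G)^T = F *m G & posdef (F *m G)].
Proof.
elim/ltn_ind: n F => -[|[|n]] IH F Fs Fu.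
- exists 0; split; try by apply/matrixP => -[].
  by move=> x; rewrite (_ : x = 0) ?eqxx//; apply/colP => -[].
- by have := skew_unit_size1 Fs; rewrite Fu.
have [j Fj] : exists j, F ord0 j != 0.
  apply/existsP; apply: contraTT Fu; rewrite negb_exists => /forallP h.
  rewrite unitmxE unitfE negbK (expand_det_row _ ord0) big1// => i _.
  by rewrite (eqP (negbNE (h i))) mul0r.
have sk (P : 'M[R]_n.+2) : (P^T *m F *m P)^T = - (P^T *m F *m P).
  by rewrite !trmx_mul trmxK Fs mulNmx mulmxN mulmxA.
pose i1 : 'I_n.+2 := lift ord0 ord0.
have j0 : j != ord0.
  apply: contraNneq Fj => ->; have /matrixP/(_ ord0 ord0) := Fs; rewrite !mxE => /eqP.
  by rewrite -addr_eq0 -mulr2n -mulr_natl mulf_eq0 pnatr_eq0.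
(* Moves the nonzero entry [F ord0 j] to position (0, 1), which makes the leading 2 x 2 block
   invertible. *)
pose s := tperm i1 j.
pose P1 : 'M[R]_n.+2 := (perm_mx s)^T.
have P1u : P1 \in unitmx by rewrite unitmx_tr; exact: unitmx_perm.
have [F1 F1E] : exists F1 : 'M[R]_(2 + n), F1 = P1^T *m F *m P1 by exists (P1^T *m F *m P1).
have F1s : F1^T = - F1 by rewrite F1E; exact: sk.
have F1u : F1 \in unitmx by rewrite F1E !unitmx_mul unitmx_tr P1u Fu.
have F1e : F1 ord0 i1 = F ord0 j.
  rewrite F1E /P1 trmxK -row_permE tr_perm_mx -col_permE !mxE.
  by rewrite tpermL tpermD// eq_sym.
pose a := ulsubmx F1; pose b := ursubmx F1; pose d := drsubmx F1.
have as_ : a^T = - a by rewrite /a trmx_ulsub F1s; apply/matrixP => x y; rewrite !mxE.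
have bs : dlsubmx F1 = - b^T.
  by rewrite /b trmx_ursub F1s; apply/matrixP => x y; rewrite !mxE opprK.
pose f := F ord0 j.
have ae : a = f *: eps2.
  rewrite (skew2 as_) /f -F1e; congr (_ *: _); rewrite !mxE; congr (F1 _ _); exact/val_inj.
have au : a \in unitmx.
  apply: (mulmx1_unit (B := - f^-1 *: eps2) _).1.
  by rewrite ae -scalemxAl -scalemxAr eps2_sq scalerA mulrN mulfV// scaleN1r opprK.
have aT := skew_inv as_ au.
(* Gaussian elimination against the block [a] leaves its Schur complement [S], again skew and
   invertible and smaller by 2. *)
pose P2 : 'M[R]_(2 + n) := block_mx 1%:M (- (invmx a *m b)) 0 1%:M.
have P2u : P2 \in unitmx by rewrite unitmxE det_ublock !det1 mulr1 unitr1.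
pose S := d + b^T *m invmx a *m b.
have E : P2^T *m F1 *m P2 = block_mx a 0 0 S.
  rewrite -[F1]submxK -/a -/b -/d bs /P2 tr_block_mx !trmx1 trmx0 raddfN /= trmx_mul aT.
  rewrite !mulmx_block !mul1mx !mul0mx !mulmx1 !mulmx0 !addr0 ?add0r.
  rewrite !mulmxN !mulNmx opprK !mulmxA mulmxV// mul1mx !addNr -!mulmxA mulVmx// mulmx1 subrr.
  by rewrite mul0mx oppr0 add0r opprK addrC /S !mulmxA.
have Fu2 : block_mx a 0 0 S \in unitmx by rewrite -E !unitmx_mul unitmx_tr P2u F1u.
have Su : S \in unitmx.
  by move: Fu2; rewrite !unitmxE det_ublock unitrM => /andP[].
have Ss : S^T = - S.
  have h : (P2^T *m F1 *m P2)^T = - (P2^T *m F1 *m P2).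
    by rewrite !trmx_mul trmxK F1s mulNmx mulmxN mulmxA.
  move: h; rewrite E tr_block_mx opp_block_mx => /eq_block_mx[_ _ _ ->//].
have [G' [G'2 G's G'p]] := IH n (ltnW (ltnSn n.+1)) S Ss Su.
(* The sign of [f] makes [a *m G2] equal to [|f|] times the identity, which is positive. *)
pose G2 := - (Num.sg f) *: eps2.
have aG2 : a *m G2 = `|f|%:M.
  rewrite ae /G2 -scalemxAl -scalemxAr eps2_sq scalerA mulrN [f * _]mulrC -normrEsg scaleNr scalerN opprK.
  by rewrite scalemx1.
have G22 : G2 *m G2 = - 1%:M.
  by rewrite /G2 -scalemxAl -scalemxAr eps2_sq scalerA mulrNN -expr2 sqr_sg Fj scale1r.
pose P : 'M[R]_(2 + n) := P1 *m P2.
have Pu : P \in unitmx by rewrite unitmx_mul P1u.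
pose G0 := block_mx G2 0 0 G'.
exists (P *m G0 *m invmx P).
have FE : F *m (P *m G0 *m invmx P) = (invmx P)^T *m block_mx `|f|%:M 0 0 (S *m G') *m invmx P.
  have -> : block_mx `|f|%:M 0 0 (S *m G') = P^T *m F *m P *m G0.
    have -> : P^T *m F *m P = block_mx a 0 0 S.
      by rewrite -E F1E /P trmx_mul !mulmxA.
    by rewrite mulmx_block !mulmx0 !mul0mx !addr0 add0r aG2.
  by rewrite !mulmxA -trmx_mul mulmxV// trmx1 mul1mx.
split.
- rewrite [LHS]mulmxA [P *m G0 *m invmx P *m _]mulmxA mulmxKV// -[P *m G0 *m G0]mulmxA.
  have -> : G0 *m G0 = - 1%:M.
    rewrite mulmx_block !mulmx0 !mul0mx !addr0 add0r G22 G'2 (scalar_mx_block 2 n 1) opp_block_mx !oppr0.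
    by [].
  by rewrite mulmxN mulmx1 mulNmx mulmxV.
- by rewrite FE !trmx_mul tr_block_mx !trmx0 tr_scalar_mx G's trmxK mulmxA.
- rewrite FE; apply: posdef_congr; first by rewrite unitmx_inv.
  refine (@posdef_block 2 n _ _ _ G'p) => x x0.
  rewrite -scalemx1 -scalemxAr -scalemxAl mulmx1 mxE mulr_gt0 ?normr_gt0// mxE.
  have [i xi] : exists i, x i ord0 != 0.
    apply/existsP; apply: contraR x0; rewrite negb_exists => /forallP h.
    by apply/eqP/colP => i; rewrite mxE; exact/eqP/negbNE.
  rewrite (bigD1 i)//= mxE ltr_pwDl//; first by rewrite -expr2 exprn_even_gt0.
  by apply: sumr_ge0 => k _; rewrite mxE -expr2 sqr_ge0.
Qed.

Section Adapted.
Variables (n : nat) (J w : 'M[R]_(n + n)) (Tm Tp : 'M[R]_(n, n + n)) (Im Ip : 'M[R]_n).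
Variable E : 'M[R]_(n + n, n).
Hypotheses (JJ : J *m J = - 1%:M) (ws : w^T = - w) (wJs : (w *m J)^T = - (w *m J)).
Hypotheses (TJm : Tm *m J = Im *m Tm) (TJp : Tp *m J = Ip *m Tp).
Hypothesis orth : forall u v : 'cV[R]_(n + n), Tm *m u = 0 -> Tp *m v = 0 -> v^T *m w *m u = 0.
Hypotheses (TEm : Tm *m E = 1%:M) (Eiso : E^T *m w *m E = 0).

Variables A Kp F : 'M[R]_n.
Hypotheses (AE : A = Tp *m E) (KpE : Kp = invmx A *m Ip *m A).
Hypothesis FE : F = E^T *m (w *m J) *m E.
Hypothesis Au : A \in unitmx.
Hypothesis neg : posdef (- (F *m (Kp + Im))).

Let Jw : J^T *m w = w *m J.
Proof. by move: wJs; rewrite trmx_mul ws mulmxN => /eqP; rewrite eqr_opp => /eqP. Qed.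

Let JwJ : J^T *m w *m J = - w.
Proof. by rewrite Jw -mulmxA JJ mulmxN mulmx1. Qed.

Let EJwJE : E^T *m J^T *m w *m J *m E = 0.
Proof. by rewrite -!mulmxA (mulmxA _ w) (mulmxA _ J) JwJ mulNmx mulmxN mulmxA Eiso oppr0. Qed.

Let Fs : F^T = - F.
Proof. by rewrite FE trmx_mul trmx_mul trmxK wJs mulNmx mulmxN mulmxA. Qed.

Let EJw : E^T *m J^T *m w *m E = F.
Proof. by rewrite FE -[E^T *m J^T *m w]mulmxA Jw. Qed.

Let orthm p q (U : 'M[R]_(n + n, p)) (V : 'M[R]_(n + n, q)) :
  Tm *m U = 0 -> Tp *m V = 0 -> V^T *m w *m U = 0.
Proof.
move=> hU hV; apply/matrixP => i j.
have := @orth (col j U) (col i V); rewrite !colE !mulmxA hU hV !mul0mx => /(_ erefl erefl).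
rewrite trmx_mul trmx_delta -!mulmxA 2!mulmxA -(mulmxA (delta_mx _ _)) -(mulmxA (delta_mx _ _)) -rowE -colE.
by rewrite colE mulmxA -colE mulmxA => /matrixP/(_ ord0 ord0); rewrite [LHS]mxE [LHS]mxE [RHS]mxE => ->; rewrite mxE.
Qed.

(** [J E - E Im] and [J E - E Kp] take values in the kernels of [Tm] and [Tp], which are orthogonal
    for [w]; expanding the pairing, with [E] and [J E] isotropic, leaves this relation between [F]
    and the two complex structures. *)
Let FK : Kp^T *m F = - (F *m Im).
Proof.
have h1 : Tm *m (J *m E - E *m Im) = 0.
  by rewrite mulmxBr !mulmxA TJm TEm -mulmxA TEm mulmx1 mul1mx subrr.
have h2 : Tp *m (J *m E - E *m Kp) = 0.
  by rewrite mulmxBr !mulmxA TJp KpE -AE !mulmxA mulmxV// mul1mx -mulmxA -AE subrr.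
have := orthm h1 h2.
rewrite trmxB !trmx_mul !mulmxBl !mulmxBr !mulmxA EJwJE sub0r.
have -> : Kp^T *m E^T *m w *m J *m E = Kp^T *m F by rewrite FE !mulmxA.
rewrite EJw -[Kp^T *m E^T *m w]mulmxA -[Kp^T *m (E^T *m w) *m E]mulmxA Eiso mulmx0 mul0mx subr0.
by move/eqP; rewrite subr_eq0 => /eqP.
Qed.

Let FKI : F *m Kp = - (Im^T *m F).
Proof.
have := congr1 trmx FK; rewrite trmx_mul trmxK trmxN trmx_mul Fs !mulNmx mulmxN opprK => <-.
by rewrite opprK.
Qed.

(** By [FKI] and transposition of a scalar, [F Kp] and [F Im] define the same quadratic form, so
    positivity of the metric controls each of them and not only their sum. *)
Let quadE (v : 'cV[R]_n) : v^T *m F *m Kp *m v = v^T *m F *m Im *m v.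
Proof.
have -> : v^T *m F *m Kp *m v = - (v^T *m Im^T *m F *m v).
  by rewrite -(mulmxA v^T F) FKI mulmxN mulNmx !mulmxA.
by rewrite -[RHS]scal_tr 3!trmx_mul trmxK Fs mulNmx !mulmxN !mulmxA.
Qed.

Let negI (v : 'cV[R]_n) : v != 0 -> (v^T *m F *m Im *m v) ord0 ord0 < 0.
Proof.
move=> /neg; rewrite mulmxN mulNmx mulmxDr mulmxDr mulmxDl !mulmxA quadE.
by rewrite mxE mxE oppr_gt0 -mulr2n pmulrn_llt0.
Qed.

Let Fu : F \in unitmx.
Proof.
apply: unitmx_injP => x Fx; apply/eqP/negPn/negP => x0; have := negI x0.
by rewrite -[x^T *m F]trmxK trmx_mul trmxK Fs mulNmx Fx oppr0 trmx0 !mul0mx mxE ltxx.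
Qed.

(** If [x = - s I y] with [y = G x], then [x^T F G x = s (y^T F I y)]: the left side is positive
    unless [x = 0], the right side is at most 0. *)
Let sum_unit (I G : 'M[R]_n) (s : R) : 0 <= s -> posdef (F *m G) ->
  (forall v : 'cV[R]_n, v != 0 -> (v^T *m F *m I *m v) ord0 ord0 < 0) ->
  1%:M + s *: (I *m G) \in unitmx.
Proof.
move=> s0 Gp hI; apply: unitmx_injP => x; rewrite mulmxDl mul1mx => hx.
apply/eqP/negPn/negP => x0; have := Gp x x0.
have [y yE] : exists y, y = G *m x by exists (G *m x).
have xE : x = - (s *: (I *m y)).
  by apply/eqP; rewrite -addr_eq0 yE mulmxA scalemxAl hx.
have -> : x^T *m (F *m G) *m x = x^T *m F *m y by rewrite yE !mulmxA.
rewrite -[_ *m y]scal_tr 2!trmx_mul trmxK Fs mulNmx mulmxN xE !mulmxN opprK.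
rewrite -scalemxAr -scalemxAr mxE !mulmxA.
have [->|y0] := eqVneq y 0; first by rewrite trmx0 !mul0mx mxE mulr0 ltxx.
by rewrite ltNge mulr_ge0_le0// ltW// hI.
Qed.

(* In the coordinates (q, xi) of the frame [M]: xi = 0 is complex Lagrangian, [E]
   spans xi = - S q, and the graphs xi = - t S q are transverse to both kernels. *)
Lemma adapted_frame : exists (M : 'M[R]_(n + n)) (S G : 'M[R]_n),
  [/\ M^T *m w *m M = block_mx 0 1%:M (- 1%:M) 0,
      J *m (M *m col_mx 1%:M 0) = (M *m col_mx 1%:M 0) *m G,
      S^T = S, M *m col_mx 1%:M (- S) = E
    & forall t : R, 0 <= t <= 1 ->
        Tm *m (M *m col_mx 1%:M (- (t *: S))) \in unitmx /\
        Tp *m (M *m col_mx 1%:M (- (t *: S))) \in unitmx].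
Proof.
have [G [G2 Gs Gp]] := compatible_structure Fs Fu.
(* [M1] spans a [J]-stable Lagrangian since [J M1 = - M1 G]; [M2] spans the image of [J E], also
   Lagrangian, in the basis dual to [M1] for [w]. *)
pose M1 := E + J *m E *m G; pose M2 := J *m E *m invmx F.
have FG : G^T *m F = - (F *m G).
  by have := Gs; rewrite trmx_mul Fs mulmxN => <-; rewrite opprK.
have iFT := skew_inv Fs Fu.
(* The graphs interpolate between [E] at [t = 1] and the complex Lagrangian [M1] at [t = 0]. *)
have M1E t : row_mx M1 M2 *m col_mx 1%:M (- (t *: (F *m G))) = E + (1 - t) *: (J *m E *m G).
  rewrite mul_row_col mulmx1 mulmxN -scalemxAr /M2 /M1 -!mulmxA mulKmx// !mulmxA.
  by rewrite scalerBl scale1r addrA.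
exists (row_mx M1 M2), (F *m G), (- G); split.
- rewrite tr_row_mx mul_col_mx mul_mx_row.
  have a1 : M1^T *m w *m M1 = 0.
    rewrite /M1 trmxD !trmx_mul !mulmxDl !mulmxDr !mulmxA Eiso add0r.
    have -> : E^T *m w *m J *m E *m G = F *m G by rewrite FE !mulmxA.
    have -> : G^T *m E^T *m J^T *m w *m E = G^T *m F by rewrite -EJw !mulmxA.
    have -> : G^T *m E^T *m J^T *m w *m J *m E *m G = G^T *m (E^T *m J^T *m w *m J *m E) *m G by rewrite !mulmxA.
    by rewrite EJwJE mulmx0 mul0mx addr0 FG subrr.
  have a2 : M1^T *m w *m M2 = 1%:M.
    rewrite /M1 /M2 trmxD !trmx_mul !mulmxDl !mulmxA.
    have -> : E^T *m w *m J *m E = F by rewrite FE !mulmxA.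
    have -> : G^T *m E^T *m J^T *m w *m J *m E *m invmx F = G^T *m (E^T *m J^T *m w *m J *m E) *m invmx F by rewrite !mulmxA.
    by rewrite EJwJE mulmx0 mul0mx addr0 mulmxV.
  have a3 : M2^T *m w *m M1 = - 1%:M.
    have := congr1 trmx a2; rewrite trmx_mul (trmx_mul M1^T) trmxK ws mulNmx mulmxN trmx1 mulmxA => <-.
    by rewrite opprK.
  have a4 : M2^T *m w *m M2 = 0.
    rewrite /M2 2!trmx_mul.
    have -> : (invmx F)^T *m (E^T *m J^T) *m w *m (J *m E *m invmx F) =
      (invmx F)^T *m (E^T *m J^T *m w *m J *m E) *m invmx F by rewrite !mulmxA.
    by rewrite EJwJE mulmx0 mul0mx.
  by rewrite mul_col_mx mul_col_mx a1 a2 a3 a4 block_mxEh.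
- rewrite mul_row_col mulmx0 addr0 mulmx1 /M1 mulmxDr mulmxDl !mulmxA JJ mulNmx mul1mx mulNmx.
  by rewrite !mulmxN -(mulmxA _ G G) G2 mulmxN mulmx1 opprK addrC.
- by rewrite Gs.
- by have := M1E 1; rewrite scale1r subrr scale0r addr0.
- move=> t /andP[t0 t1]; rewrite M1E !mulmxDr TEm -!scalemxAr !mulmxA TJm TJp -!mulmxA.
  rewrite (mulmxA Tm) TEm mul1mx (mulmxA Tp) -AE; split.
    by apply: sum_unit; rewrite ?subr_ge0.
  have -> : A + (1 - t) *: (Ip *m (A *m G)) = A *m (1%:M + (1 - t) *: (Kp *m G)).
    by rewrite mulmxDr mulmx1 -scalemxAr KpE !mulmxA mulmxV// mul1mx.
  rewrite unitmx_mul Au; apply: sum_unit; rewrite ?subr_ge0// => v v0.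
  by rewrite quadE; exact: negI.
Qed.
End Adapted.
End Linear_algebra.

(** * The lemmas of Poincare and Moser *)

Section Poincare_and_Moser.
Context {R : realType}.
Definition dmx (V : normedModType R) p q (x v : V) (M : V -> 'M[R]_(p, q)) (M' : 'M[R]_(p, q)) :=
  forall i j, is_derive x v (fun s => M s i j) (M' i j).

Lemma dmx_eq (V : normedModType R) p q (x v : V) (M : V -> 'M[R]_(p, q)) M' N' :
  dmx x v M M' -> M' = N' -> dmx x v M N'.
Proof. by move=> h <-. Qed.

Lemma dmx_cst (V : normedModType R) p q (x v : V) (M : 'M[R]_(p, q)) : dmx x v (fun=> M) 0.
Proof. by move=> i j; rewrite mxE; exact: is_derive_cst. Qed.

Lemma dmx_add (V : normedModType R) p q (x v : V) (M N : V -> 'M[R]_(p, q)) M' N' :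
  dmx x v M M' -> dmx x v N N' -> dmx x v (fun y => M y + N y) (M' + N').
Proof.
move=> hM hN i j; rewrite (_ : (fun _ => _) = fun y => M y i j + N y i j).
  by rewrite mxE; exact: is_derive_addf (hM i j) (hN i j).
by apply/funext => y; rewrite mxE.
Qed.

Lemma dmx_sub (V : normedModType R) p q (x v : V) (M N : V -> 'M[R]_(p, q)) M' N' :
  dmx x v M M' -> dmx x v N N' -> dmx x v (fun y => M y - N y) (M' - N').
Proof.
move=> hM hN i j; rewrite (_ : (fun _ => _) = fun y => M y i j - N y i j).
  by rewrite mxE mxE; exact: is_derive_subf (hM i j) (hN i j).
by apply/funext => y; rewrite !mxE.
Qed.

Lemma dmx_mul (V : normedModType R) p q r (x v : V) (M : V -> 'M[R]_(p, q)) (N : V -> 'M[R]_(q, r))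
    M' N' :
  dmx x v M M' -> dmx x v N N' -> dmx x v (fun y => M y *m N y) (M' *m N x + M x *m N').
Proof.
move=> hM hN i j; rewrite (_ : (fun _ => _) = fun y => \sum_k M y i k * N y k j).
  rewrite !mxE -big_split /=; apply: is_derive_sumf => k.
  exact: is_derive_mulf (hM i k) (hN k j).
by apply/funext => y; rewrite !mxE.
Qed.

Lemma dmx_mull (V : normedModType R) p q r (x v : V) (C : 'M[R]_(p, q)) (N : V -> 'M[R]_(q, r)) N' :
  dmx x v N N' -> dmx x v (fun y => C *m N y) (C *m N').
Proof. by move=> h; apply: dmx_eq (dmx_mul (dmx_cst x v C) h) _; rewrite mul0mx add0r. Qed.

Lemma dmx_tr (V : normedModType R) p q (x v : V) (M : V -> 'M[R]_(p, q)) M' :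
  dmx x v M M' -> dmx x v (fun y => (M y)^T) M'^T.
Proof.
move=> hM i j; rewrite (_ : (fun _ => _) = fun y => M y j i); first by rewrite mxE; exact: hM.
by apply/funext => y; rewrite mxE.
Qed.

Lemma dmx_scale (V : normedModType R) p q (x v : V) (a : V -> R) (M : V -> 'M[R]_(p, q)) a' M' :
  is_derive x v a a' -> dmx x v M M' ->
  dmx x v (fun y => a y *: M y) (a' *: M x + a x *: M').
Proof.
move=> ha hM i j; rewrite (_ : (fun _ => _) = fun y => a y * M y i j).
  by rewrite !mxE; exact: is_derive_mulf ha (hM i j).
by apply/funext => y; rewrite !mxE.
Qed.

Lemma dmx_unique (V : normedModType R) p q (x v : V) (M : V -> 'M[R]_(p, q)) M' N' :
  dmx x v M M' -> dmx x v M N' -> M' = N'.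
Proof. by move=> h h'; apply/matrixP => i j; have [_ <-] := h i j; have [_ <-] := h' i j. Qed.

Lemma deriv_zero (h : R -> R) :
  (forall t : R, 0 <= t <= 1 -> {for t, continuous h}) ->
  (forall t : R, 0 < t < 1 -> is_derive t 1 h 0) -> h 1 = h 0.
Proof.
move=> hc hd.
have [] := @MVT_segment R h (fun=> 0) 0 1 ler01.
- by apply: continuous_in_subspaceT => t; rewrite inE /= in_itv /= => t01; exact: hc.
by move=> c _; rewrite mul0r => /eqP; rewrite subr_eq0 => /eqP.
Qed.

Lemma usub_row n p (u : 'cV[R]_(n + p)) : usubmx u = row_mx 1%:M 0 *m u.
Proof. by rewrite -[u in RHS]vsubmxK mul_row_col mul1mx mul0mx addr0. Qed.

Lemma dsub_row n p (u : 'cV[R]_(n + p)) : dsubmx u = row_mx 0 1%:M *m u.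
Proof. by rewrite -[u in RHS]vsubmxK mul_row_col mul1mx mul0mx add0r. Qed.

Lemma jac_lin n p (A : 'M[R]_(p, n)) u : jac (fun w => A *m w) u = A.
Proof. by rewrite -[RHS](jac_affine A 0 u); apply: jac_near; near=> w; rewrite addr0. Unshelve. all: by end_near. Qed.

Lemma C1v_lin n p (A : 'M[R]_(p, n)) u : C1v (fun w => A *m w) u.
Proof. by have := C1v_affine A 0 u; rewrite (_ : (fun w => _) = fun w => A *m w)//; apply/funext => w; rewrite addr0. Qed.

(** The primitive in [t] solves an equation whose right-hand side does not contain the unknown;
    smoothness in [x] and differentiation under the integral sign are then instances of [ode_smooth]
    and [ode_deriv], with Lipschitz constant 0. *)
Lemma param_prim n (O : set 'cV[R]_n) (g : R -> 'cV[R]_n -> R) : open O ->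
  (forall k, CkP k [set q | O q.2] (fun t => g (clamp t))) ->
  exists P : R -> 'cV[R]_n -> R, (forall k, CkP k [set q | O q.2] P) /\
  forall x, O x ->
    [/\ P 0 x = 0, forall t : R, {for t, continuous (fun t => P t x)},
        forall t : R, 0 < t < 1 -> is_derive t 1 (fun t => P t x) (g t x)
      & forall i : 'I_n, [/\ 'D_(cvec i) (P 0) x = 0,
          forall t : R, {for t, continuous (fun t => 'D_(cvec i) (P t) x)}
        & forall t : R, 0 < t < 1 ->
            is_derive t 1 (fun t => 'D_(cvec i) (P t) x) ('D_(cvec i) (g t) x)]].
Proof.
move=> oO hg.
pose W (t : R) (u : 'cV[R]_(n + 1)) : 'cV[R]_1 := (g t (usubmx u))%:M.
pose S x := [set phi | solves (fun t y => W t (col_mx x y)) 0 phi].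
have hS x : O x -> exists phi, S x phi.
  move=> Ox; have [t|phi [h1 h2 h3 h4]] := @integral_curve R 1 (fun t => (g (clamp t) x)%:M) 0.
    apply/cont_cV_atP => i; rewrite (ord1 i) (_ : (fun _ => _) = fun t => g (clamp t) x).
      apply: (@cont_comp _ _ _ (fun t => (t, x)) (fun q : R * 'cV[R]_n => g (clamp q.1) q.2)).
        by apply: cont_pair_at; [exact: cvg_id|exact: cst_cont_at].
      exact: (CkP_cont (hg 0%N)).
    by apply/funext => s; rewrite mxE.
  exists phi; split=> // t t01 i; have := h4 t t01 i.
  rewrite /W col_mxKu clamp_id//; by case/andP: t01 => *; rewrite !ltW.
pose Phi (t : R) x := xget (fun=> 0) (S x) t.
have hPhi x : O x -> solves (fun t y => W t (col_mx x y)) 0 (fun t => Phi t x) /\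
    forall t, setT (Phi t x).
  by move=> /hS[phi Sp]; split=> //; exact: (xgetPex (fun=> 0) (ex_intro _ _ Sp)).
pose dom := [set q : R * 'cV[R]_(n + 1) | O (usubmx q.2) /\ [set: 'cV[R]_1] (dsubmx q.2)].
have oD : open dom by apply: open_dom => //; exact: openT.
have oOT : open [set q : R * 'cV[R]_n | O q.2] by exact: open_OT.
have hW k : CkPm k dom (fun t => W (clamp t)).
  move=> i j; rewrite (ord1 i) (ord1 j).
  apply: (CkP_ext (f := fun t u => g (clamp t) (usubmx u))) => //.
    by move=> q _; rewrite /W mxE.
  apply: (CkP_comp (tau := id) (g := fun _ u => usubmx u) oD oOT _ _ _ (hg k)) => [q _|a|q []//].
    exact: cvg_id.
  by move: a; have := @CkPm_usub R R _ n 1 1 k dom _ oD (CkPm_id k dom) => h a; exact: h.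
have hL (t : R) x (y y' : 'cV[R]_1) : 0 <= t <= 1 -> O x -> [set: 'cV[R]_1] y -> [set: 'cV[R]_1] y' ->
    `|W t (col_mx x y) - W t (col_mx x y')| <= 0 * `|y - y'|.
  by move=> _ _ _ _; rewrite /W !col_mxKu subrr normr0 mul0r.
have h0 k : CkPm k [set q : R * 'cV[R]_n | O q.2] (fun _ _ => 0 : 'cV[R]_1) by exact: CkPm_cst.
have hP k := ode_smooth (lexx 0) oO openT hL hPhi (hW k) (h0 k).
exists (fun t x => Phi t x ord0 ord0); split; first by move=> k; exact: hP.
move=> x Ox; have [[p0 _ pc pd] _] := hPhi x Ox; split.
- by rewrite p0 mxE.
- by move=> t; exact: (proj1 (cont_cV_atP _ _) (pc t)).
- by move=> t t01; have := pd t t01 ord0; rewrite /W col_mxKu mxE.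
move=> i; have [Z [[z0 _ zc zd] Zd]] := ode_deriv (lexx 0) oO openT hL hPhi (hW 1%N) (h0 1%N) i Ox.
have DE : (fun t : R => 'D_(cvec i) (fun x => Phi t x ord0 ord0) x) = fun t => Z t ord0 ord0.
  by apply/funext => t; have [_ ->] := Zd t ord0.
have C t : C1v (fun x => (g (clamp t) x)%:M : 'cV[R]_1) x.
  move=> a; rewrite (ord1 a); have := CkP_C1at oOT (hg 1%N) (Ox : [set q : R * 'cV[R]_n | O q.2] (t, x)).
  by rewrite (_ : (fun w => _) = g (clamp t))//; apply/funext => w; rewrite mxE.
rewrite DE; split.
- have -> : 'D_(cvec i) (fun x => Phi 0 x ord0 ord0) x = Z 0 ord0 ord0 by have := congr1 (fun f => f 0) DE.
  rewrite z0 -colE !mxE; apply: eq_trans (derive_cst 0 x (cvec i)).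
  by congr ('D_(cvec i) _ x); apply/funext => w; rewrite mxE.
- by move=> t; exact: (proj1 (cont_cV_atP _ _) (zc t)).
- move=> t t01; have := zd t t01 ord0.
  have c01 : clamp t = t by rewrite clamp_id//; case/andP: t01 => *; rewrite !ltW.
  have -> : jac (W (clamp t)) (col_mx x (Phi t x)) =
      jac (fun x => (g (clamp t) x)%:M : 'cV[R]_1) x *m row_mx 1%:M 0.
    have -> : W (clamp t) = (fun x => (g (clamp t) x)%:M : 'cV[R]_1) \o (fun u => row_mx 1%:M 0 *m u).
      by apply/funext => u; rewrite /W /= usub_row.
    rewrite jac_comp; first by rewrite jac_lin -usub_row col_mxKu.
      by rewrite -usub_row col_mxKu; exact: C.
    exact: C1v_lin.
  rewrite -mulmxA mul_row_col mul1mx mul0mx addr0 -colE !mxE c01.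
  by rewrite (_ : (fun w => _) = g t)//; apply/funext => w; rewrite mxE.
Qed.

(** Exterior derivative of a real 1-form with the sign convention of [ext1]: the entry [a b] is the
    value on the pair [(e_b, e_a)]. *)
Definition rext1 n (al : 'cV[R]_n -> 'cV[R]_n) u : 'M[R]_n := jac al u - (jac al u)^T.

Definition rclosed n (U : set 'cV[R]_n) (F : 'cV[R]_n -> 'M[R]_n) := forall u, U u ->
  forall a b c, 'D_(cvec a) (fun w => F w b c) u + 'D_(cvec b) (fun w => F w c a) u
    + 'D_(cvec c) (fun w => F w a b) u = 0.

Definition dmat n p q (j : 'I_n) (w : 'cV[R]_n -> 'M[R]_(p, q)) u : 'M[R]_(p, q) :=
  \matrix_(a, b) 'D_(cvec j) (fun x => w x a b) u.

Lemma sm_dmx n p q (U : set 'cV[R]_n) (w : 'cV[R]_n -> 'M[R]_(p, q)) x j : open U ->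
  sm U w -> U x -> dmx x (cvec j) w (dmat j w x).
Proof.
move=> oU hw Ux a b; rewrite mxE; apply: DeriveDef => //.
have h := hw 1%N a b; exact: (@CkP_derivable R bool n 0 (lift1 U) (fun _ x => w x a b) (true, x) j h Ux).
Qed.

Lemma sm_C1 n p q (U : set 'cV[R]_n) (w : 'cV[R]_n -> 'M[R]_(p, q)) x i j : open U ->
  sm U w -> U x -> C1at (fun x => w x i j) x.
Proof.
move=> oU hw Ux.
exact: (CkP_C1at (t := true) (open_lift1 oU) (hw 1%N i j)).
Qed.

Lemma ball_scale n (r : R) (x : 'cV[R]_n) (t : R) : 0 <= t <= 1 -> `|x| < r -> `|t *: x| < r.
Proof.
move=> /andP[t0 t1] xr; rewrite normrZ ger0_norm//; apply: le_lt_trans xr.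
by rewrite ler_piMl.
Qed.

Lemma dmx_line n p q (U : set 'cV[R]_n) (w : 'cV[R]_n -> 'M[R]_(p, q)) (x : 'cV[R]_n) (t : R) : open U ->
  sm U w -> U (t *: x) ->
  dmx t 1 (fun s : R => w (s *: x)) (\sum_c x c ord0 *: dmat c w (t *: x)).
Proof.
move=> oU hw Ux a b.
have := @is_derive_chain R n R (fun s : R => s *: x) (fun x => w x a b) t 1 (fun c => x c ord0)
  (sm_C1 a b oU hw Ux) _.
rewrite summxE => H; apply: is_derive_eq (H _) _.
  move=> i; rewrite (_ : (fun y => _) = fun s : R => s * x i ord0).
    apply: is_derive_eq (is_derive_mulf (is_derive_id _ _) (is_derive_cst _ _ _)) _.
    by rewrite mul1r mulr0 addr0.
  by apply/funext => s; rewrite mxE.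
by apply: eq_bigr => c _; rewrite !mxE mulrC.
Qed.

Lemma rext1E n (al : 'cV[R]_n -> 'cV[R]_n) (u : 'cV[R]_n) (D : 'I_n -> 'cV[R]_n) a b :
  (forall j, dmx u (cvec j) al (D j)) -> rext1 al u a b = D b a ord0 - D a b ord0.
Proof. by move=> h; rewrite !mxE; have [_ ->] := h b a ord0; have [_ ->] := h a b ord0. Qed.

Lemma rclosedE n (U : set 'cV[R]_n) (F : 'cV[R]_n -> 'M[R]_n) u a b c :
  rclosed U F -> (forall u, U u -> (F u)^T = - F u) -> open U -> sm U F -> U u ->
  dmat b F u a c - dmat a F u b c = dmat c F u a b.
Proof.
move=> hF sk oU sF Uu; have := hF u Uu a b c; rewrite !mxE.
have -> : 'D_(cvec b) (fun w => F w c a) u = - 'D_(cvec b) (fun w => F w a c) u.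
  have [h _] := sm_dmx b oU sF Uu a c; rewrite -deriveN//.
  apply: near_eq_derive; have n1 : \forall w \near u, U w by exact: open_nbhs_nbhs.
  apply: filterS n1 => w Uw; have := congr1 (fun M : 'M[R]_n => M a c) (sk w Uw).
  by rewrite mxE [RHS]mxE.
move=> h; have : 'D_(cvec c) (fun w => F w a b) u = 'D_(cvec b) (fun w => F w a c) u - 'D_(cvec a) (fun w => F w b c) u.
  by apply/eqP; rewrite -subr_eq0 -[X in _ == X]h; apply/eqP; ring.
by move=> ->.
Qed.

Lemma is_derive_sq (t : R) : is_derive t 1 (fun s : R => s * s) (2 * t).
Proof.
by apply: is_derive_eq (is_derive_mulf (is_derive_id _ _) (is_derive_id _ _)) _; ring.
Qed.

Lemma CkP_scale n (r : R) p q (w : 'cV[R]_n -> 'M[R]_(p, q)) k a b :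
  sm [set x : 'cV[R]_n | `|x| < r] w ->
  CkP k [set z : R * 'cV[R]_n | `|z.2| < r] (fun t x => w (clamp t *: x) a b).
Proof.
move=> hw; have oB := @open_ballcV R n 0 r; have oB' : open [set x : 'cV[R]_n | `|x| < r].
  by rewrite (_ : [set x | _] = [set x | `|x - 0| < r])//; apply/seteqP; split=> x /=; rewrite subr0.
have oT : open [set z : R * 'cV[R]_n | `|z.2| < r] by exact: (open_OT oB').
apply: (CkP_comp (tau := fun=> true) (g := fun t x => clamp t *: x) oT (open_lift1 oB') _ _ _ (hw k a b)).
- by move=> z _; exact: cst_cont_at.
- move=> j; apply: (CkP_ext (f := fun t x => clamp t * x j ord0)) => //.
    by move=> z _; rewrite mxE.
  apply: CkP_mul => //; last exact: CkP_coord.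
  by apply: CkP_time => z _; exact: clamp_cont.
- by move=> z hz; apply: ball_scale => //; exact: clamp01.
Qed.

Lemma open_ball0 n (r : R) : open [set x : 'cV[R]_n | `|x| < r].
Proof.
have := @open_ballcV R n 0 r.
by rewrite (_ : [set u | _] = [set x | `|x| < r])//; apply/seteqP; split=> x /=; rewrite subr0.
Qed.

Lemma near_eq_is_derive (f g : R -> R) (t d : R) :
  (\forall s \near t, f s = g s) -> is_derive t 1 f d -> is_derive t 1 g d.
Proof. by move=> h [h1 h2]; split; [apply: near_eq_derivable h1|rewrite -(near_eq_derive _ h)]. Qed.

Lemma is_derive_dilate n p q (U : set 'cV[R]_n) (w : 'cV[R]_n -> 'M[R]_(p, q)) (t : R) x a b j :
  open U -> sm U w -> U (t *: x) ->
  is_derive x (cvec j) (fun y => w (t *: y) a b) (t * 'D_(cvec j) (fun y => w y a b) (t *: x)).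
Proof.
move=> oU hw U'.
have := @is_derive_chain R n 'cV[R]_n (fun y => t *: y) (fun y => w y a b) x (cvec j)
  (fun i => t * (i == j)%:R) (sm_C1 a b oU hw U') _.
move=> H; apply: is_derive_eq (H _) _.
  move=> i; rewrite (_ : (fun y => _) = fun y : 'cV[R]_n => t * y i ord0).
    apply: is_derive_eq (is_derive_mulf (is_derive_cst _ _ _) (is_derive_coord i j x)) _.
    by rewrite mul0r add0r.
  by apply/funext => s; rewrite mxE.
rewrite (bigD1 j)//= eqxx mulr1 big1 ?addr0 1?mulrC// => i ij.
by rewrite (negbTE ij) !mulr0.
Qed.

(* The radial primitive [b x *m x], [b x = \int_0^1 s w (s x) ds] of a closed
   2-form; it depends linearly on the form, hence the uniformity in [C]. *)
Lemma radial_primitive n (r : R) (w : 'cV[R]_n -> 'M[R]_n) :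
  sm [set x : 'cV[R]_n | `|x| < r] w ->
  exists b : 'cV[R]_n -> 'M[R]_n, sm [set x : 'cV[R]_n | `|x| < r] b /\
  forall C : 'M[R]_n, (forall x, `|x| < r -> (C *m w x)^T = - (C *m w x)) ->
    rclosed [set x : 'cV[R]_n | `|x| < r] (fun x => C *m w x) ->
    forall x, `|x| < r -> rext1 (fun x => C *m (b x *m x)) x = C *m w x.
Proof.
set U := [set x : 'cV[R]_n | _] => hw; have oU : open U by exact: open_ball0.
have oT : open [set z : R * 'cV[R]_n | U z.2] by exact: (open_OT oU).
have hg k a b : CkP k [set q : R * 'cV[R]_n | U q.2]
    (fun t x => clamp (clamp t) * w (clamp (clamp t) *: x) a b).
  apply: (CkP_ext (f := fun t x => clamp t * w (clamp t *: x) a b)) => //.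
    by move=> z _; rewrite (clamp_id (clamp01 _)).
  apply: CkP_mul => //; last exact: CkP_scale.
  by apply: CkP_time => z _; exact: clamp_cont.
have [P hP] : exists P : 'I_n -> 'I_n -> R -> 'cV[R]_n -> R, forall a b,
    (forall k, CkP k [set q | U q.2] (P a b)) /\
    forall x, U x ->
    [/\ P a b 0 x = 0, forall t : R, {for t, continuous (fun t => P a b t x)},
        forall t : R, 0 < t < 1 -> is_derive t 1 (fun t => P a b t x) (clamp t * w (clamp t *: x) a b)
      & forall i : 'I_n, [/\ 'D_(cvec i) (P a b 0) x = 0,
          forall t : R, {for t, continuous (fun t => 'D_(cvec i) (P a b t) x)}
        & forall t : R, 0 < t < 1 ->
            is_derive t 1 (fun t => 'D_(cvec i) (P a b t) x)
              ('D_(cvec i) (fun x => clamp t * w (clamp t *: x) a b) x)]].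
  have h a b := param_prim (g := fun t x => clamp t * w (clamp t *: x) a b) oU (fun k => hg k a b).
  have [P hP] := choice (fun p => h p.1 p.2).
  by exists (fun a b => P (a, b)) => a b; exact: (hP (a, b)).
(* [Pm t x] is the integral of [s w (s x)] over [0 <= s <= t]; keeping the upper limit free turns
   the identity to prove into one that can be differentiated in [t]. *)
pose Pm (t : R) x : 'M[R]_n := \matrix_(a, b) P a b t x.
have hPm k (t : R) : CkPm k (lift1 U) (fun _ : bool => Pm t).
  move=> a b; apply: (CkP_ext (f := fun _ => P a b t)); first exact: open_lift1.
    by move=> z _; rewrite mxE.
  apply: (@CkP_comp R bool R n n (fun=> t) (fun _ x => x) (lift1 U) [set z : R * 'cV[R]_n | U z.2] k (P a b)).
  - exact: open_lift1.
  - exact: oT.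
  - by move=> z _; exact: cst_cont_at.
  - by move=> j; exact: CkP_coord.
  - by [].
  - by have [h _] := hP a b; exact: h.
have PmD (t : R) x j : U x -> dmx x (cvec j) (Pm t) (dmat j (Pm t) x).
  by move=> Ux; apply: (sm_dmx j oU) Ux => k; exact: hPm.
have dmatE (t : R) x j a b : dmat j (Pm t) x a b = 'D_(cvec j) (P a b t) x.
  by rewrite mxE; congr ('D_(cvec j) _ x); apply/funext => y; rewrite mxE.
have c01 (t : R) : 0 < t < 1 -> clamp t = t.
  by move=> t01; rewrite clamp_id//; case/andP: t01 => *; rewrite !ltW.
have tU (t : R) x : 0 <= t <= 1 -> U x -> U (t *: x) by move=> t01 Ux; exact: ball_scale.
have ltle (t : R) : 0 < t < 1 -> 0 <= t <= 1 by case/andP=> *; rewrite !ltW.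
have PmT x (t : R) : U x -> 0 < t < 1 -> dmx t 1 (fun s => Pm s x) (t *: w (t *: x)).
  move=> Ux t01 a b; have [_ /(_ x Ux)[_ _ /(_ t t01) h _]] := hP a b.
  rewrite c01// in h; rewrite (_ : (fun _ => _) = fun s => P a b s x); first by rewrite mxE.
  by apply/funext => s; rewrite mxE.
have DT x (t : R) j : U x -> 0 < t < 1 ->
    dmx t 1 (fun s => dmat j (Pm s) x) ((t * t) *: dmat j w (t *: x)).
  move=> Ux t01 a b; have [_ /(_ x Ux)[_ _ _ /(_ j)[_ _ /(_ t t01) h]]] := hP a b.
  rewrite (_ : (fun _ => _) = fun s => 'D_(cvec j) (P a b s) x); last first.
    by apply/funext => s; rewrite dmatE.
  apply: is_derive_eq h _; rewrite c01//.
  have U' : U (t *: x) by apply: tU => //; exact: ltle.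
  have h2 := is_derive_dilate a b j oU hw U'.
  have [_ ->] := is_derive_mulf (is_derive_cst t x (cvec j)) h2.
  by rewrite mul0r add0r !mxE mulrA.
exists (Pm 1); split; first by move=> k; exact: hPm.
move=> C Csk Ccl x Ux.
pose F y := C *m w y.
have hF : sm U F by apply: sm_mul => //; exact: sm_cst.
have FD (y : 'cV[R]_n) j : U y -> dmat j F y = C *m dmat j w y.
  move=> Uy; apply: (dmx_unique (sm_dmx j oU hF Uy)).
  exact: (dmx_mull C (sm_dmx j oU hw Uy)).
have D1 j : dmx x (cvec j) (fun x => C *m (Pm 1 x *m x)) (C *m (dmat j (Pm 1) x *m x + Pm 1 x *m cvec j)).
  apply: dmx_mull; apply: dmx_mul; first exact: PmD.
  move=> a b; rewrite (ord1 b); apply: is_derive_eq (is_derive_coord a j x) _.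
  by rewrite mxE eqxx andbT.
apply/matrixP => a b; rewrite (rext1E _ _ D1).
(* An entry of the exterior derivative of [C *m (Pm t x *m x)], minus [t^2 C w (t x)]: it vanishes
   at [t = 0], and its derivative in [t] vanishes by closedness. *)
pose E (t : R) : R := ((C *m (dmat b (Pm t) x *m x + Pm t x *m cvec b)) a ord0
   - (C *m (dmat a (Pm t) x *m x + Pm t x *m cvec a)) b ord0) - t * t * (C *m w (t *: x)) a b.
suff : E 1 = E 0.
  rewrite /E mulr1 mul1r scale1r mulr0 mul0r subr0 => h.
  apply/eqP; rewrite -subr_eq0 h; apply/eqP.
  have P0 : Pm 0 x = 0.
    by apply/matrixP => i j; rewrite !mxE; have [_ /(_ x Ux)[]] := hP i j.
  have D0 c : dmat c (Pm 0) x = 0.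
    apply/matrixP => i j; rewrite dmatE !mxE; have [_ /(_ x Ux)[_ _ _ /(_ c)[]]] := hP i j.
    by [].
  by rewrite P0 !D0 !mul0mx addr0 mulmx0 !mxE subrr.
have Ed (t : R) : 0 < t < 1 -> is_derive t 1 E
   (((C *m (((t * t) *: dmat b w (t *: x)) *m x + (t *: w (t *: x)) *m cvec b)) a ord0
   - (C *m (((t * t) *: dmat a w (t *: x)) *m x + (t *: w (t *: x)) *m cvec a)) b ord0)
   - ((2 * t) * (C *m w (t *: x)) a b + t * t * (C *m \sum_c x c ord0 *: dmat c w (t *: x)) a b)).
  move=> t01; have U' : U (t *: x) by apply: tU => //; exact: ltle.
  have h j : dmx t 1 (fun s => C *m (dmat j (Pm s) x *m x + Pm s x *m cvec j))
      (C *m (((t * t) *: dmat j w (t *: x)) *m x + (t *: w (t *: x)) *m cvec j)).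
    apply: dmx_mull; apply: dmx_add.
      by apply: dmx_eq (dmx_mul (DT x t j Ux t01) (dmx_cst t 1 x)) _; rewrite mulmx0 addr0.
    by apply: dmx_eq (dmx_mul (PmT x t Ux t01) (dmx_cst t 1 _)) _; rewrite mulmx0 addr0.
  apply: is_derive_subf; first exact: is_derive_subf (h b a ord0) (h a b ord0).
  exact: is_derive_mulf (is_derive_sq t) (dmx_mull C (dmx_line oU hw U') a b).
apply: deriv_zero.
  move=> t t01; have U' : U (t *: x) by exact: tU.
  have c1 j i : {for t, continuous (fun s => (C *m (dmat j (Pm s) x *m x + Pm s x *m cvec j)) i ord0)}.
    move: i; have h : forall i k, {for t, continuous (fun s => (dmat j (Pm s) x *m x + Pm s x *m cvec j) i k)}.
      move=> i k; rewrite (_ : (fun s => _) = fun s => (dmat j (Pm s) x *m x) i k + (Pm s x *m cvec j) i k); last first.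
        by apply/funext => s; rewrite mxE.
      apply: contD; move: i k; apply: cont_mulmx => i k; try exact: cst_cont_at.
        rewrite (_ : (fun s => _) = fun s => 'D_(cvec j) (P i k s) x); last by apply/funext => s; rewrite dmatE.
        by have [_ /(_ x Ux)[_ _ _ /(_ j)[_ h _]]] := hP i k; exact: h.
      rewrite (_ : (fun s => _) = fun s => P i k s x); last by apply/funext => s; rewrite mxE.
      by have [_ /(_ x Ux)[_ h _ _]] := hP i k; exact: h.
    by move=> i; move: (ord0 : 'I_1) => k; move: i k; apply: cont_mulmx => // i k; exact: cst_cont_at.
  apply: contB; first by apply: contB; exact: c1.
  apply: contM; first by apply: contM; exact: cvg_id.
  exact: is_derive_cont (dmx_mull C (dmx_line oU hw U') a b).
move=> t t01; have U' : U (t *: x) by apply: tU => //; exact: ltle.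
apply: is_derive_eq (Ed t t01) _.
have e1 j i : (C *m (((t * t) *: dmat j w (t *: x)) *m x + (t *: w (t *: x)) *m cvec j)) i ord0 =
    t * t * (\sum_c dmat j F (t *: x) i c * x c ord0) + t * F (t *: x) i j.
  rewrite mulmxDr -!scalemxAl -!scalemxAr mxE [X in X + _]mxE [X in _ + X]mxE.
  by rewrite mulmxA -FD// mulmxA -colE !mxE.
have e2 : (C *m \sum_c x c ord0 *: dmat c w (t *: x)) a b = \sum_c x c ord0 * dmat c F (t *: x) a b.
  rewrite mulmx_sumr summxE; apply: eq_bigr => c _; rewrite -scalemxAr mxE -FD//.
have e3 : F (t *: x) b a = - F (t *: x) a b.
  have := congr1 (fun M : 'M[R]_n => M a b) (Csk _ U').
  by rewrite [X in X = _ -> _]mxE [X in _ = X -> _]mxE.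
have e4 : \sum_c dmat b F (t *: x) a c * x c ord0 - \sum_c dmat a F (t *: x) b c * x c ord0 =
    \sum_c x c ord0 * dmat c F (t *: x) a b.
  rewrite -sumrB; apply: eq_bigr => c _.
  by rewrite -mulrBl (rclosedE _ _ _ Ccl Csk oU hF U') mulrC.
rewrite !e1 e2 -e4 e3 /F; ring.
Qed.

(** The potential is the sum of [x_b] times the integral of [th_b (s x)] over [0, 1]; its gradient
    is found by varying the upper limit of integration and using the symmetry of [jac th]. *)
Lemma poincare1 n (r : R) (th : 'cV[R]_n -> 'cV[R]_n) :
  sm [set x : 'cV[R]_n | `|x| < r] th ->
  (forall x, `|x| < r -> rext1 th x = 0) ->
  exists h : 'cV[R]_n -> R, sm [set x : 'cV[R]_n | `|x| < r] (fun x => (h x)%:M : 'M[R]_1) /\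
    forall x j, `|x| < r -> is_derive x (cvec j) h (th x j ord0).
Proof.
set U := [set x : 'cV[R]_n | _] => hw hcl; have oU : open U by exact: open_ball0.
have oT : open [set z : R * 'cV[R]_n | U z.2] by exact: (open_OT oU).
have hg a k : CkP k [set q : R * 'cV[R]_n | U q.2]
    (fun t x => th (clamp (clamp t) *: x) a ord0).
  apply: (CkP_ext (f := fun t x => th (clamp t *: x) a ord0)) => //; last exact: CkP_scale.
  by move=> z _; rewrite (clamp_id (clamp01 _)).
have [P hP] := choice (fun a => param_prim (g := fun t x => th (clamp t *: x) a ord0) oU (hg a)).
have hP1 k a (t : R) : CkP k (lift1 U) (fun _ : bool => P a t).
  apply: (@CkP_comp R bool R n n (fun=> t) (fun _ x => x) (lift1 U) [set z : R * 'cV[R]_n | U z.2] k (P a)).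
  - exact: open_lift1.
  - exact: oT.
  - by move=> z _; exact: cst_cont_at.
  - by move=> j; exact: CkP_coord.
  - by [].
  - by have [h _] := hP a; exact: h.
have c01 (t : R) : 0 < t < 1 -> clamp t = t.
  by move=> t01; rewrite clamp_id//; case/andP: t01 => *; rewrite !ltW.
have tU (t : R) x : 0 <= t <= 1 -> U x -> U (t *: x) by move=> t01 Ux; exact: ball_scale.
have ltle (t : R) : 0 < t < 1 -> 0 <= t <= 1 by case/andP=> *; rewrite !ltW.
exists (fun x : 'cV[R]_n => \sum_b x b ord0 * P b 1 x); split.
  move=> k i j; rewrite (ord1 i) (ord1 j).
  apply: (CkP_ext (f := fun _ (x : 'cV[R]_n) => \sum_b x b ord0 * P b 1 x)); first exact: open_lift1.
    by move=> z _; rewrite mxE.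
  apply: CkP_sum; first exact: open_lift1.
  by move=> b; apply: CkP_mul; [exact: open_lift1|exact: CkP_coord|exact: hP1].
move=> x j Ux.
have h1 : is_derive x (cvec j) (fun x : 'cV[R]_n => \sum_b x b ord0 * P b 1 x)
    (\sum_b ((b == j)%:R * P b 1 x + x b ord0 * 'D_(cvec j) (P b 1) x)).
  apply: is_derive_sumf => b; apply: is_derive_mulf; first exact: is_derive_coord.
  apply: DeriveDef => //.
  exact: (@CkP_derivable R bool n 0 (lift1 U) (fun _ => P b 1) (true, x) j (hP1 1%N b 1) Ux).
apply: is_derive_eq h1 _.
pose E (t : R) : R := \sum_b ((b == j)%:R * P b t x + x b ord0 * 'D_(cvec j) (P b t) x)
  - t * th (t *: x) j ord0.
suff : E 1 = E 0.
  rewrite /E mul1r scale1r mul0r subr0 => h.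
  apply/eqP; rewrite -subr_eq0 h; apply/eqP; apply: big1 => b _.
  by have [_ /(_ x Ux)[-> _ _ /(_ j)[-> _ _]]] := hP b; rewrite !mulr0 addr0.
apply: deriv_zero.
  move=> t t01; have U' : U (t *: x) by exact: tU.
  apply: contB.
    apply: cont_sum => b; have [_ /(_ x Ux)[_ c1 _ /(_ j)[_ c2 _]]] := hP b.
    by apply: contD; apply: contM; (try exact: cst_cont_at); [exact: c1|exact: c2].
  apply: contM; first exact: cvg_id.
  exact: is_derive_cont (dmx_line oU hw U' j ord0).
move=> t t01; have U' : U (t *: x) by apply: tU => //; exact: ltle.
have d1 : is_derive t 1 (fun s => \sum_b ((b == j)%:R * P b s x + x b ord0 * 'D_(cvec j) (P b s) x))
   (\sum_b ((b == j)%:R * th (t *: x) b ord0 + x b ord0 * (t * 'D_(cvec j) (fun y => th y b ord0) (t *: x)))).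
  apply: is_derive_sumf => b.
  have [_ /(_ x Ux)[_ _ /(_ t t01) k1 /(_ j)[_ _ /(_ t t01) k2]]] := hP b.
  apply: is_derive_addf.
    apply: is_derive_eq (is_derive_mulf (is_derive_cst _ _ _) k1) _.
    by rewrite mul0r add0r c01.
  apply: is_derive_eq (is_derive_mulf (is_derive_cst _ _ _) k2) _.
  rewrite mul0r add0r c01//; congr (_ * _).
  by have [_ ->] := is_derive_dilate b ord0 j oU hw U'.
have d2 := is_derive_mulf (is_derive_id t (1 : R)) (dmx_line oU hw U' j ord0).
apply: is_derive_eq (is_derive_subf d1 d2) _.
rewrite big_split /= (bigD1 j)//= eqxx mul1r big1 ?addr0; last first.
  by move=> b /negbTE ->; rewrite mul0r.
rewrite opprD addrACA subrr add0r summxE mulr_sumr; apply/eqP; rewrite subr_eq0; apply/eqP.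
apply: eq_bigr => c _; rewrite !mxE mulrCA; congr (_ * (_ * _)).
have := congr1 (fun M : 'M[R]_n => M c j) (hcl _ U').
by rewrite !mxE => /eqP; rewrite subr_eq0 => /eqP.
Qed.

(** The Jacobian is bounded on the compact segment [0, 1] x {0}, hence on a tube around it; balls
    are convex, so the bound gives a Lipschitz constant uniform in [t]. *)
Lemma jac_cont_tube n (r : R) (F : R -> 'cV[R]_n -> 'cV[R]_n) : 0 < r ->
  CkPm 1 [set q : R * 'cV[R]_n | `|q.2| < r] (fun t => F (clamp t)) ->
  exists M r' : R, [/\ 0 <= M, 0 < r', r' <= r &
    forall (t : R) y y', 0 <= t <= 1 -> `|y| < r' -> `|y'| < r' ->
      `|F t y - F t y'| <= M * `|y - y'|].
Proof.
set O := [set q | _] => r0 hF.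
have oO : open O by exact: (open_OT (@open_ball0 n r)).
have hJ := CkPm_jac oO hF.
have O0 (t : R) : O (t, 0) by rewrite /O /= normr0.
have c0 i j (t : R) : {for t, continuous (fun t => `|jac (F (clamp t)) 0 i j|)}.
  apply: cont_norm; apply: (@cont_comp _ _ _ (fun t : R => (t, 0 : 'cV[R]_n)) (fun q : R * 'cV[R]_n => jac (F (clamp q.1)) q.2 i j)).
    by apply: cont_pair_at; [exact: cvg_id|exact: cst_cont_at].
  exact: (CkP_cont (hJ i j)).
have [s hs] := choice (fun p => evt01 (c0 p.1 p.2)).
pose K : R := \sum_p `|jac (F (clamp (s p))) 0 p.1 p.2| + 1.
have K0 : 0 <= K by rewrite addr_ge0// sumr_ge0.
have hK i j (t : R) : 0 <= t <= 1 -> `|jac (F (clamp t)) 0 i j| < K.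
  move=> t01; apply: le_lt_trans (hs (i, j) t t01) _.
  by rewrite /K (bigD1 (i, j))//= -addrA ltrDl ltr_wpDl// sumr_ge0.
have [e e0 /near_norm[rho rho0 h]] : exists2 e : R, 0 < e & \forall x \near (0 : 'cV[R]_n),
    forall t : R, - e < t < 1 + e -> O (t, x) /\ forall i j, `|jac (F (clamp t)) x i j| < K.
  apply: (@tube R _ (0 : 'cV[R]_n) [set q | O q /\ forall i j, `|jac (F (clamp q.1)) q.2 i j| < K]).
  move=> t t01; apply: filterI; first exact: open_near.
  apply: (@near_forall _ (t, 0 : 'cV[R]_n) _ (fun i (q : R * 'cV[R]_n) => forall j, `|jac (F (clamp q.1)) q.2 i j| < K)) => i.
  apply: (@near_forall _ (t, 0 : 'cV[R]_n) _ (fun j (q : R * 'cV[R]_n) => `|jac (F (clamp q.1)) q.2 i j| < K)) => j.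
  apply: (@cont_near R _ (fun q : R * 'cV[R]_n => `|jac (F (clamp q.1)) q.2 i j|)); last exact: hK.
  by apply: cont_norm; exact: (CkP_cont (hJ i j)).
exists (K * n%:R), (Num.min r rho); split.
- by rewrite mulr_ge0.
- by rewrite lt_min r0.
- by rewrite ge_min lexx.
move=> t y y' t01; rewrite !lt_min => /andP[yr yrho] /andP[yr' yrho'].
have := @lip_jac R n n (F t) 0 y' y K K0; rewrite mul0mx subr0; apply => u u01.
have nu : `|y' + u *: (y - y') - 0| < rho by rewrite subr0; exact: ball_convex.
have te : - e < t < 1 + e by case/andP: t01 => *; apply/andP; split; lra.
have [Ou hu] := h _ nu t te.
have := CkPm_C1v oO hF Ou; rewrite clamp_id// => C; split=> // i j.
by rewrite [X in _ - X]mxE subr0 ltW//; have := hu i j; rewrite clamp_id.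
Qed.

(** Since 0 is an equilibrium, the bound of [picard] reads [|Phi t x| <= c * |x|], so trajectories
    starting in a small ball survive until time 1. The last clause is the equation of variations for
    the Jacobian of the flow. *)
Lemma local_flow n (r : R) (F : R -> 'cV[R]_n -> 'cV[R]_n) : 0 < r ->
  (forall k, CkPm k [set q : R * 'cV[R]_n | `|q.2| < r] (fun t => F (clamp t))) ->
  (forall t : R, 0 <= t <= 1 -> F t 0 = 0) ->
  exists d (Phi : R -> 'cV[R]_n -> 'cV[R]_n), [/\ 0 < d, d <= r,
    (forall k, CkPm k [set q : R * 'cV[R]_n | `|q.2| < d] Phi),
    (forall t : R, Phi t 0 = 0) &
    forall x, `|x| < d -> [/\ solves F x (fun t => Phi t x), forall t : R, `|Phi t x| < r
      & jac (Phi 0) x = 1%:M /\ (forall t : R, 0 <= t <= 1 -> forall i j, {for t, continuous (fun s => jac (Phi s) x i j)}) /\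
        forall t : R, 0 < t < 1 ->
          dmx t 1 (fun s => jac (Phi s) x) (jac (F t) (Phi t x) *m jac (Phi t) x)]].
Proof.
move=> r0 hF F0.
have [M [r' [M0 r'0 r'r hL]]] := jac_cont_tube r0 (hF 1%N).
pose c : R := 2 * expR (2 * M); have c0 : 0 < c by rewrite mulr_gt0// expR_gt0.
pose d := Num.min r (r' / c); have d0 : 0 < d by rewrite lt_min r0 divr_gt0.
pose O := [set x : 'cV[R]_n | `|x| < d]; pose Y := [set x : 'cV[R]_n | `|x| < r'].
have oO : open O by exact: open_ball0.
have oY : open Y by exact: open_ball0.
pose S x := [set phi | solves F x phi /\ forall t : R, `|phi t| <= c * `|x|].
have cE x : 2 * (`|x| + 0) * expR (2 * M) = c * `|x| by rewrite addr0 /c mulrAC.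
have hS x : O x -> exists phi, S x phi.
  rewrite /O /= lt_min => /andP[xr xr'].
  have [||||phi h1 h2] := @picard R n F x M 0 r' M0 (lexx 0).
  - move=> t y yr; apply/cont_cV_atP => i.
    exact: (CkP_cont (hF 0%N i ord0) (lt_le_trans yr r'r : [set q : R * 'cV[R]_n | `|q.2| < r] (t, y))).
  - exact: hL.
  - by move=> t t01; rewrite F0// normr0.
  - by rewrite cE mulrC -ltr_pdivlMr.
  by exists phi; split=> // t; rewrite -cE.
pose Phi (t : R) x := xget (fun=> 0) (S x) t.
have PS x : O x -> S x (fun t => Phi t x).
  by move=> /hS[phi Sp]; exact: (xgetPex (fun=> 0) (ex_intro _ _ Sp)).
have PY x (t : R) : O x -> Y (Phi t x).
  move=> Ox; have [_ h] := PS x Ox; apply: le_lt_trans (h t) _.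
  by move: Ox; rewrite /O /= lt_min => /andP[_]; rewrite ltr_pdivlMr// mulrC.
pose W (t : R) (u : 'cV[R]_(n + n)) := F t (dsubmx u).
have hP x : O x -> solves (fun t y => W t (col_mx x y)) x (fun t => Phi t x) /\ forall t, Y (Phi t x).
  move=> Ox; split; last by move=> t; exact: PY.
  have [[h1 h2 h3 h4] _] := PS x Ox; split=> // t t01 i.
  by rewrite /W col_mxKd; exact: h4.
have hLW (t : R) x (y y' : 'cV[R]_n) : 0 <= t <= 1 -> O x -> Y y -> Y y' ->
    `|W t (col_mx x y) - W t (col_mx x y')| <= M * `|y - y'|.
  by move=> t01 _; rewrite /W !col_mxKd; exact: hL.
have oD := open_dom oO oY.
have oOr : open [set q : R * 'cV[R]_n | `|q.2| < r] by exact: (open_OT (@open_ball0 n r)).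
have hW k : CkPm k [set q : R * 'cV[R]_(n + n) | O (usubmx q.2) /\ Y (dsubmx q.2)] (fun t => W (clamp t)).
  apply: (CkPm_comp (tau := id) (g := fun _ u => dsubmx u) oD oOr _ _ _ (hF k)).
  - by move=> q _; exact: cvg_id.
  - by apply: CkPm_dsub => //; exact: CkPm_id.
  - by move=> q [_ h]; exact: lt_le_trans h r'r.
have hid k : CkPm k [set q : R * 'cV[R]_n | O q.2] (fun _ x => x) by exact: CkPm_id.
exists d, Phi; split=> //.
- by rewrite ge_min lexx.
- by move=> k; exact: (ode_smooth M0 oO oY hLW hP (hW k) (hid k)).
- move=> t; have O0 : O 0 by rewrite /O /= normr0.
  by have [_ /(_ t)] := PS _ O0; rewrite normr0 mulr0 normr_le0 => /eqP.
move=> x Ox; have [Sx _] := PS x Ox; split=> //.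
  by move=> t; exact: lt_le_trans (PY x t Ox) r'r.
have [Z hZ] := choice (fun i => ode_deriv M0 oO oY hLW hP (hW 1%N) (hid 1%N) i Ox).
have JE (t : R) a i : jac (Phi t) x a i = Z i t a ord0.
  by rewrite !mxE; have [_ /(_ t a)[_ ->]] := hZ i.
have JEf a i : (fun s : R => jac (Phi s) x a i) = (fun s => Z i s a ord0).
  by apply/funext => s; rewrite JE.
split; first by apply/matrixP => a i; rewrite JE; have [[-> _ _ _] _] := hZ i; rewrite jac_id mul1mx !mxE eqxx andbT.
split.
  move=> t _ a i; rewrite JEf; have [[_ _ h _] _] := hZ i; exact: (proj1 (cont_cV_atP _ _) (h t)).
move=> t t01 a i; rewrite JEf; have [[_ _ _ /(_ t t01 a) h] _] := hZ i.
apply: is_derive_eq h _.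
have c01 : clamp t = t by rewrite clamp_id//; case/andP: t01 => *; rewrite !ltW.
have -> : jac (W (clamp t)) (col_mx x (Phi t x)) = jac (F t) (Phi t x) *m row_mx 0 1%:M.
  have -> : W (clamp t) = F t \o (fun u : 'cV[R]_(n + n) => row_mx 0 1%:M *m u).
    by apply/funext => u; rewrite /W /= c01 dsub_row.
  rewrite jac_comp; first by rewrite jac_lin -dsub_row col_mxKd.
    rewrite -dsub_row col_mxKd; have := CkPm_C1v oOr (hF 1%N) (lt_le_trans (PY x t Ox) r'r : [set q : R * 'cV[R]_n | `|q.2| < r] (t, Phi t x)).
    by rewrite c01.
  exact: C1v_lin.
rewrite -mulmxA mul_row_col mul0mx mul1mx add0r !mxE; apply: eq_bigr => b _.
by rewrite JE.
Qed.

Lemma dmx_chain (V : normedModType R) n p q (U : set 'cV[R]_n) (w : 'cV[R]_n -> 'M[R]_(p, q))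
    (g : V -> 'cV[R]_n) (x v : V) (d : 'cV[R]_n) : open U -> sm U w -> U (g x) ->
  dmx x v g d -> dmx x v (fun y => w (g y)) (\sum_c d c ord0 *: dmat c w (g x)).
Proof.
move=> oU hw Ux hg a b.
have := @is_derive_chain R n V g (fun x => w x a b) x v (fun c => d c ord0) (sm_C1 a b oU hw Ux) (fun i => hg i ord0).
move=> H; apply: is_derive_eq H _.
by rewrite summxE; apply: eq_bigr => c _; rewrite !mxE mulrC.
Qed.

Section Moser.
Variables (n : nat) (r : R) (w : 'cV[R]_n -> 'M[R]_n) (J : 'M[R]_n).
Let U := [set x : 'cV[R]_n | `|x| < r].
Hypotheses (r0 : 0 < r) (hw : sm U w) (w0u : w 0 \in unitmx).
(** In the application [C = 1] and [C = J] give the imaginary and the real part of the holomorphic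
    symplectic form. *)
Let good (C : 'M[R]_n) := (forall x, U x -> (C *m w x)^T = - (C *m w x)) /\
  rclosed U (fun x => C *m w x).
Hypotheses (g1 : good 1%:M) (gJ : good J).

Let oU : open U. Proof. exact: open_ball0. Qed.
Let U0 : U 0. Proof. by rewrite /U /= normr0. Qed.
Let w' x := w x - w 0.
Let hw' : sm U w'. Proof. by apply: sm_subr => //; exact: sm_cst. Qed.

Let good' C : good C -> (forall x, U x -> (C *m w' x)^T = - (C *m w' x)) /\
  rclosed U (fun x => C *m w' x).
Proof.
move=> [sk cl]; split.
  by move=> x Ux; rewrite /w' mulmxBr trmxB sk// (sk 0)// opprB opprK addrC.
move=> u Uu a b c; rewrite -[RHS](cl u Uu a b c).
have h i j k : 'D_(cvec i) (fun x => (C *m w' x) j k) u = 'D_(cvec i) (fun x => (C *m w x) j k) u.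
  have h1 := dmx_mull C (sm_dmx i oU hw' Uu) j k; have h2 := dmx_mull C (sm_dmx i oU hw Uu) j k.
  have h3 := dmx_sub (sm_dmx i oU hw Uu) (dmx_cst u (cvec i) (w 0)).
  have E := dmx_unique (sm_dmx i oU hw' Uu) h3; rewrite subr0 in E.
  by have [_ ->] := h1; have [_ ->] := h2; rewrite E.
by rewrite !h.
Qed.

(** Moser's field solves [wt t y *m F t y = - (b y *m y)], where [b] gives a radial primitive of
    [w - w 0]. Multiplied by [C] on the left, this is the Moser equation of [C *m wt t] with
    primitive [C *m (b y *m y)], so a single flow straightens [w] and [J *m w] together. *)
Lemma moser : exists d (Phi : 'cV[R]_n -> 'cV[R]_n),
  [/\ 0 < d, sm [set x : 'cV[R]_n | `|x| < d] Phi, Phi 0 = 0 &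
    forall x, `|x| < d -> [/\ U (Phi x), jac Phi x \in unitmx,
      (jac Phi x)^T *m w (Phi x) *m jac Phi x = w 0
    & (jac Phi x)^T *m (J *m w (Phi x)) *m jac Phi x = J *m w 0]].
Proof.
have [b [hb hbC]] := radial_primitive hw'.
pose wt (t : R) y := w 0 + t *: w' y.
have oT : open [set q : R * 'cV[R]_n | U q.2] by exact: (open_OT oU).
have hwt k : CkPm k [set q : R * 'cV[R]_n | U q.2] (fun t => wt t).
  apply: CkPm_add => //; first exact: CkPm_cst.
  apply: CkPm_scale => //; first by apply: CkP_time => q _; exact: cvg_id.
  apply: (CkPm_comp (tau := fun=> true) (g := fun _ x => x) oT (open_lift1 oU) _ _ _ (hw' k)) => //.
    by move=> q _; exact: cst_cont_at.
  exact: CkPm_id.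
have [e e0 /near_norm[rho rho0 h]] : exists2 e : R, 0 < e & \forall x \near (0 : 'cV[R]_n),
    forall t : R, - e < t < 1 + e -> U x /\ wt t x \in unitmx.
  apply: (@tube R _ (0 : 'cV[R]_n) [set q | U q.2 /\ wt q.1 q.2 \in unitmx]).
  move=> t t01; apply: filterI; first exact: (open_near oT (U0 : [set q : R * 'cV[R]_n | U q.2] (t, 0))).
  apply: (@cont_unitmx R _ n (fun q : R * 'cV[R]_n => wt q.1 q.2) (t, 0)).
    by move=> i j; exact: (CkP_cont (hwt 0%N i j) (U0 : [set q : R * 'cV[R]_n | U q.2] (t, 0))).
  by rewrite /wt /w' /= subrr scaler0 addr0.
pose r1 := Num.min r rho; have r10 : 0 < r1 by rewrite lt_min r0.
pose U1 := [set x : 'cV[R]_n | `|x| < r1].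
have oU1 : open U1 by exact: open_ball0.
have U1U x : U1 x -> U x by rewrite /U1 /= lt_min => /andP[].
have wu (t : R) x : 0 <= t <= 1 -> U1 x -> wt t x \in unitmx.
  rewrite /U1 /= lt_min => t01 /andP[_ xr].
  have xr' : `|x - 0| < rho by rewrite subr0.
  by have [] := h x xr' t _; first by case/andP: t01 => *; apply/andP; split; lra.
pose F (t : R) y := - (invmx (wt t y) *m (b y *m y)).
have oT1 : open [set q : R * 'cV[R]_n | U1 q.2] by exact: (open_OT oU1).
have hb1 k : CkPm k [set q : R * 'cV[R]_n | U1 q.2] (fun _ x => b x).
  apply: (CkPm_comp (tau := fun=> true) (g := fun _ x => x) oT1 (open_lift1 oU) _ _ _ (hb k)).
  - by move=> q _; exact: cst_cont_at.
  - exact: CkPm_id.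
  - by move=> q; exact: U1U.
have hF k : CkPm k [set q : R * 'cV[R]_n | `|q.2| < r1] (fun t => F (clamp t)).
  apply: CkPm_opp => //; apply: CkPm_mul => //; last first.
    by apply: CkPm_mul => //; exact: CkPm_id.
  apply: CkPm_inv => //; first by move=> t x; apply: wu; exact: clamp01.
  apply: (CkPm_comp (tau := clamp) (g := fun _ x => x) oT1 oT _ _ _ (hwt k)).
  - by move=> q _; exact: clamp_cont.
  - exact: CkPm_id.
  - by move=> q; exact: U1U.
have F0 (t : R) : 0 <= t <= 1 -> F t 0 = 0 by move=> _; rewrite /F !mulmx0 oppr0.
have [d [Phi [d0 dr1 hPhi Phi0 hP]]] := local_flow r10 hF F0.
have oD : open [set x : 'cV[R]_n | `|x| < d] by exact: open_ball0.
have hF1 (t : R) : 0 <= t <= 1 -> sm U1 (F t).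
  move=> t01; apply: sm_opp => //; apply: sm_mul => //; last first.
    by apply: sm_mul => //; [apply: sm_restrict hb|exact: sm_id].
  apply: sm_inv => //; first by move=> x; exact: wu.
  apply: sm_add => //; first exact: sm_cst.
  have -> : (fun u => t *: w' u) = (fun u => t%:M *m w' u) by apply/funext => u; rewrite mul_scalar_mx.
  by apply: sm_mul => //; [exact: sm_cst|exact: sm_restrict hw'].
have key C x : good C -> `|x| < d ->
    (jac (Phi 1) x)^T *m (C *m w (Phi 1 x)) *m jac (Phi 1) x = C *m w 0.
  move=> gdC; have [gC _] := gdC; move: gdC => /good'[Csk Ccl] xd; have [[P0 _ Pc Pd] PU [J0 [Jc Jd]]] := hP x xd.
  have Cr := hbC C Csk Ccl.
  have C0 : (C *m w 0)^T = - (C *m w 0) by exact: (gC 0 U0).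
  have hal : sm U (fun x => C *m (b x *m x)).
    by apply: sm_mul => //; [exact: sm_cst|apply: sm_mul => //; exact: sm_id].
  have hCw : sm U (fun x => C *m w' x) by apply: sm_mul => //; exact: sm_cst.
  have PU' t : U (Phi t x) by apply: U1U; exact: PU.
  (* Cartan's formula in matrix form: the Lie derivative of [C *m wt t] along [F t] cancels the time
     derivative [C *m w']. *)
  have bracket (t : R) : 0 <= t <= 1 -> forall y, U1 y ->
     (jac (F t) y)^T *m (C *m wt t y) + (C *m (w' y + t *: \sum_c F t y c ord0 *: dmat c w' y))
       + C *m wt t y *m jac (F t) y = 0.
    move=> t01 y Uy; have Uy' := U1U _ Uy.
    set G := C *m wt t y; set DV := jac (F t) y; set V := F t y.
    have FD j : dmx y (cvec j) (F t) (col j DV).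
      have FC := sm_C1v oU1 (hF1 t t01) Uy.
      move=> a b'; rewrite (ord1 b'); have := C1v_derive (cvec j) a FC.
      by rewrite -colE.
    have wD j : dmx y (cvec j) (wt t) (t *: dmat j w' y).
      apply: dmx_eq (dmx_add (dmx_cst _ _ _) (dmx_scale (is_derive_cst _ _ _) (sm_dmx j oU hw' Uy'))) _.
      by rewrite add0r scale0r add0r.
    have e1 j : C *m (t *: dmat j w' y) *m V + G *m col j DV = - dmat j (fun x => C *m (b x *m x)) y.
      apply: (@dmx_unique 'cV[R]_n n 1 y (cvec j) (fun y => C *m wt t y *m F t y)).
        exact: dmx_mul (dmx_mull C (wD j)) (FD j).
      move=> a b'; have [h1 h2] := sm_dmx j oU hal Uy' a b'.
      have n1 : \forall z \near y, - (C *m (b z *m z)) a b' = (C *m wt t z *m F t z) a b'.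
        have n2 : \forall z \near y, U1 z by exact: open_nbhs_nbhs.
        apply: filterS n2 => z Uz; rewrite /F mulmxN -mulmxA (mulmxA (wt t z)) mulmxV ?mul1mx ?mxE//.
        exact: wu.
      split; first by apply: near_eq_derivable n1 _; exact: derivableN.
      by rewrite -(near_eq_derive _ n1) deriveN// mxE h2.
    have Gs : G^T = - G.
      rewrite /G /wt mulmxDr -scalemxAr trmxD [(t *: _)^T]linearZ /= Csk// C0 scalerN opprD.
      by [].
    have e2 a j : (G *m DV) a j = - dmat j (fun x => C *m (b x *m x)) y a ord0
        - t * \sum_c dmat j (fun x => C *m w' x) y a c * V c ord0.
      have := congr1 (fun M : 'cV[R]_n => M a ord0) (e1 j).
      rewrite mxE [RHS]mxE colE mulmxA -colE [X in _ + X]mxE => h1.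
      apply/eqP; rewrite -subr_eq0 -h1 opprD opprK; apply/eqP.
      have -> : (C *m (t *: dmat j w' y) *m V) a ord0 = t * \sum_c dmat j (fun x => C *m w' x) y a c * V c ord0.
        have E := dmx_unique (sm_dmx j oU hCw Uy') (dmx_mull C (sm_dmx j oU hw' Uy')).
        by rewrite E -scalemxAr -scalemxAl mxE mxE.
      by ring.
    have e3 : DV^T *m G = - (G *m DV)^T.
      by rewrite trmx_mul Gs mulmxN opprK.
    have e4 a j : rext1 (fun x => C *m (b x *m x)) y a j =
        dmat j (fun x => C *m (b x *m x)) y a ord0 - dmat a (fun x => C *m (b x *m x)) y j ord0.
      exact: (rext1E a j (fun i => sm_dmx i oU hal Uy')).
    apply/matrixP => a j; rewrite e3 mxE [X in X + _]mxE [X in X + _ + _]mxE [X in - X + _ + _]mxE !e2.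
    rewrite mulmxDr [X in _ + X + _]mxE -(Cr y Uy') e4 -scalemxAr [X in _ + (_ + X) + _]mxE.
    have -> : (C *m \sum_c V c ord0 *: dmat c w' y) a j = \sum_c dmat j (fun x => C *m w' x) y a c * V c ord0
       - \sum_c dmat a (fun x => C *m w' x) y j c * V c ord0.
      rewrite mulmx_sumr summxE -sumrB; apply: eq_bigr => c _.
      rewrite -mulrBl (rclosedE _ _ _ Ccl Csk oU hCw Uy') -scalemxAr mxE mulrC.
      by have E := dmx_unique (sm_dmx c oU hCw Uy') (dmx_mull C (sm_dmx c oU hw' Uy')); rewrite E.
    by rewrite [RHS]mxE; ring.
  have ltle (t : R) : 0 < t < 1 -> 0 <= t <= 1 by case/andP=> *; rewrite !ltW.
  (* The pull-back of [C *m wt t] by the flow at time [t], constant in [t] by [bracket]. *)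
  pose K (t : R) := (jac (Phi t) x)^T *m (C *m wt t (Phi t x)) *m jac (Phi t) x.
  have K1 : K 1 = (jac (Phi 1) x)^T *m (C *m w (Phi 1 x)) *m jac (Phi 1) x.
    by rewrite /K /wt scale1r /w' addrC subrK.
  have K0 : K 0 = C *m w 0.
    by rewrite /K /wt scale0r addr0 J0 trmx1 mul1mx mulmx1.
  rewrite -K1 -K0; apply/matrixP => i j; apply: deriv_zero (fun t => K t i j) _ _.
    move=> t t01; move: i j; apply: cont_mulmx; last by move=> i j; exact: Jc.
    apply: cont_mulmx.
      by move=> i j; rewrite (_ : (fun s => _) = fun s => jac (Phi s) x j i); [exact: Jc|apply/funext => s; rewrite mxE].
    apply: cont_mulmx => i j; first exact: cst_cont_at.
    apply: (@cont_comp _ _ _ (fun s : R => (s, Phi s x)) (fun q : R * 'cV[R]_n => wt q.1 q.2 i j)).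
      by apply: cont_pair_at; [exact: cvg_id|exact: Pc].
    exact: (CkP_cont (hwt 0%N i j) (PU' t : [set q : R * 'cV[R]_n | U q.2] (t, Phi t x))).
  move=> t t01; have t01' := ltle t t01.
  have Pd' : dmx t 1 (fun s => Phi s x) (F t (Phi t x)) by move=> a b'; rewrite (ord1 b'); exact: Pd.
  have wD : dmx t 1 (fun s => wt s (Phi s x)) (w' (Phi t x) + t *: \sum_c F t (Phi t x) c ord0 *: dmat c w' (Phi t x)).
    have h1 := dmx_scale (is_derive_id t (1 : R)) (dmx_chain oU hw' (PU' t) Pd').
    by apply: dmx_eq (dmx_add (dmx_cst t 1 (w 0)) h1) _; rewrite add0r scale1r.
  have JD := Jd t t01.
  have := dmx_mul (dmx_mul (dmx_tr JD) (dmx_mull C wD)) JD.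
  move=> /(_ i j) h1; apply: is_derive_eq h1 _.
  have := congr1 (fun M => (jac (Phi t) x)^T *m M *m jac (Phi t) x) (bracket t t01' _ (PU t)).
  rewrite !mulmxDr !mulmxDl mulmx0 mul0mx => B0.
  have := congr1 (fun M : 'M[R]_n => M i j) B0.
  by rewrite [RHS]mxE => <-; congr (fun_of_matrix _ i j); rewrite trmx_mul !mulmxDr !mulmxDl !mulmxA.
exists d, (Phi 1); split=> //.
  move=> k; apply: (CkPm_comp (tau := fun=> (1 : R)) (g := fun _ x => x) (open_lift1 oD) (open_OT oD) _ _ _ (hPhi k)) => //.
    by move=> q _; exact: cst_cont_at.
  by apply: CkPm_id.
move=> x xd; have k1 := key 1%:M x g1 xd; have k2 := key J x gJ xd.
rewrite !mul1mx in k1; have [_ PU _] := hP x xd; split=> //.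
  by apply: U1U; exact: PU.
by move: w0u; rewrite -k1 unitmx_mul => /andP[].
Qed.
End Moser.
End Poincare_and_Moser.

(** * Charts, tangent maps and submanifolds *)

Section Charts_and_maps.
Context {R : realType}.
Definition grad n (F : 'cV[R]_n -> R) u : 'cV[R]_n := \col_i 'D_(cvec i) F u.

Lemma grad_comp n m (F : 'cV[R]_n -> R) (g : 'cV[R]_m -> 'cV[R]_n) u :
  C1at F (g u) -> C1v g u -> \col_i 'D_(cvec i) (F \o g) u = (jac g u)^T *m grad F (g u).
Proof.
move=> hF hg; apply/colP => j; rewrite !mxE.
have := @is_derive_chain R n _ g F u (cvec j) (fun i => jac g u i j) hF.
have h i : is_derive u (cvec j) (fun y => g y i ord0) (jac g u i j).
  by have := C1v_derive (cvec j) i hg; rewrite -colE mxE.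
by move=> /(_ h)[_ ->]; apply: eq_bigr => i _; rewrite !mxE mulrC.
Qed.

Section Charts.
Variables (n : nat) (M : @manifold R n).
Implicit Types (c d : @chart R M n) (x y : M).

Lemma atlas_smooth c : atlas c -> smooth_chart c.
Proof. by move=> ac; split; [exact: atlas_chart|move=> c' ac'; split; exact: atlas_compat]. Qed.

Lemma chart_at_smooth x : smooth_chart (chart_at x).
Proof. exact/atlas_smooth/chart_at_atlas. Qed.

Lemma cimgP c u : is_chart c -> cimg c u -> cdom c (icoord c u) /\ coord c (icoord c u) = u.
Proof. by move=> [_ _ cK _ _] [x cx <-]; rewrite cK. Qed.

Lemma img_preimage c (W : set M) : is_chart c ->
  coord c @` (cdom c `&` W) = cimg c `&` icoord c @^-1` W.
Proof.
move=> hc; have [_ _ cK _ _] := hc; apply/seteqP; split=> [_ [x [cx Wx] <-]|u [[x cx <-]]].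
  by split; [exists x|rewrite /= cK].
by rewrite /= cK// => Wx; exists x.
Qed.

Lemma open_img c (W : set M) : is_chart c -> open W -> open (coord c @` (cdom c `&` W)).
Proof.
move=> hc oW; have [_ oc _ _ ic] := hc; rewrite img_preimage// openE => u [cu Wu].
have n1 : \forall w \near u, cimg c w by exact: open_nbhs_nbhs.
have n2 : \forall w \near u, W (icoord c w) by apply: (ic u cu); exact: open_nbhs_nbhs.
exact: filterI n1 n2.
Qed.

Lemma open_imgS c (W : set M) : is_chart c -> open W -> W `<=` cdom c -> open (coord c @` W).
Proof. by move=> hc oW Wc; rewrite -(setIidr Wc); exact: open_img. Qed.

Lemma near_coord c x (W : set M) : is_chart c -> cdom c x -> open W -> W x ->
  \forall u \near coord c x, W (icoord c u) /\ cdom c (icoord c u) /\ coord c (icoord c u) = u.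
Proof.
move=> hc cx oW Wx; have o := open_img hc oW.
have n1 : \forall u \near coord c x, (coord c @` (cdom c `&` W)) u.
  by apply: open_nbhs_nbhs; split=> //; exists x.
have [_ _ cK _ _] := hc.
by apply: filterS n1 => _ [y [cy Wy] <-]; rewrite cK.
Qed.

(** Smooth charts are compatible with the charts of the atlas, so near each point the transition is
    factored through the preferred chart there. *)
Lemma trans_sm c d : smooth_chart c -> smooth_chart d ->
  sm (coord c @` (cdom c `&` cdom d)) (coord d \o icoord c).
Proof.
move=> [hc cc] [hd dd]; have [oc oic cK cont ic] := hc; have [od oid dK contd id_] := hd.
apply: sm_local => _ [x [cx dx] <-].
have aa := chart_at_atlas x; have ax := chart_at_dom x; have ha := atlas_chart aa.
have [oa _ aK _ _] := ha.
pose W := cdom c `&` cdom d `&` cdom (chart_at x).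
have oW : open W by apply: openI => //; exact: openI.
exists (coord c @` W); split.
- by apply: open_imgS => // y [[]].
- by exists x.
have h1 : sm (coord c @` W) (coord (chart_at x) \o icoord c).
  apply: sm_restrict ((smE _ _).1 ((cc _ aa).1)).
  by move=> _ [y [[cy dy] ay] <-]; exists y.
have h2 := (smE _ _).1 (dd _ aa).2.
have oWc : open (coord c @` W) by apply: open_imgS => // y [[]].
apply: (@sm_ext R n _ oWc _ _ ((coord d \o icoord (chart_at x)) \o (coord (chart_at x) \o icoord c))).
  by move=> _ [y [[cy dy] ay] <-]; rewrite /= cK// aK.
apply: (sm_comp oWc _ h1 _ h2); first exact: open_img.
by move=> _ [y [[cy dy] ay] <-]; rewrite /= cK//; exists y.
Qed.

Lemma trans_C1v c d x : smooth_chart c -> smooth_chart d -> cdom c x -> cdom d x ->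
  C1v (coord d \o icoord c) (coord c x).
Proof.
move=> sc sd cx dx; apply: (sm_C1v _ (trans_sm sc sd)); last by exists x.
by case: sc => hc _; case: sd => -[od _ _ _ _] _; exact: open_img.
Qed.

Lemma trans_comp c c' d x : smooth_chart c -> smooth_chart c' -> smooth_chart d ->
  cdom c x -> cdom c' x -> cdom d x ->
  jac (coord d \o icoord c) (coord c x) =
  jac (coord d \o icoord c') (coord c' x) *m jac (coord c' \o icoord c) (coord c x).
Proof.
move=> sc sc' sd cx c'x dx; have [hc _] := sc; have [_ _ cK _ _] := hc.
have [[oc' _ c'K _ _] _] := sc'.
have -> : jac (coord d \o icoord c) (coord c x) =
    jac ((coord d \o icoord c') \o (coord c' \o icoord c)) (coord c x).
  apply: jac_near; have n1 := near_coord hc cx oc' c'x.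
  by apply: filterS n1 => u [c'u _]; rewrite /= c'K.
rewrite jac_comp /= ?cK//; first exact: trans_C1v.
exact: trans_C1v.
Qed.

Lemma trans_id c x : is_chart c -> cdom c x -> jac (coord c \o icoord c) (coord c x) = 1%:M.
Proof.
move=> hc cx; rewrite -(jac_id (coord c x)); apply: jac_near.
have n1 := near_coord hc cx (@openT M) I.
by apply: filterS n1 => u [_ []].
Qed.

Lemma tr_trans c d y : smooth_chart c -> smooth_chart d -> cdom c y -> cdom d y ->
  tr d y = jac (coord d \o icoord c) (coord c y) *m tr c y.
Proof.
by move=> sc sd cy dy; apply: trans_comp => //; [exact: chart_at_smooth|exact: chart_at_dom].
Qed.

Lemma tr_unit c y : smooth_chart c -> cdom c y -> tr c y \in unitmx.
Proof.
move=> sc cy; have := tr_trans sc (chart_at_smooth y) cy (chart_at_dom y).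
have -> : tr (chart_at y) y = 1%:M.
  by apply: trans_id; [exact: (chart_at_smooth y).1|exact: chart_at_dom].
by move=> /esym/mulmx1_unit[].
Qed.

Lemma tr_chart_at y : tr (chart_at y) y = 1%:M.
Proof. by apply: trans_id; [exact: (chart_at_smooth y).1|exact: chart_at_dom]. Qed.

(** A change of coordinates in [c] by a diffeomorphism [Phi] of [V] with inverse [Psi]. Darboux
    charts, linear frames and the slice charts of the [L_t] are all made this way. *)
Definition rechart c (V : set 'cV[R]_n) (Phi Psi : 'cV[R]_n -> 'cV[R]_n) : @chart R M n :=
  Chart (cdom c `&` coord c @^-1` V) (Phi \o coord c) (icoord c \o Psi).

Section Rechart.
Variables (c : @chart R M n) (V : set 'cV[R]_n) (Phi Psi : 'cV[R]_n -> 'cV[R]_n).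
Hypotheses (sc : smooth_chart c) (oV : open V) (Vc : V `<=` cimg c).
Hypotheses (sPhi : sm V Phi) (oPV : open (Phi @` V)) (sPsi : sm (Phi @` V) Psi).
Hypothesis PK : forall u, V u -> Psi (Phi u) = u.
Let c' := rechart c V Phi Psi.

Lemma rechart_img : cimg c' = Phi @` V.
Proof.
apply/seteqP; split=> [_ [x [cx Vx] <-]|_ [u Vu <-]]; first by exists (coord c x).
have [cu cE] := cimgP sc.1 (Vc Vu); exists (icoord c u); last by rewrite /= cE.
by split=> //=; rewrite cE.
Qed.

Lemma rechart_is_chart : is_chart c'.
Proof.
have [hc _] := sc; have [oc oic cK cont ic] := hc; split.
- rewrite openE => x [cx Vx].
  have n1 : \forall y \near x, cdom c y by exact: open_nbhs_nbhs.
  have n2 : \forall y \near x, V (coord c y) by apply: (cont x cx); exact: open_nbhs_nbhs.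
  exact: filterI n1 n2.
- by rewrite rechart_img.
- by move=> x [cx Vx]; rewrite /= PK// cK.
- move=> x [cx Vx]; apply: (@cont_comp _ _ _ (coord c) Phi); first exact: cont.
  by apply: C1v_continuous; exact: (sm_C1v oV sPhi Vx).
- rewrite rechart_img => _ [u Vu <-].
  apply: (@cont_comp _ _ _ Psi (icoord c)).
    by apply: C1v_continuous; apply: (sm_C1v oPV sPsi); exists u.
  by rewrite PK//; apply: ic; exact: Vc.
Qed.

Lemma rechart_smooth : smooth_chart c'.
Proof.
have [hc cc] := sc; have [oc oic cK cont ic] := hc.
split; first exact: rechart_is_chart.
have [oc' _ _ _ _] := rechart_is_chart.
move=> a aa; have ha := atlas_chart aa; have [oa _ aK _ _] := ha; split; apply/smE.
  have h := (smE _ _).1 (cc _ aa).1.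
  have -> : coord a \o icoord c' = (coord a \o icoord c) \o Psi by [].
  apply: (sm_comp _ _ _ _ h).
  - by apply: open_img => //; exact: rechart_is_chart.
  - exact: open_img.
  - apply: sm_restrict sPsi => _ [x [[cx Vx] _] <-]; by exists (coord c x).
  - by move=> _ [x [[cx Vx] ax] <-]; rewrite /= PK//; exists x.
have h := (smE _ _).1 (cc _ aa).2.
have -> : coord c' \o icoord a = Phi \o (coord c \o icoord a) by [].
apply: (sm_comp _ oV _ _ sPhi).
- by apply: open_img.
- by apply: sm_restrict h => _ [x [ax [cx Vx]] <-]; exists x.
- by move=> _ [x [ax [cx Vx]] <-]; rewrite /= aK.
Qed.

Lemma rechart_tr y : cdom c' y -> tr c' y = jac Phi (coord c y) *m tr c y.
Proof.
move=> [cy Vy]; have [hc _] := sc; have [oc _ cK _ _] := hc.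
rewrite /tr; have -> : coord c' \o icoord (chart_at y) = Phi \o (coord c \o icoord (chart_at y)) by [].
have e : icoord (chart_at y) (coord (chart_at y) y) = y.
  by have [_ _ aK _ _] := (chart_at_smooth y).1; rewrite aK//; exact: chart_at_dom.
rewrite jac_comp /= ?e//; first exact: (sm_C1v oV sPhi Vy).
by apply: trans_C1v => //; [exact: chart_at_smooth|exact: chart_at_dom].
Qed.
End Rechart.

Lemma dfun_chart c (W : set M) (f : M -> R) (F : 'cV[R]_n -> R) x :
  smooth_chart c -> open W -> W `<=` cdom c -> W x ->
  (forall y, W y -> f y = F (coord c y)) -> C1at F (coord c x) ->
  dfun f x = (tr c x)^T *m grad F (coord c x).
Proof.
move=> sc oW Wc Wx fF hF; have ha := (chart_at_smooth x).1.
have ax := chart_at_dom x; have [_ _ aK _ _] := ha.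
have e := aK x ax.
have -> : coord c x = (coord c \o icoord (chart_at x)) (coord (chart_at x) x) by rewrite /= e.
rewrite -grad_comp.
- apply/colP => i; rewrite !mxE; apply: near_eq_derive.
  have n1 := near_coord ha ax oW Wx.
  by apply: filterS n1 => u [Wu _]; rewrite /= fF.
- by rewrite /= e.
- by apply: trans_C1v => //; [exact: chart_at_smooth|exact: Wc].
Qed.
End Charts.
Lemma near_const_derive (V : normedModType R) (f : V -> R) (x v : V) a d :
  (\forall y \near x, f y = a) -> is_derive x v f d -> d = 0.
Proof.
move=> h [_ <-]; have h' : \forall y \near x, f y = cst a y by exact: h.
by rewrite (near_eq_derive _ h') derive_cst.
Qed.

Lemma dmxv_cont n (g : R -> 'cV[R]_n) (t : R) d : dmx t 1 g d -> {for t, continuous g}.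
Proof. by move=> h; apply/cont_cV_atP => i; exact: is_derive_cont (h i ord0). Qed.

Lemma tr_invK n (M : @manifold R n) (c : @chart R M n) x (v : 'cV[R]_n) : smooth_chart c -> cdom c x ->
  tr c x *m (invmx (tr c x) *m v) = v.
Proof. by move=> sc cx; rewrite mulKVmx//; exact: tr_unit. Qed.

Section Velocity.
Variables (n : nat) (M : @manifold R n).

(** [velocity] refers to the preferred chart at the point [g t], which changes along the curve; here
    the whole curve can be differentiated in one smooth chart. *)
Lemma velocity_chart (c : @chart R M n) (g : R -> M) (t : R) (y : R -> 'cV[R]_n) y' v :
  smooth_chart c -> (\forall s \near t, cdom c (g s) /\ coord c (g s) = y s) ->
  dmx t 1 y y' -> tr c (g t) *m v = y' -> velocity g t v.
Proof.
move=> sc hg hy hv; have [hc _] := sc; have [oc oic cK cont ic] := hc.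
have [ct yt] := nbhs_singleton hg.
have gE : \forall s \near t, g s = icoord c (y s).
  by apply: filterS hg => s [cs <-]; rewrite cK.
have yc := dmxv_cont hy.
have ct' : {for t, continuous (fun s => icoord c (y s))}.
  apply: (@cont_comp _ _ _ y (icoord c)) => //.
  by apply: ic; rewrite -yt; exists (g t).
have gc : {for t, continuous g}.
  move=> A; rewrite (nbhs_singleton gE) => /ct' h.
  by apply: filterS2 gE h => s /= ->.
split=> // i; set a := chart_at (g t).
have sa : smooth_chart a by exact: chart_at_smooth.
have ag : cdom a (g t) by exact: chart_at_dom.
have C : C1v (coord a \o icoord c) (y t) by rewrite -yt; exact: trans_C1v.
have := is_derive_chainv i C (fun i => hy i ord0).
have -> : jac (coord a \o icoord c) (y t) *m y' = v.
  by rewrite -hv mulmxA -yt -(tr_trans sc sa ct ag) tr_chart_at mul1mx.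
have n1 : \forall s \near t, (coord a \o icoord c) (y s) i ord0 = coord a (g s) i ord0.
  by apply: filterS gE => s ->.
exact: near_eq_is_derive.
Qed.

(** A straight line in the coordinates of [c], tangent to the slice, stays in [L]; the normal
    coordinates of [c'] vanish along it, and so do their derivatives. Hence [tangent] is independent
    of the slice chart. *)
Lemma slice_tangent d (L : set M) (c c' : @chart R M n) p (v : 'cV[R]_n) :
  slice_chart d L c -> slice_chart d L c' -> cdom c p -> cdom c' p -> L p ->
  (forall j : 'I_n, (d <= j)%N -> (tr c p *m v) j ord0 = 0) ->
  forall j : 'I_n, (d <= j)%N -> (tr c' p *m v) j ord0 = 0.
Proof.
move=> [sc Lc] [sc' Lc'] cp cp' Lp hv j dj.
have [hc _] := sc; have [_ _ cK _ _] := hc; have [[oc' _ _ _ _] _] := sc'.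
set w := tr c p *m v in hv; pose u (h : R) := coord c p + h *: w.
have hu : dmx (0 : R) 1 u w.
  have h1 := dmx_scale (is_derive_id (0 : R) (1 : R)) (dmx_cst (0 : R) (1 : R) w).
  by apply: dmx_eq (dmx_add (dmx_cst (0 : R) 1 (coord c p)) h1) _; rewrite add0r scale1r scale0r addr0.
have u0 : u 0 = coord c p by rewrite /u scale0r addr0.
have C : C1v (coord c' \o icoord c) (u 0) by rewrite u0; exact: trans_C1v.
have := is_derive_chainv j C (fun i => hu i ord0).
rewrite u0 /w mulmxA -(tr_trans sc sc' cp cp') => D.
apply: (near_const_derive (a := 0) _ D).
have n1 := near_coord hc cp oc' cp'; rewrite -u0 in n1.
have n2 : \forall h \near (0 : R), cdom c' (icoord c (u h)) /\ cdom c (icoord c (u h)) /\ coord c (icoord c (u h)) = u h.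
  exact: (dmxv_cont hu n1).
apply: filterS n2 => h /= [c'h [ch cE]]; apply: (Lc' _ c'h).1 => //.
apply/(Lc _ ch) => i di; rewrite cE /u [LHS]mxE [X in _ + X]mxE hv// mulr0 addr0.
exact: (Lc _ cp).1.
Qed.

Lemma tangentE d (L : set M) (c : @chart R M n) p (v : 'cV[R]_n) :
  slice_chart d L c -> cdom c p -> L p ->
  tangent d L p v <-> forall j : 'I_n, (d <= j)%N -> (tr c p *m v) j ord0 = 0.
Proof.
move=> hs cp Lp; split=> [[c' [hs' cp' hv]]|hv]; first exact: (slice_tangent hs' hs cp' cp Lp hv).
by exists c.
Qed.
End Velocity.

Section Maps.
Variables (n p : nat) (M : @manifold R n) (N : @manifold R p).

(** [F] is any map that agrees with the coordinate expression on the image of [W], not the composite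
    itself, so that the explicit maps of the local model can serve as representatives. *)
Definition lrep (c : @chart R M n) (d : @chart R N p) (f : M -> N) (W : set M)
    (F : 'cV[R]_n -> 'cV[R]_p) :=
  [/\ open W, W `<=` cdom c, forall y, W y -> cdom d (f y), sm (coord c @` W) F
    & forall y, W y -> coord d (f y) = F (coord c y)].

Variables (c : @chart R M n) (d : @chart R N p) (f : M -> N).
Hypotheses (sc : smooth_chart c) (sd : smooth_chart d).

Lemma lrep_C1v W F x : lrep c d f W F -> W x -> C1v F (coord c x).
Proof.
move=> [oW Wc _ sF _] Wx; apply: (sm_C1v _ sF); last by exists x.
by apply: open_imgS => //; case: sc.
Qed.

Lemma lrep_cont W F x : lrep c d f W F -> W x -> {for x, continuous f}.
Proof.
move=> h Wx; have C := lrep_C1v h Wx; have [oW Wc fd sF fF] := h.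
have [[_ _ dK _ id_] _] := sd; have [[_ _ _ cc _] _] := sc.
have n1 : \forall y \near x, f y = icoord d (F (coord c y)).
  have n2 : \forall y \near x, W y by exact: open_nbhs_nbhs.
  by apply: filterS n2 => y Wy; rewrite -fF// dK//; exact: fd.
have h1 : {for x, continuous (fun y => icoord d (F (coord c y)))}.
  apply: (@cont_comp _ _ _ (fun y => F (coord c y)) (icoord d)).
    by apply: (@cont_comp _ _ _ (coord c) F); [exact: cc (Wc _ Wx)|exact: C1v_continuous].
  by apply: id_; rewrite -fF//; exists (f x) => //; exact: fd.
move=> A; rewrite (nbhs_singleton n1) => /h1 h2.
by apply: filterS2 n1 h2 => y /= ->.
Qed.

(** The bridge between [tmap], taken in preferred charts, and Jacobians in chosen charts. *)
Lemma lrep_tmap W F x : lrep c d f W F -> W x ->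
  tr d (f x) *m tmap f x = jac F (coord c x) *m tr c x.
Proof.
move=> h Wx; have C := lrep_C1v h Wx; have [oW Wc fd sF fF] := h.
have [[oc oic cK _ _] _] := sc; have [hd _] := sd; have [od _ dK _ _] := hd.
set a := chart_at x; set b := chart_at (f x).
have sa : smooth_chart a by exact: chart_at_smooth.
have sb : smooth_chart b by exact: chart_at_smooth.
have ax : cdom a x by exact: chart_at_dom.
have bx : cdom b (f x) by exact: chart_at_dom.
have [ha _] := sa; have [_ _ aK _ _] := ha; have [[ob _ bK _ _] _] := sb.
have E : tmap f x = jac (coord b \o icoord d) (coord d (f x)) *m (jac F (coord c x) *m tr c x).
  have -> : jac F (coord c x) *m tr c x = jac (F \o (coord c \o icoord a)) (coord a x).
    rewrite jac_comp /= ?aK//.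
    exact: (trans_C1v sa sc ax (Wc _ Wx)).
  have -> : tmap f x = jac ((coord b \o icoord d) \o (F \o (coord c \o icoord a))) (coord a x).
    apply: jac_near; have n1 := near_coord ha ax oW Wx.
    by apply: filterS n1 => u [Wu _]; rewrite /= -fF// dK//; exact: fd.
  have C1 : C1v (F \o (coord c \o icoord a)) (coord a x).
    have oi : open (coord a @` (cdom a `&` W)) by exact: open_img.
    have oWi : open (coord c @` W) by apply: open_imgS => //; case: sc.
    apply: (sm_C1v oi); last by exists x.
    apply: (sm_comp oi oWi _ _ sF).
      apply: sm_restrict (trans_sm sa sc) => _ [y [ay Wy] <-]; exists y => //; split=> //; exact: Wc.
    by move=> _ [y [ay Wy] <-]; rewrite /= aK//; exists y.
  rewrite jac_comp// /= aK// -fF//.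
  exact: (trans_C1v sd sb (fd _ Wx) bx).
rewrite E mulmxA -(trans_comp sd sb sd (fd _ Wx) bx (fd _ Wx)).
by rewrite trans_id ?mul1mx//; exact: fd.
Qed.

End Maps.

Section Maps2.
Variables (n p : nat) (M : @manifold R n) (N : @manifold R p).

Lemma lrep_smooth (U : set M) (f : M -> N) :
  (forall x, U x -> exists c d W F, [/\ smooth_chart c, smooth_chart d, lrep c d f W F & W x]) ->
  smooth_map U f.
Proof.
move=> h; split.
  by move=> x /h[c [d [W [F [sc sd hl Wx]]]]]; exact: (lrep_cont sc sd hl Wx).
move=> a b aa ab; apply/smE.
have sa := atlas_smooth aa; have sb := atlas_smooth ab.
have [ha _] := sa; have [hb _] := sb; have [_ _ aK _ _] := ha.
have [ob _ _ _ _] := hb.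
have K x : U x -> cdom a x -> cdom b (f x) -> exists V, [/\ open V, V (coord a x) & sm V (coord b \o f \o icoord a)].
  move=> Ux ax bx; have [c [d [W [F [sc sd hl Wx]]]]] := h x Ux.
  have [oW Wc fd sF fF] := hl; have [[oc oic cK _ _] _] := sc; have [hd _] := sd; have [od _ dK _ _] := hd.
  have fc : forall y, W y -> {for y, continuous f} by move=> y Wy; exact: (lrep_cont sc sd hl Wy).
  pose W' := W `&` f @^-1` cdom b.
  have oW' : open W'.
    rewrite openE => y [Wy by_]; apply: filterI; first exact: open_nbhs_nbhs.
    by apply: (fc y Wy); exact: open_nbhs_nbhs.
  have o1 : open (coord a @` (cdom a `&` W')) by exact: open_img.
  have o2 : open (coord c @` W) by apply: open_imgS => //; case: sc.
  have o3 : open (coord d @` (cdom d `&` cdom b)) by exact: open_img.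
  exists (coord a @` (cdom a `&` W')); split=> //; first by exists x.
  apply: (@sm_ext R n _ o1 _ _ ((coord b \o icoord d) \o (F \o (coord c \o icoord a)))).
    move=> _ [y [ay [Wy by_]] <-]; rewrite /= aK// -fF// dK//; exact: fd.
  apply: (sm_comp o1 o3 _ _ (trans_sm sd sb)).
    apply: (sm_comp o1 o2 _ _ sF).
      apply: sm_restrict (trans_sm sa sc) => _ [y [ay [Wy _]] <-]; exists y => //; split=> //; exact: Wc.
    by move=> _ [y [ay [Wy _]] <-]; rewrite /= aK//; exists y.
  move=> _ [y [ay [Wy by_]] <-]; rewrite /= aK// -fF//.
  by exists (f y) => //; split=> //; exact: fd.
apply: sm_local => _ [x [[Ux ax] bx] <-]; exact: K.
Qed.

Lemma smooth_lrep (U : set M) (f : M -> N) (c : @chart R M n) (d : @chart R N p) :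
  open U -> smooth_map U f -> smooth_chart c -> smooth_chart d ->
  lrep c d f (U `&` cdom c `&` f @^-1` cdom d) (coord d \o f \o icoord c).
Proof.
move=> oU [fc fs] sc sd; set W := U `&` _ `&` _.
have [hc _] := sc; have [hd _] := sd; have [oc _ cK _ _] := hc; have [od _ dK _ _] := hd.
have oW : open W.
  rewrite openE => y [[Uy cy] dy]; apply: filterI; first by apply: filterI; exact: open_nbhs_nbhs.
  by apply: (fc y Uy); exact: open_nbhs_nbhs.
have Wc : W `<=` cdom c by move=> y [[]].
split=> //; [by move=> y []| |by move=> y [[Uy cy] dy]; rewrite /= cK].
have oi : open (coord c @` W) by exact: open_imgS.
apply: sm_local => _ [x [[Ux cx] dx] <-].
set a := chart_at x; set b := chart_at (f x).
have sa : smooth_chart a by exact: chart_at_smooth.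
have sb : smooth_chart b by exact: chart_at_smooth.
have ax : cdom a x by exact: chart_at_dom.
have bx : cdom b (f x) by exact: chart_at_dom.
have [ha _] := sa; have [_ _ aK _ _] := ha; have [[ob _ bK _ _] _] := sb; have [oa _ _ _ _] := ha.
pose W' := W `&` cdom a `&` f @^-1` cdom b.
have oW' : open W'.
  rewrite openE => y [[[[Uy cy] dy] ay] by_]; apply: filterI.
    by apply: filterI; apply: open_nbhs_nbhs; split.
  by apply: (fc y Uy); exact: open_nbhs_nbhs.
have o1 : open (coord c @` W') by apply: open_imgS => // y [[/Wc]].
exists (coord c @` W'); split=> //; first by exists x.
have h := (smE _ _).1 (fs a b (chart_at_atlas x) (chart_at_atlas (f x))).
apply: (@sm_ext R n _ o1 _ _ ((coord d \o icoord b) \o ((coord b \o f \o icoord a) \o (coord a \o icoord c)))).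
  by move=> _ [y [[[[Uy cy] dy] ay] by_] <-]; rewrite /= cK// aK// bK.
have o2 : open (coord b @` (cdom b `&` cdom d)) by apply: open_img => //; case: sb.
pose W2 := U `&` cdom a `&` f @^-1` cdom b.
have oW2 : open W2.
  rewrite openE => y [[Uy ay] by_]; apply: filterI.
    by apply: filterI; apply: open_nbhs_nbhs; split.
  by apply: (fc y Uy); exact: open_nbhs_nbhs.
have o3 : open (coord a @` W2) by apply: open_imgS => // y [[]].
apply: (sm_comp o1 o2 _ _ (trans_sm sb sd)).
  apply: (sm_comp o1 o3 _ _ h).
    by apply: sm_restrict (trans_sm sc sa) => _ [y [[[[Uy cy] dy] ay] by_] <-]; exists y.
  by move=> _ [y [[[[Uy cy] dy] ay] by_] <-]; rewrite /= cK//; exists y.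
by move=> _ [y [[[[Uy cy] dy] ay] by_] <-]; rewrite /= cK// aK//; exists (f y).
Qed.

Lemma smooth_tfun_chart (W0 : set M) (f : R -> M -> R) (c : @chart R M n) (e : R)
    (F : 'cV[R]_(1 + n) -> R) : 0 < e -> smooth_chart c -> open W0 -> W0 `<=` cdom c ->
  sm [set w : 'cV[R]_(1 + n) | - e < usubmx w ord0 ord0 < 1 + e /\ (coord c @` W0) (dsubmx w)]
     (fun w => (F w)%:M : 'M[R]_1) ->
  (forall (t : R) x, - e < t < 1 + e -> W0 x -> f t x = F (col_mx t%:M (coord c x))) ->
  smooth_tfun W0 f.
Proof.
move=> e0 sc oW Wc sF fF; exists e => // a aa; apply/sm1E.
have sa := atlas_smooth aa; have [ha _] := sa; have [_ _ aK _ _] := ha.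
have [hc _] := sc; have [_ _ cK _ _] := hc.
have ot (A : set 'cV[R]_n) : open A ->
    open [set w : 'cV[R]_(1 + n) | - e < usubmx w ord0 ord0 < 1 + e /\ A (dsubmx w)].
  move=> oA; rewrite openE => w [hw Aw]; apply: filterI.
    have := @open_box R n (- e) (1 + e) (`|dsubmx w| + 1).
    rewrite openE => /(_ w)[|e' e'0 he']; first by split=> //; rewrite ltrDl.
    by exists e' => // y /he'[].
  by apply: dsub_cont; exact: open_nbhs_nbhs.
have o1 : open (coord a @` (W0 `&` cdom a)) by rewrite setIC; exact: open_img.
have o2 : open (coord c @` W0) by exact: open_imgS.
apply: (@sm_ext R _ _ (ot _ o1) _ _
  ((fun w => (F w)%:M : 'M[R]_1) \o (fun w : 'cV[R]_(1 + n) => col_mx (usubmx w) ((coord c \o icoord a) (dsubmx w))))).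
  move=> w [hw [x [Wx ax] xE]]; rewrite /= -xE aK// (fF _ _ hw Wx); congr (F (col_mx _ _))%:M.
  exact: usub1.
apply: (sm_comp (ot _ o1) (ot _ o2) _ _ sF).
  apply: sm_col; first exact: ot.
    by apply: sm_usub; [exact: ot|exact: sm_id].
  apply: (sm_comp (ot _ o1) o1 _ _).
  - by apply: sm_dsub; [exact: ot|exact: sm_id].
  - by move=> w [].
  - apply: sm_restrict (trans_sm sa sc) => _ [x [Wx ax] <-]; exists x => //; split=> //; exact: Wc.
move=> w [hw [x [Wx ax] xE]]; rewrite /= col_mxKu col_mxKd -xE aK//; split=> //.
by exists x.
Qed.
End Maps2.
End Charts_and_maps.

(** * Darboux charts *)

Section Constant_symplectic_forms.
Context {R : realType}.
Lemma jacD n p (f : 'cV[R]_n -> 'cV[R]_p) u j : C1v f u -> dmx u (cvec j) f (jac f u *m cvec j).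
Proof. by move=> hf a b; rewrite (ord1 b); exact: C1v_derive. Qed.

(** The algebra behind the naturality of the exterior derivative: [T] stands for the second
    derivatives of the map, whose contribution cancels by symmetry. *)
Lemma skew_pull_alg n p (T : 'I_n -> 'M[R]_(n, p)) (x : 'cV[R]_p) (J : 'M[R]_(p, n)) (A : 'M[R]_p) a b :
  (forall i j k, T i j k = T j i k) ->
  (T b *m x + J^T *m (A *m (J *m cvec b))) a ord0 - (T a *m x + J^T *m (A *m (J *m cvec a))) b ord0 =
  (J^T *m (A - A^T) *m J) a b.
Proof.
move=> hT; rewrite mxE [X in _ - X]mxE opprD addrACA.
have -> : (T b *m x) a ord0 = (T a *m x) b ord0.
  by rewrite [LHS]mxE [RHS]mxE; apply: eq_bigr => k _; rewrite hT.
have E i j : (J^T *m (A *m (J *m cvec i))) j ord0 = (J^T *m A *m J) j i.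
  by rewrite !mulmxA -colE mxE.
rewrite subrr add0r !E mulmxBr mulmxBl [RHS]mxE [X in _ = _ + X]mxE; congr (_ - _).
have -> : J^T *m A^T *m J = (J^T *m A *m J)^T by rewrite !trmx_mul trmxK mulmxA.
by rewrite [RHS]mxE.
Qed.

Lemma rext1_pull n p (U : set 'cV[R]_n) (V : set 'cV[R]_p) (al : 'cV[R]_p -> 'cV[R]_p)
    (chi : 'cV[R]_n -> 'cV[R]_p) u : open U -> open V -> sm U chi -> sm V al -> U u -> V (chi u) ->
  rext1 (fun u => (jac chi u)^T *m al (chi u)) u =
  (jac chi u)^T *m rext1 al (chi u) *m jac chi u.
Proof.
move=> oU oV hchi hal Uu Vu.
have hJ := sm_jac oU hchi; have C := sm_C1v oU hchi Uu; have Ca := sm_C1v oV hal Vu.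
have D j : dmx u (cvec j) (fun u => (jac chi u)^T *m al (chi u))
   ((dmat j (jac chi) u)^T *m al (chi u) + (jac chi u)^T *m (jac al (chi u) *m (jac chi u *m cvec j))).
  apply: dmx_mul; first exact: dmx_tr (sm_dmx j oU hJ Uu).
  by move=> a b; rewrite (ord1 b); apply: is_derive_chainv => // i; exact: (jacD j C).
apply/matrixP => a b; rewrite (rext1E a b D).
apply: (@skew_pull_alg n p (fun i => (dmat i (jac chi) u)^T)) => i j k.
have E i' j' : (dmat i' (jac chi) u)^T j' k = 'D_(cvec i') (fun y => 'D_(cvec j') (fun w => chi w k ord0) y) u.
  by rewrite mxE mxE; congr ('D_(cvec i') _ u); apply/funext => y; rewrite mxE.
apply: eq_trans (E i j) _; apply: eq_trans _ (esym (E j i)).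
exact: (@schwarz R bool n (lift1 U) (fun _ w => chi w k ord0) true u i j (open_lift1 oU) (hchi 2%N k ord0) Uu).
Qed.

Lemma rext1_closed n (U : set 'cV[R]_n) (al : 'cV[R]_n -> 'cV[R]_n) : open U -> sm U al ->
  rclosed U (rext1 al).
Proof.
move=> oU hal u Uu a b c.
have [X [D S]] : exists X : 'I_n -> 'I_n -> 'I_n -> R,
    (forall i j k, 'D_(cvec i) (fun w => rext1 al w j k) u = X i k j - X i j k) /\
    forall i j k, X i j k = X j i k.
  exists (fun i j k => 'D_(cvec i) (fun y => 'D_(cvec j) (fun w => al w k ord0) y) u); split; last first.
    move=> i j k.
    exact: (@schwarz R bool n (lift1 U) (fun _ w => al w k ord0) true u i j (open_lift1 oU) (hal 2%N k ord0) Uu).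
  move=> i j k.
  have hJ := sm_jac oU hal.
  have h l q : is_derive u (cvec i) (fun y => 'D_(cvec l) (fun w => al w q ord0) y) ('D_(cvec i) (fun y => 'D_(cvec l) (fun w => al w q ord0) y) u).
    apply: DeriveDef => //.
    exact: (@CkP_derivable R bool n 0 (lift1 U) (fun _ y => 'D_(cvec l) (fun w => al w q ord0) y) (true, u) i (CkP_D l (hal 2%N q ord0)) Uu).
  have [_ <-] := is_derive_subf (h k j) (h j k).
  by congr ('D_(cvec i) _ u); apply/funext => y; rewrite !mxE.
by rewrite !D (S a c) (S b a) (S c b); ring.
Qed.

Lemma derive_translate n (g : 'cV[R]_n -> R) (a y v : 'cV[R]_n) :
  'D_v (fun y => g (y + a)) y = 'D_v g (y + a).
Proof.
have e : (fun h : R => h^-1 *: (((fun y => g (y + a)) \o shift y) (h *: v) - g (y + a))) =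
    (fun h : R => h^-1 *: ((g \o shift (y + a)) (h *: v) - g (y + a))).
  by apply/funext => h /=; rewrite addrA.
by rewrite /derive e.
Qed.

Lemma sm_translate n p q (U : set 'cV[R]_n) (f : 'cV[R]_n -> 'M[R]_(p, q)) (a : 'cV[R]_n) (V : set 'cV[R]_n) :
  open U -> open V -> sm U f -> (forall v, V v -> U (v + a)) -> sm V (fun v => f (v + a)).
Proof.
move=> oU oV hf h; apply: (sm_comp oV oU _ h hf).
by apply: sm_add => //; [exact: sm_id|exact: sm_cst].
Qed.

(** Near each point the closed form has a primitive by [radial_primitive]; the pull-back is then the
    exterior derivative of the pulled-back primitive, hence closed. This avoids differentiating a
    triple product. *)
Lemma closed_pull n p (U : set 'cV[R]_n) (V : set 'cV[R]_p) (F : 'cV[R]_p -> 'M[R]_p)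
    (chi : 'cV[R]_n -> 'cV[R]_p) : open U -> open V -> sm U chi -> sm V F ->
  (forall u, U u -> V (chi u)) -> (forall v, V v -> (F v)^T = - F v) -> rclosed V F ->
  rclosed U (fun u => (jac chi u)^T *m F (chi u) *m jac chi u).
Proof.
move=> oU oV hchi hF UV sk cl u0 Uu0.
set v0 := chi u0; have Vv0 : V v0 by exact: UV.
have [r r0 hr] : exists2 r : R, 0 < r & forall v, `|v| < r -> V (v + v0).
  have [r r0 hr] := @near_norm R p v0 V (open_nbhs_nbhs (conj oV Vv0)).
  by exists r => // v vr; apply: hr; rewrite addrK.
pose B := [set v : 'cV[R]_p | `|v| < r]; have oB : open B by exact: open_ball0.
pose F0 v := F (v + v0).
have hF0 : sm B F0 by exact: (sm_translate oV oB hF hr).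
have [b [hb hC]] := radial_primitive hF0.
have sk0 x : `|x| < r -> (1%:M *m F0 x)^T = - (1%:M *m F0 x).
  by move=> xr; rewrite mul1mx; apply: sk; exact: hr.
have cl0 : rclosed B (fun x => 1%:M *m F0 x).
  move=> x Bx i j k.
  have D i' j' k' : 'D_(cvec i') (fun w => (1%:M *m F0 w) j' k') x = 'D_(cvec i') (fun w => F w j' k') (x + v0).
    rewrite -(derive_translate (fun w => F w j' k') v0 x (cvec i')).
    by congr ('D_(cvec i') _ x); apply/funext => y; rewrite mul1mx.
  by rewrite !D; apply: cl; exact: hr.
have E := hC 1%:M sk0 cl0.
pose al x := 1%:M *m (b x *m x).
have hal : sm B al by apply: sm_mul => //; [exact: sm_cst|apply: sm_mul => //; exact: sm_id].
pose chi0 u := chi u - v0.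
pose U' := U `&` chi0 @^-1` B.
have hchi0 : sm U chi0 by apply: sm_subr => //; exact: sm_cst.
have oU' : open U'.
  rewrite openE => u [Uu Bu]; apply: filterI; first exact: open_nbhs_nbhs.
  by apply: (C1v_continuous (sm_C1v oU hchi0 Uu)); exact: open_nbhs_nbhs.
have hchi0' : sm U' chi0 by apply: sm_restrict hchi0 => u [].
have J0 u : U u -> jac chi0 u = jac chi u.
  move=> Uu; apply: jacE => i j.
  have := dmx_sub (jacD j (sm_C1v oU hchi Uu)) (dmx_cst u (cvec j) v0).
  by move=> /(_ i ord0); rewrite subr0 -colE mxE.
have Bu0 : B (chi0 u0) by rewrite /B /chi0 /= subrr normr0.
have hal' : sm U' (fun u => (jac chi0 u)^T *m al (chi0 u)).
  apply: sm_mul => //; first by apply: sm_tr => //; exact: sm_jac.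
  by apply: (sm_comp oU' oB hchi0' _ hal) => u [].
have := rext1_closed oU' hal' (conj Uu0 Bu0).
move=> H i j k; rewrite -[RHS](H i j k).
have n1 : \forall u \near u0, U' u by exact: open_nbhs_nbhs.
have D i' j' k' : 'D_(cvec i') (fun u => ((jac chi u)^T *m F (chi u) *m jac chi u) j' k') u0 =
   'D_(cvec i') (fun w => rext1 (fun u => (jac chi0 u)^T *m al (chi0 u)) w j' k') u0.
  apply: near_eq_derive; apply: filterS n1 => u [Uu Bu].
  rewrite (rext1_pull oU' oB hchi0' hal (conj Uu Bu) Bu) E//.
  by rewrite mul1mx J0// /F0 /chi0 subrK.
by rewrite !D.
Qed.

Section HolSymp.
Variables (m : nat) (Z : @holSymp R m).

Lemma re_mx_mul p q r (A : 'M[R[i]]_(p, q)) (B : 'M[R]_(q, r)) : re_mx (A *m cmx B) = re_mx A *m B.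
Proof.
apply/matrixP => i j; rewrite !mxE (raddf_sum (@complex.Re R)); apply: eq_bigr => k _; rewrite !mxE.
by case: (A i k) => a b /=; rewrite mulr0 subr0.
Qed.

Lemma im_mx_mul p q r (A : 'M[R[i]]_(p, q)) (B : 'M[R]_(q, r)) : im_mx (A *m cmx B) = im_mx A *m B.
Proof.
apply/matrixP => i j; rewrite !mxE (raddf_sum (@complex.Im R)); apply: eq_bigr => k _; rewrite !mxE.
by case: (A i k) => a b /=; rewrite mulr0 add0r.
Qed.

Lemma re_mx_mull p q r (A : 'M[R]_(p, q)) (B : 'M[R[i]]_(q, r)) : re_mx (cmx A *m B) = A *m re_mx B.
Proof.
apply/matrixP => i j; rewrite !mxE (raddf_sum (@complex.Re R)); apply: eq_bigr => k _; rewrite !mxE.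
by case: (B k j) => a b /=; rewrite mul0r subr0.
Qed.

Lemma im_mx_mull p q r (A : 'M[R]_(p, q)) (B : 'M[R[i]]_(q, r)) : im_mx (cmx A *m B) = A *m im_mx B.
Proof.
apply/matrixP => i j; rewrite !mxE (raddf_sum (@complex.Im R)); apply: eq_bigr => k _; rewrite !mxE.
by case: (B k j) => a b /=; rewrite mul0r addr0.
Qed.

Lemma cmx_tr p q (A : 'M[R]_(p, q)) : (cmx A)^T = cmx A^T.
Proof. by apply/matrixP => i j; rewrite !mxE. Qed.

Lemma mx_complexP p q (A B : 'M[R[i]]_(p, q)) : re_mx A = re_mx B -> im_mx A = im_mx B -> A = B.
Proof.
move=> /matrixP h1 /matrixP h2; apply/matrixP => i j; have := h1 i j; have := h2 i j; rewrite !mxE.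
by case: (A i j) => a b; case: (B i j) => a' b' /= -> ->.
Qed.

(** The imaginary part of [Omega I = i Omega]. *)
Lemma Omega_re (y : Z) : re_mx (Omega y) = omegaZ y *m cpxZ y.
Proof.
have [[_ h] _ _ _ _] := OmegaP Z; have := congr1 im_mx (h y).
rewrite im_mx_mul => ->; apply/matrixP => i j; rewrite !mxE.
by case: (Omega y i j) => a b /=; rewrite mul0r mul1r add0r.
Qed.

Lemma omega_skew (y : Z) : (omegaZ y)^T = - omegaZ y.
Proof.
have [[h _] _ _ _ _] := OmegaP Z; apply/matrixP => i j.
have := congr1 (fun M : 'M[R[i]]_m => complex.Im (M i j)) (h y); rewrite !mxE => ->.
by case: (Omega y i j).
Qed.

Lemma omegaJ_skew (y : Z) : (omegaZ y *m cpxZ y)^T = - (omegaZ y *m cpxZ y).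
Proof.
rewrite -Omega_re; have [[h _] _ _ _ _] := OmegaP Z; apply/matrixP => i j.
have := congr1 (fun M : 'M[R[i]]_m => complex.Re (M i j)) (h y); rewrite !mxE => ->.
by case: (Omega y i j).
Qed.

Lemma omegaJ_swap (y : Z) : (cpxZ y)^T *m omegaZ y = omegaZ y *m cpxZ y.
Proof.
by have := omegaJ_skew y; rewrite trmx_mul omega_skew mulmxN => /eqP; rewrite eqr_opp => /eqP.
Qed.

Lemma omega_unit (y : Z) : omegaZ y \in unitmx.
Proof.
apply: unitmx_inj => v wv; have [_ _ _ _ nd] := OmegaP Z; apply: (nd y).
apply: mx_complexP; rewrite ?re_mx_mul ?im_mx_mul.
  rewrite Omega_re -omegaJ_swap -mulmxA wv mulmx0.
  by apply/matrixP => i j; rewrite !mxE.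
by rewrite -/(omegaZ y) wv; apply/matrixP => i j; rewrite !mxE.
Qed.
End HolSymp.
(* Moser's argument applied simultaneously to both parts of the holomorphic
   symplectic form, which share the same primitive up to the complex structure. *)
Lemma darboux_chart m (Z : @holSymp R m) (z : Z) :
  exists (c : @chart R Z m) (J0 w0 : 'M[R]_m),
    [/\ smooth_chart c, cdom c z, coord c z = 0 & forall y, cdom c y ->
      tr c y *m cpxZ y = J0 *m tr c y /\ omegaZ y = (tr c y)^T *m w0 *m tr c y].
Proof.
(* In the holomorphic chart [c] the complex structure is the constant [J0]; smoothness and
   closedness of [Omega] are given in charts of the atlas such as [a], and have to be transported to
   [c]. *)
have [_ /(_ z)[J0 [c [[sc cJ] cz]]]] := @cpxZP R m Z.
set a := chart_at z; have sa : smooth_chart a by exact: chart_at_smooth.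
have az : cdom a z by exact: chart_at_dom.
have aat : atlas a by exact: chart_at_atlas.
have [hc _] := sc; have [oc oic cK _ _] := hc; have [ha _] := sa; have [oa oia aK _ _] := ha.
have [[Osk OJ] Osm Ohol Ocl Ond] := OmegaP Z.
pose Wa u := im_mx (rep_form a (@Omega R m Z) u).
pose Ba u := re_mx (rep_form a (@Omega R m Z) u).
have WaE u : Wa u = (invmx (tr a (icoord a u)))^T *m omegaZ (icoord a u) *m invmx (tr a (icoord a u)).
  by rewrite /Wa /rep_form cmx_tr im_mx_mul im_mx_mull.
have BaE u : Ba u = (invmx (tr a (icoord a u)))^T *m (omegaZ (icoord a u) *m cpxZ (icoord a u)) *m invmx (tr a (icoord a u)).
  by rewrite /Ba /rep_form cmx_tr re_mx_mul re_mx_mull Omega_re.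
have sWa : sm (cimg a) Wa.
  move=> k i j; have [_ /(_ k) h] := Osm a aat i j.
  apply: (CkP_ext _ _ ((CkE _ _ _).1 h)); first exact: open_lift1.
  by move=> q _; rewrite [RHS]mxE.
have sBa : sm (cimg a) Ba.
  move=> k i j; have [/(_ k) h _] := Osm a aat i j.
  apply: (CkP_ext _ _ ((CkE _ _ _).1 h)); first exact: open_lift1.
  by move=> q _; rewrite [RHS]mxE.
have clW : rclosed (cimg a) Wa.
  move=> u cu i j k; have := congr1 (@complex.Im R) (Ocl a aat u cu i j k).
  rewrite !raddfD /= => H; rewrite -[RHS]H.
  have E q i' j' : 'D_(cvec q) (fun w => Wa w i' j') u = 'D_(cvec q) (fun w => complex.Im (rep_form a (@Omega R m Z) w i' j')) u.
    by congr ('D_(cvec q) _ u); apply/funext => w; rewrite /Wa [LHS]mxE.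
  by rewrite !E.
have clB : rclosed (cimg a) Ba.
  move=> u cu i j k; have := congr1 (@complex.Re R) (Ocl a aat u cu i j k).
  rewrite !raddfD /= => H; rewrite -[RHS]H.
  have E q i' j' : 'D_(cvec q) (fun w => Ba w i' j') u = 'D_(cvec q) (fun w => complex.Re (rep_form a (@Omega R m Z) w i' j')) u.
    by congr ('D_(cvec q) _ u); apply/funext => w; rewrite /Ba [LHS]mxE.
  by rewrite !E.
have skW u : cimg a u -> (Wa u)^T = - Wa u.
  by move=> _; rewrite WaE !trmx_mul trmxK omega_skew mulNmx mulmxN mulmxA.
have skB u : cimg a u -> (Ba u)^T = - Ba u.
  by move=> _; rewrite BaE trmx_mul (trmx_mul (invmx _)^T) trmxK omegaJ_skew mulNmx mulmxN mulmxA.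
have cJi y : cdom c y -> cpxZ y *m invmx (tr c y) = invmx (tr c y) *m J0.
  move=> cy; have uc := tr_unit sc cy; rewrite -[LHS](mulKmx uc) [tr c y *m (_ *m _)]mulmxA cJ//.
  by rewrite mulmxK.
set u0 := coord c z.
have [r r0 hr] : exists2 r : R, 0 < r & forall v, `|v| < r -> (coord c @` (cdom c `&` cdom a)) (v + u0).
  have o : open (coord c @` (cdom c `&` cdom a)) by exact: open_img.
  have [|r r0 hr] := @near_norm R m u0 (coord c @` (cdom c `&` cdom a)).
    by apply: open_nbhs_nbhs; split=> //; exists z.
  by exists r => // v vr; apply: hr; rewrite addrK.
pose U := [set v : 'cV[R]_m | `|v| < r]; have oU : open U by exact: open_ball0.
(* The transition to [a] from [c] recentred so that [z] is at 0. *)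
pose chi v := (coord a \o icoord c) (v + u0).
have hchi : sm U chi.
  apply: (sm_translate (f := coord a \o icoord c) _ oU (trans_sm sc sa) hr).
  exact: open_img.
have Ua v : U v -> cimg a (chi v).
  by move=> /hr[y [cy ay] yE]; rewrite /chi /= -yE cK//; exists y.
pose y_ v := icoord c (v + u0).
have yP v : U v -> [/\ cdom c (y_ v), cdom a (y_ v) & coord c (y_ v) = v + u0].
  by move=> /hr[y [cy ay] yE]; rewrite /y_ -yE cK.
have chiy v : U v -> icoord a (chi v) = y_ v.
  by move=> /yP[_ ay _]; rewrite /chi /= aK.
have trE v : U v -> tr a (y_ v) = jac chi v *m tr c (y_ v).
  move=> Uv; have [cy ay yE] := yP v Uv.
  rewrite (tr_trans sc sa cy ay) yE; congr (_ *m _); apply/matrixP => i j; rewrite !mxE.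
  by rewrite -(derive_translate (fun w => (coord a \o icoord c) w i ord0) u0 v).
have pullE (G : Z -> 'M[R]_m) v : U v ->
    (jac chi v)^T *m ((invmx (tr a (icoord a (chi v))))^T *m G (icoord a (chi v)) *m invmx (tr a (icoord a (chi v)))) *m jac chi v =
    (invmx (tr c (y_ v)))^T *m G (y_ v) *m invmx (tr c (y_ v)).
  move=> Uv; have [cy ay yE] := yP v Uv; rewrite chiy//.
  have e : invmx (tr a (y_ v)) *m jac chi v = invmx (tr c (y_ v)).
    have uc := tr_unit sc cy; have ua := tr_unit sa ay.
    by apply: (can_inj (mulmxK uc)); rewrite -mulmxA -trE// !mulVmx.
  by rewrite -e trmx_mul !mulmxA.
pose W v := (jac chi v)^T *m Wa (chi v) *m jac chi v.
pose B v := (jac chi v)^T *m Ba (chi v) *m jac chi v.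
have WE v : U v -> W v = (invmx (tr c (y_ v)))^T *m omegaZ (y_ v) *m invmx (tr c (y_ v)).
  by move=> Uv; rewrite /W WaE; exact: pullE.
(* With [J0] constant, the real part of [Omega] is a constant matrix times its imaginary part, as
   [moser] requires. *)
have BE v : U v -> B v = J0^T *m W v.
  move=> Uv; have [cy ay yE] := yP v Uv; rewrite WE// /B BaE (pullE (fun y => omegaZ y *m cpxZ y))// -omegaJ_swap !mulmxA -trmx_mul.
  congr (_ *m _ *m _); rewrite -trmx_mul; congr (_^T).
  exact: cJi.
have sW : sm U W.
  have hJ := sm_jac oU hchi; have h : sm U (Wa \o chi) by apply: (sm_comp oU oia hchi Ua sWa).
  by apply: sm_mul => //; apply: sm_mul => //; exact: sm_tr.
have U0 : U 0 by rewrite /U /= normr0.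
have W0u : W 0 \in unitmx.
  have [cy _ _] := yP 0 U0; have uc := tr_unit sc cy.
  by rewrite WE// !unitmx_mul unitmx_tr !unitmx_inv uc omega_unit.
have Wsk v : U v -> (W v)^T = - W v.
  by move=> Uv; rewrite /W !trmx_mul trmxK skW ?mulNmx ?mulmxN ?mulmxA//; exact: Ua.
have clW' := closed_pull oU oia hchi sWa Ua skW clW.
have clB' := closed_pull oU oia hchi sBa Ua skB clB.
have ext_closed (F G : 'cV[R]_m -> 'M[R]_m) : (forall v, U v -> F v = G v) -> rclosed U F -> rclosed U G.
  move=> FG cF v Uv i j k; rewrite -[RHS](cF v Uv i j k).
  have n1 : \forall w \near v, U w by exact: open_nbhs_nbhs.
  have E q i' j' : 'D_(cvec q) (fun w => G w i' j') v = 'D_(cvec q) (fun w => F w i' j') v.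
    by apply: near_eq_derive; apply: filterS n1 => w Uw; rewrite FG.
  by rewrite !E.
have g1 : (forall x, U x -> (1%:M *m W x)^T = - (1%:M *m W x)) /\ rclosed U (fun x => 1%:M *m W x).
  split; first by move=> x Ux; rewrite mul1mx; exact: Wsk.
  by apply: ext_closed clW' => v _; rewrite mul1mx.
have gJ : (forall x, U x -> (J0^T *m W x)^T = - (J0^T *m W x)) /\ rclosed U (fun x => J0^T *m W x).
  split; last by apply: ext_closed clB' => v Uv; rewrite -BE.
  move=> x Ux; rewrite -BE// /B trmx_mul (trmx_mul (jac chi x)^T) trmxK skB ?mulNmx ?mulmxN ?mulmxA//; exact: Ua.
have [d [Phi [d0 sPhi Phi0 hPhi]]] := moser r0 sW W0u g1 gJ.
pose D := [set x : 'cV[R]_m | `|x| < d]; have oD : open D by exact: open_ball0.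
have D0 : D 0 by rewrite /D /= normr0.
have [_ J0u _ _] := hPhi 0 D0.
have [V [oV V0 VD oPV [_ [g sg gK]]]] := ift oD sPhi D0 J0u.
pose V' := [set u : 'cV[R]_m | (Phi @` V) (u - u0)].
have tc (u : 'cV[R]_m) : {for u, continuous (fun u : 'cV[R]_m => u - u0)}.
  apply: C1v_continuous; apply: (sm_C1v (@openT _)) => //.
  by apply: sm_subr; [exact: openT|exact: sm_id|exact: sm_cst].
have oV' : open V'.
  rewrite openE => u Vu; apply: (tc u); exact: open_nbhs_nbhs.
have V'c : V' `<=` cimg c.
  move=> u [v Vv vE]; have [Uv _ _ _] := hPhi v (VD _ Vv).
  by have [y [cy _] yE] := hr _ Uv; exists y => //; rewrite yE vE subrK.
(* The new coordinates are given by the inverse of Moser's map, up to the translation by [u0]. *)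
pose g' (u : 'cV[R]_m) := g (u - u0); pose Phi' (v : 'cV[R]_m) := Phi v + u0.
have gV' : g' @` V' = V.
  apply/seteqP; split=> [_ [u [v Vv vE] <-]|v Vv]; first by rewrite /g' -vE gK.
  by exists (Phi v + u0); [rewrite /V' /= addrK; exists v|rewrite /g' addrK gK].
have sPhiV : sm V Phi by exact: (sm_restrict VD sPhi).
have sg' : sm V' g'.
  by apply: (sm_translate (f := g) oPV oV' sg) => u.
have sPhi' : sm (g' @` V') Phi'.
  by rewrite gV'; apply: sm_add => //; exact: sm_cst.
have ogV : open (g' @` V') by rewrite gV'.
have PK u : V' u -> Phi' (g' u) = u.
  by move=> [v Vv vE]; rewrite /Phi' /g' -vE gK// vE subrK.
have sc' := rechart_smooth sc oV' V'c sg' ogV sPhi' PK.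
exists (rechart c V' g' Phi'), J0, (W 0); split=> //.
- by split=> //=; rewrite /V' /= subrr; exists 0.
- by rewrite /= /g' subrr -{1}Phi0 gK.
move=> y cy'; have [cy [v Vv vE]] := cy'.
have Dv := VD _ Vv; have [Uv Jv k1 k2] := hPhi v Dv.
have yE : y_ (Phi v) = y by rewrite /y_ vE subrK cK.
have T : tr c y = jac Phi v *m tr (rechart c V' g' Phi') y.
  rewrite (rechart_tr sc oV' sg' cy') mulmxA.
  have gv : g' (coord c y) = v by rewrite /g' -vE gK.
  have -> : jac Phi v *m jac g' (coord c y) = jac (Phi' \o g') (coord c y).
    have CPhi : C1v Phi v by exact: (sm_C1v oD sPhi Dv).
    have Vy : V' (coord c y) by rewrite /V' /= -vE; exists v.
    have C1 : C1v Phi' (g' (coord c y)) by apply: (sm_C1v ogV sPhi'); exists (coord c y).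
    have C2 : C1v g' (coord c y) by exact: (sm_C1v oV' sg').
    rewrite (jac_comp C1 C2) gv; congr (_ *m _); apply/esym/jacE => i j.
    by have := dmx_add (jacD j CPhi) (dmx_cst v (cvec j) u0) i ord0; rewrite addr0 -colE mxE.
  have -> : jac (Phi' \o g') (coord c y) = 1%:M.
    rewrite -(jac_id (coord c y)); apply: jac_near.
    have n1 : \forall w \near coord c y, V' w.
      by apply: open_nbhs_nbhs; split=> //; rewrite /V' /= -vE; exists v.
    by apply: filterS n1 => w Vw; exact: PK.
  by rewrite mul1mx.
have uc := tr_unit sc cy.
have oE : omegaZ y = (tr c y)^T *m W (Phi v) *m tr c y.
  by rewrite WE// yE trmx_inv !mulmxA mulmxV ?unitmx_tr// mul1mx mulmxKV.
split; last first.
  by rewrite oE T trmx_mul -k1 !mulmxA.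
have JW : J0^T *m W (Phi v) = W (Phi v) *m J0.
  rewrite -BE// WE// yE /B BaE (pullE (fun y => omegaZ y *m cpxZ y))// yE -!mulmxA; congr (_ *m (_ *m _)).
  exact: cJi.
set Y := jac Phi v in T k1 k2 Jv; set t' := tr _ y in T.
have J0W : J0^T *m W 0 = W 0 *m J0.
  have [cy0 _ _] := yP 0 U0.
  rewrite -BE// WE// /B BaE (pullE (fun y => omegaZ y *m cpxZ y))// -!mulmxA; congr (_ *m (_ *m _)).
  exact: cJi.
(* The derivative of Moser's map carries both [W] and [J0^T *m W] to their values at 0, hence
   commutes with [J0]: the Darboux coordinates are still holomorphic. *)
have YJ : J0 *m Y = Y *m J0.
  have e : Y^T *m W (Phi v) *m (J0 *m Y) = Y^T *m W (Phi v) *m (Y *m J0).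
    rewrite [RHS]mulmxA k1 -J0W -k2 JW !mulmxA//.
  have uYW : Y^T *m W (Phi v) \in unitmx.
    by rewrite unitmx_mul unitmx_tr Jv; move: W0u; rewrite -k1 !unitmx_mul => /andP[/andP[_ ->]].
  exact: (can_inj (mulKmx uYW)).
apply: (can_inj (mulKmx Jv)); rewrite mulmxA -T cJ// mulmxA -YJ -mulmxA -T.
by [].
Qed.
End Constant_symplectic_forms.

(** * The family of bisections in coordinates *)

Section Local_model.
Context {R : realType}.
Definition bal n (r : R) : set 'cV[R]_n := [set u | `|u| < r].

Lemma open_bal n r : open (@bal n r). Proof. exact: open_ball0. Qed.

Section Family.
Variables (n : nat) (rho r0 : R) (th : 'cV[R]_n -> 'cV[R]_n).
Hypotheses (rho0 : 0 < rho) (r00 : 0 < r0).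
Local Notation Zb := (@bal (n + n) rho).
Local Notation Qb := (@bal n r0).
Hypotheses (sth : sm Qb th) (th0 : th 0 = 0).

(** The point of [L_t] over [q], for [w = (t, q)]; the time is a 1 x 1 block, so the product is
    [t theta(q)]. *)
Definition graph_at (w : 'cV[R]_(1 + n)) : 'cV[R]_(n + n) :=
  col_mx (dsubmx w) (th (dsubmx w) *m usubmx w).

Definition tbox (e : R) : set 'cV[R]_(1 + n) :=
  [set w | - e < usubmx w ord0 ord0 < 1 + e /\ `|dsubmx w| < e].

Local Notation E0 := [set w : 'cV[R]_(1 + n) | Qb (dsubmx w)].
Let oB0 : open Qb. Proof. exact: open_bal. Qed.
Let oO : open Zb. Proof. exact: open_bal. Qed.
Let oE0 : open E0.
Proof. by rewrite openE => w Bw; apply: dsub_cont; exact: open_nbhs_nbhs. Qed.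

Lemma sm_graph : sm E0 graph_at.
Proof.
have hd : sm E0 (fun w : 'cV[R]_(1 + n) => dsubmx w) by apply: sm_dsub => //; exact: sm_id.
apply: sm_col => //; apply: sm_mul => //.
  by apply: (sm_comp oE0 oB0 hd _ sth).
by apply: sm_usub => //; exact: sm_id.
Qed.

Local Notation O0 := (E0 `&` graph_at @^-1` Zb).
Let oO0 : open O0.
Proof.
rewrite openE => w [Ew Ow]; apply: filterI; first exact: open_nbhs_nbhs.
by apply: (C1v_continuous (sm_C1v oE0 sm_graph Ew)); exact: open_nbhs_nbhs.
Qed.

Lemma graph0 (t : R) : graph_at (col_mx t%:M 0) = 0.
Proof. by rewrite /graph_at col_mxKu col_mxKd th0 mul0mx col_mx0. Qed.

Lemma O0_zero (t : R) : O0 (col_mx t%:M 0).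
Proof. by split; rewrite /bal /= ?graph0 ?col_mxKd normr0. Qed.

Lemma th_C1v q : Qb q -> C1v th q. Proof. exact: (sm_C1v oB0 sth). Qed.

Lemma graph_rjac w : E0 w ->
  rsubmx (jac graph_at w) = col_mx 1%:M (usubmx w ord0 ord0 *: jac th (dsubmx w)).
Proof.
move=> Ew; rewrite -[w]vsubmxK (usub1 w) in Ew *; set t := usubmx w ord0 ord0; set q := dsubmx w in Ew *.
have [_ _ /(_ q Ew) <-] := sm_slice (t%:M) oE0 sm_graph.
have C : C1v th q by apply: th_C1v; move: Ew; rewrite /= col_mxKd.
rewrite col_mxKu col_mxKd mxE eqxx mulr1n; apply: jacE => i j.
case: (split_ordP i) => k ->.
  rewrite col_mxEu (_ : (fun _ => _) = fun q : 'cV[R]_n => q k ord0).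
    by apply: is_derive_eq (is_derive_coord k j q) _; rewrite mxE.
  by apply/funext => q'; rewrite /graph_at col_mxEu col_mxKd.
rewrite col_mxEd (_ : (fun _ => _) = fun q : 'cV[R]_n => t * th q k ord0).
  apply: is_derive_eq (is_derive_mulf (is_derive_cst t _ _) (jacD j C k ord0)) _.
  by rewrite mul0r add0r -colE mxE [RHS]mxE.
by apply/funext => q'; rewrite /graph_at col_mxEd col_mxKd col_mxKu mul_mx_scalar mxE.
Qed.

Lemma dmx_graph (q : R -> 'cV[R]_n) (t : R) q' : Qb (q t) -> dmx t 1 q q' ->
  dmx t 1 (fun s => graph_at (col_mx s%:M (q s))) (col_mx q' (th (q t) + t *: (jac th (q t) *m q'))).
Proof.
move=> Bq hq i j; rewrite (ord1 j); case: (split_ordP i) => k ->.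
  rewrite col_mxEu (_ : (fun _ => _) = fun s => q s k ord0); first exact: hq.
  by apply/funext => s; rewrite /graph_at col_mxEu col_mxKd.
rewrite col_mxEd (_ : (fun _ => _) = fun s => s * th (q s) k ord0).
  have h := is_derive_chainv k (th_C1v Bq) (fun i => hq i ord0).
  apply: is_derive_eq (is_derive_mulf (is_derive_id t (1 : R)) h) _.
  by rewrite mul1r [RHS]mxE; congr (_ + _); rewrite [RHS]mxE.
by apply/funext => s; rewrite /graph_at col_mxEd col_mxKd col_mxKu mul_mx_scalar mxE.
Qed.

Definition lift_map (P : 'cV[R]_(n + n) -> 'cV[R]_n) (w : 'cV[R]_(1 + n)) : 'cV[R]_(1 + n) :=
  col_mx (usubmx w) (P (graph_at w)).

(** Jacobian in [q], at fixed time, of [P] along the graph; its invertibility is the transversality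
    of [L_t] to the kernel of the differential of [P]. *)
Definition slice_jac (P : 'cV[R]_(n + n) -> 'cV[R]_n) (w : 'cV[R]_(1 + n)) : 'M[R]_n :=
  jac P (graph_at w) *m col_mx 1%:M (usubmx w ord0 ord0 *: jac th (dsubmx w)).

(** [uniform_ift] for the restrictions of a projection to all the [L_t] at once. The conclusion
    holds for every [e <= e0], so that the two projections can share a single box. *)
Lemma family_inverse (P : 'cV[R]_(n + n) -> 'cV[R]_n) : sm Zb P ->
  (forall t : R, 0 <= t <= 1 -> jac P 0 *m col_mx 1%:M (t *: jac th 0) \in unitmx) ->
  exists2 e0 : R, 0 < e0 & forall e : R, 0 < e <= e0 ->
    [/\ forall w, tbox e w -> Qb (dsubmx w) /\ Zb (graph_at w), open (lift_map P @` tbox e),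
        forall w, tbox e w -> slice_jac P w \in unitmx
      & exists2 H : 'cV[R]_(1 + n) -> 'cV[R]_n, sm (lift_map P @` tbox e) H
          & forall w, tbox e w -> H (lift_map P w) = dsubmx w].
Proof.
move=> sP uP; pose G := P \o graph_at.
have sG : sm O0 G.
  apply: (sm_comp oO0 oO _ _ sP); first by apply: sm_restrict sm_graph => w [].
  by move=> w [].
have rJ w : O0 w -> rsubmx (jac G w) = jac P (graph_at w) *m col_mx 1%:M (usubmx w ord0 ord0 *: jac th (dsubmx w)).
  move=> [Ew Ow]; rewrite /G jac_comp; first by rewrite -mulmx_rsub graph_rjac.
    exact: (sm_C1v oO sP).
  exact: (sm_C1v oE0 sm_graph Ew).
have [t t01|e0 e00 /= [DO oG uG [H sH HK]]] := uniform_ift oO0 sG (fun t _ => O0_zero t).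
  rewrite rJ; last exact: O0_zero.
  by rewrite graph0 col_mxKu col_mxKd mxE eqxx mulr1n; exact: uP.
exists e0 => // e /andP[ep ee]; set Gh := lift_map P.
have sub : tbox e `<=` tbox e0.
  move=> w [/andP[h1 h2] h3]; split; last exact: lt_le_trans ee.
  by apply/andP; split; lra.
have oT : open (tbox e) by exact: open_box.
split.
- by move=> w /sub/DO[].
(* The image of the smaller box is cut out of the larger image by the smooth inverse, hence open. *)
- have -> : Gh @` tbox e = Gh @` tbox e0 `&` (fun v => col_mx (usubmx v) (H v)) @^-1` tbox e.
    apply/seteqP; split=> [_ [w Tw <-]|v [[w Tw wv]]].
      split; first by exists w => //; exact: sub.
      rewrite /= (_ : usubmx (Gh w) = usubmx w); last by rewrite /Gh /lift_map col_mxKu.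
      by rewrite (_ : H (Gh w) = dsubmx w) ?vsubmxK//; exact: (HK w (sub _ Tw)).
    rewrite -wv /= (_ : usubmx (Gh w) = usubmx w); last by rewrite /Gh /lift_map col_mxKu.
    by rewrite (_ : H (Gh w) = dsubmx w) ?vsubmxK//; [exists w|exact: (HK w Tw)].
  rewrite openE => v [Gv Tv]; apply: filterI; first exact: open_nbhs_nbhs.
  have c : {for v, continuous (fun v => col_mx (usubmx v) (H v) : 'cV[R]_(1 + n))}.
    apply: cont_col_mx; first exact: usub_cont.
    by apply: C1v_continuous; exact: (sm_C1v oG sH).
  by apply: c; exact: open_nbhs_nbhs.
- by move=> w Tw; have Tw0 := sub _ Tw; rewrite /slice_jac -rJ; [exact: uG|exact: DO].
- exists H; last by move=> w /sub; exact: HK.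
  by apply: sm_restrict sH => _ [w Tw <-]; exists w => //; exact: sub.
Qed.
End Family.
Lemma sm1_C1at n (U : set 'cV[R]_n) (F : 'cV[R]_n -> R) u : open U ->
  sm U (fun u => (F u)%:M : 'M[R]_1) -> U u -> C1at F u.
Proof.
move=> oU sF Uu; have := sm_C1 ord0 ord0 oU sF Uu.
by rewrite (_ : (fun x => _) = F)//; apply/funext => x; rewrite mxE.
Qed.

Lemma dmx_time n p (F : 'cV[R]_(1 + n) -> 'cV[R]_p) (t : R) (y : 'cV[R]_n) :
  C1v F (col_mx t%:M y) ->
  dmx t 1 (fun s => F (col_mx s%:M y)) (jac F (col_mx t%:M y) *m col_mx 1%:M 0).
Proof.
move=> C i j; rewrite (ord1 j); apply: (is_derive_chainv (g := fun s => col_mx s%:M y)) => // k.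
case: (split_ordP k) => l ->; rewrite ?col_mxEu ?col_mxEd.
  rewrite (_ : (fun _ => _) = fun s : R => s); last first.
    by apply/funext => s; rewrite col_mxEu (ord1 l) !mxE.
  by apply: is_derive_eq (is_derive_id t (1 : R)) _; rewrite (ord1 l) !mxE.
rewrite (_ : (fun _ => _) = fun s : R => y l ord0); last by apply/funext => s; rewrite col_mxEd.
by rewrite mxE; exact: is_derive_cst.
Qed.

Lemma grad_slice n (A : set 'cV[R]_(1 + n)) (F : 'cV[R]_(1 + n) -> R) (s : 'cV[R]_1) : open A ->
  sm A (fun w => (F w)%:M : 'M[R]_1) ->
  open [set q | A (col_mx s q)] /\ sm [set q | A (col_mx s q)] (fun q => (F (col_mx s q))%:M : 'M[R]_1).
Proof. by move=> oA sF; have [] := sm_slice s oA sF. Qed.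

(** Poisson matrix of the standard symplectic form, the inverse of [block_mx 0 1%:M (- 1%:M) 0]. *)
Definition iw n : 'M[R]_(n + n) := block_mx 0 (- 1%:M) 1%:M 0.

Lemma derive_rslice n (f : 'cV[R]_(1 + n) -> R) (s : 'cV[R]_1) (y : 'cV[R]_n) j :
  'D_(cvec j) (fun y => f (col_mx s y)) y = 'D_(cvec (rshift 1 j)) f (col_mx s y).
Proof.
have e : (fun h : R => h^-1 *: (((fun y => f (col_mx s y)) \o shift y) (h *: cvec j) - f (col_mx s y))) =
    (fun h : R => h^-1 *: ((f \o shift (col_mx s y)) (h *: cvec (rshift 1 j)) - f (col_mx s y))).
  apply/funext => h /=; congr (_ *: (f _ - _)).
  apply/matrixP => i k; rewrite (ord1 k); case: (split_ordP i) => l ->.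
    by rewrite !mxE (unsplitK (inl _ _)) eq_lrshift mulr0 add0r.
  by rewrite !mxE (unsplitK (inr _ _)) eq_rshift !mxE.
by rewrite /derive e.
Qed.

Lemma derive_lslice n (f : 'cV[R]_(1 + n) -> R) (t : R) (y : 'cV[R]_n) :
  'D_1 (fun s : R => f (col_mx s%:M y)) t = 'D_(cvec (lshift n ord0)) f (col_mx t%:M y).
Proof.
have e : (fun h : R => h^-1 *: (((fun s : R => f (col_mx s%:M y)) \o shift t) (h *: 1) - f (col_mx t%:M y))) =
    (fun h : R => h^-1 *: ((f \o shift (col_mx t%:M y)) (h *: cvec (lshift n ord0)) - f (col_mx t%:M y))).
  apply/funext => h /=; congr (_ *: (f _ - _)).
  apply/matrixP => i j; rewrite (ord1 j); case: (split_ordP i) => k ->.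
    by rewrite !mxE (unsplitK (inl _ _)) !mxE (ord1 k) !eqxx /= mulr1n.
  by rewrite !mxE (unsplitK (inr _ _)) eq_rlshift mulr0 add0r.
by rewrite /derive e.
Qed.

Lemma sm_grad n (U : set 'cV[R]_n) (F : 'cV[R]_n -> R) : open U ->
  sm U (fun u => (F u)%:M : 'M[R]_1) -> sm U (grad F).
Proof.
move=> oU sF; have sJ := sm_tr oU (sm_jac oU sF).
apply: (sm_ext oU _ sJ) => u Uu; apply/colP => i; rewrite !mxE.
by congr ('D_(cvec i) _ u); apply/funext => w; rewrite mxE.
Qed.

Section Model.
Variables (n : nat) (rho r0 e : R) (th : 'cV[R]_n -> 'cV[R]_n) (h : 'cV[R]_n -> R).
Variables (Pm Pp : 'cV[R]_(n + n) -> 'cV[R]_n) (Hm Hp : 'cV[R]_(1 + n) -> 'cV[R]_n).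
Variables (Jm Jp : 'M[R]_n) (J0 : 'M[R]_(n + n)) (G0 : 'M[R]_n) (Qm Qp : 'cV[R]_n -> 'M[R]_n).
Local Notation Zb := (@bal (n + n) rho).
Local Notation Qb := (@bal n r0).
Local Notation gr := (graph_at th).
Local Notation Gm := (lift_map th Pm).
Local Notation Gp := (lift_map th Pp).
Local Notation Am := (lift_map th Pm @` tbox e).
Local Notation Ap := (lift_map th Pp @` tbox e).
Local Notation Mt := (slice_jac th).
Local Notation ws := (block_mx 0 1%:M (- 1%:M) 0 : 'M[R]_(n + n)).

Hypotheses (e0 : 0 < e) (sth : sm Qb th) (th0 : th 0 = 0).
Hypotheses (sh : sm Qb (fun q => (h q)%:M : 'M[R]_1))
  (hth : forall q j, Qb q -> is_derive q (cvec j) h (th q j ord0))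
  (thsym : forall q, Qb q -> (jac th q)^T = jac th q).
Hypotheses (sPm : sm Zb Pm) (sPp : sm Zb Pp).
Hypotheses (grO : forall w, tbox e w -> Qb (dsubmx w) /\ Zb (gr w)).
Hypotheses (oAm : open Am) (oAp : open Ap).
Hypotheses (um : forall w, tbox e w -> Mt Pm w \in unitmx)
  (up : forall w, tbox e w -> Mt Pp w \in unitmx).
Hypotheses (sHm : sm Am Hm) (HmK : forall w, tbox e w -> Hm (Gm w) = dsubmx w).
Hypotheses (sHp : sm Ap Hp) (HpK : forall w, tbox e w -> Hp (Gp w) = dsubmx w).
Hypotheses (orth : forall u, Zb u -> jac Pm u *m iw n *m (jac Pp u)^T = 0).
Hypotheses (Qpm : forall u, Zb u -> jac Pm u *m iw n *m (jac Pm u)^T = - Qm (Pm u))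
  (Qpp : forall u, Zb u -> jac Pp u *m iw n *m (jac Pp u)^T = Qp (Pp u)).
Hypotheses (hJm : forall u, Zb u -> jac Pm u *m J0 = Jm *m jac Pm u)
  (hJp : forall u, Zb u -> jac Pp u *m J0 = Jp *m jac Pp u).
Hypothesis JL : J0 *m col_mx 1%:M 0 = col_mx 1%:M 0 *m G0.
Hypothesis wJ : J0^T *m ws = ws *m J0.

Let oO : open Zb. Proof. exact: open_bal. Qed.
Let oB0 : open Qb. Proof. exact: open_bal. Qed.
Let oT : open (tbox (n := n) e). Proof. exact: open_box. Qed.

(* In coordinates, with w = (t, y): [st w] is the point of L_t over y in X_-, [fp w]
   the value of h at the point of L_t over y in X_+, [fh w] the value f_t(y), and
   [psi w] the value psi_t(y). *)
Definition st (w : 'cV[R]_(1 + n)) := gr (col_mx (usubmx w) (Hm w)).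
Definition fp (w : 'cV[R]_(1 + n)) := h (Hp w).
Definition phi y := Pp (st (col_mx 0 y)).
Definition phi' x := Pm (gr (col_mx 0 (Hp (col_mx 0 x)))).
Definition fh (w : 'cV[R]_(1 + n)) := fp (col_mx (usubmx w) (phi (dsubmx w))).
Definition psi (w : 'cV[R]_(1 + n)) := phi' (Pp (st w)).
Local Notation Um := [set y : 'cV[R]_n | Am (col_mx 0 y)].
Local Notation Up := [set x : 'cV[R]_n | Ap (col_mx 0 x)].

Lemma GmK v : tbox e v -> st (Gm v) = gr v.
Proof. by move=> Tv; rewrite /st HmK// /lift_map col_mxKu vsubmxK. Qed.

Lemma AmP w : Am w -> exists v, [/\ tbox e v, w = Gm v, st w = gr v & usubmx v = usubmx w].
Proof. by move=> [v Tv <-]; exists v; split=> //; [exact: GmK|rewrite /lift_map col_mxKu]. Qed.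

Lemma Pm_st w : Am w -> Pm (st w) = dsubmx w.
Proof. by move=> /AmP[v [Tv -> -> _]]; rewrite /lift_map col_mxKd. Qed.

Lemma st_O w : Am w -> Zb (st w).
Proof. by move=> /AmP[v [Tv _ -> _]]; have [] := grO Tv. Qed.

Lemma Ap_st w : Am w -> Ap (col_mx (usubmx w) (Pp (st w))).
Proof. by move=> /AmP[v [Tv _ -> <-]]; exists v. Qed.

Lemma sm_grT : sm (tbox e) gr.
Proof. by apply: (sm_restrict _ (sm_graph sth)) => w /grO[]. Qed.

Lemma sm_st : sm Am st.
Proof.
apply: (@sm_comp R _ _ oAm _ _ _ (fun w => col_mx (usubmx w) (Hm w)) _ _ oT _ _ sm_grT).
  by apply: sm_col => //; apply: sm_usub => //; exact: sm_id.
by move=> w [v Tv <-]; rewrite HmK// /lift_map col_mxKu vsubmxK.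
Qed.

Lemma sm_fp : sm Ap (fun w => (fp w)%:M : 'M[R]_1).
Proof.
apply: (@sm_comp R _ _ oAp _ _ _ Hp _ (fun q => (h q)%:M : 'M[R]_1) oB0 sHp _ sh).
by move=> w [v Tv <-]; rewrite HpK//; have [] := grO Tv.
Qed.

Lemma slice0 p q (A : set 'cV[R]_(1 + n)) (F : 'cV[R]_(1 + n) -> 'M[R]_(p, q)) (s : 'cV[R]_1) : open A ->
  open [set y | A (col_mx s y)] /\ (sm A F -> sm [set y | A (col_mx s y)] (fun y => F (col_mx s y))).
Proof.
move=> oA; have o : open [set y | A (col_mx s y)].
  rewrite openE => y Ay.
  have c : {for y, continuous (fun y : 'cV[R]_n => col_mx s y)}.
    by apply: cont_col_mx; [exact: cst_cont_at|exact: cvg_id].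
  by apply: c; exact: open_nbhs_nbhs.
split=> // sF; apply: (sm_comp o oA _ _ sF); last by [].
by apply: sm_col => //; [exact: sm_cst|exact: sm_id].
Qed.

Let oUm : open Um. Proof. by have [] := slice0 id 0 oAm. Qed.
Let oUp : open Up. Proof. by have [] := slice0 id 0 oAp. Qed.

Lemma sm_phi : sm Um phi.
Proof.
apply: (sm_comp oUm oO _ _ sPp); last by move=> y Ay; exact: st_O.
by have [_] := slice0 st 0 oAm; apply; exact: sm_st.
Qed.

Lemma tbox0 x : Up x -> tbox e (col_mx 0 (Hp (col_mx 0 x))) /\ Gp (col_mx 0 (Hp (col_mx 0 x))) = col_mx 0 x.
Proof.
move=> [v Tv vE]; have E : col_mx 0 (Hp (col_mx 0 x)) = v.
  rewrite -vE HpK// -[v]vsubmxK; congr col_mx; last by rewrite col_mxKd.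
  by have := congr1 usubmx vE; rewrite /lift_map !col_mxKu.
by rewrite E.
Qed.

Lemma sm_phi' : sm Up phi'.
Proof.
apply: (sm_comp oUp oO _ _ sPm); last by move=> x /tbox0[/grO[]].
apply: (@sm_comp R _ _ oUp _ _ _ (fun x => col_mx 0 (Hp (col_mx 0 x))) _ _ oT _ _ sm_grT).
  apply: sm_col => //; first exact: sm_cst.
  by have [_] := slice0 Hp 0 oAp; apply.
by move=> x /tbox0[].
Qed.

Lemma phiK y : Um y -> phi' (phi y) = y.
Proof.
move=> Uy; have [v [Tv vE sE uE]] := AmP Uy.
have e1 : col_mx 0 (phi y) = Gp v.
  by rewrite /phi sE /lift_map uE col_mxKu.
rewrite /phi' e1 HpK// -[RHS](col_mxKd (0 : 'cV[R]_1)) vE /lift_map col_mxKd.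
by congr (Pm (gr _)); rewrite -[RHS]vsubmxK uE col_mxKu.
Qed.

Lemma phi'_in x : Up x -> Um (phi' x).
Proof.
by move=> /tbox0[T _]; exists (col_mx 0 (Hp (col_mx 0 x))) => //; rewrite /lift_map col_mxKu.
Qed.

Lemma phi'K x : Up x -> phi (phi' x) = x.
Proof.
move=> Ux; have [T E] := tbox0 Ux.
have e1 : col_mx 0 (phi' x) = Gm (col_mx 0 (Hp (col_mx 0 x))) by rewrite /lift_map col_mxKu.
rewrite /phi e1 GmK//.
by have := congr1 dsubmx E; rewrite /lift_map !col_mxKd.
Qed.

(** Here [(a, b)] and [(a', b')] are the blocks of the differentials of [Pm] and [Pp], [D] is the
    Jacobian of [theta], and [x] is [theta]. The equation for [q'] says that a point of [L_t] moving
    over a fixed point of [X_-] has velocity in the kernel of [d Pm]; the equation for [g] says that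
    [g] pulls back to [theta] on [L_t]. Orthogonality of the kernels and transversality force the
    velocity to be Hamiltonian. *)
Lemma ham_alg (a b a' b' D : 'M[R]_n) (t : R) (q' g x : 'cV[R]_n) :
  b *m a'^T = a *m b'^T -> D^T = D -> a + t *: (b *m D) \in unitmx ->
  a *m q' + b *m (x + t *: (D *m q')) = 0 ->
  (a' + t *: (b' *m D))^T *m g = x ->
  col_mx q' (x + t *: (D *m q')) = iw n *m (col_mx a'^T b'^T *m g).
Proof.
move=> ho hD hu h1 h2.
have h3 : a'^T *m g + t *: (D *m (b'^T *m g)) = x.
  by rewrite -h2 trmxD linearZ /= trmx_mul hD mulmxDl -scalemxAl mulmxA.
have q'E : q' = - (b'^T *m g).
  apply: (can_inj (mulKmx hu)).
  have -> : (a + t *: (b *m D)) *m q' = - (b *m x).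
    rewrite mulmxDl; apply/eqP; rewrite -addr_eq0 -h1 mulmxDr -scalemxAr -!scalemxAl mulmxA.
    by rewrite -addrA [_ + b *m x]addrC.
  rewrite mulmxN; congr (- _); rewrite mulmxDl -h3 mulmxDr !mulmxA ho -scalemxAr -!scalemxAl !mulmxA.
  by [].
rewrite /iw [col_mx _ _ *m g]mul_col_mx mul_block_col !mul0mx add0r addr0 mul1mx mulNmx mul1mx -q'E; congr col_mx.
by rewrite q'E mulmxN scalerN -h3 addrK.
Qed.

Definition gp (w : 'cV[R]_(1 + n)) : 'cV[R]_n := grad (fun x => fp (col_mx (usubmx w) x)) (dsubmx w).

Lemma fp_C1 w : Ap w -> C1at (fun x => fp (col_mx (usubmx w) x)) (dsubmx w).
Proof.
move=> Aw; have [op s] := grad_slice (usubmx w) oAp sm_fp.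
by apply: (sm1_C1at op s); rewrite /= vsubmxK.
Qed.

Lemma jac_split (P : 'cV[R]_(n + n) -> 'cV[R]_n) u : jac P u = row_mx (lsubmx (jac P u)) (rsubmx (jac P u)).
Proof. by rewrite hsubmxK. Qed.

Lemma Mt_jac P v : sm Zb P -> tbox e v ->
  jac (fun q => P (gr (col_mx (usubmx v) q))) (dsubmx v) = Mt P v.
Proof.
move=> sP Tv.
have sPg : sm (tbox e) (P \o gr) by apply: (sm_comp oT oO sm_grT _ sP) => w /grO[].
have [_ _ H] := sm_slice (usubmx v) oT sPg.
have := H (dsubmx v); rewrite vsubmxK => /(_ Tv) ->.
rewrite jac_comp; [|by apply: (sm_C1v oO sP); have [] := grO Tv|exact: (sm_C1v oT sm_grT)].
by rewrite -mulmx_rsub (graph_rjac sth)//; have [] := grO Tv.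
Qed.

(** On [L_t] the composite of [fp] with [Pp] is [h] by construction; this is the equality of
    differentials. *)
Lemma gp_eq v : tbox e v -> (Mt Pp v)^T *m gp (Gp v) = th (dsubmx v).
Proof.
move=> Tv; have [Bq Ov] := grO Tv.
have Aw : Ap (Gp v) by exists v.
have uE : usubmx (Gp v) = usubmx v by rewrite /lift_map col_mxKu.
have dE : dsubmx (Gp v) = Pp (gr v) by rewrite /lift_map col_mxKd.
have C := fp_C1 Aw; rewrite uE dE in C.
have sPg : sm (tbox e) (Pp \o gr) by apply: (sm_comp oT oO sm_grT _ sPp) => w /grO[].
have [op s _] := sm_slice (usubmx v) oT sPg.
have Tv' : tbox e (col_mx (usubmx v) (dsubmx v)) by rewrite vsubmxK.
have Cg : C1v (fun q => Pp (gr (col_mx (usubmx v) q))) (dsubmx v) by exact: (sm_C1v op s).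
have := @grad_comp R n n (fun x => fp (col_mx (usubmx v) x)) (fun q => Pp (gr (col_mx (usubmx v) q))) (dsubmx v).
rewrite vsubmxK => /(_ C Cg); rewrite Mt_jac// /gp uE dE => <-.
apply/colP => j; rewrite mxE; have [_ <-] := hth j Bq.
apply: near_eq_derive; have n1 : \forall q \near dsubmx v, tbox e (col_mx (usubmx v) q) by exact: open_nbhs_nbhs.
apply: filterS n1 => q Tq; rewrite /= /fp.
have -> : col_mx (usubmx v) (Pp (gr (col_mx (usubmx v) q))) = Gp (col_mx (usubmx v) q) by rewrite /lift_map col_mxKu.
by rewrite HpK// col_mxKd.
Qed.

Lemma blocks (P : 'cV[R]_(n + n) -> 'cV[R]_n) u : (jac P u)^T = col_mx (lsubmx (jac P u))^T (rsubmx (jac P u))^T.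
Proof. by rewrite {1}(jac_split P u) tr_row_mx. Qed.

Lemma orth_blocks u : Zb u ->
  rsubmx (jac Pm u) *m (lsubmx (jac Pp u))^T = lsubmx (jac Pm u) *m (rsubmx (jac Pp u))^T.
Proof.
move=> Ou; have := orth Ou; rewrite {1}(jac_split Pm u) (blocks Pp u) /iw.
rewrite mul_row_block !mulmx0 add0r addr0 mulmx1 mulmxN mulmx1 mul_row_col mulNmx.
by move/eqP; rewrite subr_eq0 => /eqP.
Qed.

Lemma Mt_blocks P v : Mt P v = lsubmx (jac P (gr v)) + usubmx v ord0 ord0 *: (rsubmx (jac P (gr v)) *m jac th (dsubmx v)).
Proof. by rewrite /slice_jac {1}(jac_split P (gr v)) mul_row_col mulmx1 -scalemxAr. Qed.

(* The right-hand side is the Hamiltonian vector field of [fp] pulled back by [Pp]. *)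
Lemma st_velocity (t : R) y : Am (col_mx t%:M y) ->
  dmx t 1 (fun s => st (col_mx s%:M y))
    (iw n *m ((jac Pp (st (col_mx t%:M y)))^T *m gp (col_mx t%:M (Pp (st (col_mx t%:M y)))))).
Proof.
set w := col_mx _ _ => Aw; have [v [Tv wE sE uE]] := AmP Aw; have [Bq Ov] := grO Tv.
have qE : Hm w = dsubmx v by rewrite wE HmK.
have uw : usubmx v = t%:M by rewrite uE col_mxKu.
have hq := dmx_time (sm_C1v oAm sHm Aw); set q' := jac Hm _ *m _ in hq.
have Bq' : Qb (Hm (col_mx t%:M y)) by rewrite qE.
have D := dmx_graph sth Bq' hq; rewrite -/w qE in D.
have stE : (fun s : R => st (col_mx s%:M y)) = (fun s => gr (col_mx s%:M (Hm (col_mx s%:M y)))).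
  by apply/funext => s; rewrite /st col_mxKu.
rewrite stE.
have vE : v = col_mx t%:M (dsubmx v) by rewrite -uw vsubmxK.
have CP : C1v Pm (gr v) by exact: (sm_C1v oO sPm).
have D' : dmx t 1 (fun s => Pm (gr (col_mx s%:M (Hm (col_mx s%:M y)))))
   (jac Pm (gr v) *m col_mx q' (th (dsubmx v) + t *: (jac th (dsubmx v) *m q'))).
  have gE : gr (col_mx t%:M (Hm (col_mx t%:M y))) = gr v by rewrite -/w qE -vE.
  move=> i j; rewrite (ord1 j).
  have := @is_derive_chainv R R _ _ (fun s => gr (col_mx s%:M (Hm (col_mx s%:M y)))) Pm t 1 _ i.
  by rewrite gE; apply => // k; exact: D.
(* [st] stays over the fixed point [y], so [jac Pm] kills its velocity. *)
have zero : jac Pm (gr v) *m col_mx q' (th (dsubmx v) + t *: (jac th (dsubmx v) *m q')) = 0.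
  apply/matrixP => i j; rewrite [RHS]mxE; apply: (near_const_derive (a := y i j) _ (D' i j)).
  have c : {for t, continuous (fun s : R => col_mx s%:M y)}.
    by apply/cont_cV_atP => k; case: (split_ordP k) => l ->;
      [rewrite (_ : (fun _ => _) = id); [exact: cvg_id|apply/funext => s; rewrite col_mxEu (ord1 l) !mxE]
      |rewrite (_ : (fun _ => _) = fun=> y l ord0); [exact: cst_cont_at|apply/funext => s; rewrite col_mxEd]].
  have n1 : \forall s \near t, Am (col_mx s%:M y) by apply: c; exact: open_nbhs_nbhs.
  apply: filterS n1 => s As; have := Pm_st As; rewrite /st col_mxKu col_mxKd => ->.
  by [].
have gE := gp_eq Tv.
have GE : Gp v = col_mx t%:M (Pp (st w)) by rewrite /lift_map uw sE.
rewrite GE Mt_blocks in gE; have uM := um Tv; rewrite Mt_blocks uw mxE eqxx mulr1n in uM.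
rewrite uw mxE eqxx mulr1n -/gr in gE.
have Hz := zero; rewrite (jac_split Pm (gr v)) mul_row_col in Hz.
have := ham_alg (orth_blocks Ov) (thsym Bq) uM Hz gE.
by rewrite -(blocks Pp (gr v)) -sE => <-.
Qed.

(** At time 0 the section takes values in {xi = 0} and is inverse to [Pm] there. *)
Lemma jac_st0 y : Um y ->
  jac (fun y => st (col_mx 0 y)) y = col_mx 1%:M 0 *m invmx (lsubmx (jac Pm (st (col_mx 0 y)))) /\
  lsubmx (jac Pm (st (col_mx 0 y))) \in unitmx.
Proof.
move=> Uy; have [v [Tv vE sE uE]] := AmP Uy; have [Bv Ov] := grO Tv.
have u0 : usubmx v = 0 by rewrite uE col_mxKu.
have M0 : Mt Pm v = lsubmx (jac Pm (gr v)).
  by rewrite Mt_blocks u0 mxE scale0r addr0.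
have uM := um Tv; rewrite M0 -sE in uM; split=> //.
have [_ /(_ sm_st) s0] := slice0 st 0 oAm; have C := sm_C1v oUm s0 Uy.
have stE y' : st (col_mx 0 y') = col_mx (Hm (col_mx 0 y')) 0.
  by rewrite /st /graph_at !col_mxKu !col_mxKd mulmx0.
set A := jac _ y.
have dA : dsubmx A = 0.
  apply/matrixP => i j; rewrite mxE /A mxE [RHS]mxE -(derive_cst (0 : R) y (cvec j)).
  by congr ('D_(cvec j) _ y); apply/funext => y'; rewrite stE col_mxEd mxE.
have CP : C1v Pm (st (col_mx 0 y)) by rewrite sE; exact: (sm_C1v oO sPm).
have E : jac Pm (st (col_mx 0 y)) *m A = 1%:M.
  rewrite -(@jac_comp R n (n + n) n (fun y => st (col_mx 0 y)) Pm y CP C) -(jac_id y); apply: jac_near.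
  have n1 : \forall y' \near y, Um y' by exact: open_nbhs_nbhs.
  by apply: filterS n1 => y' Uy'; rewrite /= Pm_st// col_mxKd.
rewrite (jac_split Pm (st (col_mx 0 y))) -[A]vsubmxK dA mul_row_col mulmx0 addr0 in E.
rewrite -[A]vsubmxK dA mul_col_mx mul1mx mul0mx; congr col_mx.
by rewrite -[LHS](mulKmx uM) E mulmx1.
Qed.

Lemma jac_phi y : Um y ->
  jac phi y = lsubmx (jac Pp (st (col_mx 0 y))) *m invmx (lsubmx (jac Pm (st (col_mx 0 y)))).
Proof.
move=> Uy; have [E _] := jac_st0 Uy.
have [_ /(_ sm_st) s0] := slice0 st 0 oAm; have C := sm_C1v oUm s0 Uy.
have CP : C1v Pp (st (col_mx 0 y)) by apply: (sm_C1v oO sPp); exact: st_O.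
have := @jac_comp R n (n + n) n (fun y => st (col_mx 0 y)) Pp y CP C; rewrite E => J; rewrite -[LHS]/(jac (Pp \o (fun y => st (col_mx 0 y))) y) J.
by rewrite mulmxA {1}(jac_split Pp (st _)) mul_row_col mulmx1 mulmx0 addr0.
Qed.

(** [a' *m invmx a] is the differential of [phi], and orthogonality of the kernels trades [b] for
    [b']. The opposite signs of the two brackets reflect that [pi_-] is anti-Poisson. *)
Lemma poisson_alg (a b a' b' : 'M[R]_n) : a \in unitmx -> b *m a'^T = a *m b'^T ->
  (a' *m invmx a) *m (a *m b^T - b *m a^T) *m (a' *m invmx a)^T = b' *m a'^T - a' *m b'^T.
Proof.
move=> ua ho; have uaT : a^T \in unitmx by rewrite unitmx_tr.
have h1 : invmx a *m b *m a'^T = b'^T by rewrite -mulmxA ho mulKmx.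
have h2 : a' *m (b^T *m (invmx a)^T) = b'.
  by rewrite -[RHS]trmxK -h1 !trmx_mul trmxK.
rewrite trmx_mul mulmxBr mulmxBl; congr (_ - _).
  by rewrite !mulmxA mulmxKV// -[a' *m b^T *m _]mulmxA h2.
rewrite -!mulmxA trmx_inv (mulmxA (a^T)) mulmxV// mul1mx.
by congr (_ *m _); rewrite mulmxA h1.
Qed.

Lemma biv_blocks (P : 'cV[R]_(n + n) -> 'cV[R]_n) u :
  jac P u *m iw n *m (jac P u)^T =
  rsubmx (jac P u) *m (lsubmx (jac P u))^T - lsubmx (jac P u) *m (rsubmx (jac P u))^T.
Proof.
rewrite {1}(jac_split P u) (blocks P u) /iw mul_row_block !mulmx0 add0r addr0 mulmx1 mulmxN mulmx1.
by rewrite mul_row_col mulNmx.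
Qed.

Lemma phi_poisson y : Um y -> jac phi y *m Qm y *m (jac phi y)^T = Qp (phi y).
Proof.
move=> Uy; have [_ ua] := jac_st0 Uy; have Ou := st_O Uy.
have Qy : Qm y = lsubmx (jac Pm (st (col_mx 0 y))) *m (rsubmx (jac Pm (st (col_mx 0 y))))^T
    - rsubmx (jac Pm (st (col_mx 0 y))) *m (lsubmx (jac Pm (st (col_mx 0 y))))^T.
  have := Qpm Ou; rewrite Pm_st// col_mxKd biv_blocks => hQ.
  by rewrite -[LHS]opprK -hQ opprB.
rewrite jac_phi// Qy -/(phi y) (poisson_alg ua (orth_blocks Ou)) -biv_blocks.
exact: Qpp.
Qed.

(** The tangent plane {xi = 0} of Lambda is stable under [J0], which acts on it by [G0]; either
    projection carries [G0] to the complex structure of its target. *)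
Lemma phi_holo y : Um y -> jac phi y *m Jm = Jp *m jac phi y.
Proof.
move=> Uy; have [E ua] := jac_st0 Uy; have Ou := st_O Uy.
set a := lsubmx _ in E ua; set T := jac Pp (st (col_mx 0 y)); set T' := jac Pm (st (col_mx 0 y)).
pose S := col_mx 1%:M 0 *m invmx a : 'M[R]_(n + n, n).
have T'S : T' *m S = 1%:M.
  by rewrite /S mulmxA /T' (jac_split Pm) mul_row_col mulmx1 mulmx0 addr0 mulmxV.
have PS : jac phi y = T *m S.
  by rewrite jac_phi// /S mulmxA /T {2}(jac_split Pp (st _)) mul_row_col mulmx1 mulmx0 addr0.
have JS : J0 *m S = S *m (a *m G0 *m invmx a).
  by rewrite /S [LHS]mulmxA JL !mulmxA mulmxKV.
have JmE : Jm = a *m G0 *m invmx a.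
  have := hJm Ou; rewrite -/T' => /(congr1 (fun X => X *m S)).
  rewrite -(mulmxA T') JS [T' *m (S *m _)]mulmxA T'S mul1mx -(mulmxA Jm) T'S mulmx1 => ->.
  by [].
rewrite PS JmE -mulmxA -JS mulmxA hJp// mulmxA.
by [].
Qed.

Lemma jac_phi' x : Up x -> jac phi' x *m jac phi (phi' x) = 1%:M /\ jac phi (phi' x) *m jac phi' x = 1%:M.
Proof.
move=> Ux; have Uy := phi'_in Ux.
have C' := sm_C1v oUp sm_phi' Ux; have C := sm_C1v oUm sm_phi Uy.
have E : jac phi (phi' x) *m jac phi' x = 1%:M.
  rewrite -(jac_comp C C') -(jac_id x); apply: jac_near.
  have n1 : \forall x' \near x, Up x' by exact: open_nbhs_nbhs.
  by apply: filterS n1 => x' Ux'; exact: phi'K.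
by split=> //; exact: mulmx1C.
Qed.

Lemma psi0 y : Um y -> psi (col_mx 0 y) = y.
Proof. by move=> Uy; exact: phiK. Qed.

(** Domain of [psi]: the section is defined and its image under [Pp] lies in the domain of the
    inverse of [phi]. *)
Let Apsi := [set w | Am w /\ Up (Pp (st w))].

Lemma open_psi : open Apsi.
Proof.
have sPs : sm Am (Pp \o st) by apply: (sm_comp oAm oO sm_st _ sPp) => w; exact: st_O.
rewrite openE => w [Aw Uw]; apply: filterI; first exact: open_nbhs_nbhs.
by apply: (C1v_continuous (sm_C1v oAm sPs Aw)); exact: open_nbhs_nbhs.
Qed.

Lemma sm_psi : sm Apsi psi.
Proof.
have hs : sm Apsi (Pp \o st).
  have h1 : sm Am (Pp \o st) by apply: (sm_comp oAm oO sm_st _ sPp) => w; exact: st_O.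
  by apply: sm_restrict h1 => w [].
apply: (sm_comp open_psi oUp hs _ sm_phi'); first by move=> w [].
Qed.

Let Af := [set w | Um (dsubmx w) /\ Ap (col_mx (usubmx w) (phi (dsubmx w)))].

Lemma open_Af : open Af.
Proof.
rewrite openE => w [Uw Aw]; apply: filterI.
  by apply: dsub_cont; exact: open_nbhs_nbhs.
have c : {for w, continuous (fun w : 'cV[R]_(1 + n) => col_mx (usubmx w) (phi (dsubmx w)))}.
  apply: cont_col_mx; first exact: usub_cont.
  apply: (@cont_comp _ _ _ dsubmx phi); first exact: dsub_cont.
  by apply: C1v_continuous; exact: (sm_C1v oUm sm_phi).
by apply: c; exact: open_nbhs_nbhs.
Qed.

Lemma sm_fh : sm Af (fun w => (fh w)%:M : 'M[R]_1).
Proof.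
apply: (@sm_comp R _ _ open_Af _ _ _ (fun w : 'cV[R]_(1 + n) => col_mx (usubmx w) (phi (dsubmx w))) _ (fun w => (fp w)%:M : 'M[R]_1) oAp _ _ sm_fp).
  apply: sm_col; [exact: open_Af|by apply: sm_usub; [exact: open_Af|exact: sm_id]|].
  apply: (sm_comp open_Af oUm _ _ sm_phi); last by move=> w [].
  by apply: sm_dsub; [exact: open_Af|exact: sm_id].
by move=> w [].
Qed.

Definition gh (w : 'cV[R]_(1 + n)) : 'cV[R]_n := grad (fun y => fh (col_mx (usubmx w) y)) (dsubmx w).

Lemma gh_eq w : Af w -> gh w = (jac phi (dsubmx w))^T *m gp (col_mx (usubmx w) (phi (dsubmx w))).
Proof.
move=> [Uw Aw]; have C := sm_C1v oUm sm_phi Uw; have Cf := fp_C1 Aw; rewrite col_mxKu col_mxKd in Cf.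
have Ef : (fun y => fh (col_mx (usubmx w) y)) = (fun x => fp (col_mx (usubmx w) x)) \o phi.
  by apply/funext => y; rewrite /fh /= col_mxKu col_mxKd.
by rewrite /gp col_mxKu col_mxKd -(grad_comp Cf C) /gh Ef.
Qed.

Lemma psi_Af w : Apsi w -> Af (col_mx (usubmx w) (psi w)) /\ phi (psi w) = Pp (st w).
Proof.
move=> [Aw Uw]; have E : phi (psi w) = Pp (st w) by rewrite /psi phi'K.
split=> //; split; rewrite /= !col_mxKd; first exact: phi'_in.
by rewrite col_mxKu E; exact: Ap_st.
Qed.

(** The Hamiltonian velocity of [st] is pushed forward by [Pp] and by the inverse of [phi]; as both
    are Poisson, [iw] becomes [Qm]. *)
Lemma psi_velocity (t : R) y : Apsi (col_mx t%:M y) ->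
  dmx t 1 (fun s => psi (col_mx s%:M y))
    (Qm (psi (col_mx t%:M y)) *m gh (col_mx t%:M (psi (col_mx t%:M y)))).
Proof.
set w := col_mx _ _ => Pw; have [Aw Uw] := Pw.
have [Afw E] := psi_Af Pw; rewrite col_mxKu in Afw.
have V := st_velocity Aw; rewrite -/w in V.
have CP : C1v Pp (st w) by apply: (sm_C1v oO sPp); exact: st_O.
have C' : C1v phi' (Pp (st w)) by exact: (sm_C1v oUp sm_phi').
have V1 : dmx t 1 (fun s => Pp (st (col_mx s%:M y)))
    (jac Pp (st w) *m (iw n *m ((jac Pp (st w))^T *m gp (col_mx t%:M (Pp (st w)))))).
  move=> i j; rewrite (ord1 j).
  by have := @is_derive_chainv R R _ _ (fun s => st (col_mx s%:M y)) Pp t 1 _ i CP; apply=> k; exact: V.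
have V2 : dmx t 1 (fun s => psi (col_mx s%:M y)) (jac phi' (Pp (st w)) *m
    (jac Pp (st w) *m (iw n *m ((jac Pp (st w))^T *m gp (col_mx t%:M (Pp (st w))))))).
  move=> i j; rewrite (ord1 j).
  by have := @is_derive_chainv R R _ _ (fun s => Pp (st (col_mx s%:M y))) phi' t 1 _ i C'; apply=> k; exact: V1.
apply: dmx_eq V2 _; have [k1 k2] := jac_phi' Uw.
have Q := Qpp (st_O Aw); rewrite -E -phi_poisson in Q; last exact: phi'_in.
rewrite gh_eq// col_mxKu col_mxKd E.
have -> : jac phi' (Pp (st w)) *m (jac Pp (st w) *m (iw n *m ((jac Pp (st w))^T *m gp (col_mx t%:M (Pp (st w))))))
  = jac phi' (Pp (st w)) *m (jac Pp (st w) *m iw n *m (jac Pp (st w))^T) *m gp (col_mx t%:M (Pp (st w))).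
  by rewrite !mulmxA.
by rewrite Q !mulmxA k1 mul1mx.
Qed.

(** [theta] vanishes at 0, so the Hamiltonian field on [Z] vanishes at [z] for all times; this is
    what lets its flow near [z] run until time 1. *)
Lemma grad_at0 (t : R) : tbox e (col_mx t%:M (0 : 'cV[R]_n)) -> gp (col_mx t%:M (Pp 0)) = 0.
Proof.
move=> T; have := gp_eq T; rewrite col_mxKd th0.
have -> : Gp (col_mx t%:M (0 : 'cV[R]_n)) = col_mx t%:M (Pp 0) by rewrite /lift_map col_mxKu graph0.
by apply: inj_unitmx; rewrite unitmx_tr; exact: up.
Qed.
Local Notation BZ := (ws *m J0).

Lemma ws_iw : ws *m iw n = 1%:M.
Proof.
rewrite /iw mulmx_block !mul0mx !mulmx0 !mulNmx !mulmxN mul1mx !add0r !addr0 ?opprK ?oppr0.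
by rewrite -scalar_mx_block.
Qed.

Lemma BZ_skew : BZ^T = - BZ.
Proof.
by rewrite trmx_mul tr_block_mx !trmx0 trmxN !trmx1 -wJ -mulmxN opp_block_mx opprK !oppr0.
Qed.

(* [Fst] is the pull-back of Re Omega by [st], with dt-part [beta] and spatial part
   [Kst]; closedness identifies the time derivative [Dst] of [Kst] with d[beta]. *)
Definition Fst w := (jac st w)^T *m BZ *m jac st w.

Lemma sm_Fst : sm Am Fst.
Proof.
have hJ := sm_jac oAm sm_st.
by apply: sm_mul => //; apply: sm_mul => //; [exact: sm_tr|exact: sm_cst].
Qed.

Lemma Fst_closed : rclosed Am Fst.
Proof.
apply: (closed_pull (F := fun=> BZ) oAm (@openT _) sm_st) => //.
- exact: sm_cst.
- by move=> v _; exact: BZ_skew.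
- by move=> u _ a b c; rewrite !derive_cst !addr0.
Qed.

Lemma Fst_skew w : (Fst w)^T = - Fst w.
Proof. by rewrite /Fst !trmx_mul trmxK -trmx_mul BZ_skew mulNmx mulmxN mulmxA. Qed.

Definition beta w : 'cV[R]_n := \col_i Fst w (rshift 1 i) (lshift n ord0).
Definition Kst w : 'M[R]_n := \matrix_(i, j) Fst w (rshift 1 i) (rshift 1 j).
Definition Dst w : 'M[R]_n := \matrix_(i, j)
  'D_(cvec (lshift n ord0)) (fun w => Fst w (rshift 1 i) (rshift 1 j)) w.

Lemma Dst_cont (t : R) y i j : Am (col_mx t%:M y) -> {for t, continuous (fun s : R => Dst (col_mx s%:M y) i j)}.
Proof.
move=> Aw.
have c : {for t, continuous (fun s : R => col_mx s%:M y)}.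
  by apply/cont_cV_atP => k; case: (split_ordP k) => l ->;
    [rewrite (_ : (fun _ => _) = id); [exact: cvg_id|apply/funext => s; rewrite col_mxEu (ord1 l) !mxE]
    |rewrite (_ : (fun _ => _) = fun=> y l ord0); [exact: cst_cont_at|apply/funext => s; rewrite col_mxEd]].
apply: (@cont_comp _ _ _ (fun s : R => col_mx s%:M y) (fun w => Dst w i j)) => //.
rewrite (_ : (fun w => _) = fun w => 'D_(cvec (lshift n ord0)) (fun w => Fst w (rshift 1 i) (rshift 1 j)) w).
  by have [_ h1] := sm_C1 (rshift 1 i) (rshift 1 j) oAm sm_Fst Aw (lshift n ord0).
by apply/funext => w; rewrite mxE.
Qed.

Lemma Kst_derive (t : R) y : Am (col_mx t%:M y) ->
  dmx t 1 (fun s => Kst (col_mx s%:M y)) (Dst (col_mx t%:M y)).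
Proof.
move=> Aw i j; rewrite (_ : (fun s => _) = fun s : R => Fst (col_mx s%:M y) (rshift 1 i) (rshift 1 j)); last first.
  by apply/funext => s; rewrite mxE.
rewrite mxE -derive_lslice; apply: DeriveDef => //.
have C := sm_C1 (rshift 1 i) (rshift 1 j) oAm sm_Fst Aw.
have C1 : C1v (fun w => (Fst w (rshift 1 i) (rshift 1 j))%:M : 'cV[R]_1) (col_mx t%:M y).
  move=> a; rewrite (ord1 a) (_ : (fun w => _) = fun w => Fst w (rshift 1 i) (rshift 1 j))//.
  by apply/funext => w; rewrite mxE.
have [+ _] := dmx_time C1 ord0 ord0.
by rewrite (_ : (fun s : R => _) = fun s : R => Fst (col_mx s%:M y) (rshift 1 i) (rshift 1 j))//; apply/funext => s; rewrite mxE.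
Qed.

(** Closedness of [Fst] on triples with exactly one time index: Cartan's identity for the derivative
    of [s_t^* Re Omega]. *)
Lemma Dst_rext1 (s : 'cV[R]_1) y : Am (col_mx s y) ->
  Dst (col_mx s y) = rext1 (fun y => beta (col_mx s y)) y.
Proof.
move=> Aw; apply/matrixP => i j; rewrite mxE /rext1 [RHS]mxE [X in _ = X + _]mxE [X in _ = _ + X]mxE [X in _ = _ - X]mxE [X in _ = _ - X]mxE.
have bE k : (fun w : 'cV[R]_n => beta (col_mx s w) k ord0) = (fun w => (fun w => Fst w (rshift 1 k) (lshift n ord0)) (col_mx s w)).
  by apply/funext => w; rewrite mxE.
have DE k l : 'D_(cvec l) (fun w : 'cV[R]_n => beta (col_mx s w) k ord0) y =
    'D_(cvec (rshift 1 l)) (fun w => Fst w (rshift 1 k) (lshift n ord0)) (col_mx s y).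
  by rewrite bE; exact: derive_rslice.
rewrite (DE i j) (DE j i).
have H := rclosedE (rshift 1 i) (rshift 1 j) (lshift n ord0) Fst_closed (fun w _ => Fst_skew w) oAm sm_Fst Aw.
have dE l k q : dmat l Fst (col_mx s y) k q = 'D_(cvec l) (fun x => Fst x k q) (col_mx s y) by rewrite mxE.
apply: eq_trans (esym (dE _ _ _)) _; apply: eq_trans (esym H) _.
exact: (congr2 (fun a b => a - b) (dE _ _ _) (dE _ _ _)).
Qed.

Lemma Fst_blocks w : Kst w = (rsubmx (jac st w))^T *m BZ *m rsubmx (jac st w) /\
  beta w = (rsubmx (jac st w))^T *m BZ *m (jac st w *m col_mx 1%:M 0).
Proof.
have E : (rsubmx (jac st w))^T = dsubmx (jac st w)^T by rewrite trmx_rsub.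
split.
  rewrite E mul_dsub_mx mul_dsub_mx mulmx_rsub; apply/matrixP => i j.
  by rewrite mxE [RHS]mxE [RHS]mxE.
have E1 : jac st w *m col_mx 1%:M 0 = lsubmx (jac st w).
  by rewrite -[X in X *m _]hsubmxK mul_row_col mulmx1 mulmx0 addr0.
rewrite E1 E mul_dsub_mx mul_dsub_mx mulmx_lsub; apply/colP => i.
by rewrite mxE [RHS]mxE [RHS]mxE; congr (Fst w _ _); exact/val_inj.
Qed.

(** [J0] preserves {xi = 0}, which is Lagrangian for [ws], so this plane is Lagrangian for
    [ws *m J0] too. *)
Lemma Kst0 y : Um y -> Kst (col_mx 0 y) = 0.
Proof.
move=> Uy; have [-> _] := Fst_blocks (col_mx 0 y).
have [_ _ <-] := sm_slice 0 oAm sm_st => //.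
have [-> _] := jac_st0 Uy.
rewrite trmx_mul -!mulmxA (mulmxA J0) JL tr_col_mx trmx1 trmx0 -!mulmxA (mulmxA (row_mx _ _)).
by rewrite mul_row_block !mul1mx !mul0mx !addr0 (mulmxA (row_mx _ _)) mul_row_col mul0mx mulmx0 addr0 mul0mx mulmx0.
Qed.

(** Contracting [Re Omega = J0^T omega] with the Hamiltonian velocity gives [J0^T] applied to the
    differential of the pulled-back function; holomorphy of [Pp] and [phi] then moves the complex
    structure down to [Jm]. *)
Lemma beta_psi w : Apsi w -> beta w =
  (jac (fun y => psi (col_mx (usubmx w) y)) (dsubmx w))^T *m (Jm^T *m gh (col_mx (usubmx w) (psi w))).
Proof.
move=> Pw; have [Aw Uw] := Pw; have [Afw E] := psi_Af Pw.
set s := usubmx w; set y := dsubmx w; have wE : w = col_mx s y by rewrite vsubmxK.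
have s1 : s = (s ord0 ord0)%:M by rewrite [LHS]mx11_scalar.
have Ou := st_O Aw.
have [_ ->] := Fst_blocks w.
have -> : jac st w *m col_mx 1%:M 0 = iw n *m ((jac Pp (st w))^T *m gp (col_mx s (Pp (st w)))).
  rewrite wE s1 in Aw *; apply: dmx_unique (dmx_time (sm_C1v oAm sm_st Aw)) (st_velocity Aw).
have [op1 s2 J1] := sm_slice s oAm sm_st.
have Awy : Am (col_mx s y) by rewrite -wE.
have := J1 y Awy; rewrite -wE => <-.
set T := jac Pp (st w); set S := jac (fun q => st (col_mx s q)) y.
have CP : C1v Pp (st (col_mx s y)) by rewrite -wE; exact: (sm_C1v oO sPp).
have CS : C1v (fun q => st (col_mx s q)) y by exact: (sm_C1v op1 s2).
have TS : jac (fun y => Pp (st (col_mx s y))) y = T *m S.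
  by have := @jac_comp R n (n + n) n (fun q => st (col_mx s q)) Pp y CP CS; rewrite -wE.
have [op2 s3 _] := sm_slice s open_psi sm_psi.
have Pwy : Apsi (col_mx s y) by rewrite -wE.
have Cpsi : C1v (fun q => psi (col_mx s q)) y by exact: (sm_C1v op2 s3).
have Upsi : Um (psi w) by have [+ _] := Afw; rewrite col_mxKd.
have Cphi : C1v phi (psi (col_mx s y)) by rewrite -wE; exact: (sm_C1v oUm sm_phi).
have TP : T *m S = jac phi (psi w) *m jac (fun y => psi (col_mx s y)) y.
  rewrite -TS; have := @jac_comp R n n n (fun q => psi (col_mx s q)) phi y Cphi Cpsi.
  rewrite -wE => <-; apply: jac_near.
  have n1 : \forall q \near y, Apsi (col_mx s q) by exact: open_nbhs_nbhs.
  by apply: filterS n1 => q /psi_Af[_ /= ->].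
rewrite (gh_eq Afw) col_mxKu col_mxKd E.
set g := gp _.
have e1 : S^T *m BZ *m (iw n *m (T^T *m g)) = (T *m J0 *m S)^T *m g.
  rewrite -wJ !mulmxA -[S^T *m J0^T *m ws *m iw n]mulmxA ws_iw mulmx1.
  by rewrite !trmx_mul !mulmxA.
have e2 : T *m J0 *m S = Jp *m (jac phi (psi w) *m jac (fun y => psi (col_mx s y)) y).
  by rewrite /T hJp// -mulmxA TP.
rewrite -/S e1 e2 mulmxA -phi_holo// !trmx_mul !mulmxA.
by [].
Qed.

(** The exterior derivative of [beta_psi], by naturality under [psi]. *)
Lemma Dst_psi w : Apsi w -> Dst w =
  (jac (fun y => psi (col_mx (usubmx w) y)) (dsubmx w))^T *m
    rext1 (fun x => Jm^T *m gh (col_mx (usubmx w) x)) (psi w) *m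
  jac (fun y => psi (col_mx (usubmx w) y)) (dsubmx w).
Proof.
move=> Pw; have [Aw Uw] := Pw; have [Afw E] := psi_Af Pw.
set s := usubmx w; set y := dsubmx w; have wE : w = col_mx s y by rewrite vsubmxK.
have [op2 s3 _] := sm_slice s open_psi sm_psi.
have [op4 s4 _] := sm_slice s open_Af sm_fh.
have sg : sm [set x | Af (col_mx s x)] (fun x => Jm^T *m gh (col_mx s x)).
  apply: sm_mul => //; first exact: sm_cst.
  rewrite (_ : (fun x => _) = grad (fun x => fh (col_mx s x))); first exact: sm_grad.
  by apply/funext => x; rewrite /gh col_mxKu col_mxKd.
have Pwy : Apsi (col_mx s y) by rewrite -wE.
have Afy : Af (col_mx s (psi (col_mx s y))) by rewrite -wE.
have := rext1_pull op2 op4 s3 sg Pwy Afy; rewrite -wE => <-.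
rewrite {1}wE Dst_rext1; last by rewrite -wE.
have n1 : \forall q \near y, Apsi (col_mx s q) by exact: open_nbhs_nbhs.
have J : jac (fun y => beta (col_mx s y)) y =
    jac (fun q => (jac (fun q => psi (col_mx s q)) q)^T *m (Jm^T *m gh (col_mx s (psi (col_mx s q))))) y.
  by apply: jac_near; apply: filterS n1 => q /beta_psi; rewrite col_mxKu col_mxKd.
by rewrite /rext1 J.
Qed.
End Model.
End Local_model.

(** * The family of bisections on Z *)

Section Family_of_bisections.
Context {R : realType}.
Section Realization.
Variables (n : nat) (Z : @holSymp R (n + n)) (z : Z) (c : @chart R Z (n + n)).
Variables (rho r0 e : R) (th : 'cV[R]_n -> 'cV[R]_n) (J0 : 'M[R]_(n + n)) (G0 : 'M[R]_n).
Local Notation Zb := (@bal R (n + n) rho).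
Local Notation Qb := (@bal R n r0).
Local Notation gr := (graph_at th).
Local Notation ws := (block_mx 0 1%:M (- 1%:M) 0 : 'M[R]_(n + n)).
Hypotheses (sc : smooth_chart c) (cz : cdom c z) (z0 : coord c z = 0).
Hypothesis Zc : forall u, Zb u -> cimg c u.
Hypotheses (cJ : forall y, cdom c y -> tr c y *m cpxZ y = J0 *m tr c y)
  (cw : forall y, cdom c y -> omegaZ y = (tr c y)^T *m ws *m tr c y).
Hypothesis JL : J0 *m col_mx 1%:M 0 = col_mx 1%:M 0 *m G0.
Hypotheses (e0 : 0 < e) (sth : sm Qb th) (th0 : th 0 = 0).
Hypothesis thsym : forall q, Qb q -> (jac th q)^T = jac th q.
Hypothesis grO : forall w, tbox e w -> Qb (dsubmx w) /\ Zb (gr w).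

(** The base point [q] ranges over the ball of the box, where the inverses of both projections are
    available. *)
Definition Lt (t : R) : set Z :=
  [set p | cdom c p /\ exists v, [/\ tbox e v, usubmx v = t%:M & coord c p = gr v]].

Let oZb : open Zb. Proof. exact: open_bal. Qed.
Let oQb : open Qb. Proof. exact: open_bal. Qed.

Lemma Lt_icoord (v : 'cV[R]_(1 + n)) : tbox e v ->
  Lt (usubmx v ord0 ord0) (icoord c (gr v)) /\ coord c (icoord c (gr v)) = gr v.
Proof.
move=> Tv; have [_ /Zc cv] := grO Tv; have [cd cE] := cimgP sc.1 cv.
by split=> //; split=> //; exists v; split=> //; rewrite [LHS]mx11_scalar.
Qed.

Lemma t01e (t : R) : 0 <= t <= 1 -> - e < t < 1 + e.
Proof. by move=> /andP[t0 t1]; apply/andP; split; [apply: lt_le_trans t0; rewrite oppr_lt0|apply: le_lt_trans t1 _; rewrite ltrDl]. Qed.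

Lemma tbox_at (t : R) (q : 'cV[R]_n) : - e < t < 1 + e -> bal e q -> tbox e (col_mx t%:M q).
Proof. by move=> te qe; split; rewrite ?col_mxKd// col_mxKu mxE eqxx mulr1n. Qed.

Lemma Lt_z (t : R) : 0 <= t <= 1 -> Lt t z.
Proof.
move=> t01; split=> //; exists (col_mx t%:M 0); split.
- by apply: tbox_at; [exact: t01e|rewrite /bal /= normr0].
- by rewrite col_mxKu.
- by rewrite graph0.
Qed.

Section Shear.
Variable t : R.
Hypothesis te : - e < t < 1 + e.
Let V : set 'cV[R]_(n + n) := Zb `&` [set u | bal e (usubmx u)].
Let Phi (u : 'cV[R]_(n + n)) := u - col_mx 0 t%:M *m th (usubmx u).
Let Psi (u : 'cV[R]_(n + n)) := u + col_mx 0 t%:M *m th (usubmx u).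

Let tbt (q : 'cV[R]_n) : bal e q -> tbox e (col_mx t%:M q).
Proof. exact: tbox_at. Qed.

Let eQ (q : 'cV[R]_n) : bal e q -> Qb q.
Proof. by move=> /tbt/grO[]; rewrite col_mxKd. Qed.

Let oV : open V.
Proof.
apply: openI => //; rewrite openE => u Bu.
by apply: usub_cont; apply: open_nbhs_nbhs; split=> //; exact: open_bal.
Qed.

Let E1 := [set u : 'cV[R]_(n + n) | bal e (usubmx u)].
Let oE1 : open E1.
Proof. by rewrite openE => u Bu; apply: usub_cont; apply: open_nbhs_nbhs; split=> //; exact: open_bal. Qed.

Let sthu : sm E1 (fun u : 'cV[R]_(n + n) => col_mx 0 t%:M *m th (usubmx u) : 'cV[R]_(n + n)).
Proof.
apply: sm_mul => //; first exact: sm_cst.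
apply: (sm_comp oE1 oQb _ _ sth); last by move=> u /eQ.
by apply: sm_usub => //; exact: sm_id.
Qed.

Let usubPhi u : usubmx (Phi u) = usubmx u.
Proof. by rewrite /Phi mul_col_mx mul0mx -[u in LHS]vsubmxK opp_col_mx add_col_mx oppr0 addr0 col_mxKu. Qed.

Let usubPsi u : usubmx (Psi u) = usubmx u.
Proof. by rewrite /Psi mul_col_mx mul0mx -[u in LHS]vsubmxK add_col_mx addr0 col_mxKu. Qed.

Let PhiK u : Psi (Phi u) = u.
Proof. by rewrite {1}/Psi usubPhi subrK. Qed.

Let PsiK u : Phi (Psi u) = u.
Proof. by rewrite {1}/Phi usubPsi addrK. Qed.

Let sPhi : sm V Phi.
Proof.
apply: sm_subr => //; first exact: sm_id.
by apply: sm_restrict sthu => u [].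
Qed.

Let PhiV : Phi @` V = E1 `&` Psi @^-1` V.
Proof.
apply/seteqP; split=> [_ [u [Zu Eu] <-]|u [Eu Vu]].
  by rewrite /E1 /= usubPhi; split=> //; rewrite PhiK.
by exists (Psi u).
Qed.

Let sPsi1 : sm E1 Psi.
Proof. by apply: sm_add => //; exact: sm_id. Qed.

Let oPV : open (Phi @` V).
Proof.
rewrite PhiV openE => u [Eu Vu]; apply: filterI; first exact: open_nbhs_nbhs.
by apply: (C1v_continuous (sm_C1v oE1 sPsi1 Eu)); exact: open_nbhs_nbhs.
Qed.

Let sPsi : sm (Phi @` V) Psi.
Proof. by apply: sm_restrict sPsi1; rewrite PhiV => u []. Qed.

(** Subtracting [t theta(q)] from [xi] straightens [L_t] to {xi = 0}; since [q] is left alone,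
    adding it back is the inverse. *)
Definition shear := rechart c V Phi Psi.

Let Vc : V `<=` cimg c. Proof. by move=> u [/Zc]. Qed.

Let ss : smooth_chart shear.
Proof. by apply: rechart_smooth => // u _; exact: PhiK. Qed.

Let slice0P (u : 'cV[R]_(n + n)) :
  (forall j : 'I_(n + n), (n <= j)%N -> u j ord0 = 0) <-> dsubmx u = 0.
Proof.
split=> [h|h j nj].
  by apply/colP => i; rewrite !mxE h//= leq_addr.
case: (split_ordP j) nj => k -> nk; first by move: nk; rewrite leqNgt /= ltn_ord.
by have := congr1 (fun M : 'cV[R]_n => M k ord0) h; rewrite !mxE.
Qed.

Lemma jac_shear (u : 'cV[R]_(n + n)) : bal e (usubmx u) ->
  jac Phi u = 1%:M - col_mx 0 t%:M *m (jac th (usubmx u) *m row_mx 1%:M 0).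
Proof.
move=> Bu; have C := th_C1v sth (eQ Bu).
apply: jacE => i j.
have D1 : dmx u (cvec j) (fun u : 'cV[R]_(n + n) => u) (cvec j).
  by move=> a b; rewrite (ord1 b); exact: is_derive_coordv.
have D2 : dmx u (cvec j) (fun u : 'cV[R]_(n + n) => th (usubmx u)) (jac th (usubmx u) *m row_mx 1%:M 0 *m cvec j).
  have -> : (fun u : 'cV[R]_(n + n) => th (usubmx u)) = th \o (fun u => row_mx 1%:M 0 *m u).
    by apply/funext => w; rewrite /= usub_row.
  have C' : C1v (th \o (fun u : 'cV[R]_(n + n) => row_mx 1%:M 0 *m u)) u.
    move=> a; have := sthu; rewrite (_ : (fun w => _) = fun w : 'cV[R]_(n + n) => th (usubmx w) a ord0); last first.
      by apply/funext => w; rewrite /= usub_row.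
    move=> _; have sT : sm E1 (fun u : 'cV[R]_(n + n) => th (usubmx u)).
      apply: (sm_comp oE1 oQb _ _ sth); last by move=> w /eQ.
      by apply: sm_usub => //; exact: sm_id.
    exact: (sm_C1v oE1 sT Bu).
  have := jacD j C'; rewrite jac_comp; first by rewrite jac_lin -usub_row.
    by rewrite -usub_row.
  exact: C1v_lin.
apply: is_derive_eq; first exact: (dmx_sub D1 (dmx_mull (col_mx 0 t%:M) D2) i ord0).
rewrite [col_mx 0 t%:M *m _]mulmxA -[X in X - _]mul1mx -mulmxBl.
by rewrite [LHS](_ : _ = col j (1%:M - col_mx 0 t%:M *m (jac th (usubmx u) *m row_mx 1%:M 0)) i ord0) ?colE// -colE [LHS]mxE.
Qed.

Lemma shear_slice : slice_chart n (Lt t) shear.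
Proof.
split; first exact: ss.
move=> y [cy [Zy Ey]]; rewrite slice0P.
have d0 : dsubmx (coord shear y) = dsubmx (coord c y) - t *: th (usubmx (coord c y)).
  rewrite /= /Phi mul_col_mx mul0mx -[coord c y in LHS]vsubmxK opp_col_mx add_col_mx col_mxKd col_mxKu.
  by rewrite mul_scalar_mx.
rewrite d0; split=> [[_ [v [Tv vt vE]]]|/eqP].
  by rewrite vE /graph_at col_mxKu col_mxKd vt mul_mx_scalar subrr.
rewrite subr_eq0 => /eqP dE; split=> //; exists (col_mx t%:M (usubmx (coord c y))); split.
- exact: tbt.
- by rewrite col_mxKu.
- by rewrite /graph_at col_mxKu col_mxKd mul_mx_scalar -dE vsubmxK.
Qed.

Lemma Lt_shear p : Lt t p -> cdom shear p.
Proof.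
move=> [cp [v [Tv vt vE]]]; have [_ Zv] := grO Tv; split=> //=.
by split; rewrite /= vE// /graph_at col_mxKu; case: Tv.
Qed.

Lemma Lt_submanifold : submanifold n (Lt t).
Proof.
split; first exact: leq_addr.
by move=> p Lp; exists shear; [exact: shear_slice|exact: Lt_shear].
Qed.

Lemma Lt_tangent p v (w : 'cV[R]_(n + n)) : tbox e v -> usubmx v = t%:M -> cdom c p -> coord c p = gr v ->
  tangent n (Lt t) p w <-> exists x : 'cV[R]_n, tr c p *m w = col_mx 1%:M (t *: jac th (dsubmx v)) *m x.
Proof.
move=> Tv vt cp pE; have Lp : Lt t p by split=> //; exists v.
have sp := Lt_shear Lp; rewrite (tangentE w shear_slice sp Lp) slice0P.
have sV : sm V Phi := sPhi.
rewrite (rechart_tr sc oV sV sp).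
have Bu : bal e (usubmx (coord c p)) by rewrite pE /graph_at col_mxKu; case: Tv.
rewrite jac_shear// pE [usubmx (gr v)]col_mxKu; set D := jac th _; set W := tr c p.
have E (a : 'cV[R]_(n + n)) : dsubmx ((1%:M - col_mx 0 t%:M *m (D *m row_mx 1%:M 0)) *m a) = dsubmx a - t *: (D *m usubmx a).
  rewrite mulmxBl mul1mx -!mulmxA -usub_row mul_col_mx mul0mx -[X in dsubmx (X - _)]vsubmxK.
  by rewrite opp_col_mx add_col_mx col_mxKd mul_scalar_mx.
rewrite -mulmxA E; split=> [/eqP|[x xE]].
  rewrite subr_eq0 => /eqP dE; exists (usubmx (W *m w)).
  by rewrite mul_col_mx mul1mx -scalemxAl -dE vsubmxK.
by rewrite xE mul_col_mx mul1mx col_mxKu col_mxKd -scalemxAl subrr.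
Qed.

(** The graph of [t theta] is Lagrangian because the Jacobian of [theta] is symmetric. *)
Lemma Lt_lagrangian : lagrangian n (Lt t).
Proof.
split=> //; first exact: Lt_submanifold.
move=> p Lp v w; have [cp [u [Tu ut uE]]] := Lp.
rewrite !(Lt_tangent _ Tu ut cp uE) => -[x xE] [y yE].
have Qu : Qb (dsubmx u) by have [] := grO Tu.
rewrite cw// !mulmxA -trmx_mul -mulmxA xE yE.
rewrite !mul_col_mx !mul1mx tr_col_mx mul_row_block !mulmx0 mulmxN !mulmx1 add0r addr0 mul_row_col.
rewrite -!scalemxAl mulNmx linearZ /= trmx_mul thsym// -scalemxAl -scalemxAr mulmxA addrC.
exact: subrr.
Qed.

Section Side.
Variables (X : @holPoisson R n) (pi : Z -> X) (cx : @chart R X n).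
Variables (P : 'cV[R]_(n + n) -> 'cV[R]_n) (H : 'cV[R]_(1 + n) -> 'cV[R]_n).
Hypotheses (scx : smooth_chart cx) (hpi : forall p, cdom c p -> Zb (coord c p) ->
  cdom cx (pi p) /\ coord cx (pi p) = P (coord c p)).
Hypotheses (sP : sm Zb P) (oA : open (lift_map th P @` tbox e)).
Hypotheses (uP : forall w, tbox e w -> slice_jac th P w \in unitmx).
Hypotheses (sH : sm (lift_map th P @` tbox e) H)
  (HK : forall w, tbox e w -> H (lift_map th P w) = dsubmx w).
Local Notation A := (lift_map th P @` tbox e).

Let Zdom : set Z := cdom c `&` coord c @^-1` Zb.
Let oZdom : open Zdom.
Proof.
have [[oc _ _ cc _] _] := sc; rewrite openE => p [cp Zp]; apply: filterI; first exact: open_nbhs_nbhs.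
by apply: (cc p cp); exact: open_nbhs_nbhs.
Qed.

Lemma side_lrep : lrep c cx pi Zdom P.
Proof.
split=> //; first by move=> p [].
- by move=> p [cp Zp]; have [] := hpi cp Zp.
- by apply: sm_restrict sP => _ [p [cp Zp] <-].
- by move=> p [cp Zp]; have [] := hpi cp Zp.
Qed.

Lemma Lt_Zdom p : Lt t p -> Zdom p.
Proof. by move=> [cp [v [Tv vt vE]]]; split=> //=; rewrite vE; have [] := grO Tv. Qed.

(** Inverting [slice_jac] finds the tangent vector of [L_t] with the same image as the given
    vector. *)
Lemma side_transverse : transverse_ker pi n (Lt t).
Proof.
move=> p Lp v; have [cp [u [Tu ut uE]]] := Lp; have Zp := Lt_Zdom Lp.
have T := lrep_tmap sc scx side_lrep Zp.
have up := uP Tu; rewrite /slice_jac ut -uE mxE eqxx mulr1n in up.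
pose x : 'cV[R]_n := invmx (jac P (coord c p) *m col_mx 1%:M (t *: jac th (dsubmx u))) *m (jac P (coord c p) *m (tr c p *m v)).
pose w : 'cV[R]_(n + n) := invmx (tr c p) *m (col_mx 1%:M (t *: jac th (dsubmx u)) *m x).
have wE : tr c p *m w = col_mx 1%:M (t *: jac th (dsubmx u)) *m x by rewrite tr_invK.
exists w; first by apply/(Lt_tangent _ Tu ut cp uE); exists x.
have ucx : tr cx (pi p) \in unitmx by apply: tr_unit => //; have [] := hpi cp Zp.2.
apply: (can_inj (mulKmx ucx)); rewrite mulmx0 mulmxA T -mulmxA mulmxBr wE mulmxBr.
rewrite [X in _ - X]mulmxA /x.
by rewrite mulKVmx// subrr.
Qed.

Lemma side_section x : cdom cx x -> A (col_mx t%:M (coord cx x)) ->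
  Lt t (icoord c (st th H (col_mx t%:M (coord cx x)))) /\
  pi (icoord c (st th H (col_mx t%:M (coord cx x)))) = x.
Proof.
move=> cx_ /(AmP HK)[v [Tv vE sE uE]]; rewrite sE; rewrite col_mxKu in uE.
have [Lv cE] := Lt_icoord Tv; rewrite uE mxE eqxx mulr1n in Lv; split=> //.
have [cp Zp] := Lt_Zdom Lv; have [d1 d2] := hpi cp Zp.
have [[_ _ xK _ _] _] := scx; rewrite -[LHS]xK// d2 cE -[RHS]xK//; congr icoord.
by have := congr1 dsubmx vE; rewrite /lift_map !col_mxKd.
Qed.

Lemma side_inj p p' : Lt t p -> Lt t p' -> pi p = pi p' -> p = p'.
Proof.
move=> Lp Lp' pE; have [cp [v [Tv vt vE]]] := Lp; have [cp' [v' [Tv' vt' vE']]] := Lp'.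
have [_ Zp] := Lt_Zdom Lp; have [_ Zp'] := Lt_Zdom Lp'.
have [_ e1] := hpi cp Zp; have [_ e2] := hpi cp' Zp'.
have vv : v = v'.
  rewrite -[v]vsubmxK -[v']vsubmxK vt vt'; congr col_mx.
  by rewrite -HK// -[RHS]HK// /lift_map vt vt' -vE -vE' -e1 -e2 pE.
have [[_ _ cK _ _] _] := sc; rewrite -[LHS]cK// -[RHS]cK// vE vE' vv.
by [].
Qed.

Lemma side_image : pi @` Lt t = cdom cx `&` coord cx @^-1` [set y | A (col_mx t%:M y)].
Proof.
apply/seteqP; split=> [_ [p Lp <-]|x [cx_ Ax]].
  have [cp [v [Tv vt vE]]] := Lp; have [_ Zp] := Lt_Zdom Lp; have [d1 d2] := hpi cp Zp.
  by split=> //=; rewrite d2; exists v => //; rewrite /lift_map vt vE.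
by have [Lp pE] := side_section cx_ Ax; exists (icoord c (st th H (col_mx t%:M (coord cx x)))).
Qed.

Lemma side_open : open (pi @` Lt t).
Proof.
rewrite side_image; have [[oc _ _ cc _] _] := scx; have [oS _] := slice0 H t%:M oA.
rewrite openE => x [cx_ Ax]; apply: filterI; first exact: open_nbhs_nbhs.
by apply: (cc x cx_); exact: open_nbhs_nbhs.
Qed.

Lemma section_lrep : lrep cx c (fun x => icoord c (st th H (col_mx t%:M (coord cx x)))) (pi @` Lt t)
  (fun y => st th H (col_mx t%:M y)).
Proof.
have sS := sm_st sth grO oA sH HK; have [oS h] := slice0 (st th H) t%:M oA.
split; first exact: side_open.
- by rewrite side_image => x [].
- by rewrite side_image => x [cx_ Ax]; have [[]] := side_section cx_ Ax.
- by apply: sm_restrict (h sS); rewrite side_image => _ [x [_ Ax] <-].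
- rewrite side_image => x [cx_ Ax]; have [v [Tv vE sE uE]] := AmP HK Ax.
  by rewrite sE; have [] := Lt_icoord Tv.
Qed.

Lemma side_diffeo : diffeo_on pi (Lt t).
Proof.
split; first exact: side_open.
- by move=> p p'; rewrite !inE => Lp Lp'; exact: side_inj.
exists (fun x => icoord c (st th H (col_mx t%:M (coord cx x)))).
  apply: lrep_smooth => x Ux; exists cx, c, (pi @` Lt t), (fun y => st th H (col_mx t%:M y)); split=> //.
  exact: section_lrep.
by move=> x; rewrite {1}side_image => -[cx_ Ax]; exact: side_section.
Qed.

(** [sinv] is defined by choice; injectivity of [pi] on [L_t] identifies it with the explicit
    section. *)
Lemma sinv_section x : (pi @` Lt t) x ->
  sinv z pi (Lt t) x = icoord c (st th H (col_mx t%:M (coord cx x))).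
Proof.
rewrite side_image => -[cx_ Ax]; have [Lp pE] := side_section cx_ Ax.
have := xgetPex z (ex_intro (fun p => Lt t p /\ pi p = x) _ (conj Lp pE)).
by move=> [Ls sE]; apply: side_inj => //; rewrite sE pE.
Qed.
End Side.
End Shear.
End Realization.
End Family_of_bisections.

(** * The operator d^c d in coordinates, and integration over [0, 1] *)

Section Ddc_in_charts.
Context {R : realType}.

Lemma rext1_near n (a b : 'cV[R]_n -> 'cV[R]_n) u : (\forall w \near u, a w = b w) -> rext1 a u = rext1 b u.
Proof. by move=> h; rewrite /rext1 (jac_near h). Qed.

Lemma rext1_mull n (a : 'cV[R]_n -> 'cV[R]_n) (k : R) u : C1v a u ->
  rext1 (fun w => k *: a w) u = k *: rext1 a u.
Proof.
move=> Ca; rewrite /rext1 (_ : (fun w => _) = fun w => k%:M *m a w); last first.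
  by apply/funext => w; rewrite mul_scalar_mx.
by rewrite (jac_mull _ Ca) mul_scalar_mx scalerBr linearZ.
Qed.

Lemma ext1_parts n (al : 'cV[R]_n -> 'cV[R[i]]_n) u :
  ext1 al u = cmx (rext1 (fun w => re_mx (al w)) u) + 'i%C *: cmx (rext1 (fun w => im_mx (al w)) u).
Proof.
have E1 i : (fun w => re_mx (al w) i ord0) = fun w => complex.Re (al w i ord0).
  by apply/funext => w; rewrite mxE.
have E2 i : (fun w => im_mx (al w) i ord0) = fun w => complex.Im (al w i ord0).
  by apply/funext => w; rewrite mxE.
apply/matrixP => a b; rewrite !mxE !E1 !E2 /cD.
by apply/eqP; rewrite eq_complex /= !(mul0r, mul1r, addr0, oppr0, add0r, subr0) !eqxx.
Qed.

(** The left side is [dc1] unfolded, for a form whose (1,0) and (0,1) parts have exterior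
    derivatives [- i K / 2] and [i K / 2]. The condition [J^T K = - K J] says that [K] has type
    (1,1), so its (2,0) and (0,2) parts drop out and the rest adds up to [K]. *)
Lemma type11 (F : fieldType) n (im : F) (J K : 'M[F]_n) : im * im = -1 -> (2 : F) != 0 ->
  J *m J = - 1%:M -> J^T *m K = - (K *m J) ->
  let P := 2^-1 *: (1%:M - im *: J) in let Pb := 2^-1 *: (1%:M + im *: J) in
  im *: (Pb^T *m ((- 2^-1 * im) *: K) *m P + P^T *m ((- 2^-1 * im) *: K) *m Pb
          + Pb^T *m ((2^-1 * im) *: K) *m Pb
         - (P^T *m ((- 2^-1 * im) *: K) *m P
            + (Pb^T *m ((2^-1 * im) *: K) *m P + P^T *m ((2^-1 * im) *: K) *m Pb))) = K.
Proof.
move=> II n2 JJ JK P Pb.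
have PK : P^T *m K = K *m Pb.
  rewrite /P /Pb linearZ /= linearB /= trmx1 linearZ /= -scalemxAl mulmxBl mul1mx -scalemxAl JK.
  by rewrite -scalemxAr mulmxDr mulmx1 -scalemxAr scalerN opprK.
have PbK : Pb^T *m K = K *m P.
  rewrite /P /Pb linearZ /= linearD /= trmx1 linearZ /= -scalemxAl mulmxDl mul1mx -scalemxAl JK.
  by rewrite -scalemxAr mulmxBr mulmx1 -scalemxAr scalerN.
have iJJ : (im *: J) *m (im *: J) = 1%:M.
  by rewrite -scalemxAl -scalemxAr scalerA II JJ scaleN1r opprK.
have PbP : Pb *m P = 0.
  rewrite /P /Pb -scalemxAl -scalemxAr mulmxBr mulmx1 mulmxDl mul1mx iJJ.
  by rewrite [X in _ - X]addrC subrr !scaler0.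
have PPb : P *m Pb = 0.
  rewrite /P /Pb -scalemxAl -scalemxAr mulmxDr mulmx1 mulmxBl mul1mx iJJ.
  by rewrite addrA subrK subrr !scaler0.
have S : P + Pb = 1%:M.
  by rewrite /P /Pb -scalerDr addrACA addNr addr0 -mulr2n -scalerMnr scalerMnl -mulr_natr mulVf ?scale1r.
have T1 : P^T *m K *m P = 0 by rewrite PK -mulmxA PbP mulmx0.
have T2 : Pb^T *m K *m Pb = 0 by rewrite PbK -mulmxA PPb mulmx0.
have T3 : Pb^T *m K *m P + P^T *m K *m Pb = K.
  have PP : (P + Pb) *m (P + Pb) = 1%:M by rewrite S mulmx1.
  by rewrite mulmxDl !mulmxDr PbP PPb addr0 add0r in PP; rewrite PK PbK -!mulmxA -mulmxDr PP mulmx1.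
have sc (A B : 'M[F]_n) s : A *m (s *: K) *m B = s *: (A *m K *m B) by rewrite -scalemxAr -scalemxAl.
rewrite !sc T1 T2 -!scalerDr T3 !scaler0 addr0 add0r -scalerBl scalerA.
have h2 : 2^-1 + 2^-1 = 1 :> F by rewrite -[2^-1]mul1r -mulrDl; exact: mulfV n2.
by rewrite mulNr -opprD -mulrDl h2 mul1r mulrN II opprK scale1r.
Qed.

(** For a closed real form [ga], d^c acts as d after [J^*]: the (1,0) and (0,1) parts of [ga] are
    [ga / 2] minus and plus [i / 2] times [J^* ga], and only the second term has a nonzero
    differential. *)
Lemma dc1_real n (J' : 'cV[R]_n -> 'M[R]_n) (ga : 'cV[R]_n -> 'cV[R]_n) u :
  J' u *m J' u = - 1%:M -> C1v ga u -> C1v (fun w => (J' w)^T *m ga w) u -> rext1 ga u = 0 ->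
  (J' u)^T *m rext1 (fun w => (J' w)^T *m ga w) u = - (rext1 (fun w => (J' w)^T *m ga w) u *m J' u) ->
  dc1 J' (fun w => cmx (ga w)) u = cmx (rext1 (fun w => (J' w)^T *m ga w) u).
Proof.
move=> JJ Cg Cb g0; set be := fun w => _ in Cb *; set K := rext1 be u => JK.
have c0 : cmx (0 : 'M[R]_n) = 0 by apply/matrixP => i j; rewrite !mxE.
have cZ q (k : R) (A : 'M[R]_(n, q)) : cmx (k *: A) = k%:C%C *: cmx A by apply/matrixP => i j; rewrite !mxE rmorphM.
have T (s : R) w : (2^-1 *: (1%:M + (s%:C%C * 'i%C) *: cmx (J' w)))^T *m cmx (ga w) =
    cmx (2^-1 *: ga w) + 'i%C *: cmx ((s * 2^-1) *: be w).
  rewrite linearZ /= linearD /= trmx1 linearZ /= -scalemxAl mulmxDl mul1mx -scalemxAl cmx_tr -map_mxM -/(be w).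
  rewrite !cZ scalerDr !scalerA !rmorphM !fmorphV !rmorph_nat; congr (_ + _ *: _).
  by rewrite mulrC -mulrA [RHS]mulrCA.
have reT (A B : 'cV[R]_n) : re_mx (cmx A + 'i%C *: cmx B) = A.
  by apply/matrixP => i j; rewrite !mxE /=; ring.
have imT (A B : 'cV[R]_n) : im_mx (cmx A + 'i%C *: cmx B) = B.
  by apply/matrixP => i j; rewrite !mxE /=; ring.
have E10 : ext1 (typ10 J' (fun w => cmx (ga w))) u = (- 2^-1 * 'i%C) *: cmx K.
  have E w : typ10 J' (fun w => cmx (ga w)) w = cmx (2^-1 *: ga w) + 'i%C *: cmx ((-1 * 2^-1) *: be w).
    by rewrite -T /typ10 /P10 rmorphN rmorph1 mulN1r scaleNr.
  rewrite ext1_parts (_ : (fun w => re_mx _) = fun w => 2^-1 *: ga w); last by apply/funext => w; rewrite E reT.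
  rewrite (_ : (fun w => im_mx _) = fun w => (-1 * 2^-1) *: be w); last by apply/funext => w; rewrite E imT.
  rewrite !rext1_mull// g0 scaler0 c0 add0r -/K mulN1r cZ scalerA rmorphN fmorphV rmorph_nat.
  by rewrite mulrC.
have E01 : ext1 (typ01 J' (fun w => cmx (ga w))) u = (2^-1 * 'i%C) *: cmx K.
  have E w : typ01 J' (fun w => cmx (ga w)) w = cmx (2^-1 *: ga w) + 'i%C *: cmx ((1 * 2^-1) *: be w).
    by rewrite -T /typ01 /P01 rmorph1 mul1r.
  rewrite ext1_parts (_ : (fun w => re_mx _) = fun w => 2^-1 *: ga w); last by apply/funext => w; rewrite E reT.
  rewrite (_ : (fun w => im_mx _) = fun w => (1 * 2^-1) *: be w); last by apply/funext => w; rewrite E imT.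
  rewrite !rext1_mull// g0 scaler0 c0 add0r -/K mul1r cZ scalerA fmorphV rmorph_nat.
  by rewrite mulrC.
have II : 'i%C * 'i%C = -1 :> R[i] by rewrite -expr2 sqr_i.
have n2 : (2 : R[i]) != 0 by rewrite pnatr_eq0.
have cJJ : cmx (J' u) *m cmx (J' u) = - 1%:M by rewrite -map_mxM JJ map_mxN map_mx1.
have cJK : (cmx (J' u))^T *m cmx K = - (cmx K *m cmx (J' u)) by rewrite cmx_tr -!map_mxM JK map_mxN.
have H := type11 II n2 cJJ cJK.
by rewrite -E10 -E01 in H; exact: H.
Qed.

Lemma ext0_real n (g : 'cV[R]_n -> R) :
  ext0 (fun u => (g u)%:C%C) = fun u => cmx (\col_i 'D_(cvec i) g u).
Proof.
apply/funext => u; apply/colP => i; rewrite !mxE /cD /=.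
by congr (_ +i* _)%C; exact: derive_cst.
Qed.

(** [ddc] is defined in the preferred chart, where the complex structure varies. In a holomorphic
    chart [J] is constant, [d (J^* dF)] is seen to have type (1,1), and naturality of d carries this
    back to the preferred chart. *)
Lemma ddc_chart n (X : @holPoisson R n) (c : @chart R X n) (J : 'M[R]_n) (W : set X) (f : X -> R)
    (F : 'cV[R]_n -> R) x : holo_chart (@cpx R n X) J c -> open W -> W `<=` cdom c -> W x ->
  (forall y, W y -> f y = F (coord c y)) -> sm (coord c @` W) (fun u => (F u)%:M : 'M[R]_1) ->
  ddc f x = cmx ((tr c x)^T *m rext1 (fun u => J^T *m grad F u) (coord c x) *m tr c x).
Proof.
move=> [sc hJ] oW Wc Wx fF sF.
have cx := Wc x Wx; set a := chart_at x; have sa : smooth_chart a := chart_at_smooth x.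
have ax : cdom a x by exact: chart_at_dom.
have oV : open (coord c @` W) by apply: open_imgS => //; exact: sc.1.
pose ta := coord c \o icoord a.
pose U := coord a @` (cdom a `&` W).
have oU : open U by apply: open_img => //; exact: sa.1.
have Ua : U (coord a x) by exists x.
have [[_ _ aK _ _] _] := sa.
have UE u : U u -> exists y, [/\ cdom a y, W y, u = coord a y & icoord a u = y].
  by move=> [y [ay Wy] <-]; exists y; split=> //; exact: aK.
have sta : sm U ta.
  apply: sm_restrict (trans_sm sa sc) => u /UE[y [ay Wy -> _]].
  by exists y => //; split=> //; exact: Wc.
have taV u : U u -> (coord c @` W) (ta u).
  by move=> /UE[y [ay Wy -> _]]; rewrite /ta /= aK//; exists y.
have sG := sm_grad oV sF.
have JX (y : X) : cpx y *m cpx y = - 1%:M by have [H _] := cpxP X; exact: H.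
have JJ : J *m J = - 1%:M.
  have ux := tr_unit sc cx; apply: (can_inj (mulmxK ux)).
  by rewrite -mulmxA -hJ// mulmxA -hJ// -mulmxA JX mulmxN mulmx1 mulNmx mul1mx.
pose ga u := \col_i 'D_(cvec i) (fun u => f (icoord a u)) u.
have gaE u : U u -> ga u = (jac ta u)^T *m grad F (ta u).
  move=> Uu; rewrite -grad_comp; last 2 first.
  - by apply: (sm1_C1at oV sF); exact: taV.
  - exact: (sm_C1v oU sta Uu).
  have [y [ay Wy uy _]] := UE u Uu; apply/colP => i; rewrite !mxE; apply: near_eq_derive.
  rewrite uy; have n1 := near_coord sa.1 ay oW Wy.
  by apply: filterS n1 => v [Wv [_ vE]]; rewrite /= /ta /= fF.
have sga : sm U ga.
  apply: (sm_ext oU (f := fun u => (jac ta u)^T *m grad F (ta u))); first by move=> u /gaE.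
  apply: sm_mul => //; first by apply: sm_tr => //; exact: sm_jac.
  exact: (sm_comp oU oV sta taV sG).
have FE k : CkP k (lift1 (coord c @` W)) (fun _ : bool => F).
  apply: CkP_ext (sF k ord0 ord0); first exact: open_lift1.
  by move=> p _; rewrite mxE eqxx mulr1n.
have Hs v : (coord c @` W) v -> (jac (grad F) v)^T = jac (grad F) v.
  move=> Vv; apply/matrixP => i j; rewrite !mxE.
  have E k : (fun w => grad F w k ord0) = 'D_(cvec k) F by apply/funext => w; rewrite mxE.
  rewrite !E; exact: (schwarz (t := true) i j (open_lift1 oV) (FE 2%N) Vv).
have CG v : (coord c @` W) v -> C1v (grad F) v by move=> Vv; exact: (sm_C1v oV sG Vv).
have R0 v : (coord c @` W) v -> rext1 (grad F) v = 0 by move=> Vv; rewrite /rext1 Hs// subrr.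
have RJ v : (coord c @` W) v -> rext1 (fun u => J^T *m grad F u) v = J^T *m jac (grad F) v - jac (grad F) v *m J.
  by move=> Vv; rewrite /rext1 (jac_mull _ (CG v Vv)) trmx_mul trmxK Hs.
(* Type (1,1): the Hessian is symmetric, and [J] is constant with square -1. *)
have JR v : (coord c @` W) v -> J^T *m rext1 (fun u => J^T *m grad F u) v = - (rext1 (fun u => J^T *m grad F u) v *m J).
  move=> Vv; rewrite RJ// mulmxBr mulmxBl !mulmxA -(trmx_mul J J) JJ linearN /= trmx1 mulNmx mul1mx.
  by rewrite -[jac _ _ *m J *m J]mulmxA JJ mulmxN mulmx1 opprK opprD addrC.
pose J' := rep_endo a (@cpx R n X).
have chiJ u : U u -> jac ta u *m J' u = J *m jac ta u.
  move=> /UE[y [ay Wy -> yE]]; have cy := Wc y Wy; have ua := tr_unit sa ay.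
  rewrite /J' /rep_endo aK//; apply: (can_inj (mulmxK ua)).
  by rewrite -[LHS]mulmxA mulmxKV// mulmxA -(tr_trans sa sc ay cy) hJ// -mulmxA -(tr_trans sa sc ay cy).
have beE u : U u -> (J' u)^T *m ga u = (jac ta u)^T *m (J^T *m grad F (ta u)).
  by move=> Uu; rewrite gaE// !mulmxA -!trmx_mul chiJ.
have sJG : sm (coord c @` W) (fun u => J^T *m grad F u) by apply: sm_mul => //; exact: sm_cst.
have sbe : sm U (fun u => (J' u)^T *m ga u).
  apply: (sm_ext oU (f := fun u => (jac ta u)^T *m (J^T *m grad F (ta u)))); first by move=> u /beE.
  apply: sm_mul => //; first by apply: sm_tr => //; exact: sm_jac.
  exact: (sm_comp oU oV sta taV sJG).
have nU : \forall u \near coord a x, U u by exact: open_nbhs_nbhs.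
have K1 : rext1 ga (coord a x) = 0.
  rewrite (rext1_near (b := fun u => (jac ta u)^T *m grad F (ta u))); last by apply: filterS nU => u /gaE.
  by rewrite (rext1_pull oU oV sta sG Ua (taV _ Ua)) R0 ?mulmx0 ?mul0mx//; exact: taV.
have tax : ta (coord a x) = coord c x by rewrite /ta /= aK.
have K2 : rext1 (fun u => (J' u)^T *m ga u) (coord a x) =
    (tr c x)^T *m rext1 (fun u => J^T *m grad F u) (coord c x) *m tr c x.
  rewrite (rext1_near (b := fun u => (jac ta u)^T *m (J^T *m grad F (ta u)))); last by apply: filterS nU => u /beE.
  by rewrite (rext1_pull oU oV sta sJG Ua (taV _ Ua)) tax.
have chix : tr c x *m J' (coord a x) = J *m tr c x by exact: (chiJ _ Ua).
have J'J' : J' (coord a x) *m J' (coord a x) = - 1%:M.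
  have ux := tr_unit sc cx; apply: (can_inj (mulKmx ux)).
  by rewrite mulmxA chix -mulmxA chix mulmxA JJ mulNmx mul1mx mulmxN mulmx1.
rewrite -K2 -(dc1_real J'J' (sm_C1v oU sga Ua) (sm_C1v oU sbe Ua) K1); last first.
  have H : J^T *m rext1 (fun u => J^T *m grad F u) (coord c x) = - (rext1 (fun u => J^T *m grad F u) (coord c x) *m J).
    by apply: JR; rewrite -tax; exact: taV.
  rewrite K2; move: (J' (coord a x)) chix => Ja chix; set K := rext1 _ _ in H *.
  rewrite !mulmxA -trmx_mul chix trmx_mul -[_ *m J^T *m K]mulmxA H mulmxN mulNmx.
  by rewrite -!mulmxA chix.
by rewrite /ddc ext0_real.
Qed.

Lemma ftc01 (G g : R -> R) (eps : R) : 0 < eps ->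
  (forall t : R, - eps < t < 1 + eps -> is_derive t 1 G (g t)) ->
  (forall t : R, 0 <= t <= 1 -> {for t, continuous g}) ->
  \int[lebesgue_measure]_(t in `[0, 1]) g t = G 1 - G 0.
Proof.
move=> eps0 hG hg.
have te (t : R) : 0 <= t <= 1 -> - eps < t < 1 + eps.
  move=> /andP[a b]; apply/andP; split; [apply: lt_le_trans a|apply: le_lt_trans b _].
    by rewrite oppr_lt0.
  by rewrite ltrDl.
have Gc (t : R) : 0 <= t <= 1 -> {for t, continuous G}.
  move=> t01; apply: differentiable_continuous; apply/derivable1_diffP.
  by case: (hG t (te t t01)).
have o1 (t : R) : t \in `]0, 1[ -> 0 <= t <= 1.
  by rewrite in_itv /= => /andP[a b]; rewrite !ltW.
have F := @continuous_FTC2 R g G 0 1 ltr01.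
rewrite /Rintegral F/= ?fineB//.
- by apply: continuous_in_subspaceT => t; rewrite inE /= in_itv /= => /hg.
- split.
  + by move=> t /o1/te/hG[].
  + by apply: cvg_at_right_filter; apply: Gc; rewrite lexx ler01.
  + by apply: cvg_at_left_filter; apply: Gc; rewrite lexx ler01.
- by move=> t /o1/te/hG[? E]; rewrite derive1E.
Qed.

Lemma int01_real n (G : R -> 'M[R[i]]_n) (K D : R -> 'M[R]_n) (eps : R) : 0 < eps ->
  (forall t : R, - eps < t < 1 + eps -> dmx t 1 K (D t)) ->
  (forall t : R, 0 <= t <= 1 -> forall i j, {for t, continuous (fun s => D s i j)}) ->
  (forall t : R, 0 <= t <= 1 -> G t = cmx (D t)) ->
  int01 G = cmx (K 1 - K 0).
Proof.
move=> eps0 hK hD GD; apply/matrixP => i j; rewrite !mxE.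
have I1 (t : R) : t \in (`[0, 1]%classic : set R) -> complex.Re (G t i j) = D t i j.
  by rewrite inE /= in_itv /= => t01; rewrite GD// !mxE.
have I2 (t : R) : t \in (`[0, 1]%classic : set R) -> complex.Im (G t i j) = 0.
  by rewrite inE /= in_itv /= => t01; rewrite GD// !mxE.
congr (_ +i* _)%C.
  apply: eq_trans (eq_Rintegral lebesgue_measure I1) _.
  apply: (ftc01 (G := fun t => K t i j) eps0); first by move=> t /hK; exact.
  by move=> t t01; exact: hD.
apply: eq_trans (eq_Rintegral lebesgue_measure I2) _.
apply: eq_trans (ftc01 (G := fun=> 0) eps0 _ _) (subrr _) => t _.
exact: cst_cont_at.
Qed.
End Ddc_in_charts.

(** * Linear consequences of the Morita equivalence; the flows on Z and X_- *)

Section Flows.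
Context {R : realType}.
Section MoritaAlgebra.
Variables (n m : nat) (Xm Xp : @holPoisson R n) (Z : @holSymp R m).
Variables (pim : Z -> Xm) (pip : Z -> Xp).
Hypothesis HZ : morita pim pip.

Lemma im_sigmaZ (p : Z) : im_mx (sigmaZ p) = (- 4^-1) *: invmx (omegaZ p).
Proof.
rewrite /sigmaZ; have -> : (- 4^-1 : R[i]) = (- 4^-1)%:C%C by rewrite rmorphN fmorphV rmorph_nat.
apply/matrixP => i j; rewrite !mxE /=.
by rewrite /= !mul0r !mul1r !add0r addr0.
Qed.

Lemma Qpois_im k (X : @holPoisson R k) (x : X) : im_mx (sigma x) = (- 4^-1) *: Qpois x.
Proof. by rewrite /Qpois scalerA mulrNN mulVf ?scale1r// pnatr_eq0. Qed.

Lemma im_mxN p q (A : 'M[R[i]]_(p, q)) : im_mx (- A) = - im_mx A.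
Proof. by apply/matrixP => i j; rewrite !mxE; case: (A i j). Qed.

Lemma im_congr p q (T : 'M[R]_(p, q)) (S : 'M[R[i]]_q) : im_mx (cmx T *m S *m (cmx T)^T) = T *m im_mx S *m T^T.
Proof. by rewrite cmx_tr im_mx_mul im_mx_mull. Qed.

Lemma q4_inj p q : injective ( *:%R (- 4^-1) : 'M[R]_(p, q) -> _).
Proof. by apply: scalerI; rewrite oppr_eq0 invr_eq0 pnatr_eq0. Qed.

Lemma morita_Qm p : tmap pim p *m invmx (omegaZ p) *m (tmap pim p)^T = - Qpois (pim p).
Proof.
have [_ _ H _ _] := HZ; have := congr1 (@im_mx R _ _) (H p).
rewrite im_mxN im_congr im_sigmaZ Qpois_im -scalerN -scalemxAr -scalemxAl.
exact: q4_inj.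
Qed.

Lemma morita_Qp p : tmap pip p *m invmx (omegaZ p) *m (tmap pip p)^T = Qpois (pip p).
Proof.
have [_ H _ _ _] := HZ; have := congr1 (@im_mx R _ _) (H p).
rewrite im_congr im_sigmaZ Qpois_im -scalemxAr -scalemxAl.
exact: q4_inj.
Qed.

Lemma morita_holom p : tmap pim p *m cpxZ p = cpx (pim p) *m tmap pim p.
Proof. by have [[[[_ H] _ _ _] _] _ _ _ _] := HZ; exact: H. Qed.

Lemma morita_holop p : tmap pip p *m cpxZ p = cpx (pip p) *m tmap pip p.
Proof. by have [[_ [[_ H] _ _ _]] _ _ _ _] := HZ; exact: H. Qed.

Lemma morita_smoothm : smooth_map setT pim.
Proof. by have [[[[H _] _ _ _] _] _ _ _ _] := HZ. Qed.

Lemma morita_smoothp : smooth_map setT pip.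
Proof. by have [[_ [[H _] _ _ _]] _ _ _ _] := HZ. Qed.

Lemma ker_orth p (u v : 'cV[R]_m) : tmap pim p *m u = 0 -> tmap pip p *m v = 0 ->
  v^T *m omegaZ p *m u = 0.
Proof.
move=> u0 v0; have [_ _ _ H _] := HZ; have [_ K] := H p.
have : ker_t pim p u by [].
rewrite K => /(_ v v0) /(congr1 (@im_mx R _ _)).
rewrite im_mx_mul cmx_tr im_mx_mull => ->.
by apply/matrixP => i j; rewrite !mxE.
Qed.

(** The vectors [omega^-1 (d pi_+)^T a] are [omega]-orthogonal to the kernel of [d pi_+]. That
    kernel is stable under the complex structure, so they are [Omega]-orthogonal to it and lie in
    the kernel of [d pi_-]. *)
Lemma morita_orth p : tmap pim p *m invmx (omegaZ p) *m (tmap pip p)^T = 0.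
Proof.
have [_ _ _ H _] := HZ; have [_ K] := H p; have wu := omega_unit p.
suff E (a : 'cV[R]_n) : tmap pim p *m (invmx (omegaZ p) *m ((tmap pip p)^T *m a)) = 0.
  by apply/matrixP => i j; have := congr1 (fun M : 'cV[R]_n => M i ord0) (E (cvec j)); rewrite !mulmxA -colE [LHS]mxE => ->; rewrite !mxE.
set v := invmx _ *m _; suff: ker_t pim p v by [].
rewrite K => w; rewrite /ker_t /= => w0.
have wv : omegaZ p *m v = (tmap pip p)^T *m a by rewrite mulKVmx.
have E1 : w^T *m omegaZ p *m v = 0.
  by rewrite -mulmxA wv mulmxA -trmx_mul w0 trmx0 mul0mx.
have E2 : w^T *m (omegaZ p *m cpxZ p) *m v = 0.
  rewrite -omegaJ_swap -mulmxA -[X in _ *m X]mulmxA wv !mulmxA -!trmx_mul.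
  by rewrite mulmxA morita_holop -mulmxA w0 mulmx0 trmx0 mul0mx.
apply: mx_complexP.
  rewrite re_mx_mul cmx_tr re_mx_mull Omega_re E2.
  by apply/matrixP => i j; rewrite !mxE.
rewrite im_mx_mul cmx_tr im_mx_mull E1.
by apply/matrixP => i j; rewrite !mxE.
Qed.

End MoritaAlgebra.

Lemma lrep_biv n (Z : @holSymp R (n + n)) (c : @chart R Z (n + n)) (X X' : @holPoisson R n)
    (pi : Z -> X) (pi' : Z -> X') (cx : @chart R X n) (cx' : @chart R X' n) W W' P P' p :
  smooth_chart c -> smooth_chart cx -> smooth_chart cx' ->
  lrep c cx pi W P -> lrep c cx' pi' W' P' -> W p -> W' p ->
  omegaZ p = (tr c p)^T *m block_mx 0 1%:M (- 1%:M) 0 *m tr c p ->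
  jac P (coord c p) *m iw n *m (jac P' (coord c p))^T =
  tr cx (pi p) *m (tmap pi p *m invmx (omegaZ p) *m (tmap pi' p)^T) *m (tr cx' (pi' p))^T.
Proof.
move=> sc scx scx' l l' Wp Wp' wE.
have cp : cdom c p by case: l => _ + _ _ _; exact.
have u := tr_unit sc cp; have uT : (tr c p)^T \in unitmx by rewrite unitmx_tr.
have T := lrep_tmap sc scx l Wp; have T' := lrep_tmap sc scx' l' Wp'.
have -> : tr cx (pi p) *m (tmap pi p *m invmx (omegaZ p) *m (tmap pi' p)^T) *m (tr cx' (pi' p))^T =
  (tr cx (pi p) *m tmap pi p) *m invmx (omegaZ p) *m (tr cx' (pi' p) *m tmap pi' p)^T.
  by rewrite [X in _ = _ *m X]trmx_mul !mulmxA.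
rewrite T T' [X in _ = _ *m X]trmx_mul -!mulmxA; congr (_ *m _); rewrite !mulmxA; congr (_ *m _).
have wu : omegaZ p \in unitmx := omega_unit p.
have iwE : (block_mx 0 1%:M (- 1%:M) 0 : 'M[R]_(n + n)) *m iw n = 1%:M := ws_iw n.
have iwE' := mulmx1C iwE.
set T0 := tr c p in wE u uT *; set ws := block_mx _ _ _ _ in iwE iwE' wE.
have : invmx (omegaZ p) = invmx T0 *m iw n *m invmx T0^T.
  apply: (can_inj (mulKmx wu)); rewrite mulmxV// {1}wE !mulmxA.
  by rewrite mulmxK// -[_ *m ws *m iw n]mulmxA iwE mulmx1 mulmxV.
by move=> ->; rewrite !mulmxA mulmxV// mul1mx mulmxKV.
Qed.

Lemma lrep_holo n k (Z : @holSymp R k) (c : @chart R Z k) (X : @holPoisson R n)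
    (pi : Z -> X) (cx : @chart R X n) W P J0 Jx p :
  smooth_chart c -> holo_chart (@cpx R n X) Jx cx -> lrep c cx pi W P -> W p ->
  tr c p *m cpxZ p = J0 *m tr c p -> tmap pi p *m cpxZ p = cpx (pi p) *m tmap pi p ->
  jac P (coord c p) *m J0 = Jx *m jac P (coord c p).
Proof.
move=> sc [scx hx] l Wp cJ hh.
have cp : cdom c p by case: l => _ + _ _ _; exact.
have cxp : cdom cx (pi p) by case: l => _ _ + _ _; exact.
have u := tr_unit sc cp; have T := lrep_tmap sc scx l Wp.
apply: (can_inj (mulmxK u)); rewrite -[LHS]mulmxA -cJ mulmxA -T -[LHS]mulmxA hh.
by rewrite mulmxA hx// -!mulmxA T mulmxA.
Qed.

Lemma sigma_re n (X : @holPoisson R n) (x : X) : re_mx (sigma x) = cpx x *m im_mx (sigma x).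
Proof.
have [_ H _ _ _] := sigmaP X; have := congr1 (@im_mx R _ _) (H x).
rewrite im_mx_mull => ->; apply/matrixP => i j; rewrite !mxE.
by case: (sigma x i j) => a b /=; rewrite mul0r mul1r add0r.
Qed.

Lemma lrep_holo_conv n (X Y : @holPoisson R n) (f : X -> Y) (cx : @chart R X n) (cy : @chart R Y n)
    W F Jx Jy x :
  holo_chart (@cpx R n X) Jx cx -> holo_chart (@cpx R n Y) Jy cy -> lrep cx cy f W F -> W x ->
  jac F (coord cx x) *m Jx = Jy *m jac F (coord cx x) ->
  tmap f x *m cpx x = cpx (f x) *m tmap f x.
Proof.
move=> [scx hx] [scy hy] l Wx hF.
have cxx : cdom cx x by case: l => _ + _ _ _; exact.
have cyx : cdom cy (f x) by case: l => _ _ + _ _; exact.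
have T := lrep_tmap scx scy l Wx.
apply: (can_inj (mulKmx (tr_unit scy cyx))); rewrite mulmxA T -mulmxA hx// mulmxA hF.
by rewrite mulmxA hy// -!mulmxA T.
Qed.

(** [sigma] is determined by its imaginary part and the complex structure, so a holomorphic map that
    preserves [Q] preserves [sigma]. *)
Lemma lrep_poisson_conv n (X Y : @holPoisson R n) (f : X -> Y) (cx : @chart R X n) (cy : @chart R Y n)
    W F x : smooth_chart cx -> smooth_chart cy -> lrep cx cy f W F -> W x ->
  tmap f x *m cpx x = cpx (f x) *m tmap f x ->
  jac F (coord cx x) *m (tr cx x *m Qpois x *m (tr cx x)^T) *m (jac F (coord cx x))^T =
    tr cy (f x) *m Qpois (f x) *m (tr cy (f x))^T ->
  cmx (tmap f x) *m sigma x *m (cmx (tmap f x))^T = sigma (f x).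
Proof.
move=> scx scy l Wx hF.
have cyx : cdom cy (f x) by case: l => _ _ + _ _; exact.
have T := lrep_tmap scx scy l Wx; have u := tr_unit scy cyx.
have uT : (tr cy (f x))^T \in unitmx by rewrite unitmx_tr.
have -> : jac F (coord cx x) *m (tr cx x *m Qpois x *m (tr cx x)^T) *m (jac F (coord cx x))^T =
  (jac F (coord cx x) *m tr cx x) *m Qpois x *m (jac F (coord cx x) *m tr cx x)^T.
  by rewrite [X in _ = _ *m X]trmx_mul !mulmxA.
rewrite -T [X in _ *m X = _]trmx_mul !mulmxA => /(can_inj (mulmxK uT)).
rewrite -!mulmxA => /(can_inj (mulKmx u)) QE; rewrite mulmxA.
have IE : tmap f x *m im_mx (sigma x) *m (tmap f x)^T = im_mx (sigma (f x)).
  by rewrite !Qpois_im -scalemxAr -scalemxAl -mulmxA QE.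
apply: mx_complexP; last by rewrite im_congr.
by rewrite cmx_tr re_mx_mul re_mx_mull !sigma_re mulmxA hF -!mulmxA -[in RHS]IE !mulmxA.
Qed.

(** The conclusion of the theorem, named so that it can be reached in two stages: from data in
    adapted coordinates, and then from the existence of such coordinates. *)
Definition has_brane_flow n m (Xm Xp : @holPoisson R n) (Z : @holSymp R m)
    (pim : Z -> Xm) (pip : Z -> Xp) (z : Z) (L : set Z) : Prop :=
  exists Lt : R -> set Z,
    [/\ forall t : R, 0 <= t <= 1 ->
          local_brane_bisection pim pip (Lt t) /\ Lt t z,
        germ_eq z (Lt 1) L
      & local_holo_bisection pim pip (Lt 0)] /\
    let Lam := Lt 0 in
    let U := pim @` Lam in
    let V := pip @` Lam in
    let phi : Xm -> Xp := pip \o sinv z pim Lam in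
    let phi' : Xp -> Xm := pim \o sinv z pip Lam in
    holo_poisson_iso U V phi phi' /\
    exists (W0 : set Xm) (f : R -> Xm -> R),
      [/\ [/\ open W0, W0 (pim z), W0 `<=` U & smooth_tfun W0 f],
          exists (W : set Z) (tau : R -> Z -> Z),
            [/\ open W, W z,
                is_flow [set p : Z | V (pip p) /\ W0 (phi' (pip p))]
                  (fun (t : R) (p : Z) => invmx (omegaZ p) *m
                     dfun (fun q : Z => f t (phi' (pip q))) p)
                  W tau
              & exists W' : set Z, [/\ open W', W' z &
                  forall t : R, 0 <= t <= 1 ->
                    Lt t `&` W' = (tau t @` (Lam `&` W)) `&` W']]
        & exists (W1 : set Xm) (psi : R -> Xm -> Xm),
            [/\ open W1, W1 (pim z),
                is_flow W0
                  (fun (t : R) (x : Xm) => Qpois x *m dfun (f t) x) W1 psi,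
                forall x : Xm, W1 x ->
                  gkI pim pip z L x = pull_endo (psi 1) (@cpx R n Xm) x
              & forall x : Xm, W1 x ->
                  cmx (gkF pim z L x) =
                  int01 (fun t : R => pull_form (psi t) (ddc (f t)) x)]].

Section Assembly.
Variables (n : nat) (Xm Xp : @holPoisson R n) (Z : @holSymp R (n + n)).
Variables (pim : Z -> Xm) (pip : Z -> Xp) (z : Z) (c : @chart R Z (n + n)).
Variables (cm : @chart R Xm n) (cp : @chart R Xp n) (rho r0 e : R).
Variables (th : 'cV[R]_n -> 'cV[R]_n) (h : 'cV[R]_n -> R).
Variables (Pm Pp : 'cV[R]_(n + n) -> 'cV[R]_n) (Hm Hp : 'cV[R]_(1 + n) -> 'cV[R]_n).
Variables (Jm Jp : 'M[R]_n) (J0 : 'M[R]_(n + n)) (G0 : 'M[R]_n).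
Local Notation Zb := (@bal R (n + n) rho).
Local Notation Qb := (@bal R n r0).
Local Notation gr := (graph_at th).
Local Notation ws := (block_mx 0 1%:M (- 1%:M) 0 : 'M[R]_(n + n)).
Local Notation Am := (lift_map th Pm @` tbox e).
Local Notation Ap := (lift_map th Pp @` tbox e).
Hypotheses (HZ : morita pim pip) (sc : smooth_chart c) (cz : cdom c z) (z0 : coord c z = 0).
Hypothesis Zc : forall u, Zb u -> cimg c u.
Hypotheses (cJ : forall y, cdom c y -> tr c y *m cpxZ y = J0 *m tr c y)
  (cw : forall y, cdom c y -> omegaZ y = (tr c y)^T *m ws *m tr c y).
Hypothesis JL : J0 *m col_mx 1%:M 0 = col_mx 1%:M 0 *m G0.
Hypotheses (e0 : 0 < e) (sth : sm Qb th) (th0 : th 0 = 0).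
Hypotheses (sh : sm Qb (fun q => (h q)%:M : 'M[R]_1))
  (hth : forall q j, Qb q -> is_derive q (cvec j) h (th q j ord0))
  (thsym : forall q, Qb q -> (jac th q)^T = jac th q).
Hypothesis grO : forall w, tbox e w -> Qb (dsubmx w) /\ Zb (gr w).
Hypotheses (hcm : holo_chart (@cpx R n Xm) Jm cm) (hcp : holo_chart (@cpx R n Xp) Jp cp).
Hypotheses (hpm : forall p, cdom c p -> Zb (coord c p) -> cdom cm (pim p) /\ coord cm (pim p) = Pm (coord c p))
  (hpp : forall p, cdom c p -> Zb (coord c p) -> cdom cp (pip p) /\ coord cp (pip p) = Pp (coord c p)).
Hypotheses (sPm : sm Zb Pm) (sPp : sm Zb Pp).
Hypotheses (oAm : open Am) (oAp : open Ap).
Hypotheses (um : forall w, tbox e w -> slice_jac th Pm w \in unitmx)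
  (up : forall w, tbox e w -> slice_jac th Pp w \in unitmx).
Hypotheses (sHm : sm Am Hm) (HmK : forall w, tbox e w -> Hm (lift_map th Pm w) = dsubmx w).
Hypotheses (sHp : sm Ap Hp) (HpK : forall w, tbox e w -> Hp (lift_map th Pp w) = dsubmx w).
Local Notation Ltt := (Lt c e th).
Local Notation stm := (st th Hm).
Local Notation stp := (st th Hp).
Local Notation Zdom := (cdom c `&` coord c @^-1` Zb).

Definition Qof (X : @holPoisson R n) (cx : @chart R X n) (y : 'cV[R]_n) : 'M[R]_n :=
  tr cx (icoord cx y) *m Qpois (icoord cx y) *m (tr cx (icoord cx y))^T.
Local Notation Qm := (Qof cm).
Local Notation Qp := (Qof cp).

Lemma QofE (X : @holPoisson R n) (cx : @chart R X n) x : smooth_chart cx -> cdom cx x ->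
  Qof cx (coord cx x) = tr cx x *m Qpois x *m (tr cx x)^T.
Proof. by move=> [[_ _ K _ _] _] cxx; rewrite /Qof K. Qed.

Let scm := hcm.1.
Let scp := hcp.1.

Lemma pim_lrep : lrep c cm pim Zdom Pm. Proof. exact: (side_lrep sc hpm sPm). Qed.
Lemma pip_lrep : lrep c cp pip Zdom Pp. Proof. exact: (side_lrep sc hpp sPp). Qed.

Lemma Zpt u : Zb u -> exists p, [/\ Zdom p, p = icoord c u & coord c p = u].
Proof.
by move=> Zu; have [cd cE] := cimgP sc.1 (Zc Zu); exists (icoord c u); split=> //; split=> //=; rewrite cE.
Qed.

Lemma chart_orth u : Zb u -> jac Pm u *m iw n *m (jac Pp u)^T = 0.
Proof.
move=> /Zpt[p [Zp _ <-]]; rewrite (lrep_biv sc scm scp pim_lrep pip_lrep Zp Zp (cw Zp.1)).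
by rewrite (morita_orth HZ) mulmx0 mul0mx.
Qed.

Lemma chart_Qm u : Zb u -> jac Pm u *m iw n *m (jac Pm u)^T = - Qm (Pm u).
Proof.
move=> /Zpt[p [Zp _ <-]]; rewrite (lrep_biv sc scm scm pim_lrep pim_lrep Zp Zp (cw Zp.1)).
have [cx <-] := hpm Zp.1 Zp.2.
by rewrite (morita_Qm HZ) QofE// mulmxN mulNmx.
Qed.

Lemma chart_Qp u : Zb u -> jac Pp u *m iw n *m (jac Pp u)^T = Qp (Pp u).
Proof.
move=> /Zpt[p [Zp _ <-]]; rewrite (lrep_biv sc scp scp pip_lrep pip_lrep Zp Zp (cw Zp.1)).
have [cx <-] := hpp Zp.1 Zp.2.
by rewrite (morita_Qp HZ) QofE.
Qed.

Lemma chart_holm u : Zb u -> jac Pm u *m J0 = Jm *m jac Pm u.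
Proof. move=> /Zpt[p [Zp _ <-]]; exact: (lrep_holo sc hcm pim_lrep Zp (cJ Zp.1) (morita_holom HZ p)). Qed.

Lemma chart_holp u : Zb u -> jac Pp u *m J0 = Jp *m jac Pp u.
Proof. move=> /Zpt[p [Zp _ <-]]; exact: (lrep_holo sc hcp pip_lrep Zp (cJ Zp.1) (morita_holop HZ p)). Qed.

Lemma omegaJ_sym : J0^T *m ws = ws *m J0.
Proof.
have u := tr_unit sc cz; have uT : (tr c z)^T \in unitmx by rewrite unitmx_tr.
have JE : J0 = tr c z *m cpxZ z *m invmx (tr c z) by rewrite (cJ cz) mulmxK.
apply: (can_inj (mulKmx uT)); apply: (can_inj (mulmxK u)).
rewrite -!mulmxA -(cJ cz) !mulmxA -trmx_mul -(cJ cz) trmx_mul.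
rewrite -!mulmxA !(mulmxA (tr c z)^T) -(cw cz) omegaJ_swap.
by rewrite (cw cz) !mulmxA.
Qed.

Lemma Lt_brane (t : R) : 0 <= t <= 1 -> local_brane_bisection pim pip (Ltt t).
Proof.
move=> /(t01e e0) te; exists n; split.
- exact: (Lt_lagrangian sc Zc cw sth thsym grO te).
- exact: (side_transverse sc Zc sth grO te scm hpm sPm um).
- exact: (side_transverse sc Zc sth grO te scp hpp sPp up).
- exact: (side_diffeo sc Zc sth grO t scm hpm oAm sHm HmK).
- exact: (side_diffeo sc Zc sth grO t scp hpp oAp sHp HpK).
Qed.

Lemma te0 : - e < 0 < 1 + e. Proof. by apply: t01e e0 _ _; rewrite lexx ler01. Qed.

Lemma Lt0_tangent p v : Ltt 0 p -> tangent n (Ltt 0) p v <-> exists x : 'cV[R]_n, tr c p *m v = col_mx 1%:M 0 *m x.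
Proof.
move=> [cpp [u [Tu ut uE]]].
by rewrite (Lt_tangent sc Zc sth grO te0 v Tu ut cpp uE) scale0r.
Qed.

Lemma Lt0_J p v : Ltt 0 p -> tangent n (Ltt 0) p v -> tangent n (Ltt 0) p (cpxZ p *m v).
Proof.
move=> Lp; rewrite !(Lt0_tangent _ Lp) => -[x xE]; have [cpp _] := Lp.
by exists (G0 *m x); rewrite mulmxA cJ// -mulmxA xE mulmxA JL mulmxA.
Qed.

(** Lambda is Lagrangian for [omega] and stable under the complex structure, hence Lagrangian for
    [Re Omega = omega J] as well. *)
Lemma Lt0_holo : local_holo_bisection pim pip (Ltt 0).
Proof.
exists n; split; last 4 first.
- exact: (side_transverse sc Zc sth grO te0 scm hpm sPm um).
- exact: (side_transverse sc Zc sth grO te0 scp hpp sPp up).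
- exact: (side_diffeo sc Zc sth grO 0 scm hpm oAm sHm HmK).
- exact: (side_diffeo sc Zc sth grO 0 scp hpp oAp sHp HpK).
have [_ sub lag] := Lt_lagrangian sc Zc cw sth thsym grO te0.
split=> //; first by move=> p Lp v; exact: Lt0_J.
move=> p Lp v w tv tw; apply: mx_complexP.
  rewrite re_mx_mul cmx_tr re_mx_mull Omega_re -!mulmxA mulmxA (lag p Lp _ _ (Lt0_J Lp tv) tw).
  by apply/matrixP => i j; rewrite !mxE.
rewrite im_mx_mul cmx_tr im_mx_mull (lag p Lp _ _ tv tw).
by apply/matrixP => i j; rewrite !mxE.
Qed.

Lemma section_m (t : R) x : cdom cm x -> Am (col_mx t%:M (coord cm x)) ->
  [/\ Ltt t (sinv z pim (Ltt t) x), pim (sinv z pim (Ltt t) x) = x,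
      sinv z pim (Ltt t) x = icoord c (stm (col_mx t%:M (coord cm x))),
      Zdom (sinv z pim (Ltt t) x) & coord c (sinv z pim (Ltt t) x) = stm (col_mx t%:M (coord cm x))].
Proof.
move=> cx Ax; have Ux : (pim @` Ltt t) x by rewrite (side_image sc Zc grO t scm hpm HmK).
have sE := sinv_section z sc Zc grO scm hpm HmK Ux.
have [Lp pE] := side_section sc Zc grO scm hpm HmK cx Ax.
have [_ _ _ _ cE] := section_lrep sc Zc sth grO t scm hpm oAm sHm HmK.
rewrite sE; split=> //; first exact: (Lt_Zdom grO Lp).
exact: cE.
Qed.

Lemma section_p (t : R) x : cdom cp x -> Ap (col_mx t%:M (coord cp x)) ->
  [/\ Ltt t (sinv z pip (Ltt t) x), pip (sinv z pip (Ltt t) x) = x,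
      sinv z pip (Ltt t) x = icoord c (stp (col_mx t%:M (coord cp x))),
      Zdom (sinv z pip (Ltt t) x) & coord c (sinv z pip (Ltt t) x) = stp (col_mx t%:M (coord cp x))].
Proof.
move=> cx Ax; have Ux : (pip @` Ltt t) x by rewrite (side_image sc Zc grO t scp hpp HpK).
have sE := sinv_section z sc Zc grO scp hpp HpK Ux.
have [Lp pE] := side_section sc Zc grO scp hpp HpK cx Ax.
have [_ _ _ _ cE] := section_lrep sc Zc sth grO t scp hpp oAp sHp HpK.
rewrite sE; split=> //; first exact: (Lt_Zdom grO Lp).
exact: cE.
Qed.

Local Notation Uh := (pim @` Ltt 0).
Local Notation Vh := (pip @` Ltt 0).
Local Notation phiM := (pip \o sinv z pim (Ltt 0)).
Local Notation phiM' := (pim \o sinv z pip (Ltt 0)).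

Lemma scalar_mx0 : (0%:M : 'M[R]_1) = 0. Proof. exact: raddf0. Qed.

Lemma UhE : Uh = cdom cm `&` coord cm @^-1` [set y | Am (col_mx 0 y)].
Proof. by rewrite (side_image sc Zc grO 0 scm hpm HmK) scalar_mx0. Qed.

Lemma VhE : Vh = cdom cp `&` coord cp @^-1` [set y | Ap (col_mx 0 y)].
Proof. by rewrite (side_image sc Zc grO 0 scp hpp HpK) scalar_mx0. Qed.

Lemma oUh : open Uh. Proof. exact: (side_open sc Zc grO 0 scm hpm oAm HmK). Qed.
Lemma oVh : open Vh. Proof. exact: (side_open sc Zc grO 0 scp hpp oAp HpK). Qed.

Lemma phi_lrep : lrep cm cp phiM Uh (phi th Pp Hm).
Proof.
have K x : Uh x -> cdom cp (phiM x) /\ coord cp (phiM x) = phi th Pp Hm (coord cm x).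
  rewrite UhE => -[cx Ax]; have := @section_m 0 x cx; rewrite scalar_mx0 => /(_ Ax)[_ _ _ [d1 d2] sE].
  by rewrite /phi -sE; exact: hpp.
split; first exact: oUh.
- by rewrite UhE => x [].
- by move=> x /K[].
- apply: sm_restrict (sm_phi sth sPp grO oAm sHm HmK); rewrite UhE => _ [x [_ Ax] <-].
  exact: Ax.
- by move=> x /K[].
Qed.

Lemma phi'_lrep : lrep cp cm phiM' Vh (phi' th Pm Hp).
Proof.
have K x : Vh x -> cdom cm (phiM' x) /\ coord cm (phiM' x) = phi' th Pm Hp (coord cp x).
  rewrite VhE => -[cx Ax]; have := @section_p 0 x cx; rewrite scalar_mx0 => /(_ Ax)[_ _ _ [d1 d2] sE].
  by have [d3 d4] := hpm d1 d2; split; rewrite // /phi' d4 sE /st col_mxKu.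
split; first exact: oVh.
- by rewrite VhE => x [].
- by move=> x /K[].
- apply: sm_restrict (sm_phi' sth sPm grO oAp sHp HpK); rewrite VhE => _ [x [_ Ax] <-].
  exact: Ax.
- by move=> x /K[].
Qed.

Lemma sinvK_m p : Ltt 0 p -> sinv z pim (Ltt 0) (pim p) = p.
Proof.
move=> Lp; have := xgetPex z (ex_intro (fun q => Ltt 0 q /\ pim q = pim p) _ (conj Lp erefl)).
by move=> [Ls sE]; exact: (side_inj sc grO hpm HmK Ls Lp sE).
Qed.

Lemma sinvK_p p : Ltt 0 p -> sinv z pip (Ltt 0) (pip p) = p.
Proof.
move=> Lp; have := xgetPex z (ex_intro (fun q => Ltt 0 q /\ pip q = pip p) _ (conj Lp erefl)).
by move=> [Ls sE]; exact: (side_inj sc grO hpp HpK Ls Lp sE).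
Qed.

Lemma phiM_holo x : Uh x -> tmap phiM x *m cpx x = cpx (phiM x) *m tmap phiM x.
Proof.
move=> Ux; apply: (lrep_holo_conv hcm hcp phi_lrep Ux).
apply: (phi_holo sth sPm sPp grO oAm um sHm HmK chart_holm chart_holp JL).
by move: Ux; rewrite UhE => -[].
Qed.

Lemma phi_iso : holo_poisson_iso Uh Vh phiM phiM'.
Proof.
split.
- by split; [exact: oUh|exact: oVh].
- split; split.
  + by apply: lrep_smooth => x Ux; exists cm, cp, Uh, (phi th Pp Hm); split=> //; exact: phi_lrep.
  + by move=> x; exact: phiM_holo.
  + by apply: lrep_smooth => x Ux; exists cp, cm, Vh, (phi' th Pm Hp); split=> //; exact: phi'_lrep.
  + move=> x Vx; apply: (lrep_holo_conv hcp hcm phi'_lrep Vx).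
    have Ax : Ap (col_mx 0 (coord cp x)) by move: Vx; rewrite VhE => -[].
    have [E1 E2] := jac_phi' sth sPm sPp grO oAm oAp sHm HmK sHp HpK Ax.
    have H := phi_holo sth sPm sPp grO oAm um sHm HmK chart_holm chart_holp JL (phi'_in Pm HpK Ax).
    set A := jac (phi' _ _ _) _ in E1 E2 *; set B := jac _ _ in E1 E2 H.
    by rewrite -[LHS]mulmx1 -E2 mulmxA -[A *m Jp *m B]mulmxA -H !mulmxA E1 mul1mx.
- by move=> _ [p Lp <-]; rewrite /= sinvK_m// sinvK_p//; split=> //; exists p.
- by move=> _ [p Lp <-]; rewrite /= sinvK_p// sinvK_m//; split=> //; exists p.
- move=> x Ux; apply: (lrep_poisson_conv scm scp phi_lrep Ux (phiM_holo Ux)).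
  have [_ dm dp _ pE] := phi_lrep.
  rewrite -(QofE scm (dm x Ux)) -(QofE scp (dp x Ux)) (pE x Ux).
  apply: (phi_poisson sth sPm sPp grO oAm um sHm HmK chart_orth chart_Qm chart_Qp).
  by move: Ux; rewrite UhE => -[].
Qed.

Lemma tube_ball k (y0 : 'cV[R]_k) (A : set 'cV[R]_(1 + k)) : open A ->
  (forall t : R, 0 <= t <= 1 -> A (col_mx t%:M y0)) ->
  exists eps kap : R, [/\ 0 < eps, 0 < kap & forall y, `|y - y0| < kap ->
    forall t : R, - eps < t < 1 + eps -> A (col_mx t%:M y)].
Proof.
move=> oA hA; have [|eps eps0 H] := @tube R _ y0 [set q : R * 'cV[R]_k | A (col_mx q.1%:M q.2)].
  by move=> t t01; apply: cont_colmx; apply: open_nbhs_nbhs; split=> //=; exact: hA.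
by have [kap kap0 K] := near_norm H; exists eps, kap; split=> // y /K.
Qed.

Local Notation y0 := (Pm 0).
Local Notation fhh := (fh th h Pp Hm Hp).
Local Notation ghh := (gh th h Pp Hm Hp).
Local Notation psih := (psi th Pm Pp Hm Hp).
Local Notation Af := [set w : 'cV[R]_(1 + n) | Am (col_mx 0 (dsubmx w)) /\ Ap (col_mx (usubmx w) (phi th Pp Hm (dsubmx w)))].
Local Notation Apsi := [set w : 'cV[R]_(1 + n) | Am w /\ Ap (col_mx 0 (Pp (stm w)))].

Lemma tb0 (t : R) : 0 <= t <= 1 -> tbox e (col_mx t%:M 0 : 'cV[R]_(1 + n)).
Proof. by move=> t01; apply: tbox_at; [exact: t01e|rewrite /bal /= normr0]. Qed.

Lemma mem01_0 : 0 <= (0 : R) <= 1. Proof. by rewrite lexx ler01. Qed.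
Lemma mem01_1 : 0 <= (1 : R) <= 1. Proof. by rewrite lexx ler01. Qed.

Lemma Zb0 : Zb 0.
Proof. by have [_] := grO (tb0 mem01_0); rewrite graph0. Qed.

Lemma pim_z : cdom cm (pim z) /\ coord cm (pim z) = y0.
Proof. by have := hpm cz; rewrite z0; apply; exact: Zb0. Qed.

Lemma lift0 P (t : R) : lift_map th P (col_mx t%:M 0) = col_mx t%:M (P 0).
Proof. by rewrite /lift_map graph0// col_mxKu. Qed.

Lemma Am_y0 (t : R) : 0 <= t <= 1 -> Am (col_mx t%:M y0).
Proof. by move=> t01; exists (col_mx t%:M 0); [exact: tb0|exact: lift0]. Qed.

Lemma Ap_x0 (t : R) : 0 <= t <= 1 -> Ap (col_mx t%:M (Pp 0)).
Proof. by move=> t01; exists (col_mx t%:M 0); [exact: tb0|exact: lift0]. Qed.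

Lemma st_y0 (t : R) : 0 <= t <= 1 -> stm (col_mx t%:M y0) = 0.
Proof. by move=> t01; rewrite -lift0 (GmK HmK (tb0 t01)) graph0. Qed.

Lemma phi_y0 : phi th Pp Hm y0 = Pp 0.
Proof. by rewrite /phi -scalar_mx0 st_y0// mem01_0. Qed.

Lemma Apsi_y0 (t : R) : 0 <= t <= 1 -> Apsi (col_mx t%:M y0).
Proof. by move=> t01; split; [exact: Am_y0|rewrite st_y0// -scalar_mx0; apply: Ap_x0; exact: mem01_0]. Qed.

Lemma phi'_x0 : phi' th Pm Hp (Pp 0) = y0.
Proof. by rewrite -phi_y0; apply: (phiK HmK HpK); rewrite -scalar_mx0; apply: Am_y0; exact: mem01_0. Qed.

Lemma psi_y0 (t : R) : 0 <= t <= 1 -> psih (col_mx t%:M y0) = y0.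
Proof. by move=> t01; rewrite /psi st_y0// phi'_x0. Qed.

Lemma Af_y0 (t : R) : 0 <= t <= 1 -> Af (col_mx t%:M y0).
Proof.
move=> t01; split; rewrite /= ?col_mxKu !col_mxKd; first by rewrite -scalar_mx0; apply: Am_y0; exact: mem01_0.
by rewrite phi_y0; exact: Ap_x0.
Qed.

Lemma oAf : open Af. Proof. exact: (open_Af sth sPp grO oAm oAp sHm HmK). Qed.
Lemma oApsi : open Apsi. Proof. exact: (open_psi sth sPp grO oAm oAp sHm HmK). Qed.
Lemma sfh : sm Af (fun w => (fhh w)%:M : 'M[R]_1).
Proof. exact: (sm_fh sth sh sPp grO oAm oAp sHm HmK sHp HpK). Qed.
Lemma spsi : sm Apsi psih. Proof. exact: (sm_psi sth sPm sPp grO oAm oAp sHm HmK sHp HpK). Qed.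

Definition flow_fun (t : R) (x : Xm) : R := fhh (col_mx t%:M (coord cm x)).
Definition cball (k : R) : set Xm := cdom cm `&` coord cm @^-1` [set y | `|y - y0| < k].

Lemma cball_open k : open (cball k).
Proof.
have [[oc _ _ cc _] _] := scm; rewrite openE => x [cx Kx]; apply: filterI; first exact: open_nbhs_nbhs.
apply: (cc x cx); apply: open_nbhs_nbhs; split=> //; exact: open_ballcV.
Qed.

Lemma cball_z k : 0 < k -> cball k (pim z).
Proof. by move=> k0; have [d E] := pim_z; split=> //=; rewrite E subrr normr0. Qed.

Section Hamiltonian.
Variables (e1 k1 : R).
Hypotheses (e10 : 0 < e1) (k10 : 0 < k1).
Hypothesis tubf : forall y, `|y - y0| < k1 -> forall t : R, - e1 < t < 1 + e1 -> Af (col_mx t%:M y) /\ cimg cm y.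
Local Notation W0 := (cball k1).

Lemma te1 (t : R) : 0 <= t <= 1 -> - e1 < t < 1 + e1. Proof. exact: t01e. Qed.

Lemma W0_U : W0 `<=` Uh.
Proof.
move=> x [cx Kx]; rewrite UhE; split=> //.
by have [[]] := tubf Kx (te1 mem01_0); rewrite /= col_mxKd.
Qed.

Lemma W0_smooth : smooth_tfun W0 flow_fun.
Proof.
apply: (smooth_tfun_chart e10 scm (@cball_open k1) _ _ (F := fhh)); first by move=> x [].
  apply: sm_restrict sfh => w [te [x [cx Kx] xE]].
  by rewrite -[w]vsubmxK -xE usub1; have [] := tubf Kx te.
by [].
Qed.

Lemma dfun_flow (t : R) x : - e1 < t < 1 + e1 -> W0 x ->
  dfun (flow_fun t) x = (tr cm x)^T *m ghh (col_mx t%:M (coord cm x)).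
Proof.
move=> te Wx; have [cx Kx] := Wx.
have C : C1at (fun y => fhh (col_mx t%:M y)) (coord cm x).
  have [oS sS] := grad_slice t%:M oAf sfh.
  by apply: (sm1_C1at oS sS); have [] := tubf Kx te.
have Wc : W0 `<=` cdom cm by move=> y [].
apply: eq_trans (dfun_chart scm (@cball_open k1) Wc Wx (fun y _ => erefl) C) _.
by rewrite /gh col_mxKu col_mxKd.
Qed.

Definition flow_psi (t : R) (x : Xm) : Xm := icoord cm (psih (col_mx t%:M (coord cm x))).

Section FlowPsi.
Variables (e2 k2 : R).
Hypotheses (e20 : 0 < e2) (k20 : 0 < k2).
Hypothesis tubp : forall y, `|y - y0| < k2 -> forall t : R, - e2 < t < 1 + e2 ->
  Apsi (col_mx t%:M y) /\ `|psih (col_mx t%:M y) - y0| < k1.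
Local Notation W1 := (cball k2).

(** [k1] is the radius of the domain of [f]; [k2] is so small that [psi_t] maps the smaller ball
    into that domain at all times considered. *)
Lemma psi_at (t : R) x : - e2 < t < 1 + e2 -> W1 x ->
  [/\ W0 (flow_psi t x), coord cm (flow_psi t x) = psih (col_mx t%:M (coord cm x)) & Apsi (col_mx t%:M (coord cm x))].
Proof.
move=> te [cx Kx]; have [A B] := tubp Kx te; have [_ ci] := tubf B (te1 mem01_0).
have [cd cE] := cimgP scm.1 ci.
by split=> //; split=> //=; rewrite /flow_psi cE.
Qed.

Lemma flow_psiP : is_flow W0 (fun (t : R) (x : Xm) => Qpois x *m dfun (flow_fun t) x) W1 flow_psi.
Proof.
move=> x Wx; have [cx Kx] := Wx; have t2 (t : R) : 0 <= t <= 1 -> - e2 < t < 1 + e2 by exact: t01e.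
have near2 (t : R) : - e2 < t < 1 + e2 -> \forall s \near t, - e2 < s < 1 + e2.
  by move=> /andP[a b]; near=> s; apply/andP; split; near: s; [exact: lt_nbhsr|exact: lt_nbhsl].
have vel (t : R) : - e2 < t < 1 + e2 -> - e1 < t < 1 + e1 ->
    velocity (fun s => flow_psi s x) t (Qpois (flow_psi t x) *m dfun (flow_fun t) (flow_psi t x)).
  move=> te te1'; have [[cW KW] cE A] := psi_at te Wx.
  apply: (velocity_chart scm (y := fun s => psih (col_mx s%:M (coord cm x)))).
  - apply: filterS (near2 _ te) => s se; have [[] ? _ ? _] := psi_at se Wx; by split.
  - exact: (psi_velocity sth sh hth thsym sPm sPp grO oAm oAp um sHm HmK sHp HpK chart_orth chart_Qm chart_Qp A).
  - rewrite (dfun_flow te1' (conj cW KW)) -cE (QofE scm cW).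
    by rewrite ![in LHS]mulmxA.
split.
- rewrite /flow_psi scalar_mx0 (psi0 HmK HpK); first by have [[_ _ K _ _] _] := scm; exact: K.
  by have [[A _] _] := tubp Kx (t2 _ mem01_0); rewrite scalar_mx0 in A.
- by move=> t /t2 te; have [] := psi_at te Wx.
- apply: continuous_in_subspaceT => t; rewrite inE /= in_itv /= => t01.
  by have [] := vel t (t2 _ t01) (te1 t01).
- move=> t /andP[t0 t1]; apply: vel; [apply: t2|apply: te1]; by rewrite !ltW.
Unshelve. all: by end_near.
Qed.

Lemma flow_psi_lrep (t : R) : - e2 < t < 1 + e2 ->
  lrep cm cm (flow_psi t) W1 (fun y => psih (col_mx t%:M y)).
Proof.
move=> te; split; first exact: cball_open.
- by move=> x [].
- by move=> x /(psi_at te)[[]].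
- have [oS _ _] := sm_slice t%:M oApsi spsi; have [_ sS _] := sm_slice t%:M oApsi spsi.
  by apply: sm_restrict sS => _ [x /(psi_at te)[_ _ A] <-].
- by move=> x /(psi_at te)[_ ? _].
Qed.

(** [Pp] on [L_t] is this map composed with [Pm] on [L_t], so invertibility of [slice_jac th Pp]
    forces that of its Jacobian. *)
Lemma slice_unit (t : R) y : Am (col_mx t%:M y) -> jac (fun y => Pp (stm (col_mx t%:M y))) y \in unitmx.
Proof.
move=> A; have [v [Tv vE _ uv]] := AmP HmK A; rewrite col_mxKu in uv.
set F := fun y => _; pose q := dsubmx v.
have vq : v = col_mx t%:M q by rewrite -[v]vsubmxK uv.
have oT : open (tbox (n := n) e) by exact: open_box.
have ySt : y = Pm (gr v) by have := congr1 dsubmx vE; rewrite /lift_map !col_mxKd.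
have Zv : Zb (gr v) by have [] := grO Tv.
have [oS sS jS] := sm_slice t%:M oT (sm_grT sth grO).
have Cg : C1v (fun q => gr (col_mx t%:M q)) q by apply: (sm_C1v oS sS); rewrite /= -vq.
have [oA' sA' jA'] := sm_slice t%:M oAm (sm_st sth grO oAm sHm HmK).
have Cs : C1v (fun y => stm (col_mx t%:M y)) y by exact: (sm_C1v oA' sA').
have CP P : sm Zb P -> C1v P (gr v) by move=> sP; exact: (sm_C1v (@open_bal R _ rho) sP Zv).
have sv : stm (col_mx t%:M y) = gr v by rewrite vE (GmK HmK Tv).
have CF : C1v F (Pm (gr (col_mx t%:M q))).
  have sF : sm [set y | Am (col_mx t%:M y)] F.
    exact: (sm_comp oA' (@open_bal R _ rho) sA' (fun y Ay => st_O grO HmK Ay) sPp).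
  by rewrite -vq -ySt; exact: (sm_C1v oA' sF A).
have CPg : C1v (fun q => Pm (gr (col_mx t%:M q))) q.
  have sF : sm [set q | tbox e (col_mx t%:M q)] (fun q => Pm (gr (col_mx t%:M q))).
    exact: (sm_comp oS (@open_bal R _ rho) sS (fun q Tq => (grO Tq).2) sPm).
  by apply: (sm_C1v oS sF); rewrite /= -vq.
have E : slice_jac th Pp v = jac F y *m slice_jac th Pm v.
  rewrite -(Mt_jac sth grO sPp Tv) -(Mt_jac sth grO sPm Tv) uv -/q.
  rewrite [in jac F y]ySt [in gr v]vq -(jac_comp CF CPg); apply: jac_near.
  have : \forall r \near q, tbox e (col_mx t%:M r) by apply: open_nbhs_nbhs; split=> //=; rewrite -vq.
  apply: filterS => r Tr; rewrite /= /F.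
  have -> : col_mx t%:M (Pm (gr (col_mx t%:M r))) = lift_map th Pm (col_mx t%:M r) by rewrite /lift_map col_mxKu.
  by rewrite (GmK HmK Tr).
by have := up Tv; rewrite E unitmx_mul => /andP[].
Qed.

Lemma lrep_pull k (Y X' : @holPoisson R k) (f : Y -> X') (cy : @chart R Y k) (cx : @chart R X' k) W F J y :
  smooth_chart cy -> holo_chart (@cpx R k X') J cx -> lrep cy cx f W F -> W y ->
  jac F (coord cy y) \in unitmx ->
  pull_endo f (@cpx R k X') y =
    invmx (tr cy y) *m (invmx (jac F (coord cy y)) *m J *m jac F (coord cy y)) *m tr cy y.
Proof.
move=> scy [scx hJ] l Wy uF; have T := lrep_tmap scy scx l Wy.
have cyy : cdom cy y by case: l => _ + _ _ _; exact.
have cxy : cdom cx (f y) by case: l => _ _ + _ _; exact.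
have ux := tr_unit scx cxy; have uy := tr_unit scy cyy.
have uT : tmap f y \in unitmx.
  have : tr cx (f y) *m tmap f y \in unitmx by rewrite T unitmx_mul uF uy.
  by rewrite unitmx_mul => /andP[].
have uFy : jac F (coord cy y) *m tr cy y \in unitmx by rewrite unitmx_mul uF.
have LE : tmap f y *m pull_endo f (@cpx R k X') y = cpx (f y) *m tmap f y.
  by rewrite /pull_endo !mulmxA mulmxV// mul1mx.
have KE (K : 'M[R]_k) : K = pull_endo f (@cpx R k X') y ->
    jac F (coord cy y) *m tr cy y *m K = J *m (jac F (coord cy y) *m tr cy y).
  by move=> ->; rewrite -T -mulmxA LE mulmxA hJ// -mulmxA.
apply: (can_inj (mulKmx uFy)); rewrite (KE _ erefl).
rewrite !mulmxA; congr (_ *m _).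
by rewrite -[_ *m tr cy y *m invmx _]mulmxA mulmxV// mulmx1 mulmxV// mul1mx.
Qed.

Section Data.
Variables (L Wg : set Z).
Hypotheses (Linj : forall p q, L p -> L q -> pim p = pim q -> p = q).
Hypothesis gE : forall p, Wg p -> Ltt 1 p -> L p.
Hypothesis tubg : forall y, `|y - y0| < k2 -> Wg (icoord c (stm (col_mx 1%:M y))).

Lemma te2 (t : R) : 0 <= t <= 1 -> - e2 < t < 1 + e2. Proof. exact: t01e. Qed.

(** Near [pi_-(z)] the section with values in [L_1] has values in [L], hence is the section of [L]
    by injectivity of [pi_-] on [L]. *)
Lemma sinv_L x : W1 x -> [/\ Am (col_mx 1%:M (coord cm x)), sinv z pim L x = sinv z pim (Ltt 1) x,
  Zdom (sinv z pim L x) & coord c (sinv z pim L x) = stm (col_mx 1%:M (coord cm x))].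
Proof.
move=> Wx; have [cx Kx] := Wx; have [[A _] _] := tubp Kx (te2 mem01_1).
have [Lp pE sE Zp cE] := section_m cx A.
have Ls : L (sinv z pim (Ltt 1) x) by apply: gE => //; rewrite sE; exact: tubg.
have E : sinv z pim L x = sinv z pim (Ltt 1) x.
  have := xgetPex z (ex_intro (fun q => L q /\ pim q = x) _ (conj Ls pE)).
  by move=> [L1 E1]; apply: Linj => //; rewrite pE; exact: E1.
by rewrite E.
Qed.

Lemma sL_lrep : lrep cm c (sinv z pim L) W1 (fun y => stm (col_mx 1%:M y)).
Proof.
split; first exact: cball_open.
- by move=> x [].
- by move=> x /sinv_L[_ _ []].
- have [_ sS _] := sm_slice 1%:M oAm (sm_st sth grO oAm sHm HmK).
  by apply: sm_restrict sS => _ [x /sinv_L[A _ _ _] <-].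
- by move=> x /sinv_L[].
Qed.

Lemma piL_lrep : lrep cm cp (pip \o sinv z pim L) W1 (fun y => Pp (stm (col_mx 1%:M y))).
Proof.
have [oS sS _] := sm_slice 1%:M oAm (sm_st sth grO oAm sHm HmK).
split; first exact: cball_open.
- by move=> x [].
- by move=> x /sinv_L[_ _ [d1 d2] _]; have [] := hpp d1 d2.
- have sF : sm [set y | Am (col_mx 1%:M y)] (fun y => Pp (stm (col_mx 1%:M y))).
    exact: (sm_comp oS (@open_bal R _ rho) sS (fun y Ay => st_O grO HmK Ay) sPp).
  by apply: sm_restrict sF => _ [x /sinv_L[A _ _ _] <-].
- by move=> x /sinv_L[_ _ [d1 d2] <-]; have [] := hpp d1 d2.
Qed.

(** [pi_+ o s_1] equals [phi o psi_1] and [phi] is holomorphic, so pulling [I_+] back by the former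
    is pulling [I_-] back by [psi_1]. *)
Lemma gkI_psi x : W1 x -> gkI pim pip z L x = pull_endo (flow_psi 1) (@cpx R n Xm) x.
Proof.
move=> Wx; have [A _ _ _] := sinv_L Wx; have uA := slice_unit A.
have [_ _ Ap1] := psi_at (te2 mem01_1) Wx; set y := coord cm x in A uA Ap1.
have [[Umy _] pE] := psi_Af HmK HpK Ap1; rewrite col_mxKd in Umy.
have [oPsi sPsi _] := sm_slice 1%:M oApsi spsi.
have Cpsi : C1v (fun y => psih (col_mx 1%:M y)) y by exact: (sm_C1v oPsi sPsi).
have oUm : open [set y : 'cV[R]_n | Am (col_mx 0 y)] by have [oS _ _] := sm_slice 0 oAm (sm_st sth grO oAm sHm HmK).
have Cphi : C1v (phi th Pp Hm) (psih (col_mx 1%:M y)) by exact: (sm_C1v oUm (sm_phi sth sPp grO oAm sHm HmK)).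
have JE : jac (fun y => Pp (stm (col_mx 1%:M y))) y =
    jac (phi th Pp Hm) (psih (col_mx 1%:M y)) *m jac (fun y => psih (col_mx 1%:M y)) y.
  apply: eq_trans (jac_near _) (@jac_comp R _ _ _ (fun y => psih (col_mx 1%:M y)) (phi th Pp Hm) y Cphi Cpsi).
  have : \forall u \near y, Apsi (col_mx 1%:M u) by exact: open_nbhs_nbhs.
  by apply: filterS => u Au; have [_] := psi_Af HmK HpK Au.
have [u1 u2] : jac (phi th Pp Hm) (psih (col_mx 1%:M y)) \in unitmx /\ jac (fun y => psih (col_mx 1%:M y)) y \in unitmx.
  by apply/andP; rewrite -unitmx_mul -JE.
rewrite /gkI (lrep_pull scm hcp piL_lrep Wx uA) (lrep_pull scm hcm (flow_psi_lrep (te2 mem01_1)) Wx u2).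
congr (_ *m _ *m _); rewrite -/y JE.
have PH := phi_holo sth sPm sPp grO oAm um sHm HmK chart_holm chart_holp JL Umy.
move: PH u1 u2; set B := jac (phi _ _ _) _; set C := jac (fun y => _) _ => PH u1 u2.
have uBC : B *m C \in unitmx by rewrite unitmx_mul u1.
apply: (can_inj (mulKmx uBC)); rewrite !mulmxA mulmxV// mul1mx -PH.
by rewrite -[B *m C *m invmx C]mulmxA mulmxV// mulmx1.
Qed.

Lemma gkF_chart x : W1 x -> gkF pim z L x =
  (tr cm x)^T *m Kst th Hm J0 (col_mx 1%:M (coord cm x)) *m tr cm x.
Proof.
move=> Wx; have [A _ [d1 d2] _] := sinv_L Wx; have T := lrep_tmap scm sc sL_lrep Wx.
have [oS sS jS] := sm_slice 1%:M oAm (sm_st sth grO oAm sHm HmK).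
rewrite (Fst_blocks _ _ _ _).1 -jS//.
rewrite /gkF /pull_form cmx_tr re_mx_mul re_mx_mull Omega_re (cw d1).
rewrite -[_ *m cpxZ _]mulmxA (cJ d1).
set p := sinv z pim L x in T *; set S := jac _ _ in T *.
have -> : (tmap (sinv z pim L) x)^T *m ((tr c p)^T *m ws *m (J0 *m tr c p)) *m tmap (sinv z pim L) x =
  (tr c p *m tmap (sinv z pim L) x)^T *m (ws *m J0) *m (tr c p *m tmap (sinv z pim L) x).
  by rewrite [X in _ = X *m _ *m _]trmx_mul !mulmxA.
by rewrite T [X in X *m _ *m _ = _]trmx_mul !mulmxA.
Qed.

Lemma Dst_ddc (t : R) x : 0 <= t <= 1 -> W1 x ->
  pull_form (flow_psi t) (ddc (flow_fun t)) x =
  cmx ((tr cm x)^T *m Dst th Hm J0 (col_mx t%:M (coord cm x)) *m tr cm x).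
Proof.
move=> t01 Wx; have [Wp pE A] := psi_at (te2 t01) Wx.
have T := lrep_tmap scm scm (flow_psi_lrep (te2 t01)) Wx.
have Wc : W0 `<=` cdom cm by move=> y [].
have sF : sm (coord cm @` W0) (fun y => (fhh (col_mx t%:M y))%:M : 'M[R]_1).
  have [oS sS] := grad_slice t%:M oAf sfh.
  by apply: sm_restrict sS => _ [y [cy Ky] <-]; have [] := tubf Ky (te1 t01).
rewrite /pull_form (ddc_chart hcm (@cball_open k1) Wc Wp (fun y _ => erefl) sF) cmx_tr -!map_mxM; congr map_mx.
rewrite (Dst_psi sth sh hth thsym sPm sPp grO oAm oAp um sHm HmK sHp HpK chart_orth chart_holm chart_holp JL omegaJ_sym A).
rewrite !col_mxKu !col_mxKd.
have E : (fun u => Jm^T *m grad (fun y => fhh (col_mx t%:M y)) u) = fun x => Jm^T *m ghh (col_mx t%:M x).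
  by apply/funext => u; rewrite /gh col_mxKu col_mxKd.
have RX := f_equal2 (fun a b => rext1 a b) E pE.
pose U := tmap (flow_psi t) x; pose Tp := tr cm (flow_psi t x).
pose L1 (K : 'M[R]_n) := U^T *m (Tp^T *m K *m Tp) *m U.
apply: (eq_trans (f_equal L1 RX)); rewrite /L1; move: (rext1 _ _) => K.
have -> : U^T *m (Tp^T *m K *m Tp) *m U = (Tp *m U)^T *m K *m (Tp *m U).
  by rewrite [X in _ = X *m _ *m _]trmx_mul !mulmxA.
by rewrite T [X in X *m _ *m _ = _]trmx_mul !mulmxA.
Qed.

(** The fundamental theorem of calculus for [Kst], the matrix of [s_t^* Re Omega]: its time
    derivative is the integrand by [Dst_ddc], and the boundary term at time 0 vanishes by [Kst0]. *)
Lemma gkF_int x : W1 x ->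
  cmx (gkF pim z L x) = int01 (fun t : R => pull_form (flow_psi t) (ddc (flow_fun t)) x).
Proof.
move=> Wx; have [cx Kx] := Wx.
pose y := coord cm x; pose T := tr cm x.
have A (t : R) : - e2 < t < 1 + e2 -> Am (col_mx t%:M y) by move=> te; have [[]] := tubp Kx te.
rewrite (@int01_real R n _ (fun t => T^T *m Kst th Hm J0 (col_mx t%:M y) *m T) (fun t => T^T *m Dst th Hm J0 (col_mx t%:M y) *m T) e2 e20).
- have := Kst0 sth sPm grO oAm um sHm HmK JL (y := y); rewrite -scalar_mx0 => K0.
  by rewrite K0 ?mulmx0 ?mul0mx ?subr0 ?gkF_chart//; apply: A; exact: te2 mem01_0.
- move=> t /A At; have D := Kst_derive J0 sth grO oAm sHm HmK At.
  apply: dmx_eq (dmx_mul (dmx_mull T^T D) (dmx_cst _ _ T)) _.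
  by rewrite mulmx0 addr0.
- move=> t /te2/A At; apply: cont_mulmx; last by move=> i j; exact: cst_cont_at.
  apply: cont_mulmx; first by move=> i j; exact: cst_cont_at.
  by move=> i j; apply: (Dst_cont sth grO oAm sHm HmK At).
- by move=> t t01; exact: Dst_ddc.
Qed.

End Data.
End FlowPsi.

Local Notation D0 := [set p : Z | Vh (pip p) /\ W0 (phiM' (pip p))].
Local Notation XF := (fun (t : R) (p : Z) => invmx (omegaZ p) *m dfun (fun q : Z => flow_fun t (phiM' (pip q))) p).
Local Notation gph := (gp h Hp).

(** The Hamiltonian field of [(phi^-1 o pi_+)^* f_t] in the coordinates of [c]; [f_t o phi^-1] is
    [fp], so [phi] does not occur. *)
Definition tube_field (t : R) (u : 'cV[R]_(n + n)) : 'cV[R]_(n + n) :=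
  iw n *m ((jac Pp u)^T *m gph (col_mx t%:M (Pp u))).

Section FlowTau.
Variable r1 : R.
Hypotheses (r10 : 0 < r1) (r1rho : r1 <= rho).
Hypothesis tubr : forall u : 'cV[R]_(n + n), `|u| < r1 ->
  [/\ Ap (col_mx 0 (Pp u)), `|phi' th Pm Hp (Pp u) - y0| < k1
    & forall t : R, 0 <= t <= 1 -> Ap (col_mx t%:M (Pp u))].
Local Notation Br := (@bal R (n + n) r1).

Lemma Br_Zb u : Br u -> Zb u.
Proof. by rewrite /bal /= => h1; exact: lt_le_trans h1 r1rho. Qed.

Lemma tau_dom p : cdom c p -> Br (coord c p) ->
  D0 p /\ coord cm (phiM' (pip p)) = phi' th Pm Hp (Pp (coord c p)).
Proof.
move=> cp' Bp; have [d1 d2] := hpp cp' (Br_Zb Bp); have [A1 A2 _] := tubr Bp.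
have Vp : Vh (pip p) by rewrite VhE; split=> //=; rewrite d2.
have [_ _ dm _ pE] := phi'_lrep; have E := pE _ Vp; rewrite d2 in E.
split=> //; split=> //; split; first exact: dm.
by rewrite /= E.
Qed.

Lemma tau_dfun (t : R) p : 0 <= t <= 1 -> cdom c p -> Br (coord c p) ->
  tr c p *m XF t p = tube_field t (coord c p).
Proof.
move=> t01 cp' Bp; have Zp := Br_Zb Bp; have Zd : Zdom p by [].
have [A1 A2 /(_ t t01) At] := tubr Bp.
pose W := cdom c `&` coord c @^-1` Br.
have oW : open W.
  have [[oc _ _ cc _] _] := sc; rewrite openE => q [cq Bq]; apply: filterI; first exact: open_nbhs_nbhs.
  by apply: (cc q cq); apply: open_nbhs_nbhs; split=> //; exact: open_bal.
have Wc : W `<=` cdom c by move=> q [].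
have Wp : W p by [].
have [oS sS] := grad_slice t%:M oAp (sm_fp sh grO oAp sHp HpK).
have C1f : C1at (fun x => fp h Hp (col_mx t%:M x)) (Pp (coord c p)) by exact: (sm1_C1at oS sS).
have CP : C1v Pp (coord c p) by exact: (sm_C1v (@open_bal R _ rho) sPp Zp).
have fE q : W q -> flow_fun t (phiM' (pip q)) = ((fun x => fp h Hp (col_mx t%:M x)) \o Pp) (coord c q).
  move=> [cq Bq]; have [_ E] := tau_dom cq Bq; have [B1 _ _] := tubr Bq.
  by rewrite /flow_fun E /fh col_mxKu col_mxKd (phi'K HmK HpK B1).
have C2 : C1at ((fun x => fp h Hp (col_mx t%:M x)) \o Pp) (coord c p).
  have sF : sm Br (fun u => (((fun x => fp h Hp (col_mx t%:M x)) \o Pp) u)%:M : 'M[R]_1).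
    apply: (sm_comp (@open_bal R _ r1) oS _ _ sS) => [|u Bu]; last by have [_ _] := tubr Bu; exact.
    by apply: sm_restrict sPp => u /Br_Zb.
  exact: (sm1_C1at (@open_bal R _ r1) sF Bp).
have dE := dfun_chart sc oW Wc Wp fE C2.
have gE : grad ((fun x => fp h Hp (col_mx t%:M x)) \o Pp) (coord c p) = (jac Pp (coord c p))^T *m gph (col_mx t%:M (Pp (coord c p))).
  by rewrite /gp col_mxKu col_mxKd -grad_comp.
rewrite dE gE /tube_field !mulmxA; congr (_ *m _ *m _).
have T0 := tr_unit sc cp'; have uT : (tr c p)^T \in unitmx by rewrite unitmx_tr.
have wu : omegaZ p \in unitmx := omega_unit p.
have iwE : (ws : 'M[R]_(n + n)) *m iw n = 1%:M := ws_iw n.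
have wui : invmx (omegaZ p) *m omegaZ p = 1%:M := mulVmx wu.
have E : omegaZ p *m (invmx (tr c p) *m iw n *m invmx (tr c p)^T) = 1%:M.
  by rewrite (cw cp') !mulmxA mulmxK// -[_ *m ws *m iw n]mulmxA iwE mulmx1 mulmxV.
have -> : invmx (omegaZ p) = invmx (tr c p) *m iw n *m invmx (tr c p)^T.
  by rewrite -[LHS]mulmx1 -E mulmxA wui mul1mx.
by rewrite !mulmxA mulmxV// mul1mx mulmxKV.
Qed.

Lemma tube_field0 (t : R) : 0 <= t <= 1 -> tube_field t 0 = 0.
Proof.
move=> t01; rewrite /tube_field (grad_at0 sth th0 sh hth sPp grO oAp up sHp HpK (tb0 t01)).
by rewrite !mulmx0.
Qed.

Lemma gp_smooth : sm Ap gph.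
Proof.
have S := sm_fp sh grO oAp sHp HpK.
apply: (sm_ext oAp (f := fun w => dsubmx (grad (fp h Hp) w))); last by apply: sm_dsub => //; exact: sm_grad.
move=> w _; apply/colP => j; rewrite /gp !mxE; have := derive_rslice (fp h Hp) (usubmx w) (dsubmx w) j.
by rewrite vsubmxK => ->.
Qed.

Lemma open_snd k (U : set 'cV[R]_k) : open U -> open [set q : R * 'cV[R]_k | U q.2].
Proof. by move=> oU; apply: open_comp oU => q _; exact: cvg_snd. Qed.

Lemma sm_CkPm k p q (U : set 'cV[R]_k) (f : 'cV[R]_k -> 'M[R]_(p, q)) j : open U -> sm U f ->
  CkPm j [set q : R * 'cV[R]_k | U q.2] (fun _ => f).
Proof.
move=> oU sf; have := @CkPm_comp R R bool k k p q (fun=> true) (fun _ x => x)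
  [set q : R * 'cV[R]_k | U q.2] (lift1 U) j (fun _ => f).
apply=> //; [exact: open_snd|exact: open_lift1|by move=> ? _; exact: cst_cont_at|exact: CkPm_id].
Qed.

Lemma tube_field_smooth j : CkPm j [set q : R * 'cV[R]_(n + n) | `|q.2| < r1] (fun t => tube_field (clamp t)).
Proof.
have oB : open Br by exact: open_bal.
have oO := @open_snd _ _ oB.
have sPr : sm Br Pp by apply: sm_restrict sPp => u /Br_Zb.
apply: CkPm_mul => //; first exact: CkPm_cst.
apply: CkPm_mul => //.
  by apply: (sm_CkPm (f := fun u => (jac Pp u)^T) j oB); apply: sm_tr => //; exact: sm_jac.
have oA' : open [set q : R * 'cV[R]_(1 + n) | Ap q.2] by exact: open_snd.
have hid (q : R * 'cV[R]_(n + n)) : [set q : R * 'cV[R]_(n + n) | `|q.2| < r1] q -> {for q.1, continuous (@id R)}.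
  by move=> _ A; exact.
have hcol : CkPm j [set q : R * 'cV[R]_(n + n) | `|q.2| < r1] (fun t u => col_mx (clamp t)%:M (Pp u) : 'cV[R]_(1 + n)).
  apply: CkPm_col => //; last exact: (sm_CkPm j oB sPr).
  move=> a b; rewrite (ord1 a) (ord1 b).
  apply: (CkP_ext (f := fun t _ => clamp t)) => //; first by move=> q _; rewrite mxE eqxx mulr1n.
  by apply: CkP_time => q _; exact: clamp_cont.
have hmap (q : R * 'cV[R]_(n + n)) : [set q : R * 'cV[R]_(n + n) | `|q.2| < r1] q ->
    [set q : R * 'cV[R]_(1 + n) | Ap q.2] (q.1, col_mx (clamp q.1)%:M (Pp q.2)).
  by move=> Bq; have [_ _ H] := tubr Bq; exact: (H _ (clamp01 _)).
exact: (CkPm_comp oO oA' hid hcol hmap (sm_CkPm j oAp gp_smooth)).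
Qed.

Lemma st_Lt0 p : Ltt 0 p -> stm (col_mx 0 (Pm (coord c p))) = coord c p.
Proof.
move=> Lp; have [cp' Zp] := Lt_Zdom grO Lp; have [d1 d2] := hpm cp' Zp.
have Ux : Uh (pim p) by exists p.
have Ax : Am (col_mx 0%:M (coord cm (pim p))) by move: Ux; rewrite UhE scalar_mx0 => -[].
have [_ _ _ _] := section_m d1 Ax.
by rewrite sinvK_m// scalar_mx0 d2.
Qed.

(** Trajectories starting on Lambda are given by the sections [s_t], so that [tau t] maps the part
    of Lambda near [z] into [L_t] by construction; all other trajectories come from [local_flow]. *)
Lemma exists_tau : exists (W : set Z) (tau : R -> Z -> Z),
  [/\ open W, W z, is_flow D0 XF W tau
   & exists W' : set Z, [/\ open W', W' z & forall t : R, 0 <= t <= 1 ->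
       Ltt t `&` W' = (tau t @` (Ltt 0 `&` W)) `&` W']].
Proof.
have [d [Phi [d0 dr _ _ hPhi]]] := local_flow r10 tube_field_smooth tube_field0.
have oA3 : open [set w : 'cV[R]_(1 + n) | Am w /\ Br (stm w)].
  rewrite openE => w [Aw Bw]; apply: filterI; first exact: open_nbhs_nbhs.
  apply: (C1v_continuous (sm_C1v oAm (sm_st sth grO oAm sHm HmK) Aw)).
  by apply: open_nbhs_nbhs; split=> //; exact: open_bal.
have [|e3 [k3 [e30 k30 tub3]]] := tube_ball (y0 := y0) oA3.
  by move=> t t01; split; [exact: Am_y0|rewrite /bal /= st_y0// normr0].
have Zb0' := Zb0; have PC : {for (0 : 'cV[R]_(n + n)), continuous Pm}.
  by apply: C1v_continuous; exact: (sm_C1v (@open_bal R _ rho) sPm).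
have near_ball k : 0 < k -> exists2 d1 : R, 0 < d1 & forall u : 'cV[R]_(n + n), `|u| < d1 -> `|Pm u - y0| < k.
  move=> k0; have : \forall u \near (0 : 'cV[R]_(n + n)), `|Pm u - y0| < k.
    apply: (PC [set y | `|y - y0| < k]); apply: open_nbhs_nbhs; split; first exact: open_ballcV.
    by rewrite /= subrr normr0.
  move=> /near_norm[d1 d10 H]; exists d1 => // u ud; apply: H; by rewrite subr0.
have [d1 d10 hd1] := near_ball _ k30.
pose d2 := Num.min d d1; have d20 : 0 < d2 by rewrite lt_min d0.
have d2d (u : 'cV[R]_(n + n)) : `|u| < d2 -> `|u| < d /\ `|u| < d1 by rewrite lt_min => /andP.
pose WB k := cdom c `&` coord c @^-1` (@bal R (n + n) k).
have oWB k : open (WB k).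
  have [[oc _ _ cc _] _] := sc; rewrite openE => q [cq Bq]; apply: filterI; first exact: open_nbhs_nbhs.
  by apply: (cc q cq); apply: open_nbhs_nbhs; split=> //; exact: open_bal.
have WBz k : 0 < k -> WB k z by move=> k0; split=> //=; rewrite z0 /bal /= normr0.
(* [is_flow] is a condition on each trajectory separately, which permits a definition by cases. *)
pose tau (t : R) (p : Z) : Z := if pselect (Ltt 0 p) then icoord c (stm (col_mx t%:M (Pm (coord c p))))
  else icoord c (Phi t (coord c p)).
have cimgB u : Br u -> cdom c (icoord c u) /\ coord c (icoord c u) = u.
  by move=> /Br_Zb/Zc; exact: (cimgP sc.1).
have [[_ _ cK _ icc] _] := sc.
exists (WB d2), tau; split=> //; first exact: WBz.
  move=> p [cp' /d2d[ud ud1]]; rewrite /tau; case: pselect => Lp.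
    have A3 := tub3 _ (hd1 _ ud1); set y := Pm (coord c p) in A3 *.
    have te3 (t : R) : 0 <= t <= 1 -> - e3 < t < 1 + e3 by exact: t01e.
    have D (t : R) : 0 <= t <= 1 -> D0 (icoord c (stm (col_mx t%:M y))).
      move=> /te3/A3[_ Bt]; have [q1 q2] := cimgB _ Bt.
      by have [] := tau_dom q1 (_ : Br (coord c _)); rewrite ?q2.
    have V (t : R) : 0 <= t <= 1 -> velocity (fun s => icoord c (stm (col_mx s%:M y))) t (XF t (icoord c (stm (col_mx t%:M y)))).
      move=> t01; have [At Bt] := A3 t (te3 t t01); have [q1 q2] := cimgB _ Bt.
      apply: (velocity_chart sc (y := fun s => stm (col_mx s%:M y)) (y' := tube_field t (stm (col_mx t%:M y)))).
      - have : \forall s \near t, - e3 < s < 1 + e3.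
          by have /andP[a b] := te3 t t01; near=> s; apply/andP; split; near: s; [exact: lt_nbhsr|exact: lt_nbhsl].
        by apply: filterS => s /A3[_ /cimgB].
      - exact: (st_velocity sth sh hth thsym sPm sPp grO oAm oAp um sHm HmK sHp HpK chart_orth At).
      - by rewrite tau_dfun ?q2.
    split=> //.
    - by rewrite scalar_mx0 st_Lt0// cK.
    - by apply: continuous_in_subspaceT => t; rewrite inE /= in_itv /= => /V[].
    - by move=> t /andP[a b]; apply: V; rewrite !ltW.
  have [[P0 _ Pc Pd] Pr _] := hPhi _ ud.
  have Pr' t : Br (Phi t (coord c p)) by exact: Pr.
  split.
  - by rewrite P0 cK.
  - move=> t t01; have [q1 q2] := cimgB _ (Pr' t).
    by have [] := tau_dom q1 (_ : Br (coord c _)); rewrite ?q2.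
  - apply: continuous_subspaceT => t.
    by apply: (continuous_comp (Pc t)); apply: icc; apply: Zc; exact: Br_Zb.
  - move=> t t01; have [q1 q2] := cimgB _ (Pr' t).
    apply: (velocity_chart sc (y := fun s => Phi s (coord c p)) (y' := tube_field t (Phi t (coord c p)))).
    + by near=> s; exact: cimgB.
    + by move=> i j; rewrite (ord1 j); exact: Pd.
    + by rewrite tau_dfun ?q2//; have /andP[a b] := t01; rewrite !ltW.
have sS := sm_st sth grO oAm sHm HmK.
(* For the inclusion of [L_t] near [z] in the image of [tau t]: a point of [L_t] comes from the
   point of Lambda over the same point of [X_-], and the radius [d4] is chosen to keep the latter in
   [W]. *)
have n4 : \forall w \near (col_mx 0%:M y0 : 'cV[R]_(1 + n)), Am w /\ `|stm w| < d2.
  have A0 := Am_y0 mem01_0; apply: filterI; first exact: open_nbhs_nbhs.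
  have SC : {for (col_mx 0%:M y0 : 'cV[R]_(1 + n)), continuous stm} by apply: C1v_continuous; exact: (sm_C1v oAm sS A0).
  have NB : nbhs (stm (col_mx 0%:M y0)) (@bal R (n + n) d2).
    by apply: open_nbhs_nbhs; split; [exact: open_bal|rewrite /bal /= (st_y0 mem01_0) normr0].
  exact: (SC _ NB).
have [k4 k40 hk4] := near_norm n4.
have [d4 d40 hd4] := near_ball _ k40.
have hd5 (u : 'cV[R]_(n + n)) : `|u| < d4 -> Am (col_mx 0%:M (Pm u)) /\ `|stm (col_mx 0%:M (Pm u))| < d2.
  move=> /hd4 h4; apply: hk4; rewrite opp_col_mx add_col_mx subrr.
  apply: cV_norm_lt => // i; case: (split_ordP i) => j ->; first by rewrite col_mxEu mxE normr0.
  by rewrite col_mxEd; exact: le_lt_trans (coord_le_norm _ _) h4.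
exists (WB d4); split=> //; first exact: WBz.
move=> t t01; apply/seteqP; split=> [p [Lp [cp' Bp]]|_ [[p0 [L0 [cp0 /d2d[_ ud1]]] <-] Wp]].
  split=> //; have [_ [v [Tv vt vE]]] := Lp; have [_ Zp] := Lt_Zdom grO Lp.
  have [q1 q2] := hpm cp' Zp; have [A0 B0] := hd5 _ Bp; rewrite -q2 in A0 B0.
  have [L0 pE _ [cp0 Z0] cE] := section_m q1 A0; set p0 := sinv _ _ _ _ in L0 pE cp0 Z0 cE.
  exists p0; first by split=> //; split=> //=; rewrite /bal /= cE.
  rewrite /tau; case: pselect => [?|//] /=; rewrite cE (Pm_st HmK A0) col_mxKd q2.
  have -> : col_mx t%:M (Pm (coord c p)) = lift_map th Pm v by rewrite /lift_map vt vE.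
  by rewrite (GmK HmK Tv) -vE cK.
split=> //; rewrite /tau; case: pselect => [?|//] /=.
have [At _] := tub3 _ (hd1 _ ud1) t (t01e e30 t01).
have [v [Tv vE sE uE]] := AmP HmK At; rewrite sE; rewrite col_mxKu in uE.
by have [] := Lt_icoord sc Zc grO Tv; rewrite uE mxE eqxx mulr1n.
Unshelve. all: by end_near.
Qed.

End FlowTau.
End Hamiltonian.

Lemma near_slice k (y1 : 'cV[R]_k) (t : R) (P : set 'cV[R]_(1 + k)) :
  (\forall w \near (col_mx t%:M y1 : 'cV[R]_(1 + k)), P w) -> \forall y \near y1, P (col_mx t%:M y).
Proof.
move=> nP; have idc : {for y1, continuous (@id 'cV[R]_k)} by move=> A; exact.
have C : {for y1, continuous (fun y : 'cV[R]_k => col_mx t%:M y : 'cV[R]_(1 + k))}.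
  by apply: cont_col_mx idc; exact: cst_cont_at.
exact: (C P nP).
Qed.

Lemma brane_flow_local (L : set Z) : (forall p q, L p -> L q -> pim p = pim q -> p = q) ->
  germ_eq z (Ltt 1) L ->
  has_brane_flow pim pip z L.
Proof.
move=> Linj gL; exists Ltt; split.
  split=> //; last exact: Lt0_holo.
  by move=> t t01; split; [exact: Lt_brane|exact: (Lt_z cz z0 e0 th0)].
split; first exact: phi_iso.
have [cy0 y0E] := pim_z; have [_ ocm _ _ _] := scm.1.
have cimy0 : cimg cm y0 by exists (pim z).
have oA1 : open [set w : 'cV[R]_(1 + n) | Af w /\ cimg cm (dsubmx w)].
  rewrite openE => w [Aw Cw]; apply: filterI; first by apply: open_nbhs_nbhs; split=> //; exact: oAf.
  by apply: (@dsub_cont R 1 n w); exact: open_nbhs_nbhs.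
have [|e1 [k1 [e10 k10 tub1]]] := tube_ball (y0 := y0) oA1.
  by move=> t t01; split; [exact: Af_y0|rewrite /= col_mxKd].
have tubf y : `|y - y0| < k1 -> forall t : R, - e1 < t < 1 + e1 -> Af (col_mx t%:M y) /\ cimg cm y.
  by move=> Ky t te; have [A B] := tub1 y Ky t te; rewrite /= col_mxKd in B.
exists (cball k1), flow_fun; split.
- by split; [exact: cball_open|exact: cball_z|exact: (W0_U e10 tubf)|exact: (W0_smooth e10 tubf)].
- have [eps [kap [eps0 kap0 tubA]]] := tube_ball oAp Ap_x0.
  have PC : {for (0 : 'cV[R]_(n + n)), continuous Pp}.
    by apply: C1v_continuous; exact: (sm_C1v (@open_bal R _ rho) sPp Zb0).
  have [oUp _ _] := sm_slice 0 oAp (sm_st sth grO oAp sHp HpK).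
  have Up0 : Ap (col_mx 0 (Pp 0)) by rewrite -scalar_mx0; exact: (Ap_x0 mem01_0).
  have PhC : {for Pp 0, continuous (phi' th Pm Hp)}.
    by apply: C1v_continuous; exact: (sm_C1v oUp (sm_phi' sth sPm grO oAp sHp HpK) Up0).
  have nb1 : nbhs (phi' th Pm Hp (Pp 0)) [set y : 'cV[R]_n | `|y - y0| < k1].
    by apply: open_nbhs_nbhs; split; [exact: open_ballcV|rewrite /= phi'_x0 subrr normr0].
  have nb2 : nbhs (Pp 0) [set x : 'cV[R]_n | `|x - Pp 0| < kap].
    by apply: open_nbhs_nbhs; split; [exact: open_ballcV|rewrite /= subrr normr0].
  have nb3 : nbhs (0 : 'cV[R]_(n + n)) Zb by apply: open_nbhs_nbhs; split; [exact: open_bal|exact: Zb0].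
  have n1 : nbhs (0 : 'cV[R]_(n + n)) [set u | `|phi' th Pm Hp (Pp u) - y0| < k1] := PC _ (PhC _ nb1).
  have n2 : nbhs (0 : 'cV[R]_(n + n)) [set u | `|Pp u - Pp 0| < kap] := PC _ nb2.
  have [r r0' hr] := near_norm (filterI (filterI n1 n2) nb3).
  have hr' (u : 'cV[R]_(n + n)) : `|u| < r ->
      [/\ Ap (col_mx 0 (Pp u)), `|phi' th Pm Hp (Pp u) - y0| < k1
        & forall t : R, 0 <= t <= 1 -> Ap (col_mx t%:M (Pp u))].
    move=> ur; have [|[h1 h2] _] := hr u; first by rewrite subr0.
    by split=> //; [rewrite -scalar_mx0; apply: (tubA _ h2); exact: t01e mem01_0|move=> t t01; apply: (tubA _ h2); exact: t01e].
  pose r1 := Num.min r rho.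
  have rho0 : 0 < rho by have := Zb0; rewrite /bal /= normr0.
  have r10 : 0 < r1 by rewrite lt_min r0'.
  have r1rho : r1 <= rho by rewrite ge_min lexx orbT.
  apply: (exists_tau (k1 := k1) r10 r1rho) => u ur.
  by apply: hr'; move: ur; rewrite lt_min => /andP[].
- have [Wg [oWg Wgz gE]] := gL.
  have oA2 : open [set w : 'cV[R]_(1 + n) | Apsi w /\ [set y : 'cV[R]_n | `|y - y0| < k1] (psih w)].
    rewrite openE => w [Aw Bw]; apply: filterI; first by apply: open_nbhs_nbhs; split=> //; exact: oApsi.
    have SC : {for w, continuous psih} by apply: C1v_continuous; exact: (sm_C1v oApsi spsi Aw).
    by apply: (SC [set y : 'cV[R]_n | `|y - y0| < k1]); apply: open_nbhs_nbhs; split=> //; exact: open_ballcV.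
  have [|e2 [k2 [e20 k20 tub2]]] := tube_ball (y0 := y0) oA2.
    by move=> t t01; split; [exact: Apsi_y0|rewrite /= psi_y0// subrr normr0].
  have A1 := Am_y0 mem01_1.
  have nW : \forall y \near y0, Wg (icoord c (stm (col_mx 1%:M y))).
    apply: (near_slice (P := fun w => Wg (icoord c (stm w)))).
    have SC : {for (col_mx 1%:M y0 : 'cV[R]_(1 + n)), continuous stm}.
      by apply: C1v_continuous; exact: (sm_C1v oAm (sm_st sth grO oAm sHm HmK) A1).
    apply: (SC [set u | Wg (icoord c u)]); rewrite (st_y0 mem01_1).
    have [[_ _ cK _ icc] _] := sc; apply: (icc 0); first by exact: (Zc Zb0).
    by rewrite -z0 cK//; exact: open_nbhs_nbhs.
  have [k3 k30 hk3] := near_norm nW.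
  (* [k2] serves the flow [psi], and [k3] keeps [s_1] in the neighbourhood [Wg] where [L_1] and [L]
     agree. *)
  pose k := Num.min k2 k3; have k0 : 0 < k by rewrite lt_min k20.
  have tubp y : `|y - y0| < k -> forall t : R, - e2 < t < 1 + e2 ->
      Apsi (col_mx t%:M y) /\ `|psih (col_mx t%:M y) - y0| < k1.
    by rewrite lt_min => /andP[Ky _]; exact: tub2.
  have tubg y : `|y - y0| < k -> Wg (icoord c (stm (col_mx 1%:M y))).
    by rewrite lt_min => /andP[_ /hk3].
  have gE' p : Wg p -> Ltt 1 p -> L p.
    move=> Wp Lp; have : (Ltt 1 `&` Wg) p by [].
    by rewrite gE => -[].
  exists (cball k), flow_psi; split.
  + exact: cball_open.
  + exact: cball_z.
  + exact: (flow_psiP e10 tubf e20 tubp).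
  + exact: (gkI_psi e10 tubf e20 tubp Linj gE' tubg).
  + exact: (gkF_int e10 tubf e20 tubp Linj gE' tubg).
Qed.

End Assembly.

End Flows.

(** * Adapted coordinates at z *)

Section Adapted_coordinates.
Context {R : realType}.
(** Two rank counts: [morita_orth], with both differentials of rank [n], gives [2 n <= m];
    orthogonality of the two kernels, of dimension [m - n] each, gives [2 (m - n) <= m]. *)
Lemma morita_dim n m (Xm Xp : @holPoisson R n) (Z : @holSymp R m) (pim : Z -> Xm) (pip : Z -> Xp) (z : Z) :
  morita pim pip -> m = (n + n)%N.
Proof.
move=> HZ; have [[[_ _ rm _] [_ _ rp _]] _ _ _ _] := HZ.
have wu := omega_unit z; have wiu : invmx (omegaZ z) \in unitmx by rewrite unitmx_inv.
apply/eqP; rewrite eqn_leq; apply/andP; split; last first.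
  have := mulmx0_rank_max (morita_orth HZ z).
  by rewrite mxrankMfree ?row_free_unit// mxrank_tr rm rp.
pose Km := kermx (tmap pim z)^T; pose Kp := kermx (tmap pip z)^T.
have kerE (T : 'M[R]_(n, m)) (K := kermx T^T) (i : 'I_m) : T *m (row i K)^T = 0.
  by apply: trmx_inj; rewrite trmx_mul trmxK -row_mul mulmx_ker row0 trmx0.
have E : (Kp *m omegaZ z) *m Km^T = 0.
  apply/matrixP => i j; rewrite [RHS]mxE.
  have := ker_orth HZ (kerE (tmap pim z) j) (kerE (tmap pip z) i).
  rewrite trmxK -row_mul -/Kp -/Km => /matrixP/(_ ord0 ord0); rewrite [RHS]mxE => <-.
  by rewrite !mxE; apply: eq_bigr => k _; rewrite !mxE.
have := mulmx0_rank_max E; rewrite mxrankMfree ?row_free_unit// mxrank_tr !mxrank_ker !mxrank_tr rm rp.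
have : (n <= m)%N by rewrite -(rm z) rank_leq_col.
by lia.
Qed.

Lemma sinv_diffeo n m (M : @manifold R m) (N : @manifold R n) (pi : M -> N) (L : set M) (z : M) :
  diffeo_on pi L -> pi @` L = setT ->
  [/\ smooth_map setT (sinv z pi L), forall x, L (sinv z pi L x) /\ pi (sinv z pi L x) = x
    & forall p, L p -> sinv z pi L (pi p) = p].
Proof.
move=> [_ inj [s ss sL]] sur.
have sL' x : L (s x) /\ pi (s x) = x by apply: sL; rewrite sur.
have inj' p q : L p -> L q -> pi p = pi q -> p = q by move=> Lp Lq; apply: inj; rewrite inE.
have E : sinv z pi L = s.
  apply/funext => x; have := xgetPex z (ex_intro (fun p => L p /\ pi p = x) _ (sL' x)).
  by move=> [L1 E1]; have [L2 E2] := sL' x; apply: inj' => //; rewrite E2; exact: E1.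
rewrite E -sur; split=> // p Lp; have [L2 E2] := sL' (pi p).
by apply: inj'.
Qed.

(** In a slice chart at [s x] the normal coordinates of [s] vanish identically near [x]. *)
Lemma section_tangent n m d (M : @manifold R m) (N : @manifold R n) (s : N -> M) (L : set M) x v :
  submanifold d L -> smooth_map setT s -> (forall x, L (s x)) -> tangent d L (s x) (tmap s x *m v).
Proof.
move=> [_ sub] ss sL; have [c' slc csx] := sub _ (sL x); have [sc' sl] := slc.
apply/(tangentE _ slc csx (sL x)) => j dj.
have sx : smooth_chart (chart_at x) := chart_at_smooth x.
have l := smooth_lrep (openT) ss sx sc'.
have Wx : (setT `&` cdom (chart_at x) `&` s @^-1` cdom c') x by split=> //; split=> //; exact: chart_at_dom.
have T := lrep_tmap sx sc' l Wx; rewrite mulmxA T tr_chart_at mulmx1.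
rewrite mxE big1// => k _; rewrite [X in X * _](_ : _ = 0) ?mul0r// mxE.
have [oW _ _ _ _] := l.
apply: (@eq_trans _ _ ('D_(cvec k) (fun _ : 'cV[R]_n => 0 : R) (coord (chart_at x) x))); last exact: derive_cst.
apply: near_eq_derive.
have := near_coord sx.1 (chart_at_dom x) oW Wx.
apply: filterS => u [[_ cu] _] /=.
by have [+ _] := sl _ cu; exact.
Qed.

Lemma lrep_ker_orth n m (Xm Xp : @holPoisson R n) (Z : @holSymp R m) (pim : Z -> Xm) (pip : Z -> Xp)
    (c : @chart R Z m) (cm : @chart R Xm n) (cp : @chart R Xp n) Wm Wp Pm Pp w0 p (u v : 'cV[R]_m) :
  morita pim pip -> smooth_chart c -> smooth_chart cm -> smooth_chart cp ->
  lrep c cm pim Wm Pm -> lrep c cp pip Wp Pp -> Wm p -> Wp p ->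
  omegaZ p = (tr c p)^T *m w0 *m tr c p ->
  jac Pm (coord c p) *m u = 0 -> jac Pp (coord c p) *m v = 0 -> v^T *m w0 *m u = 0.
Proof.
move=> HZ sc scm scp lm lp Wmp Wpp wE hu hv.
have cp' : cdom c p by case: lm => _ + _ _ _; exact.
have cmp : cdom cm (pim p) by case: lm => _ _ + _ _; exact.
have cpp : cdom cp (pip p) by case: lp => _ _ + _ _; exact.
have Tm := lrep_tmap sc scm lm Wmp; have Tp := lrep_tmap sc scp lp Wpp.
pose u' := invmx (tr c p) *m u; pose v' := invmx (tr c p) *m v.
have uE : u = tr c p *m u' by rewrite tr_invK.
have vE : v = tr c p *m v' by rewrite tr_invK.
have hu' : tmap pim p *m u' = 0.
  by apply: (can_inj (mulKmx (tr_unit scm cmp))); rewrite mulmxA Tm -mulmxA -uE hu mulmx0.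
have hv' : tmap pip p *m v' = 0.
  by apply: (can_inj (mulKmx (tr_unit scp cpp))); rewrite mulmxA Tp -mulmxA -vE hv mulmx0.
have := ker_orth HZ hu' hv'; rewrite wE => <-.
by rewrite uE vE trmx_mul !mulmxA.
Qed.

Lemma lrep_comp n m k (M : @manifold R n) (N : @manifold R m) (Q : @manifold R k)
    (c : @chart R M n) (d : @chart R N m) (e : @chart R Q k) (f : M -> N) (g : N -> Q) W W' F G :
  smooth_chart c -> smooth_chart d -> lrep c d f W F -> lrep d e g W' G ->
  lrep c e (g \o f) (W `&` f @^-1` W') (G \o F).
Proof.
move=> sc sd l l'; have [oW Wc Wd sF fF] := l; have [oW' Wd' We sG gG] := l'.
have oV : open (W `&` f @^-1` W').
  rewrite openE => x [Wx W'x]; apply: filterI; first exact: open_nbhs_nbhs.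
  by apply: (lrep_cont sc sd l Wx); exact: open_nbhs_nbhs.
split=> //.
- by move=> x [/Wc].
- by move=> x [_ /We].
- have Vc : (W `&` f @^-1` W') `<=` cdom c by move=> x [/Wc].
  apply: (sm_comp (open_imgS sc.1 oV Vc) (open_imgS sd.1 oW' Wd') _ _ sG).
    by apply: sm_restrict sF => _ [x [Wx _] <-]; exists x.
  by move=> _ [x [Wx W'x] <-]; rewrite -fF//; exists (f x).
- by move=> x [Wx W'x]; rewrite /= -fF// -gG.
Qed.

Lemma form_zero n (A : 'M[R]_n) : (forall v w : 'cV[R]_n, w^T *m A *m v = 0) -> A = 0.
Proof.
move=> h; apply/matrixP => i j; have := h (cvec j) (cvec i) => /matrixP/(_ ord0 ord0).
by rewrite [RHS]mxE -colE trmx_delta -rowE !mxE => ->.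
Qed.

Section Instance.
Variables (n : nat) (Xm Xp : @holPoisson R n) (Z : @holSymp R (n + n)).
Variables (pim : Z -> Xm) (pip : Z -> Xp) (z : Z) (L : set Z).
Variables (cm : @chart R Xm n) (cp : @chart R Xp n) (Jm Jp : 'M[R]_n).
Hypotheses (HZ : morita pim pip) (HL : brane_bisection pim pip L) (Lz : L z).
Hypothesis HGK : symplectic_type pim pip z L.
Hypotheses (hcm : holo_chart (@cpx R n Xm) Jm cm) (hcp : holo_chart (@cpx R n Xp) Jp cp).
Hypotheses (cmz : cdom cm (pim z)) (cpz : cdom cp (pip z)).
Let scm := hcm.1.
Let scp := hcp.1.
Local Notation s := (sinv z pim L).
Local Notation s' := (sinv z pip L).
Local Notation y0 := (coord cm (pim z)).

Definition mrep (c : @chart R Z (n + n)) := coord cm \o pim \o icoord c.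
Definition prep (c : @chart R Z (n + n)) := coord cp \o pip \o icoord c.
Definition srep (c : @chart R Z (n + n)) := coord c \o s \o icoord cm.
Local Notation Wm c := (setT `&` cdom c `&` pim @^-1` cdom cm).
Local Notation Wp c := (setT `&` cdom c `&` pip @^-1` cdom cp).
Local Notation Ws c := (setT `&` cdom cm `&` s @^-1` cdom c).

Lemma s_spec : [/\ smooth_map setT s, forall x, L (s x) /\ pim (s x) = x & forall p, L p -> s (pim p) = p].
Proof. by have [_ dm _ im _] := HL; exact: sinv_diffeo. Qed.

Lemma s'_spec : [/\ smooth_map setT s', forall x, L (s' x) /\ pip (s' x) = x & forall p, L p -> s' (pip p) = p].
Proof. by have [_ _ dp _ ip] := HL; exact: sinv_diffeo. Qed.

Lemma sz : s (pim z) = z. Proof. by have [_ _ K] := s_spec; exact: K. Qed.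
Lemma s'z : s' (pip z) = z. Proof. by have [_ _ K] := s'_spec; exact: K. Qed.

Lemma mrep_lrep c : smooth_chart c -> lrep c cm pim (Wm c) (mrep c).
Proof. by move=> sc; apply: (smooth_lrep (openT) (morita_smoothm HZ) sc scm). Qed.

Lemma prep_lrep c : smooth_chart c -> lrep c cp pip (Wp c) (prep c).
Proof. by move=> sc; apply: (smooth_lrep (openT) (morita_smoothp HZ) sc scp). Qed.

Lemma srep_lrep c : smooth_chart c -> lrep cm c s (Ws c) (srep c).
Proof. by move=> sc; have [ss _ _] := s_spec; apply: (smooth_lrep (openT) ss scm sc). Qed.

Section AtChart.
Variable c : @chart R Z (n + n).
Hypotheses (sc : smooth_chart c) (cz : cdom c z).

Lemma Wmz : Wm c z. Proof. by []. Qed.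
Lemma Wpz : Wp c z. Proof. by []. Qed.
Lemma Wsz : Ws c (pim z). Proof. by split; [|rewrite /= sz]. Qed.

Lemma srep_y0 : srep c y0 = coord c z.
Proof. by have [_ _ _ _ E] := srep_lrep sc; rewrite -E ?sz//; exact: Wsz. Qed.

Lemma mrep_srep : jac (mrep c) (coord c z) *m jac (srep c) y0 = 1%:M.
Proof.
have Cs := lrep_C1v scm (srep_lrep sc) Wsz; have Cm := lrep_C1v sc (mrep_lrep sc) Wmz.
have Cm' : C1v (mrep c) (srep c y0) by rewrite srep_y0.
rewrite -[in X in jac _ X *m _]srep_y0 -(jac_comp Cm' Cs) -(jac_id y0); apply: jac_near.
have [oW _ _ _ _] := srep_lrep sc.
have := near_coord scm.1 cmz oW Wsz.
apply: filterS => u [[[_ c1] c2] [c3 c4]] /=.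
have [[_ _ K _ _] _] := sc; have [_ sL _] := s_spec; rewrite /mrep /srep /= K//.
by have [_ ->] := sL (icoord cm u).
Qed.

Lemma prep_srep_lrep : lrep cm cp (pip \o s) (Ws c `&` s @^-1` Wp c) (prep c \o srep c) /\
  (Ws c `&` s @^-1` Wp c) (pim z).
Proof.
split; last by split; [exact: Wsz|rewrite /= sz].
exact: (lrep_comp scm sc (srep_lrep sc) (prep_lrep sc)).
Qed.

Lemma jac_prep_srep : jac (prep c \o srep c) y0 = jac (prep c) (coord c z) *m jac (srep c) y0.
Proof.
have Cs := lrep_C1v scm (srep_lrep sc) Wsz; have Cp := lrep_C1v sc (prep_lrep sc) Wpz.
have Cp' : C1v (prep c) (srep c y0) by rewrite srep_y0.
by rewrite (jac_comp Cp' Cs) srep_y0.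
Qed.

(** The section of [pi_-] factors through that of [pi_+], as [s = s' o (pi_+ o s)]. Since [d pi_-]
    is a left inverse of [ds], the differential of [pi_+ o s] is invertible. *)
Lemma prep_unit : jac (prep c) (coord c z) *m jac (srep c) y0 \in unitmx.
Proof.
have [ss' sL' sK'] := s'_spec; have [ss sL sK] := s_spec.
have l' := smooth_lrep (openT) ss' scp sc.
have W'z : (setT `&` cdom cp `&` s' @^-1` cdom c) (pip z) by split; [|rewrite /= s'z].
have Cs' := lrep_C1v scp l' W'z; set S' := coord c \o s' \o icoord cp in Cs'.
have ppz : prep c (coord c z) = coord cp (pip z).
  by have [_ _ _ _ E] := prep_lrep sc; rewrite -E.
have [l2 V2] := prep_srep_lrep.
have Cps := lrep_C1v scm l2 V2.
have E2 : (prep c \o srep c) y0 = coord cp (pip z) by rewrite /= srep_y0.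
rewrite -E2 in Cs'; rewrite -jac_prep_srep.
have E3 : jac (srep c) y0 = jac S' ((prep c \o srep c) y0) *m jac (prep c \o srep c) y0.
  rewrite -(jac_comp Cs' Cps); apply: jac_near.
  have [oW2 _ _ _ _] := l2.
  have := near_coord scm.1 cmz oW2 V2; apply: filterS => u [[[[_ c1] c2] [_ c5]] [c3 c4]] /=.
  have [[_ _ K _ _] _] := sc; have [[_ _ Kp _ _] _] := scp.
  rewrite /S' /prep /srep /= K// Kp// sK' //.
  by have [] := sL (icoord cm u).
have := mrep_srep; rewrite E3 mulmxA => /mulmx1_unit[_]; exact.
Qed.

Lemma srep_iso w0 x : (forall y, cdom c y -> omegaZ y = (tr c y)^T *m w0 *m tr c y) -> Ws c x ->
  (jac (srep c) (coord cm x))^T *m w0 *m jac (srep c) (coord cm x) = 0.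
Proof.
move=> cw Wx; have [ss sL _] := s_spec; have [[d [_ sub lag]] _ _ _ _] := HL.
have T := lrep_tmap scm sc (srep_lrep sc) Wx; have [[_ cx] csx] := Wx.
have Z0 : (tmap s x)^T *m omegaZ (s x) *m tmap s x = 0.
  apply: form_zero => v w; have Ls y : L (s y) by have [] := sL y.
  have := lag _ (Ls x) _ _ (section_tangent x v sub ss Ls) (section_tangent x w sub ss Ls).
  by rewrite trmx_mul !mulmxA.
have u := tr_unit scm cx; have uT : (tr cm x)^T \in unitmx by rewrite unitmx_tr.
apply: (can_inj (mulKmx uT)); apply: (can_inj (mulmxK u)); rewrite mulmx0 mul0mx.
rewrite -!mulmxA -T !mulmxA -trmx_mul -T trmx_mul -Z0 (cw _ csx).
by rewrite !mulmxA.
Qed.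

(** The matrix of the metric at [pi_-(z)] in the coordinates of [cm], up to a positive factor; this
    is the positivity that [adapted_frame] takes as input. *)
Lemma type_posdef J0 w0 : (forall y, cdom c y -> tr c y *m cpxZ y = J0 *m tr c y) ->
  (forall y, cdom c y -> omegaZ y = (tr c y)^T *m w0 *m tr c y) ->
  let E := jac (srep c) y0 in let A := jac (prep c) (coord c z) *m E in
  posdef (- ((E^T *m (w0 *m J0) *m E) *m (invmx A *m Jp *m A + Jm))).
Proof.
move=> cJ cw E A.
have ux := tr_unit scm cmz; have T := lrep_tmap scm sc (srep_lrep sc) Wsz.
have csz : cdom c (s (pim z)) by rewrite sz.
have FE : gkF pim z L (pim z) = (tr cm (pim z))^T *m (E^T *m (w0 *m J0) *m E) *m tr cm (pim z).
  rewrite /gkF /pull_form cmx_tr re_mx_mul re_mx_mull Omega_re (cw _ csz).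
  rewrite -[_ *m cpxZ _]mulmxA (cJ _ csz).
  set p := s (pim z) in T *.
  have -> : (tmap s (pim z))^T *m ((tr c p)^T *m w0 *m (J0 *m tr c p)) *m tmap s (pim z) =
    (tr c p *m tmap s (pim z))^T *m (w0 *m J0) *m (tr c p *m tmap s (pim z)).
    by rewrite [X in _ = X *m _ *m _]trmx_mul !mulmxA.
  by rewrite T [X in X *m _ *m _ = _]trmx_mul !mulmxA.
have [l2 V2] := prep_srep_lrep; have uA : jac (prep c \o srep c) y0 \in unitmx by rewrite jac_prep_srep prep_unit.
have IE := lrep_pull scm hcp l2 V2 uA; rewrite jac_prep_srep -/E -/A in IE.
have CE : cpx (pim z) = invmx (tr cm (pim z)) *m Jm *m tr cm (pim z).
  by apply: (can_inj (mulKmx ux)); rewrite -mulmxA mulKVmx// hcm.2.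
set K := invmx A *m Jp *m A in IE *; set F := E^T *m _ *m E in FE *.
move=> v v0; pose v' := invmx (tr cm (pim z)) *m v.
have vE : v = tr cm (pim z) *m v' by rewrite tr_invK.
have v'0 : v' != 0 by apply: contraNneq v0 => v'0; rewrite vE v'0 mulmx0.
have := HGK (pim z) v'0.
have -> : gkg pim pip z L (pim z) = (- 2^-1) *: ((tr cm (pim z))^T *m (F *m (K + Jm)) *m tr cm (pim z)).
  rewrite /gkg FE; have -> : gkI pim pip z L (pim z) = invmx (tr cm (pim z)) *m K *m tr cm (pim z) by exact: IE.
  rewrite CE -mulmxDl -mulmxDr !mulmxA mulmxK//.
have alg (a b : 'cV[R]_n) (T0 X : 'M[R]_n) : a = T0 *m b ->
    b^T *m ((- 2^-1) *: (T0^T *m X *m T0)) *m b = 2^-1 *: (a^T *m (- X) *m a).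
  move=> ->; rewrite -scalemxAr -scalemxAl scaleNr mulmxN mulNmx scalerN [in RHS]trmx_mul.
  by rewrite !mulmxA.
rewrite (alg _ _ _ _ vE).
by rewrite mxE pmulr_rgt0 ?invr_gt0 ?ltr0n.
Qed.

End AtChart.

(** A Darboux chart at [z] followed by the inverse of the linear frame of [adapted_frame]: a linear
    change keeps the complex structure and the form constant, and this one makes the form
    standard. *)
Lemma frame_data : exists (c : @chart R Z (n + n)) (J0 : 'M[R]_(n + n)) (S G : 'M[R]_n),
  [/\ smooth_chart c, cdom c z, coord c z = 0,
      forall y, cdom c y -> tr c y *m cpxZ y = J0 *m tr c y
    & forall y, cdom c y -> omegaZ y = (tr c y)^T *m block_mx 0 1%:M (- 1%:M) 0 *m tr c y] /\
  [/\ J0 *m col_mx 1%:M 0 = col_mx 1%:M 0 *m G, S^T = S, jac (srep c) y0 = col_mx 1%:M (- S)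
    & forall t : R, 0 <= t <= 1 ->
        jac (mrep c) 0 *m col_mx 1%:M (- (t *: S)) \in unitmx /\
        jac (prep c) 0 *m col_mx 1%:M (- (t *: S)) \in unitmx].
Proof.
have [c [J0 [w0 [sc cz c0 cJw]]]] := darboux_chart z.
have cJ y (cy : cdom c y) := (cJw y cy).1; have cw y (cy : cdom c y) := (cJw y cy).2.
have u := tr_unit sc cz; have uT : (tr c z)^T \in unitmx by rewrite unitmx_tr.
have JE : J0 = tr c z *m cpxZ z *m invmx (tr c z) by rewrite (cJ _ cz) mulmxK.
have wE : w0 = invmx (tr c z)^T *m omegaZ z *m invmx (tr c z) by rewrite (cw _ cz) !mulmxA mulVmx// mul1mx mulmxK.
have JZ : cpxZ z *m cpxZ z = - 1%:M by have [H _] := cpxZP Z; exact: H.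
have JJ : J0 *m J0 = - 1%:M.
  by rewrite JE !mulmxA mulmxKV// -[_ *m cpxZ z *m cpxZ z]mulmxA JZ mulmxN mulmx1 mulNmx mulmxV.
have skc (T A : 'M[R]_(n + n)) : A^T = - A -> (T^T *m A *m T)^T = - (T^T *m A *m T).
  by move=> AE; rewrite !trmx_mul trmxK AE mulNmx mulmxN mulmxA.
have ws0 : w0^T = - w0 by rewrite wE -trmx_inv skc// omega_skew.
have wJ0E : w0 *m J0 = invmx (tr c z)^T *m (omegaZ z *m cpxZ z) *m invmx (tr c z).
  by rewrite wE JE !mulmxA mulmxKV.
have wJs : (w0 *m J0)^T = - (w0 *m J0) by rewrite wJ0E -trmx_inv skc// omegaJ_skew.
have hm : jac (mrep c) 0 *m J0 = Jm *m jac (mrep c) 0.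
  by rewrite -c0; exact: (lrep_holo sc hcm (mrep_lrep sc) (Wmz cz) (cJ _ cz) (morita_holom HZ z)).
have hp : jac (prep c) 0 *m J0 = Jp *m jac (prep c) 0.
  by rewrite -c0; exact: (lrep_holo sc hcp (prep_lrep sc) (Wpz cz) (cJ _ cz) (morita_holop HZ z)).
have orth (v v' : 'cV[R]_(n + n)) : jac (mrep c) 0 *m v = 0 -> jac (prep c) 0 *m v' = 0 -> v'^T *m w0 *m v = 0.
  rewrite -c0; exact: (lrep_ker_orth HZ sc scm scp (mrep_lrep sc) (prep_lrep sc) (Wmz cz) (Wpz cz) (cw _ cz)).
have TE := mrep_srep sc cz; rewrite c0 in TE.
have iso := srep_iso sc cw (Wsz cz).
have Au := prep_unit sc cz; have pd := type_posdef sc cz cJ cw; rewrite /= c0 in Au pd.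
have [M [S [G [MwM JM SS ME tu]]]] := adapted_frame JJ ws0 wJs hm hp orth TE iso erefl erefl erefl Au pd.
have Mu : M \in unitmx.
  apply: unitmx_inj => v Mv.
  have wsv : (block_mx 0 1%:M (- 1%:M) 0 : 'M[R]_(n + n)) *m v = 0 by rewrite -MwM -mulmxA Mv mulmx0.
  have iwE := mulmx1C (ws_iw (R := R) n).
  by rewrite -[v]mul1mx -iwE -mulmxA wsv mulmx0.
have [[oc oci cK cc icc] _] := sc.
pose c1 := rechart c (cimg c) (mulmx (invmx M)) (mulmx M).
have MK v : M *m (invmx M *m v) = v :> 'cV[R]_(n + n) by rewrite mulKVmx.
have MK' v : invmx M *m (M *m v) = v :> 'cV[R]_(n + n) by rewrite mulKmx.
have smM (A : 'M[R]_(n + n)) U : open U -> sm U (mulmx A : 'cV[R]_(n + n) -> 'cV[R]_(n + n)).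
  by move=> oU; apply: sm_mul => //; [exact: sm_cst|exact: sm_id].
have oV : open (mulmx (invmx M) @` cimg c : set 'cV[R]_(n + n)).
  have -> : mulmx (invmx M) @` cimg c = (mulmx M : 'cV[R]_(n + n) -> _) @^-1` cimg c.
    apply/seteqP; split=> [_ [v cv <-]|v cv]; first by rewrite /= MK.
    by exists (M *m v).
  rewrite openE => v cv; apply: (C1v_continuous (C1v_lin M v)); exact: open_nbhs_nbhs.
have s1 : smooth_chart c1.
  exact: (rechart_smooth sc oci (fun u h => h) (smM _ _ oci) oV (smM _ _ oV) (fun v _ => MK v)).
have c1z : cdom c1 z by split=> //; exists z.
have c1d y : cdom c1 y -> cdom c y by case.
have tr1 y : cdom c1 y -> tr c1 y = invmx M *m tr c y.
  by move=> cy; rewrite (rechart_tr sc oci (smM _ _ oci) cy) jac_lin.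
have c10 : coord c1 z = 0 by rewrite /= c0 mulmx0.
have Wc1 := Wmz c1z.
have jm : jac (mrep c1) 0 = jac (mrep c) 0 *m M.
  have C := lrep_C1v sc (mrep_lrep sc) (Wmz cz); rewrite c0 in C.
  have C' : C1v (mrep c) (M *m 0) by rewrite mulmx0.
  by have := jac_comp C' (C1v_lin M 0); rewrite jac_lin mulmx0 => <-.
have jp : jac (prep c1) 0 = jac (prep c) 0 *m M.
  have C := lrep_C1v sc (prep_lrep sc) (Wpz cz); rewrite c0 in C.
  have C' : C1v (prep c) (M *m 0) by rewrite mulmx0.
  by have := jac_comp C' (C1v_lin M 0); rewrite jac_lin mulmx0 => <-.
have js : jac (srep c1) y0 = invmx M *m jac (srep c) y0.
  exact: (jac_mull _ (lrep_C1v scm (srep_lrep sc) (Wsz cz))).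
exists c1, (invmx M *m J0 *m M), S, G; split; split=> //.
- by move=> y cy; rewrite tr1// -[LHS]mulmxA cJ; [rewrite !mulmxA mulmxK|exact: c1d].
- move=> y cy; rewrite tr1// -MwM cw; last exact: c1d.
  set T := tr c y.
  have -> : (invmx M *m T)^T *m (M^T *m w0 *m M) *m (invmx M *m T) =
      (M *m (invmx M *m T))^T *m w0 *m (M *m (invmx M *m T)) by rewrite [in RHS]trmx_mul !mulmxA.
  by rewrite mulKVmx.
- by rewrite -!mulmxA JM !mulmxA mulVmx// mul1mx.
- by rewrite js -ME mulmxA mulVmx// mul1mx.
- by move=> t t01; rewrite jm jp -!mulmxA; exact: tu.
Qed.

Lemma brane_flow_germ : has_brane_flow pim pip z L.
Proof.
have [c [J0 [S [G [[sc cz c0 cJ cw] [JL SS sE tu]]]]]] := frame_data.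
have [ss sL sK] := s_spec; have [oWs Wsc Wsd sS Es] := srep_lrep sc.
have oV0 := open_imgS scm.1 oWs Wsc; set V0 := coord cm @` _ in oV0 sS.
have V0y : V0 y0 by exists (pim z) => //; exact: (Wsz cz).
have Sy0 : srep c y0 = 0 by rewrite (srep_y0 sc cz).
(* [L] as a graph: [q] is the horizontal part of the section [s] in coordinates, [g] its local
   inverse, and [th] the vertical part of [s] as a function of the horizontal coordinate. *)
pose q := fun y => usubmx (srep c y).
have sq : sm V0 q by apply: sm_usub.
have Cs y : V0 y -> C1v (srep c) y by move=> Vy; exact: (sm_C1v oV0 sS Vy).
have jq y : V0 y -> jac q y = usubmx (jac (srep c) y).
  move=> Vy; have -> : q = fun y => row_mx 1%:M 0 *m srep c y by apply/funext => u; rewrite /q usub_row.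
  by rewrite (jac_mull _ (Cs y Vy)) -[jac (srep c) y in LHS]vsubmxK mul_row_col mul1mx mul0mx addr0.
have jq0 : jac q y0 = 1%:M by rewrite jq// sE col_mxKu.
have uq0 : jac q y0 \in unitmx by rewrite jq0 unitmx1.
have [V [oV Vy0 VV0 oqV [ju [g sg gK]]]] := ift oV0 sq V0y uq0.
have q0 : q y0 = 0 by rewrite /q Sy0 linear0.
have gqV x : (q @` V) x -> V (g x) /\ q (g x) = x by move=> [y Vy <-]; rewrite gK.
have qV0 : (q @` V) 0 by exists y0.
have g0 : g 0 = y0 by rewrite -q0 gK.
pose Sg := srep c \o g; pose th := fun x => dsubmx (Sg x).
have sSg : sm (q @` V) Sg by apply: (sm_comp oqV oV0 sg _ sS) => x /gqV[/VV0].
have usg x : (q @` V) x -> usubmx (Sg x) = x by move=> /gqV[].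
have Sgth x : (q @` V) x -> Sg x = col_mx x (th x) by move=> Vx; rewrite -[LHS]vsubmxK usg.
have CSg x : (q @` V) x -> C1v Sg x by move=> Vx; exact: (sm_C1v oqV sSg Vx).
have sthV : sm (q @` V) th by exact: sm_dsub.
have jth x : (q @` V) x -> jac th x = dsubmx (jac Sg x).
  move=> Vx; have -> : th = fun x => row_mx 0 1%:M *m Sg x by apply/funext => u; rewrite /th dsub_row.
  by rewrite (jac_mull _ (CSg x Vx)) -[jac Sg x in LHS]vsubmxK mul_row_col mul1mx mul0mx add0r.
have juS x : (q @` V) x -> usubmx (jac Sg x) = 1%:M.
  move=> Vx; have E : jac (fun x => usubmx (Sg x)) x = usubmx (jac Sg x).
    have -> : (fun x => usubmx (Sg x)) = fun x => row_mx 1%:M 0 *m Sg x by apply/funext => u; rewrite usub_row.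
    by rewrite (jac_mull _ (CSg x Vx)) -[jac Sg x in LHS]vsubmxK mul_row_col mul1mx mul0mx addr0.
  rewrite -E -(jac_id x); apply: jac_near.
  have : \forall u \near x, (q @` V) u by exact: open_nbhs_nbhs.
  by apply: filterS => u; exact: usg.
have jSg x : (q @` V) x -> jac Sg x = col_mx 1%:M (jac th x).
  by move=> Vx; rewrite -[LHS]vsubmxK juS// jth.
have Cg x : (q @` V) x -> C1v g x by move=> Vx; exact: (sm_C1v oqV sg Vx).
have jSg' x : (q @` V) x -> jac Sg x = jac (srep c) (g x) *m jac g x.
  by move=> Vx; apply: (jac_comp _ (Cg x Vx)); apply: Cs; apply: VV0; have [] := gqV x Vx.
(* Matches the planes of [adapted_frame], so that the graphs of [t th] are transverse to both
   kernels at [z] for all [t]. *)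
have jth0 : jac th 0 = - S.
  have := jSg' 0 qV0; rewrite jSg// g0 sE mul_col_mx mul1mx => /eq_col_mx[g1 ->].
  by rewrite -g1 mulmx1.
(* [L] is Lagrangian for [Im Omega], that is, [th] is a closed 1-form; its potential [h] defines the
   functions [f_t]. *)
have thsym x : (q @` V) x -> (jac th x)^T = jac th x.
  move=> Vx; have [Vg _] := gqV x Vx; have [x' [Wx' xE]] : exists x', Ws c x' /\ coord cm x' = g x.
    by have [x' Wx' E] := VV0 _ Vg; exists x'.
  have := srep_iso sc cw Wx'; rewrite xE => iso.
  have : (jac Sg x)^T *m block_mx 0 1%:M (- 1%:M) 0 *m jac Sg x = 0.
    rewrite jSg'// trmx_mul.
    by rewrite -!mulmxA (mulmxA (block_mx _ _ _ _)) (mulmxA (jac (srep c) (g x))^T) (mulmxA (jac (srep c) (g x))^T) iso mul0mx mulmx0.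
  rewrite jSg// tr_col_mx trmx1 mul_row_block !mulmx0 mulmxN !mulmx1 add0r addr0 mul_row_col.
  rewrite mulmx1 mul1mx addrC => /eqP; rewrite subr_eq0 => /eqP E.
  exact: esym E.
have [r0 r00 hr0] : exists2 r0 : R, 0 < r0 & @bal R n r0 `<=` q @` V.
  have : \forall u \near (0 : 'cV[R]_n), (q @` V) u by exact: open_nbhs_nbhs.
  by move=> /near_norm[r r_0 H]; exists r => // u ur; apply: H; rewrite subr0.
have sth : sm (@bal R n r0) th by exact: sm_restrict sthV.
have th0 : th 0 = 0 by rewrite /th /Sg /= g0 Sy0 linear0.
have [|h [sh hth]] := poincare1 sth.
  by move=> x xr; rewrite /rext1 thsym ?subrr//; exact: hr0.
have lm := mrep_lrep sc; have lp := prep_lrep sc.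
have [oWm Wmc Wmd sPm Em] := lm; have [oWp Wpc Wpd sPp Ep] := lp.
have oIm := open_imgS sc.1 oWm Wmc; have oIp := open_imgS sc.1 oWp Wpc.
have [rho rho0 hrho] : exists2 rho : R, 0 < rho & @bal R (n + n) rho `<=` (coord c @` Wm c) `&` (coord c @` Wp c).
  have : \forall u \near (0 : 'cV[R]_(n + n)), ((coord c @` Wm c) `&` (coord c @` Wp c)) u.
    apply: filterI; apply: open_nbhs_nbhs; split=> //; by exists z.
  by move=> /near_norm[r r_0 H]; exists r => // u ur; apply: H; rewrite subr0.
have sPm' : sm (@bal R (n + n) rho) (mrep c) by apply: sm_restrict sPm => u /hrho[].
have sPp' : sm (@bal R (n + n) rho) (prep c) by apply: sm_restrict sPp => u /hrho[].
have [[oc oci cK cc icc] _] := sc.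
have Zc u : @bal R (n + n) rho u -> cimg c u by move=> /hrho[[p [[_ cp'] _] <-] _]; exists p.
have pt p u : cdom c p -> coord c p = u -> (coord c @` Wm c) u -> Wm c p.
  move=> cp' pE [p' Wp' E]; have [[_ cp''] _] := Wp'.
  by rewrite -(cK p)// pE -E cK.
have pt' p u : cdom c p -> coord c p = u -> (coord c @` Wp c) u -> Wp c p.
  move=> cp' pE [p' Wp' E]; have [[_ cp''] _] := Wp'.
  by rewrite -(cK p)// pE -E cK.
have hpm p : cdom c p -> @bal R (n + n) rho (coord c p) -> cdom cm (pim p) /\ coord cm (pim p) = mrep c (coord c p).
  by move=> cp' /hrho[W _]; have Wmp := pt p _ cp' erefl W; split; [exact: Wmd|exact: Em].
have hpp p : cdom c p -> @bal R (n + n) rho (coord c p) -> cdom cp (pip p) /\ coord cp (pip p) = prep c (coord c p).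
  by move=> cp' /hrho[_ W]; have Wpp := pt' p _ cp' erefl W; split; [exact: Wpd|exact: Ep].
have tth (t : R) : t *: jac th 0 = - (t *: S) by rewrite jth0 scalerN.
have [|em em0 hem] := family_inverse rho0 r00 sth th0 sPm'.
  by move=> t /tu[]; rewrite tth.
have [|ep ep0 hep] := family_inverse rho0 r00 sth th0 sPp'.
  by move=> t /tu[_]; rewrite tth.
(* One box for both projections. *)
pose e := Num.min em ep; have e0 : 0 < e by rewrite lt_min em0.
have [|grO oAm um [Hm sHm HmK]] := hem e; first by rewrite e0 ge_min lexx.
have [|_ oAp up [Hp sHp HpK]] := hep e; first by rewrite e0 ge_min lexx orbT.
have Linj p p' : L p -> L p' -> pim p = pim p' -> p = p'.
  by move=> Lp Lp' E; rewrite -(sK p)// -(sK p')// E.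
have thsym' x : @bal R n r0 x -> (jac th x)^T = jac th x by move=> /hr0; exact: thsym.
apply: (brane_flow_local HZ sc cz c0 Zc cJ cw JL e0 sth th0 sh hth thsym' grO hcm hcp hpm hpp sPm' sPp'
  oAm oAp um up sHm HmK sHp HpK Linj).
have L1 p : Lt c e th 1 p -> L p.
  move=> [cp' [v [Tv vt vE]]]; have [/hr0 Qv _] := grO v Tv.
  have [Vg _] := gqV _ Qv; have [x' Wx' xE] := VV0 _ Vg.
  have [[_ cx'] csx] := Wx'; have EE := Es _ Wx'.
  have -> : p = s x'; last by have [] := sL x'.
  rewrite -(cK p)// -(cK (s x'))//; congr (icoord c).
  by rewrite vE EE xE /graph_at vt mul_mx_scalar scale1r -Sgth.
(* Conversely, a point of [L] is determined by its image in [X_-], so closeness to [z] forces its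
   horizontal coordinate into the ball over which [L_1] is defined. *)
have nL : \forall p \near z, L p -> Lt c e th 1 p.
  have [_ _ _ ccm _] := scm.1.
  have Cq : {for y0, continuous q} by apply: C1v_continuous; exact: (sm_C1v oV0 sq V0y).
  have n1 : nbhs y0 (V `&` [set y | @bal R n e (q y)]).
    apply: filterI; first exact: open_nbhs_nbhs.
    have NB : nbhs (q y0) (@bal R n e) by apply: open_nbhs_nbhs; split; [exact: open_bal|rewrite q0 /bal /= normr0].
    exact: (Cq _ NB).
  have n2 : nbhs (pim z) [set x | [/\ V (coord cm x), @bal R n e (q (coord cm x)) & Ws c x]].
    have a : nbhs (pim z) [set x | V (coord cm x) /\ @bal R n e (q (coord cm x))] := ccm _ cmz _ n1.
    have b : nbhs (pim z) (Ws c) by apply: open_nbhs_nbhs; split=> //; exact: (Wsz cz).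
    by apply: filterS (filterI a b) => x [[x1 x2] x3]; split.
  have [pc _] := morita_smoothm HZ; have n3 : nbhs z [set p | [/\ V (coord cm (pim p)), @bal R n e (q (coord cm (pim p))) & Ws c (pim p)]] := pc z I _ n2.
  apply: filterS n3 => p [Vp Bp Wp'] Lp; have [[_ cmp] csp] := Wp'.
  have EE := Es _ Wp'; rewrite /= sK// in csp EE.
  split=> //; exists (col_mx 1%:M (q (coord cm (pim p)))); split.
  - by apply: tbox_at Bp; apply: (t01e e0); rewrite ler01 lexx.
  - by rewrite col_mxKu.
  - rewrite /graph_at col_mxKu col_mxKd mul_mx_scalar scale1r -Sgth; last by exists (coord cm (pim p)).
    by rewrite /Sg /= gK.
have : nbhs z [set p | L p -> Lt c e th 1 p] := nL.
rewrite nbhsE => -[W [oW Wz] WL]; exists W; split=> //.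
by apply/seteqP; split=> p [Lp Wp']; split=> //; [exact: L1|exact: WL].
Qed.

End Instance.
End Adapted_coordinates.
Theorem theorem8p2 (R : realType) (n m : nat)
    (Xm Xp : @holPoisson R n) (Z : @holSymp R m)
    (pim : Z -> Xm) (pip : Z -> Xp) (HZ : morita pim pip)
    (L : set Z) (HL : brane_bisection pim pip L)
    (z : Z) (Lz : L z) (HGK : symplectic_type pim pip z L) :
  exists Lt : R -> set Z,
    [/\ forall t : R, 0 <= t <= 1 ->
          local_brane_bisection pim pip (Lt t) /\ Lt t z,
        germ_eq z (Lt 1) L
      & local_holo_bisection pim pip (Lt 0)] /\
    let Lam := Lt 0 in
    let U := pim @` Lam in
    let V := pip @` Lam in
    let phi : Xm -> Xp := pip \o sinv z pim Lam in
    let phi' : Xp -> Xm := pim \o sinv z pip Lam in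
    holo_poisson_iso U V phi phi' /\
    exists (W0 : set Xm) (f : R -> Xm -> R),
      [/\ [/\ open W0, W0 (pim z), W0 `<=` U & smooth_tfun W0 f],
          exists (W : set Z) (tau : R -> Z -> Z),
            [/\ open W, W z,
                is_flow [set p : Z | V (pip p) /\ W0 (phi' (pip p))]
                  (fun (t : R) (p : Z) => invmx (omegaZ p) *m
                     dfun (fun q : Z => f t (phi' (pip q))) p)
                  W tau
              & exists W' : set Z, [/\ open W', W' z &
                  forall t : R, 0 <= t <= 1 ->
                    Lt t `&` W' = (tau t @` (Lam `&` W)) `&` W']]
        & exists (W1 : set Xm) (psi : R -> Xm -> Xm),
            [/\ open W1, W1 (pim z),
                is_flow W0
                  (fun (t : R) (x : Xm) => Qpois x *m dfun (f t) x) W1 psi,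
                forall x : Xm, W1 x ->
                  gkI pim pip z L x = pull_endo (psi 1) (@cpx R n Xm) x
              & forall x : Xm, W1 x ->
                  cmx (gkF pim z L x) =
                  int01 (fun t : R => pull_form (psi t) (ddc (f t)) x)]].
Proof.
(* Substituting [m = n + n] lets the coordinates on [Z] be split into the blocks [q] and [xi]. *)
have mE := morita_dim z HZ; subst m.
have [_ /(_ (pim z)) [Jm [cm [hcm cmz]]]] := cpxP Xm.
have [_ /(_ (pip z)) [Jp [cp [hcp cpz]]]] := cpxP Xp.
exact: (brane_flow_germ HZ HL Lz HGK hcm hcp cmz cpz).
Qed.
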